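(* Let $K$ be a field and let $\Lambda$ be a connected finite dimensional hereditary $K$-algebra of infinite representation type, with associated hereditary abelian category $\mathcal H\subseteq\mathbf D^{\mathrm b}(\operatorname{mod}\Lambda)$ and preprojective algebra $\Pi=\bigoplus_{n\ge0}\operatorname{Hom}(\Lambda,\tau^{-n}\Lambda)$. Then the assignment $$X\mapsto\bigoplus_{n\in\mathbb Z}\operatorname{Hom}(\Lambda,\tau^{-n}X)\qquad(X\in\mathcal H)$$ induces an equivalence $$\mathcal H\xrightarrow{\sim}(\operatorname{grmod}\Pi)/(\operatorname{grmod}_0\Pi),$$ in the following sense: the functor $\Gamma_*\colon\mathcal H\to\operatorname{GrMod}\Pi$, $X\mapsto\bigoplus_{n\in\mathbb Z}\operatorname{Hom}(\Lambda,\tau^{-n}X)$, admits a partial left adjoint $T\colon\operatorname{grmod}\Pi\to\mathcal H$ with $T(\Pi)=\Lambda$, and $T$ is exact and induces an equivalence $(\operatorname{grmod}\Pi)/(\operatorname{grmod}_0\Pi)\xrightarrow{\sim}\mathcal H$.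
   Context: Modules over $\Lambda$. $\operatorname{mod}\Lambda$ is the category of finitely presented $\Lambda$-modules; hereditary means $\operatorname{Ext}^n_\Lambda(-,-)=0$ for all $n>1$. An additive category $\mathcal C$ has a decomposition $\mathcal C=\bigvee_i\mathcal C_i$ if each $\mathcal C_i$ is a full additive subcategory, each object of $\mathcal C$ is a coproduct $\coprod_iC_i$ with $C_i\in\mathcal C_i$, and $\mathcal C_i\cap(\bigvee_{j\ne i}\mathcal C_j)=0$ for all $i$. For $\Lambda$ connected hereditary of infinite representation type there is a decomposition $\operatorname{mod}\Lambda=\mathcal P\vee\mathcal R\vee\mathcal I$, where $\mathcal P$, $\mathcal R$, $\mathcal I$ are the full subcategories of preprojective, regular and postinjective (also called preinjective) modules: the indecomposables in $\mathcal P$ are the modules $\tau^{-n}P$ ($n\ge0$, $P$ indecomposable projective), those in $\mathcal I$ are the modules $\tau^nI$ ($n\ge0$, $I$ indecomposable injective), for the Auslander--Reiten translate $\tau$ of $\operatorname{mod}\Lambda$, and those in $\mathcal R$ are all the others. The category $\mathcal H$. For $\mathcal A=\operatorname{mod}\Lambda$, let $\mathcal A[n]\subseteq\mathbf D^{\mathrm b}(\mathcal A)$ be the full subcategory of complexes with cohomology concentrated in degree $-n$; then $\mathbf D^{\mathrm b}(\mathcal A)=\bigvee_{n\in\mathbb Z}\mathcal A[n]$. The category $\mathbf D^{\mathrm b}(\mathcal A)$ has Serre duality: there is an equivalence $\tau\colon\mathbf D^{\mathrm b}(\mathcal A)\xrightarrow{\sim}\mathbf D^{\mathrm b}(\mathcal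 A)$ with natural isomorphisms $D\operatorname{Hom}(X,Y[1])\cong\operatorname{Hom}(Y,\tau X)$, where $D=\operatorname{Hom}_K(-,K)$. Set $$\mathcal H:=\mathcal I[-1]\vee\mathcal P[0]\vee\mathcal R[0]\subseteq\mathbf D^{\mathrm b}(\operatorname{mod}\Lambda).$$ This is a hereditary abelian category (the heart of a t-structure on $\mathbf D^{\mathrm b}(\mathcal A)$ induced by the torsion pair $(\mathcal I,\mathcal P\vee\mathcal R)$), and $\tau$ restricts to an equivalence $\tau\colon\mathcal H\xrightarrow{\sim}\mathcal H$. The module $\Lambda$ is viewed as an object of $\mathcal P[0]\subseteq\mathcal H$; $\tau^{-n}$ denotes the $n$-th power of the quasi-inverse of $\tau$. Preprojective algebra and graded modules. $\Pi=\bigoplus_{n\ge0}\operatorname{Hom}(\Lambda,\tau^{-n}\Lambda)$ is a graded ring with multiplication $xy=(\tau^{-q}x)\circ y$ for $x\in\Pi_p$, $y\in\Pi_q$; the right $\Pi$-module structure on $\bigoplus_{n\in\mathbb Z}\operatorname{Hom}(\Lambda,\tau^{-n}X)$ is given by the same formula. $\operatorname{GrMod}\Pi$ is the category of $\mathbb Z$-graded right $\Pi$-modules, $\operatorname{grmod}\Pi$ its full subcategory of finitely presented modules, and $\operatorname{grmod}_0\Pi$ its full subcategory of finite length modules; $\operatorname{grmod}\Pi$ is abelian and contains $\operatorname{grmod}_0\Pi$ as a Serre subcategory, and the quotient is the abelian quotient category. ''Partial left adjoint'' means that there are natural isomorphisms $\operatorname{Hom}_{\mathcal H}(T(M),Y)\cong\operatorname{Hom}_{\operatorname{GrMod}\Pi}(M,\Gamma_*(Y))$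 for all $M\in\operatorname{grmod}\Pi$ and $Y\in\mathcal H$. *)

(* Defs.v *)
From HB Require Import structures.
From mathcomp Require Import all_boot all_order all_algebra all_field.
From mathcomp Require Import zify boolp.

Set Implicit Arguments.
Unset Strict Implicit.
Unset Printing Implicit Defensive.

Import GRing.Theory.
Local Open Scope ring_scope.

Local Obligation Tactic := try by [].

Record cat := Cat {
  obj :> Type;
  hom : obj -> obj -> Type;
  idm : forall X, hom X X;
  comp : forall X Y Z, hom Y Z -> hom X Y -> hom X Z;
  compA : forall X Y Z W (h : hom Z W) (g : hom Y Z) (f : hom X Y),
    comp h (comp g f) = comp (comp h g) f;
  comp1m : forall X Y (f : hom X Y), comp (idm Y) f = f;
  compm1 : forall X Y (f : hom X Y), comp f (idm X) = f }.

Arguments hom {c}.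
Arguments idm {c} X : simpl never.
Arguments comp {c X Y Z} g f : simpl never.
Notation "g \oc f" := (comp g f) (at level 40, left associativity).

Definition is_iso (C : cat) (X Y : C) (f : hom X Y) : Prop :=
  exists g : hom Y X, g \oc f = idm X /\ f \oc g = idm Y.

Definition isomorphic (C : cat) (X Y : C) : Prop :=
  exists f : hom X Y, is_iso f.

Record functor (C D : cat) := Functor {
  fobj :> C -> D;
  fmap : forall X Y, hom X Y -> hom (fobj X) (fobj Y);
  fmap1 : forall X, fmap (idm X) = idm (fobj X);
  fmapM : forall X Y Z (g : hom Y Z) (f : hom X Y),
    fmap (g \oc f) = fmap g \oc fmap f }.

Arguments fmap {C D} _ {X Y} _.

Program Definition fid (C : cat) : functor C C :=
  {| fobj := fun X => X; fmap := fun X Y f => f |}.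

Program Definition fcomp (C D E : cat) (G : functor D E) (F : functor C D) :
    functor C E :=
  {| fobj := fun X => G (F X); fmap := fun X Y f => fmap G (fmap F f) |}.
Next Obligation. by move=> C D E G F X; rewrite /= !fmap1. Qed.
Next Obligation. by move=> C D E G F X Y Z g f; rewrite /= !fmapM. Qed.

Definition natural (C D : cat) (F G : functor C D)
    (a : forall X, hom (F X) (G X)) : Prop :=
  forall X Y (f : hom X Y), fmap G f \oc a X = a Y \oc fmap F f.

Definition nat_iso (C D : cat) (F G : functor C D) : Prop :=
  exists a : forall X, hom (F X) (G X), natural a /\ forall X, is_iso (a X).

Definition is_equivalence (C D : cat) (F : functor C D) : Prop :=
  exists G : functor D C,
    nat_iso (fcomp G F) (fid C) /\ nat_iso (fcomp F G) (fid D).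

Definition full_sub (C : cat) (P : C -> Prop) : cat :=
  @Cat {X : C | P X} (fun X Y => hom (proj1_sig X) (proj1_sig Y))
    (fun X => idm (proj1_sig X)) (fun X Y Z g f => g \oc f)
    (fun _ _ _ _ => @compA C _ _ _ _) (fun _ _ => @comp1m C _ _)
    (fun _ _ => @compm1 C _ _).

Program Definition incl (C : cat) (P : C -> Prop) : functor (full_sub P) C :=
  {| fobj := fun X => proj1_sig X; fmap := fun X Y f => f |}.

Section AdditiveNotions.
Variable C : cat.

Definition zero_obj (Z : C) : Prop :=
  forall X, (exists! f : hom X Z, True) /\ (exists! f : hom Z X, True).

Definition zero_mor (X Y : C) (f : hom X Y) : Prop :=
  exists (Z : C) (g : hom Z Y) (h : hom X Z), zero_obj Z /\ f = g \oc h.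

Definition is_kernel (X Y Z : C) (g : hom Y Z) (k : hom X Y) : Prop :=
  zero_mor (g \oc k) /\
  forall (W : C) (h : hom W Y), zero_mor (g \oc h) ->
    exists! u : hom W X, k \oc u = h.

Definition is_cokernel (X Y Z : C) (f : hom X Y) (c : hom Y Z) : Prop :=
  zero_mor (c \oc f) /\
  forall (W : C) (h : hom Y W), zero_mor (h \oc f) ->
    exists! u : hom Z W, u \oc c = h.

Definition short_exact (X Y Z : C) (f : hom X Y) (g : hom Y Z) : Prop :=
  is_kernel g f /\ is_cokernel f g.

Definition is_coproduct (I : Type) (N : I -> C) (X : C)
    (inj : forall i, hom (N i) X) : Prop :=
  forall (Y : C) (f : forall i, hom (N i) Y),
    exists! h : hom X Y, forall i, h \oc inj i = f i.

Definition is_coprod2 (Y Z X : C) (i : hom Y X) (j : hom Z X) : Prop :=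
  forall (W : C) (f : hom Y W) (g : hom Z W),
    exists! h : hom X W, h \oc i = f /\ h \oc j = g.

Definition indecomposable (X : C) : Prop :=
  ~ zero_obj X /\
  forall (Y Z : C) (i : hom Y X) (j : hom Z X),
    is_coprod2 i j -> zero_obj Y \/ zero_obj Z.

Definition add_closure (S : C -> Prop) (X : C) : Prop :=
  exists (n : nat) (N : 'I_n -> C) (inj : forall i, hom (N i) X),
    is_coproduct inj /\ forall i, S (N i).

(* The full subcategory [S \vee T]. *)
Definition join (S T : C -> Prop) (X : C) : Prop :=
  exists (Y Z : C) (i : hom Y X) (j : hom Z X),
    [/\ is_coprod2 i j, S Y & T Z].

End AdditiveNotions.

Definition exact_functor (C D : cat) (F : functor C D) : Prop :=
  forall (X Y Z : C) (f : hom X Y) (g : hom Y Z),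
    short_exact f g -> short_exact (fmap F f) (fmap F g).

Definition mor_class (C : cat) := forall X Y : C, hom X Y -> Prop.

Definition inverts (C D : cat) (W : mor_class C) (F : functor C D) : Prop :=
  forall (X Y : C) (f : hom X Y), W X Y f -> is_iso (fmap F f).

(* The universal property of [Q : C -> C[W^-1]]: for every [E], composition   *)
(* with [Q] is an equivalence from the category of functors [D -> E] to the   *)
(* category of functors [C -> E] inverting [W].                               *)
Definition is_localization (C D : cat) (W : mor_class C) (Q : functor C D) :
    Prop :=
  [/\ inverts W Q,
      forall (E : cat) (F : functor C E), inverts W F ->
        exists F' : functor D E, nat_iso (fcomp F' Q) F
    & forall (E : cat) (F G : functor D E)
        (a : forall X : C, hom (F (Q X)) (G (Q X))),
        @natural C E (fcomp F Q) (fcomp G Q) a ->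
        exists! b : forall Y : D, hom (F Y) (G Y),
          natural b /\ forall X, b (Q X) = a X].

(* Explicit construction of [C[W^-1]]: formal composites of morphisms of [C]  *)
(* and of formal inverses of morphisms in [W], modulo the congruence          *)
(* generated by the expected relations.                                       *)
Section Localize.
Variables (C : cat) (W : mor_class C).

Inductive zigzag : C -> C -> Type :=
| zmor X Y : hom X Y -> zigzag X Y
| zinv X Y (w : hom X Y) : W w -> zigzag Y X
| zcomp X Y Z : zigzag Y Z -> zigzag X Y -> zigzag X Z.

Inductive zeq : forall X Y, zigzag X Y -> zigzag X Y -> Prop :=
| zeq_refl X Y (s : zigzag X Y) : zeq s s
| zeq_sym X Y (s t : zigzag X Y) : zeq s t -> zeq t s
| zeq_trans X Y (s t u : zigzag X Y) : zeq s t -> zeq t u -> zeq s u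
| zeq_comp X Y Z (s s' : zigzag Y Z) (t t' : zigzag X Y) :
    zeq s s' -> zeq t t' -> zeq (zcomp s t) (zcomp s' t')
| zeq_assoc X Y Z V (s : zigzag Z V) (t : zigzag Y Z) (u : zigzag X Y) :
    zeq (zcomp s (zcomp t u)) (zcomp (zcomp s t) u)
| zeq_idl X Y (s : zigzag X Y) : zeq (zcomp (zmor (idm Y)) s) s
| zeq_idr X Y (s : zigzag X Y) : zeq (zcomp s (zmor (idm X))) s
| zeq_mor X Y Z (g : hom Y Z) (f : hom X Y) :
    zeq (zcomp (zmor g) (zmor f)) (zmor (g \oc f))
| zeq_invl X Y (w : hom X Y) (Ww : W w) :
    zeq (zcomp (zinv Ww) (zmor w)) (zmor (idm X))
| zeq_invr X Y (w : hom X Y) (Ww : W w) :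
    zeq (zcomp (zmor w) (zinv Ww)) (zmor (idm Y)).

Definition zclass X Y := {c : zigzag X Y -> Prop | exists s, c = zeq s}.

Definition zpi X Y (s : zigzag X Y) : zclass X Y :=
  exist _ (zeq s) (ex_intro _ s erefl).

Definition zrepr X Y (c : zclass X Y) : zigzag X Y :=
  projT1 (cid (proj2_sig c)).

Lemma zreprK X Y (c : zclass X Y) : zpi (zrepr c) = c.
Proof.
rewrite /zrepr; case: cid => s /= e; case: c e => c p /= e.
by rewrite /zpi; apply: eq_exist => /=.
Qed.

Lemma zpi_eq X Y (s t : zigzag X Y) : zeq s t -> zpi s = zpi t.
Proof.
move=> st; apply: eq_exist => /=; apply/funext => u; apply/propext.
by split=> h; [apply: zeq_trans (zeq_sym st) h|apply: zeq_trans st h].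
Qed.

Lemma zpi_inj X Y (s t : zigzag X Y) : zpi s = zpi t -> zeq s t.
Proof. by case=> ->; apply: zeq_refl. Qed.

Lemma zreprP X Y (s : zigzag X Y) : zeq (zrepr (zpi s)) s.
Proof. by apply: zpi_inj; rewrite zreprK. Qed.

Definition zmul X Y Z (c : zclass Y Z) (d : zclass X Y) : zclass X Z :=
  zpi (zcomp (zrepr c) (zrepr d)).

Lemma zmul_pi X Y Z (s : zigzag Y Z) (t : zigzag X Y) :
  zmul (zpi s) (zpi t) = zpi (zcomp s t).
Proof. by apply: zpi_eq; apply: zeq_comp; apply: zreprP. Qed.

Program Definition localize : cat :=
  {| obj := C; hom := zclass; idm := fun X => zpi (zmor (idm X));
     comp := zmul |}.
Next Obligation.
move=> X Y Z V h g f; rewrite -(zreprK h) -(zreprK g) -(zreprK f) !zmul_pi.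
by apply: zpi_eq; apply: zeq_assoc.
Qed.
Next Obligation.
move=> X Y f; rewrite -(zreprK f) zmul_pi; apply: zpi_eq; exact: zeq_idl.
Qed.
Next Obligation.
move=> X Y f; rewrite -(zreprK f) zmul_pi; apply: zpi_eq; exact: zeq_idr.
Qed.

Program Definition localize_functor : functor C localize :=
  {| fobj := fun X => X : localize; fmap := fun X Y f => zpi (zmor f) |}.
Next Obligation.
move=> X Y Z g f; apply: esym; apply: etrans (zmul_pi _ _) _.
exact/zpi_eq/zeq_mor.
Qed.

End Localize.

(* The quotient of an abelian category by a Serre subcategory: formally       *)
(* invert the morphisms with kernel and cokernel in the subcategory.          *)
Definition serre_class (C : cat) (S : C -> Prop) : mor_class C :=
  fun X Y f =>
    (exists (N : C) (k : hom N X), is_kernel f k /\ S N) /\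
    (exists (N : C) (c : hom Y N), is_cokernel f c /\ S N).

Definition serre_quotient (C : cat) (S : C -> Prop) : cat :=
  localize (serre_class S).

Definition serre_quotient_functor (C : cat) (S : C -> Prop) :
  functor C (serre_quotient S) := localize_functor (serre_class S).

Record lin_cat (K : fieldType) := LinCat {
  lobj : Type;
  lhom : lobj -> lobj -> lmodType K;
  lidm : forall X, lhom X X;
  lcomp : forall X Y Z, lhom Y Z -> lhom X Y -> lhom X Z;
  lcompA : forall X Y Z W (h : lhom Z W) (g : lhom Y Z) (f : lhom X Y),
    lcomp h (lcomp g f) = lcomp (lcomp h g) f;
  lcomp1m : forall X Y (f : lhom X Y), lcomp (lidm Y) f = f;
  lcompm1 : forall X Y (f : lhom X Y), lcomp f (lidm X) = f;
  lcompDl : forall X Y Z (a : K) (g h : lhom Y Z) (f : lhom X Y),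
    lcomp (a *: g + h) f = a *: lcomp g f + lcomp h f;
  lcompDr : forall X Y Z (a : K) (g : lhom Y Z) (f h : lhom X Y),
    lcomp g (a *: f + h) = a *: lcomp g f + lcomp g h }.

Definition cat_of_lin (K : fieldType) (D : lin_cat K) : cat :=
  Cat (@lcompA K D) (@lcomp1m K D) (@lcompm1 K D).
Coercion cat_of_lin : lin_cat >-> cat.

Definition linear_functor (K : fieldType) (C D : lin_cat K)
    (F : functor C D) : Prop :=
  forall (X Y : C) (a : K) (f g : lhom X Y),
    fmap F (a *: f + g : lhom X Y) =
      a *: (fmap F f : lhom (F X) (F Y)) + (fmap F g : lhom (F X) (F Y)).

(* [amul false] is the multiplication of [L], and [amul true] that of the     *)
(* opposite algebra, so that [module L false] and [module L true] are the     *)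
(* right and the left [L]-modules; both are written with the scalar acting    *)
(* on the right.                                                              *)
Definition amul (K : fieldType) (L : falgType K) (op : bool) (a b : L) : L :=
  if op then b * a else a * b.

Record module (K : fieldType) (L : falgType K) (op : bool) := Module {
  mcar :> lmodType K;
  mact : mcar -> L -> mcar;
  mact_linl : forall (k : K) (x y : mcar) (a : L),
    mact (k *: x + y) a = k *: mact x a + mact y a;
  mact_linr : forall (k : K) (x : mcar) (a b : L),
    mact x (k *: a + b) = k *: mact x a + mact x b;
  mact1 : forall x, mact x 1 = x;
  mactM : forall x a b, mact (mact x a) b = mact x (amul op a b) }.

Arguments mact {K L op m}.

Record mhom (K : fieldType) (L : falgType K) (op : bool)
    (M N : module L op) := Mhom {
  mfun :> M -> N;
  mhom_lin : forall (k : K) (x y : M),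
    mfun (k *: x + y) = k *: mfun x + mfun y;
  mhom_act : forall (x : M) (a : L), mfun (mact x a) = mact (mfun x) a }.

Section Modules.
Variables (K : fieldType) (L : falgType K) (op : bool).
Local Notation modl := (module L op).

Lemma mhom_eq (M N : modl) (f g : mhom M N) : f =1 g -> f = g.
Proof.
case: f g => [f lf af] [g lg ag] /= fg.
have {fg} e : f = g by apply/funext.
by subst g; congr Mhom; apply: Prop_irrelevance.
Qed.

Lemma mhom0 (M N : modl) (f : mhom M N) : f 0 = 0.
Proof. by have := mhom_lin f (-1) 0 0; rewrite !scaleN1r !addNr. Qed.

Lemma mhomN (M N : modl) (f : mhom M N) x : f (- x) = - f x.
Proof.
by have := mhom_lin f (-1) x 0; rewrite mhom0 !scaleN1r !addr0.
Qed.

Lemma mact0l (M : modl) a : mact (0 : M) a = 0.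
Proof. by have := mact_linl (-1) (0 : M) 0 a; rewrite !scaleN1r !addNr. Qed.

Lemma mactNl (M : modl) (x : M) a : mact (- x) a = - mact x a.
Proof.
by have := mact_linl (-1) x 0 a; rewrite mact0l !scaleN1r !addr0.
Qed.

Program Definition mhom_id (M : modl) : mhom M M := {| mfun := id |}.

Program Definition mhom_comp (M N P : modl) (g : mhom N P) (f : mhom M N) :
  mhom M P := {| mfun := fun x => g (f x) |}.
Next Obligation. by move=> M N P g f k x y; rewrite /= !mhom_lin. Qed.
Next Obligation. by move=> M N P g f x a; rewrite /= !mhom_act. Qed.

Program Definition mhom_zero (M N : modl) : mhom M N :=
  {| mfun := fun _ => 0 |}.
Next Obligation. by move=> M N k x y; rewrite /= scaler0 addr0. Qed.
Next Obligation. by move=> M N x a; rewrite /= mact0l. Qed.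

Program Definition mhom_opp (M N : modl) (f : mhom M N) : mhom M N :=
  {| mfun := fun x => - f x |}.
Next Obligation. by move=> M N f k x y; rewrite /= mhom_lin opprD scalerN. Qed.
Next Obligation. by move=> M N f x a; rewrite /= mhom_act mactNl. Qed.

Program Definition regular : modl :=
  {| mcar := L; mact := fun x a => amul op x a |}.
Next Obligation.
move=> k x y a; rewrite /amul.
by case: op; rewrite ?mulrDr ?mulrDl -?scalerAr -?scalerAl.
Qed.
Next Obligation.
move=> k x a b; rewrite /amul.
by case: op; rewrite ?mulrDr ?mulrDl -?scalerAr -?scalerAl.
Qed.
Next Obligation. by move=> x; rewrite /amul; case: op; rewrite ?mul1r ?mulr1. Qed.
Next Obligation. by move=> x a b; rewrite /amul; case: op; rewrite mulrA. Qed.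

Program Definition zero_module : modl :=
  {| mcar := 'rV[K]_0; mact := fun x _ => x |}.
Next Obligation. by move=> k x a b; rewrite [LHS]thinmx0 [RHS]thinmx0. Qed.

Definition surj (M N : modl) (f : mhom M N) : Prop :=
  forall y, exists x, f x = y.

(* [Im f = Ker g]. *)
Definition exact_at (M N P : modl) (f : mhom M N) (g : mhom N P) : Prop :=
  forall y, g y = 0 <-> exists x, f x = y.

(* There is an exact sequence [L^m -> L^n -> M -> 0]. *)
Definition fin_pres (M : modl) : Prop :=
  exists (n m : nat) (g : 'I_n -> M) (r : 'I_m -> 'I_n -> L),
    (forall x : M, exists c : 'I_n -> L, x = \sum_i mact (g i) (c i)) /\
    (forall c : 'I_n -> L, \sum_i mact (g i) (c i) = 0 <->
       exists e : 'I_m -> L, forall i, c i = \sum_j amul op (r j i) (e j)).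

Definition projective (P : modl) : Prop :=
  forall (M N : modl) (g : mhom M N) (f : mhom P N), surj g ->
    exists h : mhom P M, forall x, g (h x) = f x.

Definition injective_mod (I : modl) : Prop :=
  forall (M N : modl) (g : mhom M N) (f : mhom M I), injective g ->
    exists h : mhom N I, forall x, h (g x) = f x.

(* [Ext^(k+1)(X, Y) = 0], computed from projective resolutions of [X].        *)
Definition Ext_zero_succ (k : nat) (X Y : modl) : Prop :=
  forall (P : nat -> modl) (d : forall n, mhom (P n.+1) (P n))
         (e : mhom (P 0%N) X),
    (forall n, projective (P n)) ->
    surj e -> exact_at (d 0%N) e -> (forall n, exact_at (d n.+1) (d n)) ->
    forall f : mhom (P k.+1) Y, (forall x, f (d k.+1 x) = 0) ->
      exists g : mhom (P k) Y, forall x, f x = g (d k x).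

Definition minimal_proj_pres (P1 P0 M : modl)
    (p1 : mhom P1 P0) (p0 : mhom P0 M) : Prop :=
  [/\ fin_pres P0 /\ projective P0, fin_pres P1 /\ projective P1,
      surj p0 /\ exact_at p1 p0,
      (* [p0 : P0 -> M] is a projective cover *)
      (forall (X : modl) (g : mhom X P0),
         surj (mhom_comp p0 g) -> surj g)
    & (* [p1 : P1 -> Ker p0] is a projective cover *)
      (forall (X : modl) (g : mhom X P1),
         exact_at (mhom_comp p1 g) p0 -> surj g)].

(* [N] is isomorphic to the transpose of [M], that is, to the cokernel of     *)
(* [Hom(p1, L) : Hom(P0, L) -> Hom(P1, L)] for a minimal projective           *)
(* presentation [P1 -> P0 -> M -> 0]; [c] is the cokernel map.                *)
Definition is_transpose (M : modl) (N : module L (~~ op)) : Prop :=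
  exists (P1 P0 : modl) (p1 : mhom P1 P0) (p0 : mhom P0 M)
         (c : mhom P1 regular -> N),
    [/\ minimal_proj_pres p1 p0,
        (forall (k : K) (f g h : mhom P1 regular),
           (forall x, h x = k *: f x + g x) -> c h = k *: c f + c g),
        (forall (a : L) (f h : mhom P1 regular),
           (forall x, h x = amul op a (f x)) -> c h = mact (c f) a),
        (forall y, exists f, c f = y)
      & (forall f, c f = 0 <->
           exists g : mhom P0 regular, forall x, f x = g (p1 x))].

(* [N] is isomorphic to [D M = Hom_K(M, K)]. *)
Definition is_dual (M : modl) (N : module L (~~ op)) : Prop :=
  exists b : N -> M -> K,
    [/\ (forall y, scalar (b y)) /\ (forall x, scalar (b^~ x)),
        (forall y, (forall x, b y x = 0) -> y = 0),
        (forall phi : M -> K, scalar phi -> exists y, b y =1 phi)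
      & (forall y a x, b (mact y a) x = b y (mact x a))].

End Modules.

Arguments regular {K} L op.
Arguments zero_module {K} L op.

(* [N] is isomorphic to [tau M = D Tr M], resp. to [tau^- M = Tr D M].        *)
Definition is_AR_translate (K : fieldType) (L : falgType K)
    (M N : module L false) : Prop :=
  exists T : module L true, @is_transpose K L false M T /\ @is_dual K L true T N.

Definition is_inv_AR_translate (K : fieldType) (L : falgType K)
    (M N : module L false) : Prop :=
  exists E : module L true, @is_dual K L false M E /\ @is_transpose K L true E N.

Definition Mod (K : fieldType) (L : falgType K) : cat.
Proof.
refine (@Cat (module L false) (@mhom K L false) (@mhom_id K L false)
  (@mhom_comp K L false) _ _ _).
- by move=> X Y Z W h g f; apply: mhom_eq.
- by move=> X Y f; apply: mhom_eq.
- by move=> X Y f; apply: mhom_eq.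
Defined.

Definition mod (K : fieldType) (L : falgType K) : cat :=
  full_sub (fun M : Mod L => fin_pres (M : module L false)).

Section RepresentationType.
Variables (K : fieldType) (L : falgType K).

Definition connected : Prop :=
  forall e : L, e * e = e -> (forall a, a * e = e * a) -> e = 0 \/ e = 1.

Definition hereditary : Prop :=
  forall (n : nat) (X Y : module L false),
    (1 < n)%N -> Ext_zero_succ n.-1 X Y.

Definition infinite_type : Prop :=
  ~ exists (n : nat) (M : 'I_n -> mod L),
      forall X : mod L, indecomposable X -> exists i, isomorphic X (M i).

Definition mmod (M : mod L) : module L false := proj1_sig M.

Fixpoint iter_rel (n : nat) (R : module L false -> module L false -> Prop)
    (M N : mod L) : Prop :=
  if n is n'.+1 then
    exists M' : mod L, iter_rel n' R M M' /\ R (mmod M') (mmod N)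
  else isomorphic M N.

Definition preprojective_ind (X : mod L) : Prop :=
  indecomposable X /\
  exists (n : nat) (P : mod L),
    [/\ indecomposable P, projective (mmod P)
      & iter_rel n (@is_inv_AR_translate K L) P X].

Definition postinjective_ind (X : mod L) : Prop :=
  indecomposable X /\
  exists (n : nat) (I : mod L),
    [/\ indecomposable I, injective_mod (mmod I)
      & iter_rel n (@is_AR_translate K L) I X].

Definition regular_ind (X : mod L) : Prop :=
  [/\ indecomposable X, ~ preprojective_ind X & ~ postinjective_ind X].

Definition Pcat : mod L -> Prop := add_closure preprojective_ind.
Definition Icat : mod L -> Prop := add_closure postinjective_ind.
Definition Rcat : mod L -> Prop := add_closure regular_ind.

End RepresentationType.

Record complex (K : fieldType) (L : falgType K) := Complex {
  cx :> int -> mod L;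
  cd : forall n : int, mhom (mmod (cx n)) (mmod (cx (n + 1)));
  cdd : forall n x, cd (n + 1) (cd n x) = 0;
  cx_bounded : exists N : nat, forall n : int, (N < `|n|)%N ->
    forall x : mmod (cx n), x = 0 }.

Record cmap (K : fieldType) (L : falgType K) (X Y : complex L) := Cmap {
  cf :> forall n : int, mhom (mmod (X n)) (mmod (Y n));
  cf_d : forall n x, cf (n + 1) (cd X n x) = cd Y n (cf n x) }.

Section Complexes.
Variables (K : fieldType) (L : falgType K).
Local Notation complex := (complex L).

Lemma cmap_eq (X Y : complex) (f g : cmap X Y) :
  (forall n, f n =1 g n) -> f = g.
Proof.
case: f g => [f df] [g dg] /= fg.
have {fg} e : f = g.
  by apply: functional_extensionality_dep => n; apply: mhom_eq; apply: fg.
by subst g; congr Cmap; apply: Prop_irrelevance.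
Qed.

Program Definition cmap_id (X : complex) : cmap X X :=
  {| cf := fun n => mhom_id _ |}.

Program Definition cmap_comp (X Y Z : complex) (g : cmap Y Z) (f : cmap X Y) :
  cmap X Z := {| cf := fun n => mhom_comp (g n) (f n) |}.
Next Obligation. by move=> X Y Z g f n x /=; rewrite !cf_d. Qed.

Definition Chb : cat.
Proof.
refine (@Cat complex (@cmap K L) cmap_id cmap_comp _ _ _).
- by move=> X Y Z W h g f; apply: cmap_eq.
- by move=> X Y f; apply: cmap_eq.
- by move=> X Y f; apply: cmap_eq.
Defined.

Program Definition shift_complex (X : complex) : complex :=
  {| cx := fun n => X (n + 1); cd := fun n => mhom_opp (cd X (n + 1)) |}.
Next Obligation. by move=> X n x /=; rewrite mhomN cdd !oppr0. Qed.
Next Obligation.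
move=> X; have [N hN] := cx_bounded X; exists N.+1 => n hn; apply: hN. lia.
Qed.

Program Definition shift_cmap (X Y : complex) (f : cmap X Y) :
    cmap (shift_complex X) (shift_complex Y) :=
  {| cf := fun n => f (n + 1) : mhom (mmod (shift_complex X n))
                                     (mmod (shift_complex Y n)) |}.
Next Obligation. by move=> X Y f n x /=; rewrite mhomN cf_d. Qed.

Program Definition shift : functor Chb Chb :=
  {| fobj := shift_complex : Chb -> Chb; fmap := @shift_cmap |}.
Next Obligation. by move=> X; apply: cmap_eq. Qed.
Next Obligation. by move=> X Y Z g f; apply: cmap_eq. Qed.

Lemma zero_module_eq (x y : zero_module L false) : x = y.
Proof. by rewrite [LHS]thinmx0 [RHS]thinmx0. Qed.

Lemma fin_pres_zero : fin_pres (zero_module L false).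
Proof.
exists 0%N, 0%N, (fun _ => 0), (fun _ _ => 0); split=> [x|c].
  by exists (fun _ => 0); apply: zero_module_eq.
by split=> [_|_]; [exists (fun _ => 0) => - []|apply: zero_module_eq].
Qed.

Lemma fin_pres_regular : fin_pres (regular L false).
Proof.
exists 1%N, 0%N, (fun _ => 1), (fun _ _ => 0); split=> [x|c].
  by exists (fun _ => x); rewrite big_ord1 /= /amul mul1r.
rewrite big_ord1 /= /amul mul1r; split=> [c0|[e he]].
  by exists (fun _ => 0) => i; rewrite big_ord0 ord1.
by rewrite he big_ord0.
Qed.

Definition zero_mod : mod L := exist _ _ fin_pres_zero.
Definition regular_mod : mod L := exist _ _ fin_pres_regular.

Program Definition stalk (M : mod L) : complex :=
  {| cx := fun n => if n == 0 then M else zero_mod;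
     cd := fun n => mhom_zero _ _ |}.
Next Obligation.
move=> M; exists 0%N => n; case: eqP => [->//|_] _ x.
exact: zero_module_eq.
Qed.

(* [f] induces isomorphisms on cohomology; the index [n] is about [H^(n+1)]. *)
Definition quasi_iso : mor_class Chb := fun X Y (f : cmap X Y) =>
  forall n : int,
    (forall x : mmod (X (n + 1)), cd X (n + 1) x = 0 ->
       (exists y, cd Y n y = f (n + 1) x) -> exists z, cd X n z = x) /\
    (forall y : mmod (Y (n + 1)), cd Y (n + 1) y = 0 ->
       exists x z, cd X (n + 1) x = 0 /\ y = f (n + 1) x + cd Y n z).

(* [H^m(X)] is isomorphic to [M]. *)
Definition is_cohomology (X : complex) (m : int) (M : mod L) : Prop :=
  exists n : int, n + 1 = m /\
  exists (Z : mod L) (k : mhom (mmod Z) (mmod (X (n + 1))))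
         (p : mhom (mmod Z) (mmod M)),
    [/\ injective k, exact_at k (cd X (n + 1)), surj p
      & forall z, p z = 0 <-> exists x, cd X n x = k z].

Definition concentrated (X : complex) (m : int) : Prop :=
  forall n : int, n + 1 <> m -> exact_at (cd X n) (cd X (n + 1)).

End Complexes.

Arguments Chb {K} L.
Arguments quasi_iso {K} L.
Arguments shift {K} L.
Arguments regular_mod {K} L.

(* [D^b(mod L)] as the localization [dQ] of the category of bounded complexes *)
(* at the quasi-isomorphisms, with the [K]-linear structure for which [dQ] is *)
(* linear and the shift functor induced by that of complexes.                 *)
Record derived_cat (K : fieldType) (L : falgType K) := DerivedCat {
  dcat :> lin_cat K;
  dQ : functor (Chb L) dcat;
  dQ_localization : is_localization (quasi_iso L) dQ;
  dQ_linear : forall (X Y : complex L) (a : K) (f g h : cmap X Y),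
    (forall n x, h n x = a *: f n x + g n x) ->
    fmap dQ (h : @hom (Chb L) X Y) =
      a *: (fmap dQ (f : @hom (Chb L) X Y) : lhom (dQ X) (dQ Y))
      + (fmap dQ (g : @hom (Chb L) X Y) : lhom (dQ X) (dQ Y));
  dshift : functor dcat dcat;
  dshift_Q : nat_iso (fcomp dshift dQ) (fcomp dQ (shift L)) }.

Arguments dQ {K L} d.
Arguments dshift {K L} d.

(* Serre duality: an equivalence [tau] with quasi-inverse [taui] and natural  *)
(* isomorphisms [Hom(Y, tau X) -> D Hom(X, Y[1])], written as pairings.       *)
Record serre_duality (K : fieldType) (L : falgType K) (D : derived_cat L) :=
    SerreDuality {
  tau : functor D D;
  taui : functor D D;
  tau_linear : linear_functor tau;
  taui_linear : linear_functor taui;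
  tau_unit : forall X : D, hom (tau (taui X)) X;
  tau_unit_nat : @natural D D (fcomp tau taui) (fid D) tau_unit;
  tau_unit_iso : forall X : D, is_iso (tau_unit X);
  tau_counit : forall X : D, hom (taui (tau X)) X;
  tau_counit_nat : @natural D D (fcomp taui tau) (fid D) tau_counit;
  tau_counit_iso : forall X : D, is_iso (tau_counit X);
  serre : forall X Y : D, lhom Y (tau X) -> lhom X (dshift D Y) -> K;
  serre_linl : forall (X Y : D) h, scalar (fun g => @serre X Y g h);
  serre_linr : forall (X Y : D) g, scalar (@serre X Y g);
  serre_inj : forall (X Y : D) g, (forall h, @serre X Y g h = 0) -> g = 0;
  serre_surj : forall (X Y : D) (phi : lhom X (dshift D Y) -> K),
    scalar phi -> exists g, @serre X Y g =1 phi;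
  serre_natX : forall (X X' Y : D) (f : hom X X') (g : hom Y (tau X))
      (h : hom X' (dshift D Y)),
    @serre X' Y (fmap tau f \oc g) h = @serre X Y g (h \oc f);
  serre_natY : forall (X Y Y' : D) (u : hom Y' Y) (g : hom Y (tau X))
      (h : hom X (dshift D Y')),
    @serre X Y' (g \oc u) h = @serre X Y g (fmap (dshift D) u \oc h) }.

(* The full subcategory [S[-m]] of [D^b(mod L)]: complexes with cohomology    *)
(* concentrated in degree [m], where it belongs to [S].                       *)
Definition in_degree (K : fieldType) (L : falgType K) (D : derived_cat L)
    (m : int) (S : mod L -> Prop) (X : D) : Prop :=
  exists C : complex L,
    [/\ isomorphic X (dQ D C), concentrated C m
      & exists M : mod L, is_cohomology C m M /\ S M].

(* [I[-1] \vee P[0] \vee R[0]]. *)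
Definition inH (K : fieldType) (L : falgType K) (D : derived_cat L) :
    D -> Prop :=
  join (in_degree 1 (@Icat K L))
       (join (in_degree 0 (@Pcat K L)) (in_degree 0 (@Rcat K L))).

Definition Hcat (K : fieldType) (L : falgType K) (D : derived_cat L) : cat :=
  full_sub (@inH K L D).

Definition Lambda (K : fieldType) (L : falgType K) (D : derived_cat L) : D :=
  dQ D (stalk (regular_mod L)).

(* A graded [K]-algebra [A = (+)_(n >= 0) A_n], given by its homogeneous      *)
(* components. Products are indexed by proofs of degree equalities in order   *)
(* to avoid casts.                                                            *)
Record gr_alg (K : fieldType) := GrAlg {
  gcomp :> nat -> lmodType K;
  gmul : forall p q r : nat, (p + q)%N = r -> gcomp p -> gcomp q -> gcomp r;
  gone : gcomp 0%N;
  gmul_linl : forall p q r (e : (p + q)%N = r) (k : K) (x y : gcomp p)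
      (z : gcomp q),
    gmul e (k *: x + y) z = k *: gmul e x z + gmul e y z;
  gmul_linr : forall p q r (e : (p + q)%N = r) (k : K) (x : gcomp p)
      (y z : gcomp q),
    gmul e x (k *: y + z) = k *: gmul e x y + gmul e x z;
  gmul1 : forall p (e : (p + 0)%N = p) (x : gcomp p), gmul e x gone = x;
  gmul1l : forall p (e : (0 + p)%N = p) (x : gcomp p), gmul e gone x = x;
  gmulA : forall p q r m k l (e1 : (p + q)%N = m) (e2 : (m + r)%N = k)
      (e3 : (q + r)%N = l) (e4 : (p + l)%N = k)
      (x : gcomp p) (y : gcomp q) (z : gcomp r),
    gmul e2 (gmul e1 x y) z = gmul e4 x (gmul e3 y z) }.

Arguments gmul {K g p q r}.
Arguments gone {K}.

Record gr_mod (K : fieldType) (A : gr_alg K) := GrMod {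
  gmcomp :> int -> lmodType K;
  gact : forall (n : int) (q : nat) (m : int), n + q%:Z = m ->
    gmcomp n -> A q -> gmcomp m;
  gact_linl : forall n q m (e : n + q%:Z = m) (k : K) (x y : gmcomp n)
      (z : A q),
    gact e (k *: x + y) z = k *: gact e x z + gact e y z;
  gact_linr : forall n q m (e : n + q%:Z = m) (k : K) (x : gmcomp n)
      (y z : A q),
    gact e x (k *: y + z) = k *: gact e x y + gact e x z;
  gact1 : forall n (e : n + 0%:Z = n) (x : gmcomp n), gact e x (gone A) = x;
  gactA : forall n q r m k l (e1 : n + q%:Z = m) (e2 : m + r%:Z = k)
      (e3 : (q + r)%N = l) (e4 : n + l%:Z = k)
      (x : gmcomp n) (y : A q) (z : A r),
    gact e2 (gact e1 x y) z = gact e4 x (gmul e3 y z) }.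

Arguments gact {K A g n q m}.

Record gr_hom (K : fieldType) (A : gr_alg K) (M N : gr_mod A) := GrHom {
  ghfun :> forall n, M n -> N n;
  gh_lin : forall n (k : K) (x y : M n),
    ghfun (k *: x + y) = k *: ghfun x + ghfun y;
  gh_act : forall n q m (e : n + q%:Z = m) (x : M n) (y : A q),
    ghfun (gact e x y) = gact e (ghfun x) y }.

Arguments ghfun {K A M N} _ n _.

Section GradedModules.
Variables (K : fieldType) (A : gr_alg K).

Lemma gr_hom_eq (M N : gr_mod A) (f g : gr_hom M N) :
  (forall n (x : M n), f n x = g n x) -> f = g.
Proof.
case: f g => [f lf af] [g lg ag] /= fg.
have {fg} e : f = g.
  by apply: functional_extensionality_dep => n; apply/funext/fg.
by subst g; congr GrHom; apply: Prop_irrelevance.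
Qed.

Program Definition gr_id (M : gr_mod A) : gr_hom M M :=
  {| ghfun := fun n x => x |}.

Program Definition gr_comp (M N P : gr_mod A) (g : gr_hom N P)
    (f : gr_hom M N) : gr_hom M P := {| ghfun := fun n x => g n (f n x) |}.
Next Obligation. by move=> M N P g f n k x y; rewrite /= !gh_lin. Qed.
Next Obligation. by move=> M N P g f n q m e x y; rewrite /= !gh_act. Qed.

Definition GrModCat : cat.
Proof.
refine (@Cat (gr_mod A) (@gr_hom K A) gr_id gr_comp _ _ _).
- by move=> X Y Z W h g f; apply: gr_hom_eq.
- by move=> X Y f; apply: gr_hom_eq.
- by move=> X Y f; apply: gr_hom_eq.
Defined.

(* [F] is free on the homogeneous elements [u i] of degrees [a i].            *)
Definition gr_free (n : nat) (a : 'I_n -> int) (F : gr_mod A)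
    (u : forall i, F (a i)) : Prop :=
  forall (M : gr_mod A) (x : forall i, M (a i)),
    exists! h : gr_hom F M, forall i, h (a i) (u i) = x i.

Definition gr_fin_pres (M : gr_mod A) : Prop :=
  exists (F1 F0 : gr_mod A) (f : gr_hom F1 F0) (p : gr_hom F0 M),
    [/\ exists (n : nat) (a : 'I_n -> int) (u : forall i, F1 (a i)), gr_free u,
        exists (n : nat) (a : 'I_n -> int) (u : forall i, F0 (a i)), gr_free u,
        (forall n (y : M n), exists x, p n x = y)
      & (forall n (y : F0 n), p n y = 0 <-> exists x, f n x = y)].

Definition gr_submodule (M : gr_mod A) (U : forall n, M n -> Prop) : Prop :=
  [/\ forall n, U n 0,
      forall n (k : K) (x y : M n), U n x -> U n y -> U n (k *: x + y)
    & forall n q m (e : n + q%:Z = m) (x : M n) (y : A q),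
        U n x -> U m (gact e x y)].

Definition gr_sub (M : gr_mod A) (U V : forall n, M n -> Prop) : Prop :=
  forall n x, U n x -> V n x.

(* There is a composition series [0 = U_0 < ... < U_l = M]. *)
Definition finite_length (M : gr_mod A) : Prop :=
  exists (l : nat) (U : nat -> forall n, M n -> Prop),
    [/\ forall i, gr_submodule (U i),
        forall n x, U 0%N n x <-> x = 0,
        forall n x, U l n x
      & forall i, (i < l)%N ->
          [/\ gr_sub (U i) (U i.+1), ~ gr_sub (U i.+1) (U i)
            & forall V, gr_submodule V -> gr_sub (U i) V ->
                gr_sub V (U i.+1) -> gr_sub V (U i) \/ gr_sub (U i.+1) V]].

Definition grmod : cat := full_sub (gr_fin_pres : GrModCat -> Prop).

Definition grmod0 : grmod -> Prop := fun M => finite_length (proj1_sig M).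

Lemma gmul0l p q r (e : (p + q)%N = r) (z : A q) : gmul e (0 : A p) z = 0.
Proof. by have := gmul_linl e (-1) 0 0 z; rewrite !scaleN1r !addNr. Qed.

Lemma gact0l (M : gr_mod A) n q m (e : n + q%:Z = m) (z : A q) :
  gact e (0 : M n) z = 0.
Proof. by have := gact_linl e (-1) (0 : M n) 0 z; rewrite !scaleN1r !addNr. Qed.

Definition reg_comp (n : int) : lmodType K :=
  if n is Posz p then A p else 'rV[K]_0.

Definition reg_act (n : int) (q : nat) (m : int) :
    n + q%:Z = m -> reg_comp n -> A q -> reg_comp m :=
  match n, m return n + q%:Z = m -> reg_comp n -> A q -> reg_comp m with
  | Posz p, Posz r => fun e x y => gmul (congr1 absz e) x y
  | _, _ => fun _ _ _ => 0
  end.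

Definition gr_regular : gr_mod A.
Proof.
refine (@GrMod K A reg_comp reg_act _ _ _ _).
- case=> [p|p] q [r|r] e k x y z /=; rewrite ?scaler0 ?addr0 //.
  exact: gmul_linl.
- case=> [p|p] q [r|r] e k x y z /=; rewrite ?scaler0 ?addr0 //.
  exact: gmul_linr.
- case=> [p|p] e x /=; first exact: gmul1.
  by rewrite [LHS]thinmx0 [RHS]thinmx0.
- case=> [p|p] q r [m|m] [k|k] l e1 e2 e3 e4 x y z //=.
  + exact: gmulA.
  + exact: gmul0l.
Defined.

Lemma gr_hom0 (M N : gr_mod A) (f : gr_hom M N) n : f n 0 = 0.
Proof. by have := gh_lin f (-1) (0 : M n) 0; rewrite !scaleN1r !addNr. Qed.

Program Definition gr_zero (M N : gr_mod A) : gr_hom M N :=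
  {| ghfun := fun n _ => 0 |}.
Next Obligation. by move=> M N n k x y; rewrite /= scaler0 addr0. Qed.
Next Obligation. by move=> M N n q m e x y; rewrite /= gact0l. Qed.

Definition reg_lift (M : gr_mod A) (x : M 0) (n : int) : reg_comp n -> M n :=
  match n return reg_comp n -> M n with
  | Posz p => fun a => gact (add0r p%:Z) x a
  | Negz p => fun _ => 0
  end.

Program Definition reg_hom (M : gr_mod A) (x : M 0) : gr_hom gr_regular M :=
  {| ghfun := reg_lift x |}.
Next Obligation.
move=> M x [p|p] k a b /=; first exact: gact_linr.
by rewrite scaler0 addr0.
Qed.
Next Obligation.
move=> M x [p|p] q [m|m] e a b //=; rewrite ?gact0l //.
  by rewrite -(gactA (add0r _) e).
have := gact_linr (add0r m%:Z) (-1) x 0 0.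
by rewrite !scaleN1r !addNr.
Qed.

Lemma gr_free_regular :
  gr_free (n := 1) (a := fun _ => 0) (F := gr_regular) (fun _ => gone A).
Proof.
move=> M x; exists (reg_hom (x ord0)); split=> [i|h hx].
  have -> : i = ord0 by apply/val_inj; case: i => -[].
  exact: (gact1 (add0r 0%:Z) (x ord0)).
apply: gr_hom_eq => -[p|p] a /=; last first.
  by rewrite -(gr_hom0 h); congr (h _ _); rewrite [LHS]thinmx0 [RHS]thinmx0.
rewrite -(hx ord0) -gh_act /=; congr (h _ _).
exact: gmul1l.
Qed.

Lemma gr_fin_pres_regular : gr_fin_pres gr_regular.
Proof.
exists gr_regular, gr_regular, (gr_zero _ _), (gr_id _); split.
- by exists 1%N, (fun _ => 0), (fun _ => gone A); apply: gr_free_regular.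
- by exists 1%N, (fun _ => 0), (fun _ => gone A); apply: gr_free_regular.
- by move=> n y; exists y.
- by move=> n y /=; split=> [->|[x <-]//]; exists 0.
Qed.

Definition grmod_regular : grmod := exist _ _ gr_fin_pres_regular.

End GradedModules.

Arguments GrModCat {K} A.
Arguments grmod {K} A.
Arguments grmod_regular {K} A.

Section Preprojective.
Variables (K : fieldType) (L : falgType K) (D : derived_cat L).
Variable S : serre_duality D.

Local Notation F := (taui S).
Local Notation O := (Lambda D).

(* The power [tau^-n X], for [n : int]. *)
Definition tp (n : int) (X : D) : D :=
  match n with
  | Posz p => iter p (taui S) X
  | Negz p => iter p.+1 (tau S) X
  end.

Fixpoint iter_map (G : functor D D) (p : nat) (X Y : D) (f : hom X Y) :
    hom (iter p G X) (iter p G Y) :=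
  if p is p'.+1 return hom (iter p G X) (iter p G Y)
  then fmap G (iter_map G p' f) else f.

Definition tp_map (n : int) (X Y : D) (f : hom X Y) : hom (tp n X) (tp n Y) :=
  match n return hom (tp n X) (tp n Y) with
  | Posz p => iter_map (taui S) p f
  | Negz p => iter_map (tau S) p.+1 f
  end.

Definition succz (n : int) : int :=
  match n with
  | Posz p => Posz p.+1
  | Negz 0 => Posz 0
  | Negz p.+1 => Negz p
  end.

(* The isomorphism [tau^- (tau^-n X) -> tau^-(n+1) X]: the identity for       *)
(* [n >= 0], and the counit of the quasi-inverse for [n < 0].                 *)
Definition tp_step (n : int) (X : D) : hom (F (tp n X)) (tp (succz n) X) :=
  match n return hom (F (tp n X)) (tp (succz n) X) with
  | Posz p => idm _
  | Negz 0 => tau_counit S X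
  | Negz p.+1 => tau_counit S (iter p.+1 (tau S) X)
  end.

Fixpoint tp_steps (n : int) (q : nat) (X : D) :
    hom (iter q F (tp n X)) (tp (iter q succz n) X) :=
  match q return hom (iter q F (tp n X)) (tp (iter q succz n) X) with
  | 0 => idm _
  | q'.+1 => tp_step (iter q' succz n) X \oc fmap F (tp_steps n q' X)
  end.

Definition tp_cast (n m : int) (e : n = m) (X : D) : hom (tp n X) (tp m X) :=
  match e in _ = m return hom (tp n X) (tp m X) with erefl => idm _ end.

Lemma iter_succz (n : int) (q : nat) : iter q succz n = n + q%:Z.
Proof.
elim: q => [|q /= ->]; first by rewrite addr0.
have h (m : int) : succz m = m + 1 by case: m => [m|[|m]] /=; lia.
by rewrite h; lia.
Qed.

(* The canonical isomorphism [tau^-q (tau^-n X) -> tau^-(n+q) X]. *)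
Definition tp_add (n : int) (q : nat) (m : int) (e : n + q%:Z = m) (X : D) :
    hom (iter q F (tp n X)) (tp m X) :=
  tp_cast (etrans (iter_succz n q) e) X \oc tp_steps n q X.

(* [xy = (tau^-q x) o y] for [x : L -> tau^-n X] and [y : L -> tau^-q L].     *)
Definition gamma_act (X : D) (n : int) (q : nat) (m : int)
    (e : n + q%:Z = m) (x : lhom O (tp n X)) (y : lhom O (tp q O)) :
    lhom O (tp m X) :=
  tp_add e X \oc (iter_map F q x \oc y).

Lemma comp_linl (X Y Z : D) (a : K) (g h : lhom Y Z) (f : lhom X Y) :
  comp (c := D) (a *: g + h : lhom Y Z) f =
  a *: (comp (c := D) g f : lhom X Z) + (comp (c := D) h f : lhom X Z).
Proof. exact: lcompDl. Qed.

Lemma comp_linr (X Y Z : D) (a : K) (g : lhom Y Z) (f h : lhom X Y) :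
  comp (c := D) g (a *: f + h : lhom X Y) =
  a *: (comp (c := D) g f : lhom X Z) + (comp (c := D) g h : lhom X Z).
Proof. exact: lcompDr. Qed.

Lemma iter_map1 (G : functor D D) p X : iter_map G p (idm X) = idm _.
Proof. by elim: p => //= p ->; rewrite fmap1. Qed.

Lemma iter_mapM (G : functor D D) p X Y Z (g : hom Y Z) (f : hom X Y) :
  iter_map G p (g \oc f) = iter_map G p g \oc iter_map G p f.
Proof. by elim: p => //= p ->; rewrite fmapM. Qed.

Lemma iter_map_lin (G : functor D D) : linear_functor G ->
  forall p (X Y : D) (a : K) (f g : lhom X Y),
  iter_map G p (a *: f + g : lhom X Y) =
    a *: (iter_map G p f : lhom (iter p G X) (iter p G Y))
    + (iter_map G p g : lhom (iter p G X) (iter p G Y)).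
Proof. by move=> Gl; elim=> //= p IH X Y a f g; rewrite IH Gl. Qed.

Lemma tp_map1 n X : tp_map n (idm X) = idm _.
Proof. by case: n => n; apply: iter_map1. Qed.

Lemma tp_mapM n X Y Z (g : hom Y Z) (f : hom X Y) :
  tp_map n (g \oc f) = tp_map n g \oc tp_map n f.
Proof. by case: n => n; apply: iter_mapM. Qed.

Lemma tp_cast_id n (e : n = n) X : tp_cast e X = idm _.
Proof. by rewrite (eq_irrelevance e erefl). Qed.

Lemma tp_cast_nat n m (e : n = m) X Y (f : hom X Y) :
  tp_map m f \oc tp_cast e X = tp_cast e Y \oc tp_map n f.
Proof. by case: m / e; rewrite /= comp1m compm1. Qed.

Lemma tp_step_cast n m (e : n = m) X :
  tp_step m X \oc fmap F (tp_cast e X) =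
  tp_cast (congr1 succz e) X \oc tp_step n X.
Proof. by case: m / e; rewrite /= fmap1 comp1m compm1. Qed.

Lemma tp_step_nat n X Y (f : hom X Y) :
  tp_map (succz n) f \oc tp_step n X = tp_step n Y \oc fmap F (tp_map n f).
Proof.
case: n => [p|[|p]] /=; first by rewrite comp1m compm1.
  exact: (tau_counit_nat S).
exact: (tau_counit_nat S (iter_map (tau S) p.+1 f)).
Qed.

Lemma tp_steps_nat n q X Y (f : hom X Y) :
  tp_map (iter q succz n) f \oc tp_steps n q X =
  tp_steps n q Y \oc iter_map F q (tp_map n f).
Proof.
elim: q => [|q IH] /=; first by rewrite comp1m compm1.
by rewrite compA tp_step_nat -!compA -!fmapM IH.
Qed.

Lemma tp_add_nat n q m (e : n + q%:Z = m) X Y (f : hom X Y) :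
  tp_map m f \oc tp_add e X = tp_add e Y \oc iter_map F q (tp_map n f).
Proof. by rewrite /tp_add compA tp_cast_nat -!compA tp_steps_nat. Qed.

Fixpoint iter_cat (r q : nat) (X : D) :
    hom (iter r F (iter q F X)) (iter (r + q) F X) :=
  match r return hom (iter r F (iter q F X)) (iter (r + q) F X) with
  | 0 => idm _
  | r'.+1 => fmap F (iter_cat r' q X)
  end.

Lemma iter_cat_nat r q X Y (f : hom X Y) :
  iter_map F (r + q) f \oc iter_cat r q X =
  iter_cat r q Y \oc iter_map F r (iter_map F q f).
Proof.
elim: r => [|r IH] /=; first by rewrite comp1m compm1.
by rewrite -!fmapM IH.
Qed.

Lemma tp_steps_cat n r q X
    (e : iter r succz (iter q succz n) = iter (r + q) succz n) :
  tp_steps n (r + q) X \oc iter_cat r q (tp n X) =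
  tp_cast e X \oc (tp_steps (iter q succz n) r X
                     \oc iter_map F r (tp_steps n q X)).
Proof.
elim: r e => [|r IH] e /=; first by rewrite tp_cast_id !comp1m compm1.
have e' : iter r succz (iter q succz n) = iter (r + q) succz n.
  by rewrite iterD.
rewrite -compA -fmapM (IH e') fmapM compA tp_step_cast.
by rewrite (eq_irrelevance e (congr1 succz e')) -!compA -fmapM.
Qed.

Lemma tp_steps_pos r q X (e : iter r succz q%:Z = (r + q)%N%:Z) :
  tp_cast e X \oc tp_steps q%:Z r X = iter_cat r q X.
Proof.
elim: r e => [|r IH] e /=; first by rewrite tp_cast_id comp1m.
have e' : iter r succz q%:Z = (r + q)%N%:Z by rewrite iter_succz; lia.
have h := tp_step_cast e' X; rewrite /= comp1m in h.
by rewrite -(IH e') fmapM h -compA (eq_irrelevance e (congr1 succz e')).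
Qed.

Lemma gamma_act_linl X n q m (e : n + q%:Z = m) (k : K)
    (x y : lhom O (tp n X)) (z : lhom O (tp q O)) :
  gamma_act e (k *: x + y) z = k *: gamma_act e x z + gamma_act e y z.
Proof.
rewrite /gamma_act (iter_map_lin (taui_linear S)) comp_linl.
exact: comp_linr.
Qed.

Lemma gamma_act_linr X n q m (e : n + q%:Z = m) (k : K)
    (x : lhom O (tp n X)) (y z : lhom O (tp q O)) :
  gamma_act e x (k *: y + z) = k *: gamma_act e x y + gamma_act e x z.
Proof. rewrite /gamma_act comp_linr; exact: comp_linr. Qed.

Lemma gamma_act1 X n (e : n + 0%:Z = n) (x : lhom O (tp n X)) :
  gamma_act e x (idm O) = x.
Proof.
rewrite /gamma_act /tp_add /= tp_cast_id !comp1m.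
exact: (@compm1 D _ _ x).
Qed.

Lemma tp_steps0 p X (e : iter p succz 0%:Z = p%:Z) :
  tp_cast e X \oc tp_steps 0%:Z p X = idm _.
Proof.
elim: p e => [|p IH] e /=; first by rewrite tp_cast_id comp1m.
have e' : iter p succz 0%:Z = p%:Z by rewrite iter_succz; lia.
have h := tp_step_cast e' X; rewrite /= comp1m in h.
by rewrite (eq_irrelevance e (congr1 succz e')) compA -h -fmapM IH fmap1.
Qed.

Lemma gamma_act1l p (e : 0%:Z + p%:Z = p%:Z) (x : lhom O (tp p O)) :
  gamma_act (n := 0%:Z) e (idm O) x = x.
Proof.
rewrite /gamma_act iter_map1 comp1m /tp_add tp_steps0.
exact: (@comp1m D _ _ x).
Qed.

Lemma gamma_actA X n q r m k l (e1 : n + q%:Z = m) (e2 : m + r%:Z = k)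
    (e3 : q%:Z + r%:Z = l%:Z) (e4 : n + l%:Z = k)
    (x : lhom O (tp n X)) (y : lhom O (tp q O)) (z : lhom O (tp r O)) :
  gamma_act e2 (gamma_act e1 x y) z = gamma_act e4 x (gamma_act e3 y z).
Proof.
have el : l = (r + q)%N by case: e3 => <-; rewrite addnC.
subst l.
have em : m = iter q succz n by rewrite iter_succz.
move: e1 e2; subst m => e1 e2.
have ek : k = iter r succz (iter q succz n) by rewrite iter_succz.
move: e2 e4; subst k => e2 e4.
rewrite /gamma_act /tp_add !tp_cast_id !comp1m tp_steps_pos.
move: (etrans _ _) => e.
rewrite !iter_mapM -!compA (compA (iter_map F (r + q) x)) iter_cat_nat.
rewrite -!compA (compA (tp_steps n (r + q) X)) (tp_steps_cat X (esym e)).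
have eK : tp_cast e X \oc tp_cast (esym e) X = idm _.
  by case: _ / e; rewrite /= comp1m.
by rewrite !compA eK !comp1m.
Qed.

Definition preproj_alg : gr_alg K.
Proof.
refine (@GrAlg K (fun p => lhom O (tp p O))
  (fun p q r e x y => gamma_act (n := p) (m := r) (congr1 Posz e) x y)
  (idm O) _ _ _ _ _).
- by move=> p q r e k x y z; apply: gamma_act_linl.
- by move=> p q r e k x y z; apply: gamma_act_linr.
- by move=> p e x; apply: gamma_act1.
- by move=> p e x; apply: gamma_act1l.
- by move=> p q r m k l e1 e2 e3 e4 x y z; apply: gamma_actA.
Defined.

(* [(+)_n Hom(L, tau^-n X)]. *)
Definition gamma_obj (X : D) : gr_mod preproj_alg.
Proof.
refine (@GrMod K preproj_alg (fun n => lhom O (tp n X)) (@gamma_act X) _ _ _ _).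
- by move=> n q m e k x y z; apply: gamma_act_linl.
- by move=> n q m e k x y z; apply: gamma_act_linr.
- by move=> n e x; apply: gamma_act1.
- by move=> n q r m k l e1 e2 e3 e4 x y z; apply: gamma_actA.
Defined.

Definition gamma_map (X Y : D) (f : hom X Y) :
  gr_hom (gamma_obj X) (gamma_obj Y).
Proof.
refine (@GrHom K preproj_alg (gamma_obj X) (gamma_obj Y)
  (fun n (x : lhom O (tp n X)) => tp_map n f \oc x) _ _).
- by move=> n k x y; apply: comp_linr.
- move=> n q m e x y; rewrite /= /gamma_act compA tp_add_nat.
  by rewrite iter_mapM !compA.
Defined.

Definition gammaD : functor D (GrModCat preproj_alg).
Proof.
refine (@Functor D (GrModCat preproj_alg) gamma_obj gamma_map _ _).
- move=> X; apply: gr_hom_eq => n x /=; rewrite tp_map1.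
  exact: (@comp1m D _ _ x).
- move=> X Y Z g f; apply: gr_hom_eq => n x /=; rewrite tp_mapM.
  by rewrite -(@compA D).
Defined.

Definition gamma : functor (Hcat D) (GrModCat preproj_alg) :=
  fcomp gammaD (incl (inH (D := D))).

(* Natural bijections [Hom_H (T M, Y) = Hom_GrMod (M, Gamma_* Y)]. *)
Definition partial_left_adjoint
    (T : functor (grmod preproj_alg) (Hcat D)) : Prop :=
  exists phi : forall (M : grmod preproj_alg) (Y : Hcat D),
      hom (T M) Y -> @hom (GrModCat preproj_alg) (proj1_sig M) (gamma Y),
    [/\ forall M Y, bijective (phi M Y),
        forall M Y (a : K) (f g : lhom (proj1_sig (T M)) (proj1_sig Y)) n x,
          ghfun (phi M Y (a *: f + g)) n x =
            a *: ghfun (phi M Y f) n x + ghfun (phi M Y g) n x,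
        forall M (Y Y' : Hcat D) (g : hom Y Y') (f : hom (T M) Y),
          phi M Y' (g \oc f) = fmap gamma g \oc phi M Y f
      & forall (M M' : grmod preproj_alg) Y (u : hom M' M) (f : hom (T M) Y),
          phi M' Y (f \oc fmap T u) =
            phi M Y f \oc (u : @hom (GrModCat preproj_alg) _ _)].

Definition induces_equivalence
    (T : functor (grmod preproj_alg) (Hcat D)) : Prop :=
  exists T' : functor (serre_quotient (@grmod0 K preproj_alg)) (Hcat D),
    nat_iso (fcomp T' (serre_quotient_functor (@grmod0 K preproj_alg))) T /\
    is_equivalence T'.

End Preprojective.

(* Main.v *)
(* A two-term complex of projectives P satisfies Hom_D(P, X) = chain maps modulo homotopy, since
   this functor of X inverts quasi-isomorphisms and Yoneda applies. So a module M and its resolution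
   P1 -> P0 compute Hom(M, N) and Ext^1(M, N) in D, and h0 X = Hom(Lambda, X) identifies the objects
   with Hom(Lambda, X[j]) = 0 for j <> 0 with finite dimensional modules.

   Infinite type and connectedness make tau^-m Lambda a module for every m >= 0: otherwise the
   indecomposable projectives split into those leaving the modules and the others, without maps in
   either direction, so by connectedness all leave, and there are only finitely many indecomposables.
   It follows that X lies in H if and only if tau^-m X is a module for all large m; the comparison
   with Auslander-Reiten translates is the formula Hom(Lambda, tau M) = D Ext^1(M, Lambda).

   Hence H can be studied through Hom(Lambda, tau^-n X) for large n: isomorphisms, kernels and
   cokernels are detected there, since Hom(Lambda, tau^-n -) is an Ext^1 and so right exact on
   modules. If M is the cokernel of a map of graded free modules, T(M) is the cokernel in H of the
   corresponding map between sums of powers tau^a Lambda, and the universal map M -> Gamma(T(M)) is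
   bijective in high degrees. This gives exactness of T. The truncations of Gamma(T(M)) are
   finitely presented and map to M by an isomorphism of the quotient category, which makes the
   functor induced by T fully faithful; applied to Gamma(Y) they show that it is essentially
   surjective. *)

From HB Require Import structures.
From mathcomp Require Import all_boot all_order all_algebra all_field.
From mathcomp Require Import zify boolp.
From mathcomp Require classical_sets.
Require Import Defs.

Set Implicit Arguments.
Unset Strict Implicit.
Unset Printing Implicit Defensive.

Import GRing.Theory.
Local Open Scope ring_scope.

Local Obligation Tactic := try by [].

(** * Vector spaces *)

(** [derived_cat] provides a localization with a linear structure and a shift, but no triangles, and
    [serre_duality] does not relate [tau] to the shift. So no cone enters as an object of [D]:
    heredity gives resolutions of length one, and every statement about [Hom] and [Ext^1] is read
    off from maps out of a two-term complex of projectives. Linearity of the shift and its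
    commutation with [tau] are derived.

    The definition of [H] by preprojective, regular and postinjective summands is hard to compute
    with. It is therefore replaced by a condition on large powers of [tau^-], which passes to sums,
    summands and isomorphic objects. A map, kernel or cokernel in [H] is then handled by applying
    one power of [tau^-] that turns all objects involved into modules; statements valid for all
    large [n] can be intersected, so finitely many objects always share such a power.

    On the graded side, kernels in [grmod] are tested on free modules of rank one, and finite
    presentation is established for cokernels and for truncations of [Gamma(Y)]. *)

Section LinearAlgebra.
Variable K : fieldType.
Implicit Types V W : lmodType K.

Definition lin V W (f : V -> W) : Prop :=
  forall k x y, f (k *: x + y) = k *: f x + f y.

Lemma lin0 V W (f : V -> W) : lin f -> f 0 = 0.
Proof. by move=> h; have := h (-1) 0 0; rewrite !scaleN1r !addNr. Qed.

Lemma linD V W (f : V -> W) : lin f -> forall x y, f (x + y) = f x + f y.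
Proof. by move=> h x y; have := h 1 x y; rewrite !scale1r. Qed.

Lemma linZ V W (f : V -> W) : lin f -> forall k x, f (k *: x) = k *: f x.
Proof. by move=> h k x; have := h k x 0; rewrite (lin0 h) !addr0. Qed.

Lemma linN V W (f : V -> W) : lin f -> forall x, f (- x) = - f x.
Proof. by move=> h x; rewrite -scaleN1r (linZ h) scaleN1r. Qed.

Lemma linB V W (f : V -> W) : lin f -> forall x y, f (x - y) = f x - f y.
Proof. by move=> h x y; rewrite (linD h) (linN h). Qed.

Lemma lin_sum V W (f : V -> W) : lin f ->
  forall I (r : seq I) (P : pred I) (F : I -> V),
  f (\sum_(i <- r | P i) F i) = \sum_(i <- r | P i) f (F i).
Proof. by move=> h I r P F; apply: big_morph; [exact: linD|exact: lin0]. Qed.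

Lemma lin_inj V W (f : V -> W) : lin f -> (forall x, f x = 0 -> x = 0) ->
  injective f.
Proof.
move=> h k x y e; apply/eqP; rewrite -subr_eq0; apply/eqP/k.
by rewrite (linB h) e subrr.
Qed.

Lemma lin_comp V W (X : lmodType K) (g : W -> X) (f : V -> W) :
  lin g -> lin f -> lin (fun x => g (f x)).
Proof. by move=> hg hf k x y; rewrite hf hg. Qed.

Definition lclosed V (U : V -> Prop) : Prop :=
  U 0 /\ forall k x y, U x -> U y -> U (k *: x + y).

Lemma lclosedD V (U : V -> Prop) : lclosed U ->
  forall x y, U x -> U y -> U (x + y).
Proof. by case=> _ h x y hx hy; have := h 1 x y hx hy; rewrite scale1r. Qed.

Lemma lclosedZ V (U : V -> Prop) : lclosed U -> forall k x, U x -> U (k *: x).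
Proof. by case=> h0 h k x hx; have := h k x 0 hx h0; rewrite addr0. Qed.

Lemma lclosedN V (U : V -> Prop) : lclosed U -> forall x, U x -> U (- x).
Proof. by move=> h x hx; rewrite -scaleN1r; apply: lclosedZ. Qed.

Lemma lclosedB V (U : V -> Prop) : lclosed U ->
  forall x y, U x -> U y -> U (x - y).
Proof. by move=> h x y hx hy; apply: lclosedD => //; apply: lclosedN. Qed.

Section Sub.
Variables (V : lmodType K) (U : V -> Prop) (cU : lclosed U).

(** The closure proof is a phantom argument: through it the structure instances below attach to the
    type itself. *)
Definition sublm of lclosed U : Type := {x : V | U x}.
Local Notation S := (sublm cU).
Definition sub_val (x : S) : V := proj1_sig x.
Definition sub_mk (x : V) (hx : U x) : S := exist _ x hx.

Lemma sub_val_inj : injective sub_val.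
Proof. by move=> [x hx] [y hy] /= e; apply: eq_exist. Qed.

Lemma sub_valP (x : S) : U (sub_val x). Proof. exact: proj2_sig. Qed.

HB.instance Definition _ := gen_eqMixin S.
HB.instance Definition _ := gen_choiceMixin S.

Definition sub_add (x y : S) : S := sub_mk (lclosedD cU (sub_valP x) (sub_valP y)).
Definition sub_opp (x : S) : S := sub_mk (lclosedN cU (sub_valP x)).
Definition sub_zero : S := sub_mk (proj1 cU).
Definition sub_scale k (x : S) : S := sub_mk (lclosedZ cU k (sub_valP x)).

Lemma sub_addA : associative sub_add.
Proof. by move=> x y z; apply: sub_val_inj; rewrite /= addrA. Qed.
Lemma sub_addC : commutative sub_add.
Proof. by move=> x y; apply: sub_val_inj; rewrite /= addrC. Qed.
Lemma sub_add0 : left_id sub_zero sub_add.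
Proof. by move=> x; apply: sub_val_inj; rewrite /= add0r. Qed.
Lemma sub_addN : left_inverse sub_zero sub_opp sub_add.
Proof. by move=> x; apply: sub_val_inj; rewrite /= addNr. Qed.
HB.instance Definition _ :=
  GRing.isZmodule.Build S sub_addA sub_addC sub_add0 sub_addN.

Lemma sub_scaleA a b (x : S) : sub_scale a (sub_scale b x) = sub_scale (a * b) x.
Proof. by apply: sub_val_inj; rewrite /= scalerA. Qed.
Lemma sub_scale1 : left_id 1 sub_scale.
Proof. by move=> x; apply: sub_val_inj; rewrite /= scale1r. Qed.
Lemma sub_scaleDr : right_distributive sub_scale +%R.
Proof. by move=> k x y; apply: sub_val_inj; rewrite /= scalerDr. Qed.
Lemma sub_scaleDl x : {morph sub_scale^~ x : a b / a + b}.
Proof. by move=> a b; apply: sub_val_inj; rewrite /= scalerDl. Qed.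
HB.instance Definition _ := GRing.Zmodule_isLmodule.Build K S
  sub_scaleA sub_scale1 sub_scaleDr sub_scaleDl.

Lemma sub_val_lin : lin (sub_val : S -> V). Proof. by []. Qed.
End Sub.

Section Quo.
Variables (V : lmodType K) (U : V -> Prop) (cU : lclosed U).

(** Cosets are predicates, so that two of them are equal by extensionality; representatives are
    picked by choice. *)
Definition quolm of lclosed U : Type :=
  {c : V -> Prop | exists x, c = fun y => U (y - x)}.
Local Notation Q := (quolm cU).
Definition quo_pi (x : V) : Q :=
  exist _ (fun y => U (y - x)) (ex_intro _ x erefl).
Definition quo_repr (c : Q) : V := projT1 (cid (proj2_sig c)).

Lemma quo_reprK c : quo_pi (quo_repr c) = c.
Proof.
rewrite /quo_repr; case: cid => x /= e; case: c e => c p /= e.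
by rewrite /quo_pi; apply: eq_exist => /=.
Qed.

Lemma quo_piE x y : quo_pi x = quo_pi y <-> U (x - y).
Proof.
split=> [[] /(congr1 (fun c => c x)) <-|h].
  by rewrite subrr; case: cU.
apply: eq_exist => /=; apply/funext => z; apply/propext; split=> hz.
  have -> : z - y = (z - x) + (x - y) by rewrite addrA subrK.
  exact: lclosedD.
have -> : z - x = (z - y) - (x - y) by rewrite opprB addrA subrK.
exact: lclosedB.
Qed.

Lemma quo_repr_pi x : U (quo_repr (quo_pi x) - x).
Proof. by apply/quo_piE; rewrite quo_reprK. Qed.

HB.instance Definition _ := gen_eqMixin Q.
HB.instance Definition _ := gen_choiceMixin Q.

Definition quo_add (x y : Q) : Q := quo_pi (quo_repr x + quo_repr y).
Definition quo_opp (x : Q) : Q := quo_pi (- quo_repr x).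
Definition quo_scale k (x : Q) : Q := quo_pi (k *: quo_repr x).

Lemma quo_addE x y : quo_add (quo_pi x) (quo_pi y) = quo_pi (x + y).
Proof.
apply/quo_piE; rewrite opprD addrACA.
by apply: lclosedD => //; apply: quo_repr_pi.
Qed.
Lemma quo_oppE x : quo_opp (quo_pi x) = quo_pi (- x).
Proof. by apply/quo_piE; rewrite -opprD; apply: lclosedN => //; apply: quo_repr_pi. Qed.
Lemma quo_scaleE k x : quo_scale k (quo_pi x) = quo_pi (k *: x).
Proof.
by apply/quo_piE; rewrite -scalerBr; apply: lclosedZ => //; apply: quo_repr_pi.
Qed.

Lemma quo_addA : associative quo_add.
Proof.
by move=> x y z; rewrite -(quo_reprK x) -(quo_reprK y) -(quo_reprK z) !quo_addE addrA.
Qed.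
Lemma quo_addC : commutative quo_add.
Proof. by move=> x y; rewrite /quo_add addrC. Qed.
Lemma quo_add0 : left_id (quo_pi 0) quo_add.
Proof. by move=> x; rewrite -(quo_reprK x) quo_addE add0r. Qed.
Lemma quo_addN : left_inverse (quo_pi 0) quo_opp quo_add.
Proof. by move=> x; rewrite -(quo_reprK x) quo_oppE quo_addE addNr. Qed.
HB.instance Definition _ :=
  GRing.isZmodule.Build Q quo_addA quo_addC quo_add0 quo_addN.

Lemma quo_piD x y : quo_pi x + quo_pi y = quo_pi (x + y).
Proof. exact: quo_addE. Qed.

Lemma quo_scaleA a b (x : Q) : quo_scale a (quo_scale b x) = quo_scale (a * b) x.
Proof. by rewrite -(quo_reprK x) !quo_scaleE scalerA. Qed.
Lemma quo_scale1 : left_id 1 quo_scale.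
Proof. by move=> x; rewrite -(quo_reprK x) !quo_scaleE scale1r. Qed.
Lemma quo_scaleDr : right_distributive quo_scale +%R.
Proof.
move=> k x y; rewrite -(quo_reprK x) -(quo_reprK y).
by rewrite quo_piD !quo_scaleE quo_piD scalerDr.
Qed.
Lemma quo_scaleDl x : {morph quo_scale^~ x : a b / a + b}.
Proof.
by move=> a b; rewrite -(quo_reprK x) !quo_scaleE quo_piD scalerDl.
Qed.
HB.instance Definition _ := GRing.Zmodule_isLmodule.Build K Q
  quo_scaleA quo_scale1 quo_scaleDr quo_scaleDl.

Lemma quo_pi_lin : lin (quo_pi : V -> Q).
Proof. by move=> k x y; rewrite -quo_piD -quo_scaleE. Qed.
End Quo.

(** Finite dimension as a bare spanning condition, because Hom spaces come as arbitrary
    [lmodType]s. *)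
Definition fd V : Prop :=
  exists (n : nat) (g : 'I_n -> V), forall x, exists c : 'I_n -> K,
    x = \sum_i c i *: g i.

Definition isdim V n : Prop :=
  exists (f : V -> 'rV[K]_n) (g : 'rV[K]_n -> V),
    [/\ lin f, lin g, cancel f g & cancel g f].

(** A spanning family of least size is a basis: a relation with [c 0 k != 0] expresses [g k] through
    the other members, which would then already span. *)
Lemma fd_isdim V : fd V -> exists n, isdim V n.
Proof.
pose P n := `[< exists g : 'I_n -> V, forall x, exists c : 'I_n -> K,
    x = \sum_i c i *: g i >].
case=> n0 h0; have exP : exists n, P n by exists n0; apply/asboolP.
case: (ex_minnP exP) => n /asboolP [g hg] nmin; exists n.
pose G (c : 'rV[K]_n) : V := \sum_i c 0 i *: g i.
have Gl : lin G.
  move=> k x y; rewrite /G scaler_sumr -big_split /=; apply: eq_bigr => i _.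
  by rewrite !mxE scalerDl scalerA.
have Gi : injective G.
  apply: lin_inj => // c c0; apply/rowP => k; rewrite mxE; apply/eqP.
  apply: contraT => ck; case: n => [|n] in g hg nmin G Gl c c0 k ck *.
    by case: k {ck} => [].
  suff : P n by move/nmin; rewrite ltnn.
  apply/asboolP; exists (fun i => g (lift k i)) => x.
  have [d ->] := hg x; exists (fun i => d (lift k i) - d k / c 0 k * c 0 (lift k i)).
  have gk : g k = - \sum_i (c 0 (lift k i) / c 0 k) *: g (lift k i).
    move: c0; rewrite /G (bigD1_ord k) //= => /eqP; rewrite addr_eq0 => /eqP e.
    apply: (scalerI ck); rewrite e scalerN scaler_sumr; congr (- _).
    by apply: eq_bigr => i _; rewrite scalerA mulrC divfK.
  rewrite (bigD1_ord k) //= gk scalerN scaler_sumr addrC -sumrN -big_split /=.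
  apply: eq_bigr => i _; rewrite scalerA scalerBl; congr (_ - _ *: _).
  by rewrite mulrA mulrAC.
have exG x : exists c, G c = x.
  have [d ->] := hg x; exists (\row_i d i).
  by apply: eq_bigr => i _; rewrite mxE.
pose F x := projT1 (cid (exG x)).
have FK : cancel F G by move=> x; rewrite /F; case: cid.
have GK : cancel G F by move=> c; apply: Gi; rewrite FK.
exists F, G; split=> // k x y; apply: Gi; rewrite FK Gl !FK //.
Qed.

Lemma fd_surj V W (f : V -> W) : lin f -> (forall y, exists x, f x = y) ->
  fd V -> fd W.
Proof.
move=> fl fs [n [g hg]]; exists n, (fun i => f (g i)) => y.
have [x <-] := fs y; have [c ->] := hg x; exists c.
by rewrite (lin_sum fl); apply: eq_bigr => i _; rewrite (linZ fl).
Qed.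

(** The family [g] is chosen so that the coordinates of its images have maximal rank. Adding any [x]
    cannot raise the rank, so [F x] lies in the row space and injectivity brings the relation back
    to [V]. *)
Lemma fd_inj V W (f : V -> W) : lin f -> injective f -> fd W -> fd V.
Proof.
move=> fl fi /fd_isdim [n [w [w' [wl _ wK _]]]].
pose F x := w (f x); have Fl : lin F by apply: lin_comp.
have Fi : injective F by move=> x y /(can_inj wK)/fi.
pose M m (g : 'I_m -> V) := \matrix_i F (g i).
pose P a := `[< exists m (g : 'I_m -> V), \rank (M m g) = a >].
have exP : exists a, P a.
  by exists (\rank (M 0%N (fun _ => 0))); apply/asboolP; exists 0%N, (fun _ => 0).
have bP a : P a -> (a <= n)%N by move/asboolP=> [m [g <-]]; apply: rank_leq_col.
case: (ex_maxnP exP bP) => a /asboolP [m [g ga]] amax.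
exists m, g => x.
pose g' (i : 'I_(1 + m)) := match split i with inl _ => x | inr j => g j end.
have e : M _ g' = col_mx (F x) (M m g).
  apply/row_matrixP => i; rewrite rowK /g' -[i]splitK.
  case: (split i) => j; rewrite unsplitK /=.
    by rewrite rowKu; apply/rowP => l; rewrite !mxE ord1.
  by rewrite rowKd rowK.
have sub1 : (M m g <= M _ g')%MS.
  by rewrite e; apply: submx_trans (addsmxSr (F x) _) _; rewrite addsmxE.
have sub2 : (F x <= M _ g')%MS.
  by rewrite e; apply: submx_trans (addsmxSl _ (M m g)) _; rewrite addsmxE.
have r : \rank (M m g) == \rank (M _ g').
  rewrite eqn_leq mxrankS //= ga; apply: amax.
  by apply/asboolP; exists _, g'.
have : (F x <= M m g)%MS.
  have [_ h] := mxrank_leqif_sup sub1.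
  by apply: submx_trans sub2 _; rewrite -h.
case/submxP => c hc; exists (fun i => c 0 i); apply: Fi.
rewrite (lin_sum Fl) hc mulmx_sum_row; apply: eq_bigr => i _.
by rewrite rowK (linZ Fl).
Qed.

Lemma fd_prod V W : fd V -> fd W -> fd (V * W)%type.
Proof.
move=> [n [g hg]] [m [h hh]]; exists (n + m)%N.
exists (fun i => match split i with inl j => (g j, 0) | inr j => (0, h j) end).
case=> x y; have [c ->] := hg x; have [d ->] := hh y.
exists (fun i => match split i with inl j => c j | inr j => d j end).
have l1 : lin (fun x : V => (x, 0 : W) : (V * W)%type).
  by move=> k u v; apply: injective_projections; rewrite //= scaler0 addr0.
have l2 : lin (fun y : W => (0 : V, y) : (V * W)%type).
  by move=> k u v; apply: injective_projections; rewrite //= scaler0 addr0.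
rewrite big_split_ord /=.
transitivity ((\sum_i c i *: g i, 0 : W) + (0 : V, \sum_i d i *: h i)).
  by apply: injective_projections; rewrite /= ?addr0 ?add0r.
congr (_ + _); [rewrite (lin_sum l1)|rewrite (lin_sum l2)]; apply: eq_bigr => i _.
  by rewrite -[lshift _ _]/(unsplit (inl _)) unsplitK (linZ l1).
by rewrite -[rshift _ _]/(unsplit (inr _)) unsplitK (linZ l2).
Qed.

Lemma fd_vect (V : vectType K) : fd V.
Proof.
exists (\dim {:V}), (fun i => (vbasis {:V})`_i) => x.
by exists (fun i => coord (vbasis {:V}) i x); apply: coord_vbasis; rewrite memvf.
Qed.

(** The matrix of an injective map is row free, so its rank is [a]; if [a = b] it is also row full,
    and preimages come from solving [c *m A = w y]. *)
Lemma isdim_inj V W a b (f : V -> W) : isdim V a -> isdim W b -> lin f ->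
  injective f -> (a <= b)%N /\ (a = b -> forall y, exists x, f x = y).
Proof.
move=> [v [v' [vl v'l vK v'K]]] [w [w' [wl w'l wK w'K]]] fl fi.
pose A := \matrix_i w (f (v' (delta_mx 0 i))).
have hA c : c *m A = w (f (v' c)).
  rewrite [in RHS](row_sum_delta c) (lin_sum v'l) (lin_sum fl) (lin_sum wl).
  rewrite mulmx_sum_row; apply: eq_bigr => i _.
  by rewrite rowK (linZ v'l) (linZ fl) (linZ wl).
have fr : row_free A.
  apply/row_freeP; have : \rank (kermx A) == 0%N.
    rewrite mxrank_eq0; apply/eqP/row_matrixP => i; rewrite row0.
    have : row i (kermx A) *m A = 0 by rewrite -row_mul mulmx_ker row0.
    rewrite hA -[RHS](lin0 wl) => /(can_inj wK); rewrite -(lin0 fl) => /fi.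
    by rewrite -(lin0 v'l) => /(can_inj v'K).
  rewrite mxrank_ker subn_eq0 => h; apply/row_freeP.
  by rewrite /row_free eqn_leq rank_leq_row.
split=> [|ab y]; first by rewrite -(eqP fr) rank_leq_col.
have fu : row_full A by rewrite /row_full (eqP fr) ab.
have [c hc] := submxP (submx_full (w y) fu).
by exists (v' c); apply: (can_inj wK); rewrite -hA.
Qed.

(** The value is 0 by default when the space is not finite dimensional; the facts below assume
    [fd]. *)
Definition dimv V : nat :=
  if pselect (exists n, isdim V n) is left h then projT1 (cid h) else 0%N.

Lemma dimvP V : fd V -> isdim V (dimv V).
Proof.
move=> /fd_isdim h; rewrite /dimv; case: pselect => // h'.
by case: cid.
Qed.

Lemma dimv_inj V W (f : V -> W) : fd W -> lin f -> injective f ->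
  (dimv V <= dimv W)%N /\ (dimv V = dimv W -> forall y, exists x, f x = y).
Proof.
by move=> fW fl fi; apply: isdim_inj => //; apply: dimvP => //; apply: fd_inj fi fW.
Qed.

(** The number of vectors is the dimension plus one. This is applied to the powers of an
    endomorphism. *)
Lemma fd_dependent V : fd V -> exists n, forall x : 'I_n -> V,
  exists c : 'I_n -> K, (exists i, c i != 0) /\ \sum_i c i *: x i = 0.
Proof.
move=> /fd_isdim [n [v [v' [vl _ vK _]]]]; exists n.+1 => x.
pose A := \matrix_i v (x i).
have : kermx A != 0.
  rewrite -mxrank_eq0 mxrank_ker -lt0n subn_gt0 ltnS; exact: rank_leq_col.
move/matrix0Pn => [i [j kij]]; exists (fun j => kermx A i j); split; first by exists j.
apply: (can_inj vK); rewrite (lin_sum vl) (lin0 vl).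
have := congr1 (row i) (mulmx_ker A); rewrite row_mul row0 mulmx_sum_row => h.
by rewrite -[RHS]h; apply: eq_bigr => l _; rewrite (linZ vl) rowK [row i _ 0 l]mxE.
Qed.

(** The pairing identifies [W] with the dual of [V], and the conclusion identifies [V] with the dual
    of [W]. The elements [e i] represent the coordinate functions of [V], so they form the basis
    dual to the [g i]. *)
Lemma fd_reflexive V W (b : W -> V -> K) : fd V ->
  (forall y, scalar (b y)) -> (forall x, scalar (b^~ x)) ->
  (forall y, (forall x, b y x = 0) -> y = 0) ->
  (forall phi : V -> K, scalar phi -> exists y, b y =1 phi) ->
  (forall x, (forall y, b y x = 0) -> x = 0) /\
  (forall Phi : W -> K, scalar Phi -> exists x, forall y, Phi y = b y x).
Proof.
move=> /fd_isdim [n [v [v' [vl v'l vK v'K]]]] bl br b0 bs.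
have cs (i : 'I_n) : scalar (fun x => v x 0 i) by move=> k x y /=; rewrite vl !mxE.
pose e i := projT1 (cid (bs _ (cs i))).
have he i x : b (e i) x = v x 0 i by rewrite /e; case: cid => y /= ->.
have b0l x : b 0 x = 0.
  by have := br x (-1) 0 0; rewrite !scaleN1r !addNr mulN1r addNr.
have b0r y : b y 0 = 0.
  by have := bl y (-1) 0 0; rewrite !scaleN1r !addNr mulN1r addNr.
split=> [x hx|Phi Pl].
  by apply: (can_inj vK); rewrite (lin0 vl); apply/rowP => i; rewrite -he hx mxE.
pose g i := v' (delta_mx 0 i).
have P0 : Phi 0 = 0 by have := Pl (-1) 0 0; rewrite !scaleN1r !addNr mulN1r addNr.
have sumP I (r : seq I) (c : I -> K) (y : I -> W) (Q : W -> K) : Q 0 = 0 -> scalar Q ->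
    Q (\sum_(i <- r) c i *: y i) = \sum_(i <- r) c i * Q (y i).
  by move=> Q0 Ql; elim: r => [|i r IH]; rewrite ?big_nil ?big_cons // Ql IH.
have sumV I (r : seq I) (c : I -> K) (y : I -> V) (Q : V -> K) : Q 0 = 0 -> scalar Q ->
    Q (\sum_(i <- r) c i *: y i) = \sum_(i <- r) c i * Q (y i).
  by move=> Q0 Ql; elim: r => [|i r IH]; rewrite ?big_nil ?big_cons // Ql IH.
have xE x : x = \sum_i v x 0 i *: g i.
  rewrite -{1}(vK x) {1}(row_sum_delta (v x)) (lin_sum v'l).
  by apply: eq_bigr => i _; rewrite (linZ v'l).
have yE y : y = \sum_i b y (g i) *: e i.
  apply/eqP; rewrite -subr_eq0; apply/eqP/b0 => x; rewrite addrC -scaleN1r.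
  rewrite (br x) mulN1r (sumP _ _ _ _ (b^~ x) (b0l x) (br x)) {2}(xE x).
  rewrite (sumV _ _ _ _ (b y) (b0r y) (bl y)) addrC.
  by apply/eqP; rewrite subr_eq0; apply/eqP/eq_bigr => i _; rewrite he mulrC.
exists (\sum_i Phi (e i) *: g i) => y.
rewrite {1}(yE y) (sumP _ _ _ _ Phi P0 Pl) (sumV _ _ _ _ (b y) (b0r y) (bl y)).
by apply: eq_bigr => i _; rewrite mulrC.
Qed.

End LinearAlgebra.

Arguments sublm {K V U} cU.
Arguments quolm {K V U} cU.

(** * Modules *)

Section ModuleConstructions.
Variables (K : fieldType) (L : falgType K) (op : bool).
Local Notation modl := (module L op).
Implicit Types M N P : modl.

Lemma mactDl M (x y : M) a : mact (x + y) a = mact x a + mact y a.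
Proof. exact: (linD (f := fun x : M => mact x a) (fun k x y => mact_linl k x y a)). Qed.

Lemma mact_linE M (x : M) : lin (mact x : L -> M).
Proof. by move=> k a b; apply: mact_linr. Qed.

Lemma mact_linE2 M (a : L) : lin (fun x : M => mact x a).
Proof. by move=> k x y; apply: mact_linl. Qed.

Lemma mact_scalar M (x : M) (k : K) : mact x k%:A = k *: x.
Proof. by rewrite (linZ (mact_linE x)) mact1. Qed.

Lemma amul_scalar (a : L) (k : K) : amul op a k%:A = k *: a.
Proof. exact: (@mact_scalar (regular L op)). Qed.

Definition sclosed M (U : M -> Prop) : Prop :=
  lclosed U /\ forall x a, U x -> U (mact x a).

Section SubModule.
Variables (M : modl) (U : M -> Prop) (cU : sclosed U).

Definition msub : modl.
Proof.
refine (@Module K L op (sublm (proj1 cU))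
  (fun x a => sub_mk (proj1 cU) (proj2 cU _ a (sub_valP x))) _ _ _ _).
- by move=> k x y a; apply: sub_val_inj; rewrite /= mact_linl.
- by move=> k x a b; apply: sub_val_inj; rewrite /= mact_linr.
- by move=> x; apply: sub_val_inj; rewrite /= mact1.
- by move=> x a b; apply: sub_val_inj; rewrite /= mactM.
Defined.

Definition mincl : mhom msub M.
Proof. by refine (@Mhom K L op msub M (@sub_val K M U (proj1 cU)) _ _). Defined.

Lemma mincl_inj : injective mincl. Proof. exact: sub_val_inj. Qed.

Lemma mincl_im x : U x <-> exists y, mincl y = x.
Proof.
split=> [h|[y <-]]; last exact: sub_valP.
by exists (sub_mk (proj1 cU) h).
Qed.

Lemma quo_act_subproof (x : quolm (proj1 cU)) (a : L) (y : M) :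
  quo_pi (proj1 cU) y = x ->
  quo_pi (proj1 cU) (mact (quo_repr x) a) = quo_pi (proj1 cU) (mact y a).
Proof.
move=> <-; apply/quo_piE; rewrite -(linB (mact_linE2 a)).
by apply: (proj2 cU); apply: quo_repr_pi.
Qed.

Definition mquo : modl.
Proof.
refine (@Module K L op (quolm (proj1 cU))
  (fun x a => quo_pi (proj1 cU) (mact (quo_repr x) a)) _ _ _ _).
- move=> k x y a; rewrite -(quo_reprK x) -(quo_reprK y) -(quo_pi_lin (proj1 cU)).
  by rewrite !(quo_act_subproof a erefl) mact_linl (quo_pi_lin (proj1 cU)).
- by move=> k x a b; rewrite mact_linr (quo_pi_lin (proj1 cU)).
- by move=> x; rewrite mact1 quo_reprK.
- by move=> x a b; rewrite (quo_act_subproof b erefl) mactM.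
Defined.

Definition mpi : mhom M mquo.
Proof.
refine (@Mhom K L op M mquo (@quo_pi K M U (proj1 cU)) _ _).
- exact: quo_pi_lin.
- by move=> x a /=; rewrite (quo_act_subproof a erefl).
Defined.

Lemma mpi_surj : surj mpi.
Proof. by move=> y; exists (quo_repr y); apply: quo_reprK. Qed.

Lemma mpi_ker x : mpi x = 0 <-> U x.
Proof.
have := quo_piE (proj1 cU) x 0; rewrite subr0 => <-.
by rewrite -[quo_pi _ 0]/(mpi 0) mhom0.
Qed.
End SubModule.

Definition mprod M N : modl.
Proof.
refine (@Module K L op (M * N)%type (fun x a => (mact x.1 a, mact x.2 a)) _ _ _ _).
- by move=> k x y a; rewrite !mact_linl.
- by move=> k x a b; rewrite !mact_linr.
- by case=> x y; rewrite /= !mact1.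
- by move=> x a b; rewrite /= !mactM.
Defined.

Program Definition mfst M N : mhom (mprod M N) M := {| mfun := fst |}.
Program Definition msnd M N : mhom (mprod M N) N := {| mfun := snd |}.
Program Definition minl M N : mhom M (mprod M N) := {| mfun := fun x => (x, 0) |}.
Next Obligation.
by move=> M N k x y; apply: injective_projections; rewrite /= ?scaler0 ?addr0.
Qed.
Next Obligation. by move=> M N x a; rewrite /= mact0l. Qed.
Program Definition minr M N : mhom N (mprod M N) := {| mfun := fun x => (0, x) |}.
Next Obligation.
by move=> M N k x y; apply: injective_projections; rewrite /= ?scaler0 ?addr0.
Qed.
Next Obligation. by move=> M N x a; rewrite /= mact0l. Qed.

Program Definition mlinc M N (k : K) (f g : mhom M N) : mhom M N :=
  {| mfun := fun x => k *: f x + g x |}.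
Next Obligation.
move=> M N k f g l x y /=; rewrite !mhom_lin !scalerDr !scalerA mulrC.
by rewrite addrACA.
Qed.
Next Obligation. by move=> M N k f g x a /=; rewrite !mhom_act mact_linl. Qed.

Definition rclosed M N (R : M -> N -> Prop) : Prop :=
  [/\ R 0 0, forall k x x' y y', R x y -> R x' y' -> R (k *: x + x') (k *: y + y')
    & forall x y a, R x y -> R (mact x a) (mact y a)].

(** Diagram chases are run with relations: one writes down which [y] may correspond to [x], and a
    closed relation that is single valued at 0 is single valued everywhere, by subtraction. *)
Lemma mhom_of_rel M N (R : M -> N -> Prop) : rclosed R ->
  (forall x, exists y, R x y) -> (forall y, R 0 y -> y = 0) ->
  exists f : mhom M N, forall x, R x (f x).
Proof.
move=> [R0 Rl Ra] Rt Ru.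
have Ru' x y y' : R x y -> R x y' -> y = y'.
  move=> h h'; apply/eqP; rewrite -subr_eq0; apply/eqP/Ru.
  by have := Rl (-1) _ _ _ _ h' h; rewrite !scaleN1r !addNr addrC.
pose f x := projT1 (cid (Rt x)).
have fR x : R x (f x) by rewrite /f; case: cid.
unshelve eexists (@Mhom K L op M N f _ _) => //.
- by move=> k x y; apply: Ru' (fR _) _; apply: Rl.
- by move=> x a; apply: Ru' (fR _) _; apply: Ra.
Qed.

(** The relation is a submodule of the product that projects onto [M]; projectivity splits this
    projection. It lifts through several conditions at once, as needed for maps of complexes. *)
Lemma proj_lift_rel M N (R : M -> N -> Prop) : projective M -> rclosed R ->
  (forall x, exists y, R x y) -> exists f : mhom M N, forall x, R x (f x).
Proof.
move=> pM [R0 Rl Ra] Rt.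
have cR : @sclosed (mprod M N) (fun z => R z.1 z.2).
  split; first split=> // k [x y] [x' y']; first exact: Rl.
  by move=> [x y] a; apply: Ra.
have [|h hh] := pM _ _ (mhom_comp (mfst M N) (mincl cR)) (mhom_id M).
  move=> x; have [y hy] := Rt x.
  by exists (sub_mk (proj1 cR) (x := (x, y)) hy).
exists (mhom_comp (msnd M N) (mhom_comp (mincl cR) h)) => x.
have e : (sub_val (h x)).1 = x := hh x.
by have := sub_valP (h x); rewrite e.
Qed.

Lemma projective_retract M N (s : mhom M N) (p : mhom N M) :
  projective N -> (forall x, p (s x) = x) -> projective M.
Proof.
move=> pN sp X Y g f gs; have [h hh] := pN _ _ g (mhom_comp f p) gs.
by exists (mhom_comp h s) => x; rewrite /= hh /= sp.
Qed.

Definition mker_closed M N (f : mhom M N) : sclosed (fun x => f x = 0).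
Proof.
split; first split; first exact: mhom0.
  by move=> k x y hx hy; rewrite mhom_lin hx hy scaler0 addr0.
by move=> x a hx; rewrite mhom_act hx mact0l.
Qed.

Definition mim_closed M N (f : mhom M N) : sclosed (fun y => exists x, f x = y).
Proof.
split; first split; first by exists 0; apply: mhom0.
  by move=> k x y [u <-] [v <-]; exists (k *: u + v); rewrite mhom_lin.
by move=> x a [u <-]; exists (mact u a); rewrite mhom_act.
Qed.

Definition mfree (n : nat) : modl.
Proof.
refine (@Module K L op {ffun 'I_n -> L} (fun c a => [ffun i => amul op (c i) a]) _ _ _ _).
- move=> k x y a; apply/ffunP => i; rewrite !ffunE.
  exact: (@mact_linl _ _ _ (regular L op)).
- move=> k x a b; apply/ffunP => i; rewrite !ffunE.
  exact: (@mact_linr _ _ _ (regular L op)).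
- by move=> x; apply/ffunP => i; rewrite !ffunE; apply: (@mact1 _ _ _ (regular L op)).
- by move=> x a b; apply/ffunP => i; rewrite !ffunE; apply: (@mactM _ _ _ (regular L op)).
Defined.

Definition mfree_hom n M (x : 'I_n -> M) : mhom (mfree n) M.
Proof.
refine (@Mhom K L op (mfree n) M (fun c : {ffun 'I_n -> L} => \sum_i mact (x i) (c i)) _ _).
- move=> k c d; rewrite scaler_sumr -big_split /=; apply: eq_bigr => i _.
  by rewrite !ffunE mact_linr.
- move=> c a /=; rewrite (lin_sum (mact_linE2 a)); apply: eq_bigr => i _.
  by rewrite ffunE mactM.
Defined.

Definition mbasis n (i : 'I_n) : mfree n := [ffun j => if j == i then 1 else 0] : {ffun 'I_n -> L}.

Lemma mfree_homE n M (x : 'I_n -> M) i : mfree_hom x (mbasis i) = x i.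
Proof.
rewrite /= (bigD1 i) //= ffunE eqxx mact1 big1 ?addr0 // => j ji.
by rewrite ffunE (negbTE ji) (lin0 (mact_linE _)).
Qed.

Lemma mfree_hom_uniq n M (f g : mhom (mfree n) M) :
  (forall i, f (mbasis i) = g (mbasis i)) -> f = g.
Proof.
have h (f' : mhom (mfree n) M) (c : mfree n) :
    f' c = \sum_i mact (f' (mbasis i)) ((c : {ffun 'I_n -> L}) i).
  have fl : lin f' by apply: mhom_lin.
  rewrite -(eq_bigr _ (fun i _ => mhom_act f' _ _)) -(lin_sum fl); congr (f' _).
  apply/ffunP => j; rewrite sum_ffunE (bigD1 j) //= !ffunE eqxx /amul.
  rewrite big1 ?addr0; first by case: op; rewrite ?mulr1 ?mul1r.
  move=> i ij; rewrite !ffunE eq_sym (negbTE ij) /amul.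
  by case: op; rewrite ?mulr0 ?mul0r.
by move=> fg; apply: mhom_eq => c; rewrite !h; apply: eq_bigr => i _; rewrite fg.
Qed.

Lemma mfree_projective n : projective (mfree n).
Proof.
move=> M N g f gs; have [x hx] := choice (fun i => gs (f (mbasis i))).
exists (mfree_hom x) => c.
rewrite -[LHS]/(mhom_comp g (mfree_hom x) c); congr (mfun _ c).
by apply: mfree_hom_uniq => i; rewrite -hx; congr (g _); apply: mfree_homE.
Qed.

Lemma fd_free n : fd (mfree n).
Proof. exact: (@fd_vect K {ffun 'I_n -> L}). Qed.

(** Vector space generators are also module generators, scalars acting as [k%:A]. The module of
    relations is a subspace of a free module of finite dimension, so it is finitely generated for
    the same reason. *)
Lemma fin_presP M : fin_pres M <-> fd M.
Proof.
split=> [[n [m [g [r [hg _]]]]]|[n [g hg]]].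
  apply: fd_surj (mhom_lin (mfree_hom g)) _ (fd_free n).
  move=> y; have [c ->] := hg y; exists ([ffun i => c i] : {ffun _ -> _}).
  by apply: eq_bigr => i _; rewrite ffunE.
pose f := mfree_hom g.
have [m [r hr]] : fd (msub (mker_closed f)).
  exact: fd_inj (mhom_lin (mincl _)) (@mincl_inj _ _ (mker_closed f)) (fd_free n).
exists n, m, g, (fun j i => (mincl _ (r j) : {ffun 'I_n -> L}) i); split=> [x|c].
  have [c ->] := hg x; exists (fun i => (c i)%:A).
  by apply: eq_bigr => i _; rewrite mact_scalar.
split=> [c0|[e he]].
  pose d : mfree n := [ffun i => c i] : {ffun 'I_n -> L}.
  have /(mincl_im (mker_closed f)) [d' hd] : f d = 0.
    by rewrite -[RHS]c0; apply: eq_bigr => i _; rewrite ffunE.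
  have [k hk] := hr d'; exists (fun j => (k j)%:A) => i.
  transitivity ((d : {ffun 'I_n -> L}) i); first by rewrite ffunE.
  rewrite -hd hk (lin_sum (f := mincl _)); last exact: mhom_lin.
  rewrite sum_ffunE; apply: eq_bigr => j _.
  rewrite (linZ (f := mincl _)); last exact: mhom_lin.
  by rewrite ffunE amul_scalar.
under eq_bigr do rewrite he (lin_sum (mact_linE _)).
rewrite exchange_big big1 //= => j _.
under eq_bigr do rewrite -mactM.
rewrite -(lin_sum (mact_linE2 _)).
have : f (mincl _ (r j)) = 0 by apply/(mincl_im (mker_closed f)); exists (r j).
by move=> /= ->; rewrite mact0l.
Qed.

Lemma free_cover M : fd M -> exists n (f : mhom (mfree n) M), surj f.
Proof.
move=> [n [g hg]]; exists n, (mfree_hom g) => y; have [c ->] := hg y.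
exists ([ffun i => (c i)%:A] : {ffun _ -> _}).
by apply: eq_bigr => i _; rewrite ffunE mact_scalar.
Qed.

Lemma fd_msub M (U : M -> Prop) (cU : sclosed U) : fd M -> fd (msub cU).
Proof. exact: fd_inj (mhom_lin (mincl cU)) (@mincl_inj _ _ cU). Qed.

Lemma fd_mquo M (U : M -> Prop) (cU : sclosed U) : fd M -> fd (mquo cU).
Proof. exact: fd_surj (mhom_lin (mpi cU)) (@mpi_surj _ _ cU). Qed.

Lemma mhom_factor_surj M N P (p : mhom M N) (f : mhom M P) : surj p ->
  (forall x, p x = 0 -> f x = 0) -> exists g : mhom N P, forall x, g (p x) = f x.
Proof.
move=> ps pf.
have [||y [x [hx <-]]|g hg] := @mhom_of_rel N P (fun y z => exists x, p x = y /\ f x = z).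
- split=> [|k ? ? ? ? [x [<- <-]] [x' [<- <-]]|? ? a [x [<- <-]]].
  + by exists 0; rewrite !mhom0.
  + by exists (k *: x + x'); rewrite !mhom_lin.
  + by exists (mact x a); rewrite !mhom_act.
- by move=> y; have [x <-] := ps y; exists (f x), x.
- exact: pf.
exists g => x; have [x' [e <-]] := hg (p x).
apply/eqP; rewrite -subr_eq0; apply/eqP.
have fl : lin f by apply: mhom_lin.
have pl : lin p by apply: mhom_lin.
by rewrite -(linB fl) pf // (linB pl) e subrr.
Qed.

Lemma mhom_factor_inj M N P (i : mhom N P) (f : mhom M P) : injective i ->
  (forall x, exists y, i y = f x) -> exists g : mhom M N, forall x, i (g x) = f x.
Proof.
move=> ii fi; apply: (@mhom_of_rel M N (fun x y => i y = f x)) => // [|y].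
  split=> [|k x x' y y' h h'|x y a h]; first by rewrite !mhom0.
    by rewrite !mhom_lin h h'.
  by rewrite !mhom_act h.
by rewrite mhom0 -(mhom0 i) => /ii.
Qed.

End ModuleConstructions.

(** * Submodules of projective modules over a hereditary algebra *)

Section HereditaryModules.
Variables (K : fieldType) (L : falgType K).
Hypothesis hL : hereditary L.
Local Notation modl := (module L false).

(** Bundling a module with its finite dimension allows syzygies to be iterated by recursion. *)
Let fdm := {M : modl | fd M}.
Let cov (V : fdm) := cid (free_cover (proj2_sig V)).
Let covn (V : fdm) : nat := projT1 (cov V).
Let covf (V : fdm) : mhom (mfree L false (covn V)) (proj1_sig V) :=
  projT1 (cid (projT2 (cov V))).
Let covs (V : fdm) : surj (covf V).
Proof. by rewrite /covf; case: (cid (projT2 (cov V))). Qed.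
Let kerm (V : fdm) : fdm :=
  exist _ (msub (mker_closed (covf V))) (fd_msub _ (fd_free _ _ _)).

Let kz V z : covf V (mincl (mker_closed (covf V)) z) = 0.
Proof. exact: (sub_valP z). Qed.

(** A free cover of [U] splits because [Ext^2(P/U, N) = 0] for its kernel [N]: in the resolution of
    [P/U] with [P] in degree 0, the cover of [U] in degree 1 and the cover of [N] in degree 2, the
    last cover is a cocycle with values in [N]. *)
Lemma sub_projective (P U : modl) (i : mhom U P) :
  projective P -> injective i -> fd U -> projective U.
Proof.
move=> pP ii fU.
pose Us := fix Us n : fdm := if n is n'.+1 then kerm (Us n') else exist _ U fU.
pose Ps n : modl := if n is n'.+1 then mfree L false (covn (Us n')) else P.
pose ds n : mhom (Ps n.+1) (Ps n) :=
  match n return mhom (Ps n.+1) (Ps n) with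
  | 0 => mhom_comp i (covf (Us 0%N))
  | n'.+1 => mhom_comp (mincl (mker_closed (covf (Us n')))) (covf (Us n'.+1))
  end.
have [|||||g hg] := hL (X := mquo (mim_closed i)) (Y := proj1_sig (Us 1%N)) (isT : 1 < 2)%N
   (P := Ps) (d := ds) (e := mpi (mim_closed i)) _ _ _ _ (f := covf (Us 1%N)) _.
- by case=> [|n] //; apply: mfree_projective.
- exact: mpi_surj.
- move=> y; split=> [/mpi_ker [x <-]|[x <-]].
    by have [z <-] := covs (V := Us 0%N) x; exists z.
  by apply/mpi_ker; exists (covf (Us 0%N) x).
- case=> [|n] y; split.
  + rewrite /= -[X in _ = X](mhom0 i) => /ii h.
    have /(mincl_im (mker_closed (covf (Us 0%N)))) [z <-] := h.
    by have [x <-] := covs (V := Us 1%N) z; exists x.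
  + case=> x <-; have e := congr1 (mfun i) (kz (V := Us 0%N) (covf (Us 1%N) x)).
    by move: e; rewrite mhom0.
  + move=> e.
    have h : covf (Us n.+1) y = 0.
      by apply: (@mincl_inj _ _ _ _ _ (mker_closed (covf (Us n)))); rewrite mhom0; apply: e.
    have /(mincl_im (mker_closed (covf (Us n.+1)))) [z <-] := h.
    by have [x <-] := covs (V := Us n.+2) z; exists x.
  + case=> x <-.
    have e := congr1 (mincl (mker_closed (covf (Us n))))
      (kz (V := Us n.+1) (covf (Us n.+2) x)).
    by move: e; rewrite mhom0.
- by move=> x; apply: (kz (V := Us 1%N)).
set p := covf (Us 0%N).
set k := mincl (mker_closed p).
have gk z : g (k z) = z.
  by have [x <-] := covs (V := Us 1%N) z; rewrite [RHS]hg.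
(* Since [g] retracts the cover onto its kernel, each [u] has exactly one preimage annihilated by
   [g]; this preimage is the section. *)
have [||y [py gy]|s hs] := @mhom_of_rel _ _ _ U (mfree L false (covn (Us 0%N)))
   (fun u x => p x = u /\ g x = 0).
- split=> [|l x x' y y' [<- h] [<- h']|x y a [<- h]]; rewrite ?mhom0 //.
    by rewrite !mhom_lin h h' scaler0 addr0.
  by rewrite !mhom_act h mact0l.
- move=> u; have [x <-] := covs (V := Us 0%N) u; exists (x - k (g x)).
  have pl : lin p by apply: mhom_lin.
  have gl : lin g by apply: mhom_lin.
  rewrite (linB pl) (linB gl) gk subrr; split=> //.
  by rewrite [p (k _)](kz (V := Us 0%N)) subr0.
- have /(mincl_im (mker_closed p)) [z hz] := py.
  by rewrite -hz; move: gy; rewrite -hz gk => ->; rewrite mhom0.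
apply: (projective_retract (s := s) (p := p)); first exact: mfree_projective.
by move=> x; case: (hs x).
Qed.

End HereditaryModules.

(** * Linear categories and localizations *)

Definition Sets : cat.
Proof.
by refine (@Cat Type (fun A B => A -> B) (fun A x => x)
  (fun A B C g f x => g (f x)) _ _ _).
Defined.

Lemma Sets_iso (A B : Sets) (f : A -> B) :
  (forall x y, f x = f y -> x = y) -> (forall y, exists x, f x = y) ->
  @is_iso Sets A B f.
Proof.
move=> fi fs; exists (fun y => projT1 (cid (fs y))).
by split; apply/funext => x; rewrite /comp /=; case: cid => //= y /fi.
Qed.

Section ClassQuotient.
Variables (T : Type) (R : T -> T -> Prop).
Hypothesis Rr : forall x, R x x.
Hypothesis Rs : forall x y, R x y -> R y x.
Hypothesis Rt : forall x y z, R x y -> R y z -> R x z.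

Definition classes := {c : T -> Prop | exists x, c = R x}.
Definition cls (x : T) : classes := exist _ (R x) (ex_intro _ x erefl).

Lemma clsE x y : cls x = cls y <-> R x y.
Proof.
split=> [[] /(congr1 (fun c => c y)) ->//|h].
apply: eq_exist; apply/funext => z; apply/propext; split; first exact: Rt (Rs h).
exact: Rt.
Qed.

Definition crepr (c : classes) : T := projT1 (cid (proj2_sig c)).
Lemma creprK c : cls (crepr c) = c.
Proof.
rewrite /crepr; case: cid => s /= e; case: c e => c p /= e.
by rewrite /cls; apply: eq_exist => /=.
Qed.
End ClassQuotient.

Section LinearCategory.
Variables (K : fieldType) (D : lin_cat K).
Implicit Types X Y Z : D.

Definition homF (A : D) : functor D Sets.
Proof.
refine (@Functor D Sets (fun X => lhom A X)
  (fun X Y (f : hom X Y) (h : lhom A X) => f \oc h : lhom A Y) _ _) => [X|X Y Z g f].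
  by apply/funext => h; exact: (@comp1m D).
by apply/funext => h; rewrite -(@compA D).
Defined.

(** [comp] of the underlying category and [lcomp] are convertible but not the same for rewriting;
    calculations are moved to [lcomp], where the additive laws live. *)
Lemma lcompE X Y Z (g : lhom Y Z) (f : lhom X Y) :
  comp (c := D) g f = lcomp g f. Proof. by []. Qed.

Lemma fmapL (F : functor D D) X Y Z (g : lhom Y Z) (f : lhom X Y) :
  fmap F (lcomp g f) = lcomp (fmap F g : lhom (F Y) (F Z)) (fmap F f : lhom (F X) (F Y)).
Proof. exact: fmapM. Qed.

Lemma lcompDl_ X Y Z (f : lhom X Y) : lin (fun g : lhom Y Z => lcomp g f).
Proof. by move=> k g h; apply: lcompDl. Qed.
Lemma lcompDr_ X Y Z (g : lhom Y Z) : lin (fun f : lhom X Y => lcomp g f).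
Proof. by move=> k f h; apply: lcompDr. Qed.

Lemma lcomp0l X Y Z (f : lhom X Y) : lcomp (0 : lhom Y Z) f = 0.
Proof. exact: (lin0 (lcompDl_ f)). Qed.
Lemma lcomp0r X Y Z (g : lhom Y Z) : lcomp g (0 : lhom X Y) = 0.
Proof. exact: (lin0 (lcompDr_ g)). Qed.
Lemma lcompD X Y Z (g h : lhom Y Z) (f : lhom X Y) :
  lcomp (g + h) f = lcomp g f + lcomp h f.
Proof. exact: (linD (lcompDl_ f)). Qed.
Lemma lcompDR X Y Z (g : lhom Y Z) (f h : lhom X Y) :
  lcomp g (f + h) = lcomp g f + lcomp g h.
Proof. exact: (linD (lcompDr_ g)). Qed.
Lemma lcompB X Y Z (g h : lhom Y Z) (f : lhom X Y) :
  lcomp (g - h) f = lcomp g f - lcomp h f.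
Proof. exact: (linB (lcompDl_ f)). Qed.
Lemma lcompBR X Y Z (g : lhom Y Z) (f h : lhom X Y) :
  lcomp g (f - h) = lcomp g f - lcomp g h.
Proof. exact: (linB (lcompDr_ g)). Qed.
Lemma lcompNl X Y Z (g : lhom Y Z) (f : lhom X Y) :
  lcomp (- g) f = - lcomp g f.
Proof. exact: (linN (lcompDl_ f)). Qed.
Lemma lcompZl X Y Z k (g : lhom Y Z) (f : lhom X Y) :
  lcomp (k *: g) f = k *: lcomp g f.
Proof. exact: (linZ (lcompDl_ f)). Qed.
Lemma lcompZr X Y Z k (g : lhom Y Z) (f : lhom X Y) :
  lcomp g (k *: f) = k *: lcomp g f.
Proof. exact: (linZ (lcompDr_ g)). Qed.

Definition biprod X Y Z (i1 : lhom X Z) (i2 : lhom Y Z)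
    (p1 : lhom Z X) (p2 : lhom Z Y) : Prop :=
  [/\ lcomp p1 i1 = lidm X, lcomp p2 i2 = lidm Y, lcomp p1 i2 = 0,
      lcomp p2 i1 = 0 & lcomp i1 p1 + lcomp i2 p2 = lidm Z].

Lemma biprod_coprod X Y Z (i1 : lhom X Z) (i2 : lhom Y Z) p1 p2 :
  biprod i1 i2 p1 p2 -> @is_coprod2 D _ _ _ i1 i2.
Proof.
case=> h11 h22 h12 h21 h W f g.
exists (lcomp (f : lhom X W) p1 + lcomp (g : lhom Y W) p2); split.
  split.
    apply: etrans (lcompD _ _ _) _.
    by rewrite -!lcompA h11 h21 lcompm1 lcomp0r addr0.
  apply: etrans (lcompD _ _ _) _.
  by rewrite -!lcompA h12 h22 lcompm1 lcomp0r add0r.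
move=> u [<- <-]; rewrite !lcompE -!lcompA -lcompDR h.
exact: lcompm1.
Qed.

(** The projections come from the universal property, and [i1 p1 + i2 p2] is the identity because
    both restrict to [i1] and [i2]. *)
Lemma coprod_biprod X Y Z (i1 : lhom X Z) (i2 : lhom Y Z) :
  @is_coprod2 D _ _ _ i1 i2 -> exists p1 p2, biprod i1 i2 p1 p2.
Proof.
move=> h.
have [p1 [[p11 p12] _]] := h X (lidm X) (0 : lhom Y X).
have [p2 [[p21 p22] _]] := h Y (0 : lhom X Y) (lidm Y).
rewrite !lcompE in p11 p12 p21 p22.
exists p1, p2; split=> //.
have [u [_ hu]] := h Z i1 i2.
rewrite -(hu (lidm Z)); last by split; apply: lcomp1m.
symmetry; apply: hu; rewrite !lcompE !lcompD -!lcompA p11 p21 p12 p22.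
by rewrite !lcompm1 !lcomp0r addr0 add0r.
Qed.

Lemma fmap_iso (C E : cat) (F : functor C E) (X Y : C) (f : hom X Y) :
  is_iso f -> is_iso (fmap F f).
Proof.
by case=> g [gf fg]; exists (fmap F g); rewrite -!fmapM gf fg !fmap1.
Qed.

Lemma isomorphic_refl (C : cat) (X : C) : isomorphic X X.
Proof. by exists (idm X), (idm X); rewrite comp1m. Qed.
Lemma isomorphic_sym (C : cat) (X Y : C) : isomorphic X Y -> isomorphic Y X.
Proof. by case=> f [g [gf fg]]; exists g, f. Qed.
Lemma is_iso_comp (C : cat) (X Y Z : C) (g : hom Y Z) (f : hom X Y) :
  is_iso g -> is_iso f -> is_iso (g \oc f).
Proof.
case=> g' [g'g gg'] [f' [f'f ff']]; exists (f' \oc g').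
rewrite !compA -(compA f') g'g compm1 f'f -(compA g) ff' compm1.
by rewrite gg'.
Qed.
Lemma isomorphic_trans (C : cat) (X Y Z : C) :
  isomorphic X Y -> isomorphic Y Z -> isomorphic X Z.
Proof. by case=> f hf [g hg]; exists (g \oc f); apply: is_iso_comp. Qed.
Lemma fmap_isomorphic (C E : cat) (F : functor C E) (X Y : C) :
  isomorphic X Y -> isomorphic (F X) (F Y).
Proof. by case=> f /(fmap_iso F) h; exists (fmap F f). Qed.

End LinearCategory.

Section LocalizationLemmas.
Variables (C D : cat) (W : mor_class C) (Q : functor C D).
Hypothesis HQ : is_localization W Q.

Lemma nat_inverse (A B : cat) (F G : functor A B) (a : forall X, hom (F X) (G X)) :
  natural a -> (forall X, is_iso (a X)) -> exists b : forall X, hom (G X) (F X),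
  [/\ natural b, forall X, b X \oc a X = idm _ & forall X, a X \oc b X = idm _].
Proof.
move=> an ai; pose b X := projT1 (cid (ai X)).
have bP X : b X \oc a X = idm _ /\ a X \oc b X = idm _ by rewrite /b; case: cid.
exists b; split=> [X Y f|X|X]; [|by case: (bP X)|by case: (bP X)].
have [_ h2] := bP X; have [h3 _] := bP Y.
have e : a Y \oc (fmap F f \oc b X) = fmap G f by rewrite compA -an -compA h2 compm1.
by rewrite -[LHS]comp1m -h3 -compA e.
Qed.

(** The transformation and its inverse both extend along [Q]; the composites of the extensions are
    identities by the uniqueness clause. *)
Lemma localization_nat_iso (E : cat) (F G : functor D E) :
  nat_iso (fcomp F Q) (fcomp G Q) -> nat_iso F G.
Proof.
have [Q1 Q2 Q3] := HQ => -[a [an ai]].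
have [a' [a'n a'a aa']] := nat_inverse an ai.
have [b [[bn bb] _]] := Q3 E F G a an.
have [c [[cn cc] _]] := Q3 E G F a' a'n.
have natid (H : functor D E) (d : forall Y, hom (H Y) (H Y)) : natural d ->
    (forall X, d (Q X) = idm _) -> forall Y, d Y = idm _.
  move=> dn dd.
  have [|e [_ eu]] := Q3 E H H (fun X => idm _) _.
    by move=> X1 Y1 f; rewrite comp1m compm1.
  move=> Y; rewrite -(eu d) //.
  suff -> : e = (fun Y => idm (H Y)) by [].
  by apply: eu; split=> // X1 Y1 f; rewrite comp1m compm1.
exists b; split=> // Y; exists (c Y); split.
  apply: (natid F (fun Y => c Y \oc b Y)) => [X1 Y1 f|X].
    by rewrite compA cn -compA bn compA.
  by rewrite bb cc; apply: a'a.
apply: (natid G (fun Y => b Y \oc c Y)) => [X1 Y1 f|X].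
  by rewrite compA bn -compA cn compA.
by rewrite bb cc; apply: aa'.
Qed.

(** [Q] factors through the full subcategory of objects isomorphic to some [Q X]. That factorization
    descends to [D], and followed by the inclusion it is isomorphic to the identity of [D]. *)
Lemma localization_ess_surj (Y : D) : exists X : C, isomorphic Y (Q X).
Proof.
have [Q1 Q2 Q3] := HQ.
pose im (Z : D) := exists X : C, isomorphic Z (Q X).
have hQ X : im (Q X) by exists X; apply: isomorphic_refl.
pose Q0 : functor C (full_sub im) :=
  @Functor C (full_sub im) (fun X => exist _ (Q X) (hQ X))
    (fun X Y f => fmap Q f) (fun X => fmap1 Q X) (fun X Y Z g f => fmapM Q g f).
have [X Y' f Wf|F' [a [an ai]]] := Q2 _ Q0.
  by have [g h] := Q1 _ _ _ Wf; exists g.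
have [b [_ bi]] : nat_iso (fcomp (incl im) F') (fid D).
  apply: localization_nat_iso; exists (fun X => a X : hom (fcomp (fcomp (incl im) F') Q X) (Q X)).
  by split=> // X; have [g h] := ai X; exists g.
have [X hX] := proj2_sig (F' Y).
exists X; apply: isomorphic_trans hX; apply: isomorphic_sym.
by exists (b Y); apply: bi.
Qed.

End LocalizationLemmas.

Section LocalizationHom.
Variables (K : fieldType) (C : cat) (D : lin_cat K) (W : mor_class C) (Q : functor C D).
Hypothesis HQ : is_localization W Q.

(** Yoneda: [F] descends to [F'] on [D], and [al] becomes a natural transformation from [F'] to
    [Hom(Q P, -)] sending the universal element [e] to the identity. Then [h = h o al(e)] equals
    [al] of [F'(h)] applied to [e], and that element is some [F f e]. *)
Lemma localization_hom (F : functor C Sets) (P : C) (e : F P)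
    (al : forall X, F X -> hom (Q P) (Q X)) :
  inverts W F ->
  (forall X Y (f : hom X Y) x, al Y (fmap F f x) = fmap Q f \oc al X x) ->
  al P e = idm _ ->
  (forall X (x : F X), exists f : hom P X, x = fmap F f e) ->
  (forall X (h : hom (Q P) (Q X)), exists f : hom P X, h = fmap Q f) /\
  (forall X (f g : hom P X), fmap Q f = fmap Q g -> fmap F f e = fmap F g e).
Proof.
move=> HF aln ale eg; have [Q1 Q2 Q3] := HQ.
have [F' [a [an ai]]] := Q2 _ _ HF.
have [a' [a'a aa']] := ai P.
pose e' : F' (Q P) := a' e.
have ae : a P e' = e by apply: (congr1 (fun g => g e) aa').
have nE X (f : hom P X) : fmap F f e = a X (fmap F' (fmap Q f) e').
  by rewrite -{1}ae; apply: (congr1 (fun g => g e') (an P X f)).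
split; last by move=> X f g fg; rewrite !nE fg.
have [|b [[bn bb] _]] := Q3 Sets F' (homF (Q P)) (fun X y => al X (a X y)) _.
  move=> X Y f; apply/funext => y; rewrite [LHS]/comp [RHS]/comp /= -aln.
  by congr (al _ _); apply: (congr1 (fun g => g y) (an X Y f)).
move=> X h.
have be : (b (Q P) e' : hom (Q P) (Q P)) = idm (Q P) by rewrite bb ae ale.
have hE : h = (b (Q X) (fmap F' h e') : hom (Q P) (Q X)).
  have e1 : h \oc (b (Q P) e' : hom (Q P) (Q P)) = b (Q X) (fmap F' h e').
    exact: (congr1 (fun g : F' (Q P) -> lhom (Q P) (Q X) => g e') (bn (Q P) (Q X) h)).
  by rewrite -e1 be compm1.
rewrite bb in hE; have [f hf] := eg X (a X (fmap F' h e')).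
by exists f; rewrite hE hf aln ale compm1.
Qed.

End LocalizationHom.

(** * Two-term complexes *)

Section TwoTerm.
Variables (K : fieldType) (L : falgType K).
Local Notation modl := (module L false).
Local Notation zm := (zero_mod L).
Implicit Types X Y : complex L.

Lemma zmE (x y : mmod zm) : x = y. Proof. exact: zero_module_eq. Qed.

Section Two.
Variables (P1 P0 : mod L) (d : mhom (mmod P1) (mmod P0)).

(** [P0] sits in degree 0 and [P1] in degree -1. Matching on the constructors of [int] lets [n + 1]
    reduce in each branch, so the differential needs no casts. *)
Definition two_ob (n : int) : mod L :=
  match n with Posz 0 => P0 | Negz 0 => P1 | _ => zm end.

Definition two_d (n : int) : mhom (mmod (two_ob n)) (mmod (two_ob (n + 1))) :=
  match n return mhom (mmod (two_ob n)) (mmod (two_ob (n + 1))) with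
  | Negz 0 => d
  | Posz p => mhom_zero _ _
  | Negz p.+1 => mhom_zero _ _
  end.

Lemma two_ob_zero n (x : mmod (two_ob n)) : n <> 0 -> n <> -1 -> x = 0.
Proof. by case: n x => [[|n]|[|n]] x // _ _; apply: zmE. Qed.

Definition two : complex L.
Proof.
refine (@Complex K L two_ob two_d _ _).
  case=> [n|[|n]] x //.
  by have -> : two_d (Negz n.+1) x = 0; [|rewrite mhom0].
exists 1%N => n hn x; apply: two_ob_zero => e; move: hn; rewrite e //.
Defined.

Section TwoMap.
Variables (X : complex L) (f1 : mhom (mmod P1) (mmod (X (Negz 0))))
  (f0 : mhom (mmod P0) (mmod (X (Posz 0)))).
Hypothesis f10 : forall x, cd X (Negz 0) (f1 x) = f0 (d x).
Hypothesis f0Z : forall x, cd X (Posz 0) (f0 x) = 0.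

Definition two_map_f (n : int) : mhom (mmod (two n)) (mmod (X n)) :=
  match n return mhom (mmod (two n)) (mmod (X n)) with
  | Posz 0 => f0 | Negz 0 => f1 | Posz p.+1 => mhom_zero _ _
  | Negz p.+1 => mhom_zero _ _ end.

Lemma two_map_d n x : two_map_f (n + 1) (cd two n x) = cd X n (two_map_f n x).
Proof.
case: n x => [[|n]|[|n]] x; last 1 first.
- have -> : cd two (Negz n.+1) x = 0 by [].
  by have -> : two_map_f (Negz n.+1) x = 0; rewrite ?mhom0.
- by have -> : cd two (Posz 0) x = 0; [|rewrite mhom0; apply: esym (f0Z x)].
- have -> : cd two (Posz n.+1) x = 0 by [].
  by have -> : two_map_f (Posz n.+1) x = 0; rewrite ?mhom0.
- exact: esym (f10 x).
Qed.

Definition two_map : cmap two X := Cmap two_map_d.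
End TwoMap.

(** Chain homotopy; only its components out of degrees 0 and -1 can be nonzero. *)
Definition htp X (f g : cmap two X) : Prop :=
  exists (s0 : mhom (mmod P0) (mmod (X (Negz 0))))
         (s1 : mhom (mmod P1) (mmod (X (Negz 1)))),
  (forall x : mmod P0, f (Posz 0) x = g (Posz 0) x + cd X (Negz 0) (s0 x)) /\
  (forall x : mmod P1, f (Negz 0) x = g (Negz 0) x + (s0 (d x) + cd X (Negz 1) (s1 x))).

Lemma htp_refl X (f : cmap two X) : htp f f.
Proof.
by exists (mhom_zero _ _), (mhom_zero _ _); split=> x; rewrite /= !mhom0 ?addr0.
Qed.

Lemma htp_sym X (f g : cmap two X) : htp f g -> htp g f.
Proof.
case=> s0 [s1 [h0 h1]]; exists (mhom_opp s0), (mhom_opp s1).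
by split=> x; rewrite /= ?h0 ?h1 !mhomN -?opprD addrK.
Qed.

Lemma htp_trans X (f g h : cmap two X) : htp f g -> htp g h -> htp f h.
Proof.
case=> s0 [s1 [h0 h1]] [t0 [t1 [k0 k1]]].
exists (mlinc 1 s0 t0), (mlinc 1 s1 t1).
split=> x; rewrite /= !scale1r ?h0 ?h1 ?k0 ?k1 !(linD (mhom_lin (cd X _))).
  by rewrite -addrA [X in _ + X = _]addrC.
rewrite -addrA; congr (_ + _).
by rewrite addrC addrACA.
Qed.

Lemma htp_comp X Y (u : cmap X Y) (f g : cmap two X) :
  htp f g -> htp (cmap_comp u f) (cmap_comp u g).
Proof.
case=> s0 [s1 [h0 h1]]; exists (mhom_comp (u _) s0), (mhom_comp (u _) s1).
split=> x; rewrite /= ?h0 ?h1 !(linD (mhom_lin (u _))).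
  by rewrite -(cf_d u).
by rewrite -(cf_d u (n := Negz 1)).
Qed.

Lemma cone_lift X Y (q : cmap X Y) n (u : mmod (X (n + 1 + 1))) (v : mmod (Y (n + 1))) :
  quasi_iso L X Y q -> cd X (n + 1 + 1) u = 0 -> q (n + 1 + 1) u = cd Y (n + 1) v ->
  exists (a : mmod (X (n + 1))) (b : mmod (Y n)),
    cd X (n + 1) a = u /\ v = q (n + 1) a + cd Y n b.
Proof.
move=> qi du e.
have [z hz] := (qi (n + 1)).1 u du (ex_intro _ v (esym e)).
have [|x [b [dx hb]]] := (qi n).2 (v - q (n + 1) z).
  by rewrite (linB (mhom_lin (cd Y _))) -(cf_d q) hz -e subrr.
exists (x + z), b; rewrite (linD (mhom_lin (cd X _))) dx add0r hz; split=> //.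
by rewrite (linD (mhom_lin (q _))) addrAC -hb subrK.
Qed.

Hypotheses (pP1 : projective (mmod P1)) (pP0 : projective (mmod P0)).

Lemma cone_lift_proj (P : modl) X Y (q : cmap X Y) n (pP : projective P)
    (u : mhom P (mmod (X (n + 1 + 1)))) (v : mhom P (mmod (Y (n + 1)))) :
  quasi_iso L X Y q -> (forall x, cd X (n + 1 + 1) (u x) = 0) ->
  (forall x, q (n + 1 + 1) (u x) = cd Y (n + 1) (v x)) ->
  exists (a : mhom P (mmod (X (n + 1)))) (b : mhom P (mmod (Y n))),
    (forall x, cd X (n + 1) (a x) = u x) /\
    (forall x, v x = q (n + 1) (a x) + cd Y n (b x)).
Proof.
move=> qi du e.
have [||f hf] := @proj_lift_rel _ _ _ P (mprod (mmod (X (n + 1))) (mmod (Y n)))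
  (fun x z => cd X (n + 1) z.1 = u x /\ v x = q (n + 1) z.1 + cd Y n z.2) pP.
- split=> [|k x x' [y1 y2] [y1' y2'] /= [h1 h2] [h1' h2']|x [y1 y2] a /= [h1 h2]];
    rewrite /= ?mhom0 ?addr0 //.
    by rewrite !mhom_lin h1 h1' h2 h2' !scalerDr addrACA.
  by rewrite !mhom_act h1 h2 mactDl.
- by move=> x; have [a [b h]] := cone_lift qi (du x) (e x); exists (a, b).
exists (mhom_comp (mfst _ _) f), (mhom_comp (msnd _ _) f).
by split=> x; case: (hf x).
Qed.

(** Degree 0 is lifted by surjectivity on [H^0]; degree -1 is lifted by acyclicity of the cone,
    applied to what the first lift leaves over. *)
Lemma htp_surj X Y (q : cmap X Y) : quasi_iso L X Y q ->
  forall g : cmap two Y, exists f : cmap two X, htp g (cmap_comp q f).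
Proof.
move=> qi g; pose g0 : mhom (mmod P0) (mmod (Y (Posz 0))) := g (Posz 0).
pose g1 : mhom (mmod P1) (mmod (Y (Negz 0))) := g (Negz 0).
have gd x : cd Y (Negz 0) (g1 x) = g0 (d x) by rewrite -(cf_d g (n := Negz 0)).
have gZ x : cd Y (Posz 0) (g0 x) = 0 by rewrite -(cf_d g (n := Posz 0)) mhom0.
have [||f hf] := @proj_lift_rel _ _ _ _ (mprod (mmod (X (Posz 0))) (mmod (Y (Negz 0))))
  (fun x z => cd X (Posz 0) z.1 = 0 /\ g0 x = q (Posz 0) z.1 + cd Y (Negz 0) z.2) pP0.
- split=> [|k x x' [y1 y2] [y1' y2'] /= [h1 h2] [h1' h2']|x [y1 y2] a /= [h1 h2]];
    rewrite /= ?mhom0 ?addr0 //.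
    by rewrite !mhom_lin h1 h1' h2 h2' !scalerDr addrACA scaler0 addr0.
  by rewrite !mhom_act h1 h2 mactDl mact0l.
- move=> x; have [a [b [h1 h2]]] := (qi (Negz 0)).2 (g0 x) (gZ x).
  by exists (a, b).
pose f0 := mhom_comp (mfst _ _) f; pose s0 := mhom_comp (msnd _ _) f.
have f0Z x : cd X (Posz 0) (f0 x) = 0 by case: (hf x).
have f0E x : g0 x = q (Posz 0) (f0 x) + cd Y (Negz 0) (s0 x) by case: (hf x).
have [||f1 [s1 [h1 h2]]] := @cone_lift_proj _ X Y q (Negz 1) pP1 (mhom_comp f0 d)
    (mlinc (-1) (mhom_comp s0 d) g1) qi.
- by move=> x; apply: f0Z.
- move=> x; change (q (Posz 0) (f0 (d x)) = cd Y (Negz 0) (-1 *: s0 (d x) + g1 x)).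
  by rewrite mhom_lin gd f0E scaleN1r [RHS]addrC addrK.
exists (two_map (f1 := f1) (f0 := f0) h1 f0Z), s0, s1; split=> x; first exact: f0E.
have e : - s0 (d x) + g1 x = q (Negz 0) (f1 x) + cd Y (Negz 1) (s1 x).
  by rewrite -scaleN1r; apply: h2.
change (g1 x = q (Negz 0) (f1 x) + (s0 (d x) + cd Y (Negz 1) (s1 x))).
by rewrite [s0 _ + _]addrC addrA -e [RHS]addrC addNKr.
Qed.

(** The homotopy between the composites is lifted one degree at a time: at each stage the difference
    of the maps together with the given homotopy is a cocycle of the cone of [q]. *)
Lemma htp_inj X Y (q : cmap X Y) : quasi_iso L X Y q ->
  forall f g : cmap two X, htp (cmap_comp q f) (cmap_comp q g) -> htp f g.
Proof.
move=> qi f g [s0 [s1 [h0 h1]]].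
pose f0 : mhom (mmod P0) (mmod (X (Posz 0))) := f (Posz 0).
pose f1 : mhom (mmod P1) (mmod (X (Negz 0))) := f (Negz 0).
pose g0 : mhom (mmod P0) (mmod (X (Posz 0))) := g (Posz 0).
pose g1 : mhom (mmod P1) (mmod (X (Negz 0))) := g (Negz 0).
have fd x : cd X (Negz 0) (f1 x) = f0 (d x) by rewrite -(cf_d f (n := Negz 0)).
have fZ x : cd X (Posz 0) (f0 x) = 0 by rewrite -(cf_d f (n := Posz 0)) mhom0.
have gd x : cd X (Negz 0) (g1 x) = g0 (d x) by rewrite -(cf_d g (n := Negz 0)).
have gZ x : cd X (Posz 0) (g0 x) = 0 by rewrite -(cf_d g (n := Posz 0)) mhom0.
have h0' x : q (Posz 0) (f0 x) = q (Posz 0) (g0 x) + cd Y (Negz 0) (s0 x) by apply: h0.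
have h1' x : q (Negz 0) (f1 x) = q (Negz 0) (g1 x) + (s0 (d x) + cd Y (Negz 1) (s1 x)).
  exact: h1.
have [||t0 [r0 [k1 k2]]] := @cone_lift_proj _ X Y q (Negz 1) pP0 (mlinc (-1) g0 f0) s0 qi.
- move=> x; change (cd X (Posz 0) (-1 *: g0 x + f0 x) = 0).
  by rewrite mhom_lin gZ fZ scaler0 addr0.
- move=> x; change (q (Posz 0) (-1 *: g0 x + f0 x) = cd Y (Negz 0) (s0 x)).
  by rewrite mhom_lin scaleN1r h0' addrA addNr add0r.
have k1' x : cd X (Negz 0) (t0 x) = f0 x - g0 x.
  by rewrite [RHS]addrC -scaleN1r; apply: k1.
have k2' x : s0 x = q (Negz 0) (t0 x) + cd Y (Negz 1) (r0 x) by exact: k2.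
have [||t1 [r1 [l1 l2]]] := @cone_lift_proj _ X Y q (Negz 2) pP1
    (mlinc (-1) (mlinc 1 g1 (mhom_comp t0 d)) f1) (mlinc 1 (mhom_comp r0 d) s1) qi.
- move=> x; change (cd X (Negz 0) (-1 *: (1 *: g1 x + t0 (d x)) + f1 x) = 0).
  by rewrite !mhom_lin scaleN1r scale1r gd fd k1' [g0 _ + _]addrCA (subrr (g0 (d x))) (addr0 (f0 (d x))) (addNr (f0 (d x))).
- move=> x; change (q (Negz 0) (-1 *: (1 *: g1 x + t0 (d x)) + f1 x)
    = cd Y (Negz 1) (1 *: r0 (d x) + s1 x)).
  rewrite !mhom_lin scaleN1r !scale1r h1' k2' opprD -!addrA.
  by rewrite [- _ + (q _ (g1 x) + _)]addrCA addKr addKr.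
exists t0, t1; split=> x.
  by change (f0 x = g0 x + cd X (Negz 0) (t0 x)); rewrite k1' [RHS]addrC subrK.
have e : cd X (Negz 1) (t1 x) = f1 x - (g1 x + t0 (d x)).
  by rewrite [RHS]addrC -scaleN1r -[g1 x]scale1r; apply: l1.
change (f1 x = g1 x + (t0 (d x) + cd X (Negz 1) (t1 x))).
by rewrite e addrA [RHS]addrC subrK.
Qed.

(** The functor that the two-term complex represents on the homotopy category. *)
Definition htpF : functor (Chb L) Sets.
Proof.
refine (@Functor (Chb L) Sets (fun X => classes (@htp X))
  (fun X Y (u : cmap X Y) c => cls (@htp Y) (cmap_comp u (crepr c))) _ _).
  move=> X; apply/funext => c; rewrite -[RHS](creprK c); congr cls.
  exact: (@comp1m (Chb L)).
move=> X Y Z v u; apply/funext => c; rewrite /comp /=.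
have -> : cmap_comp (cmap_comp v u) (crepr c) = cmap_comp v (cmap_comp u (crepr c)).
  by rewrite -[LHS](@compA (Chb L)).
apply/(clsE (@htp_refl Z) (@htp_sym Z) (@htp_trans Z)).
apply: htp_comp; apply: htp_sym.
apply/(clsE (@htp_refl Y) (@htp_sym Y) (@htp_trans Y)).
by rewrite creprK.
Defined.

Lemma htpFE X Y (u : cmap X Y) (f : cmap two X) :
  fmap htpF (u : @hom (Chb L) X Y) (cls (@htp X) f) = cls (@htp Y) (cmap_comp u f).
Proof.
apply/(clsE (@htp_refl Y) (@htp_sym Y) (@htp_trans Y)).
apply: htp_comp; apply/(clsE (@htp_refl X) (@htp_sym X) (@htp_trans X)).
by rewrite creprK.
Qed.

Lemma htpF_inverts : inverts (quasi_iso L) htpF.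
Proof.
move=> X Y q qi; apply: Sets_iso => [c c'|c].
  rewrite -(creprK c) -(creprK c') => e.
  have {e} := etrans (esym (htpFE q _)) (etrans e (htpFE q _)).
  move=> /(clsE (@htp_refl Y) (@htp_sym Y) (@htp_trans Y)) h.
  by apply/(clsE (@htp_refl X) (@htp_sym X) (@htp_trans X)); apply: htp_inj qi _ _ h.
have [f hf] := htp_surj qi (crepr c); exists (cls (@htp X) f).
rewrite -(creprK c); apply: etrans (htpFE q f) _.
by apply/(clsE (@htp_refl Y) (@htp_sym Y) (@htp_trans Y)); apply: htp_sym.
Qed.

End Two.
End TwoTerm.

(** * Maps out of a two-term complex in the derived category *)

Section DerivedHom.
Variables (K : fieldType) (L : falgType K) (D : derived_cat L).
Implicit Types X Y : complex L.

Definition Qm X Y (f : cmap X Y) : lhom (dQ D X) (dQ D Y) :=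
  fmap (dQ D) (f : @hom (Chb L) X Y).

Lemma Qm_comp X Y Z (g : cmap Y Z) (f : cmap X Y) :
  Qm (cmap_comp g f) = lcomp (Qm g) (Qm f).
Proof. exact: (@fmapM _ _ (dQ D) X Y Z g f). Qed.

Lemma Qm_id X : Qm (cmap_id X) = lidm _.
Proof. exact: (@fmap1 _ _ (dQ D) X). Qed.

Lemma Qm_lin X Y a (f g h : cmap X Y) :
  (forall n x, h n x = a *: f n x + g n x) -> Qm h = a *: Qm f + Qm g.
Proof. exact: dQ_linear. Qed.

Program Definition cmap_zero X Y : cmap X Y := {| cf := fun n => mhom_zero _ _ |}.
Next Obligation. by move=> X Y n x /=; rewrite mhom0. Qed.

Program Definition cmap_linc X Y a (f g : cmap X Y) : cmap X Y :=
  {| cf := fun n => mlinc a (f n) (g n) |}.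
Next Obligation. by move=> X Y a f g n x /=; rewrite !cf_d mhom_lin. Qed.

Lemma Qm_linc X Y a (f g : cmap X Y) : Qm (cmap_linc a f g) = a *: Qm f + Qm g.
Proof. exact: Qm_lin. Qed.

Lemma Qm0 X Y : Qm (cmap_zero X Y) = 0.
Proof.
have e : Qm (cmap_zero X Y) = 1 *: Qm (cmap_zero X Y) + Qm (cmap_zero X Y).
  by apply: Qm_lin => n x /=; rewrite scaler0 addr0.
by apply: (addrI (Qm (cmap_zero X Y))); rewrite -{1}[X in X + _]scale1r -e addr0.
Qed.

Lemma Qm_iso X Y (f : cmap X Y) : quasi_iso L X Y f -> @is_iso D _ _ (Qm f).
Proof. by case: (dQ_localization D) => h _ _; apply: h. Qed.

(** The zero endomorphism of an acyclic complex is a quasi-isomorphism, so it becomes invertible. *)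
Lemma acyclic_zero X : (forall n, exact_at (cd X n) (cd X (n + 1))) ->
  lidm (dQ D X) = 0.
Proof.
move=> ac; have [|g [h _]] := @Qm_iso X X (cmap_zero X X).
  move=> n; split=> [x dx _|y dy]; first by have [h _] := ac n x; exact: h.
  have [h _] := ac n y; have [z <-] := h dy.
  by exists 0, z; rewrite !mhom0 add0r.
by rewrite -[LHS]h Qm0; apply: lcomp0r.
Qed.

Section TwoHom.
Variables (P1 P0 : mod L) (d : mhom (mmod P1) (mmod P0)).
Hypotheses (pP1 : projective (mmod P1)) (pP0 : projective (mmod P0)).
Local Notation P := (two d).

Lemma two_id_acyclic (M : mod L) n :
  exact_at (cd (two (mhom_id (mmod M))) n) (cd (two (mhom_id (mmod M))) (n + 1)).
Proof.
have [->|n2] := eqVneq n (Negz 1).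
  by move=> y; split=> [|[x <-]]; [move=> h; exists 0; rewrite mhom0; apply: esym h|].
have [->|n1] := eqVneq n (Negz 0).
  by move=> y; split=> // _; exists y.
have z (x : mmod (two (mhom_id (mmod M)) (n + 1))) : x = 0.
  by apply: two_ob_zero => e; [move: n1|move: n2]; move/eqP; apply; lia.
move=> y; split=> [_|[x <-]]; last exact: cdd.
by exists 0; rewrite mhom0 (z y).
Qed.

Lemma through_contractible M X Y (g : cmap (two (mhom_id (mmod M))) Y)
  (f : cmap X (two (mhom_id (mmod M)))) : Qm (cmap_comp g f) = 0.
Proof.
rewrite Qm_comp -[Qm f]lcomp1m (acyclic_zero (@two_id_acyclic M)).
by rewrite lcomp0l lcomp0r.
Qed.

Lemma through_contractible_shift M X Y
  (g : cmap (shift_complex (two (mhom_id (mmod M)))) Y)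
  (f : cmap X (shift_complex (two (mhom_id (mmod M))))) : Qm (cmap_comp g f) = 0.
Proof.
rewrite Qm_comp -[Qm f]lcomp1m acyclic_zero ?lcomp0l ?lcomp0r // => n y.
have h := @two_id_acyclic M (n + 1) y; split=> [e|[x <-]].
  have [|x hx] := h.1; first by apply: oppr_inj; rewrite oppr0; exact: e.
  by exists (- x); rewrite mhomN -[RHS]hx; exact: opprK.
exact: cdd.
Qed.

(** The two parts of the homotopy factor through contractible complexes, [P0 = P0] in degrees -1, 0
    and [P1 = P1] in degrees -2, -1; both are zero in [D]. *)
Lemma htp_Qm X (f g : cmap P X) : htp f g -> Qm f = Qm g.
Proof.
case=> s0 [s1 [h0 h1]].
pose i := @two_map K L P1 P0 d (two (mhom_id (mmod P0))) d (mhom_id _)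
  (fun x => erefl) (fun x => erefl).
have [k0 k0E] : exists k0 : mhom (mmod P0) (mmod (X (Posz 0))),
   forall x, k0 x = cd X (Negz 0) (s0 x) by exists (mhom_comp (cd X (Negz 0)) s0).
have k0d x : cd X (Negz 0) (s0 x) = k0 (mhom_id (mmod P0) x) by rewrite k0E.
have k0Z x : cd X (Posz 0) (k0 x) = 0 by rewrite k0E (@cdd _ _ X (Negz 0)).
pose i' := @two_map K L P0 P0 (mhom_id _) X s0 k0 k0d k0Z.
pose jf (n : int) : mhom (mmod (P n)) (mmod (shift_complex (two (mhom_id (mmod P1))) n)) :=
  match n return mhom (mmod (P n)) (mmod (shift_complex (two (mhom_id (mmod P1))) n)) with
  | Negz 0 => mhom_id _ | Posz p => mhom_zero _ _ | Negz p.+1 => mhom_zero _ _ end.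
have jd n x : jf (n + 1) (cd P n x) = cd (shift_complex (two (mhom_id (mmod P1)))) n (jf n x).
  case: n x => [n|[|n]] x.
  - have -> : cd P (Posz n) x = 0 by [].
    by transitivity (cd (shift_complex (two (mhom_id (mmod P1)))) (Posz n) 0); rewrite ?mhom0.
  - by rewrite [RHS]/= oppr0.
  - have -> : cd P (Negz n.+1) x = 0 by [].
    by transitivity (cd (shift_complex (two (mhom_id (mmod P1)))) (Negz n.+1) 0); rewrite ?mhom0.
pose j := Cmap jd.
have [t tE] : exists t : mhom (mmod P1) (mmod (X (Negz 0))),
   forall x, t x = cd X (Negz 1) (s1 x) by exists (mhom_comp (cd X (Negz 1)) s1).
(* The sign of [s1] offsets the sign in the differential of the shifted complex. *)
pose jf' (n : int) : mhom (mmod (shift_complex (two (mhom_id (mmod P1))) n)) (mmod (X n)) :=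
  match n return mhom (mmod (shift_complex (two (mhom_id (mmod P1))) n)) (mmod (X n)) with
  | Negz 0 => t | Negz 1 => mhom_opp s1
  | Posz p => mhom_zero _ _ | Negz p.+2 => mhom_zero _ _ end.
have jd' n x : jf' (n + 1) (cd (shift_complex (two (mhom_id (mmod P1)))) n x)
    = cd X n (jf' n x).
  case: n x => [n|[|[|n]]] x.
  - by transitivity (cd X (Posz n) 0); rewrite ?mhom0.
  - by rewrite [LHS]/= tE (@cdd _ _ X (Negz 1)).
  - by rewrite [RHS]mhomN -tE [LHS]mhomN.
  - transitivity (cd X (Negz n.+2) 0); rewrite ?mhom0 //.
    have -> : cd (shift_complex (two (mhom_id (mmod P1)))) (Negz n.+2) x = 0.
      exact: oppr0.
    by rewrite !mhom0.
pose j' := Cmap jd'.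
have -> : f = cmap_linc 1 (cmap_comp i' i) (cmap_linc 1 (cmap_comp j' j) g).
  apply: cmap_eq => n x; case: n x => [[|n]|[|n]] x.
  - rewrite h0 -k0E /= !scale1r.
    by change (g (Posz 0) x + k0 x = k0 x + (0 + g (Posz 0) x)); rewrite add0r addrC.
  - by rewrite (zmE x 0) !mhom0.
  - rewrite h1 -tE /= !scale1r.
    change (g (Negz 0) x + (s0 (d x) + t x) = s0 (d x) + (t x + g (Negz 0) x)).
    by rewrite addrC -addrA.
  - by rewrite (zmE x 0) !mhom0.
by rewrite !Qm_linc through_contractible through_contractible_shift !scaler0 !add0r.
Qed.

(** The universal element is the class of the identity, and a class is sent to [Qm] of a
    representative; [htp_Qm] makes this well defined and natural. *)
Lemma two_hom X (h : lhom (dQ D P) (dQ D X)) : exists f : cmap P X, h = Qm f.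
Proof.
have [] := @localization_hom K _ D _ _ (dQ_localization D) (htpF d) P
  (cls (@htp K L P1 P0 d P) (cmap_id P)) (fun Y c => Qm (crepr c)) (htpF_inverts d pP1 pP0).
- move=> Y Z u c; rewrite -[RHS]Qm_comp; apply: htp_Qm.
  by apply/(clsE (@htp_refl _ _ _ _ d Z) (@htp_sym _ _ _ _ d Z) (@htp_trans _ _ _ _ d Z)); rewrite creprK.
- rewrite -[RHS]Qm_id; apply: htp_Qm.
  by apply/(clsE (@htp_refl _ _ _ _ d P) (@htp_sym _ _ _ _ d P) (@htp_trans _ _ _ _ d P)); rewrite creprK.
- move=> Y c; exists (crepr c); rewrite -[LHS](creprK c) [RHS]htpFE.
  by congr cls; apply/esym/(@compm1 (Chb L)).
by move=> e _; exact: (e X h).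
Qed.

Lemma two_hom_htp X (f g : cmap P X) : Qm f = Qm g -> htp f g.
Proof.
move=> fg.
have [] := @localization_hom K _ D _ _ (dQ_localization D) (htpF d) P
  (cls (@htp K L P1 P0 d P) (cmap_id P)) (fun Y c => Qm (crepr c)) (htpF_inverts d pP1 pP0).
- move=> Y Z u c; rewrite -[RHS]Qm_comp; apply: htp_Qm.
  by apply/(clsE (@htp_refl _ _ _ _ d Z) (@htp_sym _ _ _ _ d Z) (@htp_trans _ _ _ _ d Z)); rewrite creprK.
- rewrite -[RHS]Qm_id; apply: htp_Qm.
  by apply/(clsE (@htp_refl _ _ _ _ d P) (@htp_sym _ _ _ _ d P) (@htp_trans _ _ _ _ d P)); rewrite creprK.
- move=> Y c; exists (crepr c); rewrite -[LHS](creprK c) [RHS]htpFE.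
  by congr cls; apply/esym/(@compm1 (Chb L)).
move=> _ e; have {e} := etrans (esym (htpFE f _)) (etrans (e X f g fg) (htpFE g _)).
have -> : cmap_comp f (cmap_id P) = f by exact: (@compm1 (Chb L)).
have -> : cmap_comp g (cmap_id P) = g by exact: (@compm1 (Chb L)).
by move/(clsE (@htp_refl _ _ _ _ d X) (@htp_sym _ _ _ _ d X) (@htp_trans _ _ _ _ d X)).
Qed.

Section Resolution.
Variables (C : complex L) (M : mod L) (p : mhom (mmod P0) (mmod M)).
Hypotheses (d_inj : injective d) (p_surj : surj p) (dp : exact_at d p).
Hypotheses (C0 : concentrated C 0) (Z : mod L) (k : mhom (mmod Z) (mmod (C (Posz 0))))
  (c : mhom (mmod Z) (mmod M)).
Hypotheses (k_inj : injective k) (k_ker : exact_at k (cd C (Posz 0))) (c_surj : surj c)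
  (c_ker : forall z, c z = 0 <-> exists x, cd C (Negz 0) x = k z).

Lemma resolution_qi : exists f : cmap P C, quasi_iso L P C f /\
  forall x z, f (Posz 0) x = k z -> p x = c z.
Proof.
have [||f0 hf0] := @proj_lift_rel _ _ _ _ (mmod (C (Posz 0)))
    (fun x y => exists z, k z = y /\ c z = p x) pP0.
- split=> [|l x x' y y' [z [<- h]] [z' [<- h']]|x y a [z [<- h]]].
  + by exists 0; rewrite !mhom0.
  + by exists (l *: z + z'); rewrite !mhom_lin h h'.
  + by exists (mact z a); rewrite !mhom_act h.
- by move=> x; have [z hz] := c_surj (p x); exists (k z), z.
have f0Z x : cd C (Posz 0) (f0 x) = 0.
  by have [z [<- _]] := hf0 x; apply/k_ker; exists z.
have f0E x z : f0 x = k z -> p x = c z.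
  by have [z' [<- h]] := hf0 x => /k_inj <-.
have [||f1 hf1] := @proj_lift_rel _ _ _ _ (mmod (C (Negz 0)))
    (fun x y => cd C (Negz 0) y = f0 (d x)) pP1.
- split=> [|l x x' y y' h h'|x y a h]; first by rewrite !mhom0.
    by rewrite !mhom_lin h h'.
  by rewrite !mhom_act h.
- move=> x; have [z [hz h]] := hf0 (d x).
  have /c_ker [b hb] : c z = 0 by rewrite h; apply/dp; exists x.
  by exists b; rewrite hb hz.
exists (two_map hf1 f0Z); split=> [n|x z]; last exact: f0E.
have [->|n1] := eqVneq n (Negz 0).
  split=> [x _ [y hy]|y dy].
    have [z [hz h]] := hf0 x.
    have : c z = 0 by apply/c_ker; exists y; rewrite hz; exact: hy.
    by rewrite h => /dp [w hw]; exists w.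
  have /k_ker [z hz] := dy; have [x hx] := p_surj (c z).
  have [z' [hz' h]] := hf0 x.
  have /c_ker [b hb] : c (z - z') = 0.
    by rewrite (linB (mhom_lin c)) h hx subrr.
  exists x, b; split=> //; change (y = f0 x + cd C (Negz 0) b).
  by rewrite hb (linB (mhom_lin k)) hz -hz' [RHS]addrC subrK.
have C1 : exact_at (cd C n) (cd C (n + 1)).
  by apply: C0 => e; move/eqP: n1; apply; lia.
split=> [x dx _|y dy]; last first.
  by have [z hz] := (C1 y).1 dy; exists 0, z; rewrite !mhom0 add0r.
suff -> : x = 0 by exists 0; rewrite mhom0.
have [e|n2] := eqVneq n (Negz 1).
  by move: x dx; rewrite e => x dx; apply: d_inj; rewrite mhom0; exact: dx.
by apply: two_ob_zero => e; [move: n1|move: n2]; move/eqP; apply; lia.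
Qed.

End Resolution.
End TwoHom.
End DerivedHom.

(** * Linearity of equivalences and the inverse of the shift *)

Section AdditiveEquivalence.
Variables (K : fieldType) (D : lin_cat K) (F : functor D D).
Hypothesis F_full : forall X Y (g : lhom (F X) (F Y)), exists f : lhom X Y, fmap F f = g.
Hypothesis F_faithful : forall X Y (f g : lhom X Y), fmap F f = fmap F g -> f = g.
Hypothesis D_zero : exists Z : D, lidm Z = 0.
Hypothesis D_biprod : forall X Y : D, exists (Z : D) (i1 : lhom X Z) (i2 : lhom Y Z)
  (p1 : lhom Z X) (p2 : lhom Z Y), biprod i1 i2 p1 p2.
Hypothesis F_scalar : forall (X : D) (k : K),
  fmap F (k *: lidm X : lhom X X) = k *: (lidm (F X)) :> lhom (F X) (F X).

Let F1 X : fmap F (lidm X : lhom X X) = lidm (F X). Proof. exact: (@fmap1 _ _ F X). Qed.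

Lemma equiv_zero X Y : fmap F (0 : lhom X Y) = 0 :> lhom (F X) (F Y).
Proof.
have [Z Z0] := D_zero; have [h hh] := @F_full Z Z 0.
have FZ0 : lidm (F Z) = 0.
  by rewrite -F1 -hh -[h]lcomp1m Z0 lcomp0l.
rewrite -(lcomp0l Y (0 : lhom X Z)) fmapL -[fmap F (0 : lhom X Z)]lcomp1m FZ0.
by rewrite lcomp0l lcomp0r.
Qed.

(** Addition is determined by biproducts: [f + g] is a composite [X -> X (+) X -> Y]. A fully
    faithful functor preserves the biproduct equations, so it preserves this composite. *)
Lemma equiv_add X Y (f g : lhom X Y) :
  fmap F (f + g : lhom X Y) = (fmap F f : lhom (F X) (F Y)) + fmap F g.
Proof.
have [Z [i1 [i2 [p1 [p2 [h11 h22 h12 h21 h]]]]]] := D_biprod X X.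
(* By fullness the sum is the image of some [s]; faithfulness gives [s i1 = i1] and [s i2 = i2], so
   [s] is the identity. *)
have Fh : lcomp (fmap F i1 : lhom _ _) (fmap F p1) + lcomp (fmap F i2 : lhom _ _) (fmap F p2)
    = lidm (F Z).
  have [s hs] := F_full (lcomp (fmap F i1 : lhom (F X) (F Z)) (fmap F p1) +
     lcomp (fmap F i2 : lhom (F X) (F Z)) (fmap F p2)).
  have s1 : lcomp s i1 = i1.
    apply: F_faithful; rewrite fmapL hs lcompD -!lcompA -!fmapL h11 h21.
    by rewrite lcompm1 lcomp0r equiv_zero addr0.
  have s2 : lcomp s i2 = i2.
    apply: F_faithful; rewrite fmapL hs lcompD -!lcompA -!fmapL h22 h12.
    by rewrite lcompm1 lcomp0r equiv_zero add0r.
  have e0 : s = lidm Z by rewrite -[s]lcompm1 -h lcompDR !lcompA s1 s2 h.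
  by rewrite -hs e0 F1.
have [s [s1 s2]] : exists s, lcomp s i1 = f /\ lcomp s i2 = g.
  exists (lcomp f p1 + lcomp g p2).
  by rewrite !lcompD -!lcompA h11 h22 h12 h21 !lcompm1 !lcomp0r addr0 add0r.
have [t [t1 t2]] : exists t, lcomp p1 t = lidm X /\ lcomp p2 t = lidm X.
  by exists (i1 + i2); rewrite !lcompDR h11 h22 h12 h21 addr0 add0r.
have e : f + g = lcomp s t.
  by rewrite -[t]lcomp1m -h lcompD lcompDR -!lcompA t1 t2 !lcompm1 s1 s2.
rewrite e fmapL -[fmap F t]lcomp1m -Fh lcompD lcompDR -!lcompA -!fmapL t1 t2.
by rewrite !lcompm1 s1 s2.
Qed.

Lemma equiv_linear X Y : lin (fun f : lhom X Y => fmap F f : lhom (F X) (F Y)).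
Proof.
move=> k f g; rewrite equiv_add; congr (_ + _).
have -> : k *: f = lcomp (k *: lidm Y) f by rewrite lcompZl lcomp1m.
by rewrite fmapL F_scalar lcompZl lcomp1m.
Qed.
End AdditiveEquivalence.

Definition mkmod (K : fieldType) (L : falgType K) (M : module L false) (h : fd M) : mod L :=
  exist _ M ((fin_presP M).2 h).

Lemma mod_fd (K : fieldType) (L : falgType K) (M : mod L) : fd (mmod M).
Proof. by apply/fin_presP; apply: (proj2_sig M). Qed.

Section Unshift.
Variables (K : fieldType) (L : falgType K).
Implicit Types X Y : complex L.

(** The target degree is given by a proof of [i + 1 = j], because [n - 1 + 1] does not reduce to
    [n]. *)
Definition cdx X i j (e : i + 1 = j) : mhom (mmod (X i)) (mmod (X j)) :=
  match e in _ = j return mhom (mmod (X i)) (mmod (X j)) with erefl => cd X i end.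

Definition mcast X i j (e : i = j) : mhom (mmod (X i)) (mmod (X j)) :=
  match e in _ = j return mhom (mmod (X i)) (mmod (X j)) with erefl => mhom_id _ end.

Lemma cdx_cd X i (e : i + 1 = i + 1) x : cdx X e x = cd X i x.
Proof. by rewrite (eq_irrelevance e erefl). Qed.

Lemma mcast_id X i (e : i = i) x : mcast X e x = x.
Proof. by rewrite (eq_irrelevance e erefl). Qed.

Lemma cdx_dd X i j k (e : i + 1 = j) (e' : j + 1 = k) x : cdx X e' (cdx X e x) = 0.
Proof. by case: _ / e' ; case: _ / e; apply: cdd. Qed.

Lemma cdx_nat X Y (f : cmap X Y) i j (e : i + 1 = j) x : f j (cdx X e x) = cdx Y e (f i x).
Proof. by case: _ / e; apply: cf_d. Qed.

Lemma mcast_nat X Y (f : cmap X Y) i j (e : i = j) x : f j (mcast X e x) = mcast Y e (f i x).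
Proof. by case: _ / e. Qed.

Lemma mcast_cdx X i j i' j' (e : i + 1 = j) (e' : i' + 1 = j') (ei : i = i') (ej : j = j') x :
  mcast X ej (cdx X e x) = cdx X e' (mcast X ei x).
Proof.
move: e e'; case: _ / ei; case: _ / ej => e e'.
by rewrite (eq_irrelevance e e').
Qed.

Lemma mcastK X i j (e : i = j) (e' : j = i) x : mcast X e' (mcast X e x) = x.
Proof. by move: e'; case: _ / e => e'; rewrite mcast_id. Qed.

Lemma quasi_isoP X Y (f : cmap X Y) : quasi_iso L X Y f <->
  forall i j k (e : i + 1 = j) (e' : j + 1 = k),
    (forall x : mmod (X j), cdx X e' x = 0 ->
       (exists y, cdx Y e y = f j x) -> exists z, cdx X e z = x) /\
    (forall y : mmod (Y j), cdx Y e' y = 0 ->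
       exists x z, cdx X e' x = 0 /\ y = f j x + cdx Y e z).
Proof.
split=> [h i j k e e'|h n]; last exact: (h n _ _ erefl erefl).
by case: _ / e'; case: _ / e; apply: (h i).
Qed.

Lemma pred_succ (n : int) : (n - 1) + 1 = (n + 1) - 1. Proof. by lia. Qed.
Lemma succ_pred (n : int) : n + 1 - 1 = n. Proof. by lia. Qed.
Lemma pred_succK (n : int) : n - 1 + 1 = n. Proof. by lia. Qed.

Definition unshift_complex X : complex L.
Proof.
refine (@Complex K L (fun n => X (n - 1)) (fun n => mhom_opp (cdx X (pred_succ n))) _ _).
  by move=> n x; rewrite /= mhomN cdx_dd !oppr0.
have [N hN] := cx_bounded X; exists N.+1 => n hn; apply: hN; lia.
Defined.

Definition unshift_cmap X Y (f : cmap X Y) : cmap (unshift_complex X) (unshift_complex Y).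
Proof.
refine (@Cmap K L (unshift_complex X) (unshift_complex Y) (fun n => f (n - 1)) _).
by move=> n x; rewrite /= mhomN cdx_nat.
Defined.

Definition unshift : functor (Chb L) (Chb L).
Proof.
refine (@Functor (Chb L) (Chb L) unshift_complex unshift_cmap _ _).
  by move=> X; apply: cmap_eq.
by move=> X Y Z g f; apply: cmap_eq.
Defined.

Lemma unshift_cdx X i j (e : i + 1 = j) (e' : i - 1 + 1 = j - 1) x :
  cdx (unshift_complex X) e x = - cdx X e' x.
Proof. by move: e'; case: _ / e => e'; rewrite /= (eq_irrelevance e' (pred_succ i)). Qed.

Lemma unshift_qi X Y (f : cmap X Y) : quasi_iso L X Y f ->
  quasi_iso L _ _ (unshift_cmap f).
Proof.
move=> /quasi_isoP h; apply/quasi_isoP => i j k e e'.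
have f1 : i - 1 + 1 = j - 1 by lia.
have f2 : j - 1 + 1 = k - 1 by lia.
have [h1 h2] := h _ _ _ f1 f2.
split=> [x|y]; rewrite (unshift_cdx _ f2).
  move=> /eqP; rewrite oppr_eq0 => /eqP dx [y]; rewrite (unshift_cdx _ f1) => hy.
  have [|z hz] := h1 x dx; first by exists (- y); rewrite mhomN.
  by exists (- z); rewrite (unshift_cdx _ f1) mhomN opprK.
move=> /eqP; rewrite oppr_eq0 => /eqP dy; have [x [z [dx hz]]] := h2 y dy.
exists x, (- z); rewrite (unshift_cdx _ f2) (unshift_cdx _ f1) dx oppr0; split=> //.
by rewrite mhomN opprK.
Qed.

Lemma shift_cdx X i j (e : i + 1 = j) (e' : i + 1 + 1 = j + 1) x :
  cdx (shift_complex X) e x = - cdx X e' x.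
Proof. by move: e'; case: _ / e => e'; rewrite /= cdx_cd. Qed.

Lemma unshift_shift : nat_iso (fcomp unshift (shift L)) (fid (Chb L)).
Proof.
have d1 X n (x : mmod (X (n - 1 + 1))) : mcast X (pred_succK (n + 1))
    (cd (unshift_complex (shift_complex X)) n x) = cd X n (mcast X (pred_succK n) x).
  have e : n - 1 + 1 + 1 = n + 1 - 1 + 1 by lia.
  by rewrite /= (shift_cdx _ e) opprK (mcast_cdx _ erefl (pred_succK n)).
have d2 X n (x : mmod (X n)) : mcast X (esym (pred_succK (n + 1))) (cd X n x) =
    cd (unshift_complex (shift_complex X)) n (mcast X (esym (pred_succK n)) x).
  have e : n - 1 + 1 + 1 = n + 1 - 1 + 1 by lia.
  rewrite /= (shift_cdx _ e) opprK.
  exact: (mcast_cdx (erefl _) e (esym (pred_succK n))).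
exists (fun X => @Cmap K L (unshift_complex (shift_complex X)) X _ (@d1 X)); split.
  by move=> X Y f; apply: cmap_eq => n x /=; rewrite mcast_nat.
move=> X; exists (@Cmap K L X (unshift_complex (shift_complex X)) _ (@d2 X)).
by split; apply: cmap_eq => n x; rewrite /comp /= mcastK.
Qed.

Lemma shift_unshift : nat_iso (fcomp (shift L) unshift) (fid (Chb L)).
Proof.
have d1 X n (x : mmod (X (n + 1 - 1))) : mcast X (succ_pred (n + 1))
    (cd (shift_complex (unshift_complex X)) n x) = cd X n (mcast X (succ_pred n) x).
  by rewrite /= opprK (mcast_cdx _ erefl (succ_pred n)).
have d2 X n (x : mmod (X n)) : mcast X (esym (succ_pred (n + 1))) (cd X n x) =
    cd (shift_complex (unshift_complex X)) n (mcast X (esym (succ_pred n)) x).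
  by rewrite /= opprK; exact: (mcast_cdx (erefl _) (pred_succ (n + 1)) (esym (succ_pred n))).
exists (fun X => @Cmap K L (shift_complex (unshift_complex X)) X _ (@d1 X)); split.
  by move=> X Y f; apply: cmap_eq => n x /=; rewrite mcast_nat.
move=> X; exists (@Cmap K L X (shift_complex (unshift_complex X)) _ (@d2 X)).
by split; apply: cmap_eq => n x; rewrite /comp /= mcastK.
Qed.
End Unshift.

Lemma fmap_faithful (C E : cat) (F : functor C E) (G : functor E C) :
  nat_iso (fcomp G F) (fid C) ->
  forall X Y (f g : hom X Y), fmap F f = fmap F g -> f = g.
Proof.
case=> a [an ai] X Y f g e.
have [b [ba ab]] := ai X.
have h (k : hom X Y) : k = a Y \oc fmap G (fmap F k) \oc b.
  by have := an X Y k; rewrite /= => <-; rewrite -compA ab compm1.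
by rewrite (h f) (h g) e.
Qed.

Lemma fmap_full (C E : cat) (F : functor C E) (G : functor E C) :
  nat_iso (fcomp G F) (fid C) -> nat_iso (fcomp F G) (fid E) ->
  forall X Y (g : hom (F X) (F Y)), exists f : hom X Y, fmap F f = g.
Proof.
move=> h h' X Y g; have [a [an ai]] := h; have [b [ba ab]] := ai X.
exists (a Y \oc fmap G g \oc b).
apply: (fmap_faithful h').
have := an X Y (a Y \oc fmap G g \oc b); rewrite /= -compA ba compm1 => e.
have [c [ca _]] := ai Y.
have aI (k k' : hom (G (F X)) (G (F Y))) : a Y \oc k = a Y \oc k' -> k = k'.
  by move=> /(congr1 (fun k => c \oc k)); rewrite !compA ca !comp1m.
by apply: aI.
Qed.

(** * The derived category *)

Section DerivedShift.
Variables (K : fieldType) (L : falgType K) (D : derived_cat L).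
Implicit Types X Y : D.

Lemma dQ_ess_surj Y : exists C : complex L, isomorphic Y (dQ D C).
Proof. exact: (localization_ess_surj (dQ_localization D)). Qed.

Lemma derived_zero : exists Z : D, lidm Z = 0.
Proof.
exists (dQ D (stalk (zero_mod L))); rewrite -Qm_id -(Qm0 D); congr Qm.
apply: cmap_eq => n x; rewrite /= .
have z (y : mmod (if n == 0 then zero_mod L else zero_mod L)) : y = 0.
  by move: y; case: (n == 0) => y; apply: zmE.
by rewrite [LHS]z [RHS]z.
Qed.

Program Definition mprod_map (M N M' N' : module L false) (f : mhom M M') (g : mhom N N') :
  mhom (mprod M N) (mprod M' N') := {| mfun := fun x => (f x.1, g x.2) |}.
Next Obligation. by move=> M N M' N' f g k x y; rewrite /= !mhom_lin. Qed.
Next Obligation. by move=> M N M' N' f g x a; rewrite /= !mhom_act. Qed.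

Definition sum_complex (A B : complex L) : complex L.
Proof.
refine (@Complex K L
  (fun n => mkmod (fd_prod (mod_fd (A n)) (mod_fd (B n)) : fd (mprod (mmod (A n)) (mmod (B n)))))
  (fun n => mprod_map (cd A n) (cd B n)) _ _).
- by move=> n x /=; rewrite !cdd.
- have [N hN] := cx_bounded A; have [N' hN'] := cx_bounded B.
  exists (N + N')%N => n hn [x y].
  by rewrite (hN n _ x) ?(hN' n _ y) //; lia.
Defined.

(** The biproduct equations hold for direct sums of complexes and survive in [D] because [dQ] is
    linear. *)
Lemma derived_biprod X Y : exists (Z : D) (i1 : lhom X Z) (i2 : lhom Y Z)
  (p1 : lhom Z X) (p2 : lhom Z Y), biprod i1 i2 p1 p2.
Proof.
have [A [a [a' [a'a aa']]]] := dQ_ess_surj X.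
have [B [b [b' [b'b bb']]]] := dQ_ess_surj Y.
rewrite !lcompE in a'a aa' b'b bb'.
pose S := sum_complex A B.
have d1 n (x : mmod (A n)) : minl (mmod (A (n + 1))) (mmod (B (n + 1))) (cd A n x) =
    cd S n (minl (mmod (A n)) (mmod (B n)) x).
  by apply: injective_projections; rewrite //= mhom0.
have d2 n (x : mmod (B n)) : minr (mmod (A (n + 1))) (mmod (B (n + 1))) (cd B n x) =
    cd S n (minr (mmod (A n)) (mmod (B n)) x).
  by apply: injective_projections; rewrite //= mhom0.
pose i1 : cmap A S := @Cmap K L A S (fun n => minl (mmod (A n)) (mmod (B n))) d1.
pose i2 : cmap B S := @Cmap K L B S (fun n => minr (mmod (A n)) (mmod (B n))) d2.
pose p1 : cmap S A := @Cmap K L S A (fun n => mfst (mmod (A n)) (mmod (B n)))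
  (fun n x => erefl).
pose p2 : cmap S B := @Cmap K L S B (fun n => msnd (mmod (A n)) (mmod (B n)))
  (fun n x => erefl).
exists (dQ D S), (lcomp (Qm D i1) a), (lcomp (Qm D i2) b), (lcomp a' (Qm D p1)),
  (lcomp b' (Qm D p2)).
have e11 : lcomp (Qm D p1) (Qm D i1) = lidm _.
  by rewrite -Qm_comp -Qm_id; congr Qm; apply: cmap_eq.
have e22 : lcomp (Qm D p2) (Qm D i2) = lidm _.
  by rewrite -Qm_comp -Qm_id; congr Qm; apply: cmap_eq.
have e12 : lcomp (Qm D p1) (Qm D i2) = 0.
  by rewrite -Qm_comp -Qm0; congr Qm; apply: cmap_eq.
have e21 : lcomp (Qm D p2) (Qm D i1) = 0.
  by rewrite -Qm_comp -Qm0; congr Qm; apply: cmap_eq.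
have e : lcomp (Qm D i1) (Qm D p1) + lcomp (Qm D i2) (Qm D p2) = lidm _.
  rewrite -!Qm_comp -Qm_id -[X in X + _]scale1r; symmetry; apply: Qm_lin => n [x y] /=.
  by apply: injective_projections; rewrite /= scale1r ?addr0 ?add0r.
split.
- by rewrite -lcompA (lcompA (Qm D p1)) e11 lcomp1m.
- by rewrite -lcompA (lcompA (Qm D p2)) e22 lcomp1m.
- by rewrite -lcompA (lcompA (Qm D p1)) e12 lcomp0l lcomp0r.
- by rewrite -lcompA (lcompA (Qm D p2)) e21 lcomp0l lcomp0r.
- by rewrite -!lcompA (lcompA a) aa' (lcompA b) bb' !lcomp1m.
Qed.

Local Notation S := (dshift D).

(** The inverse shift of complexes preserves quasi-isomorphisms, so it descends; both natural
    isomorphisms are checked on complexes. *)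
Lemma shift_inverse : exists U : functor D D,
  nat_iso (fcomp U S) (fid D) /\ nat_iso (fcomp S U) (fid D).
Proof.
have [Q1 Q2 Q3] := dQ_localization D.
have [A B f fq|U [a [an ai]]] := Q2 _ (fcomp (dQ D) (unshift L)).
  exact: (Q1 _ _ _ (unshift_qi fq)).
have [s [sn si]] := dshift_Q D.
have [u [un ui]] := @unshift_shift K L; have [v [vn vi]] := @shift_unshift K L.
exists U; split; apply: (localization_nat_iso (dQ_localization D)).
- exists (fun X : Chb L => fmap (dQ D) (u X) \oc (a (shift L X) \oc fmap U (s X))); split.
    move=> X Y f; rewrite /= compA.
    have n1 := un X Y f; have n2 := an _ _ (fmap (shift L) f); have n3 := sn X Y f.
    rewrite /= in n1 n2 n3.
    rewrite -[fmap (dQ D) f \oc _]fmapM n1 fmapM -!compA.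
    apply: (congr1 (fun g => fmap (dQ D) (u Y) \oc g)).
    by rewrite compA n2 -!compA -!fmapM n3.
  move=> X; apply: is_iso_comp; first exact: fmap_iso.
  by apply: is_iso_comp; [apply: ai|exact: (fmap_iso U (si X))].
have [t [tn ts st]] := nat_inverse sn si.
exists (fun X : Chb L => fmap (dQ D) (v X) \oc (s (unshift L X) \oc fmap S (a X))); split.
  move=> X Y f; rewrite /= compA.
  have n1 := vn X Y f; have n2 := sn _ _ (fmap (unshift L) f); have n3 := an X Y f.
  rewrite /= in n1 n2 n3.
  rewrite -[fmap (dQ D) f \oc _]fmapM n1 fmapM -!compA.
  apply: (congr1 (fun g => fmap (dQ D) (v Y) \oc g)).
  by rewrite compA n2 -!compA -!fmapM n3.
move=> X; apply: is_iso_comp; first exact: fmap_iso.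
by apply: is_iso_comp; [apply: si|exact: (fmap_iso S (ai X))].
Qed.

Lemma shift_full X Y (g : lhom (S X) (S Y)) : exists f : lhom X Y, fmap S f = g.
Proof. have [U [h h']] := shift_inverse; exact: (fmap_full h h'). Qed.

Lemma shift_faithful X Y (f g : lhom X Y) : fmap S f = fmap S g -> f = g.
Proof. have [U [h _]] := shift_inverse; exact: (fmap_faithful h). Qed.

Lemma shift_ess_surj Y : exists X, isomorphic (S X) Y.
Proof.
have [U [_ [a [_ ai]]]] := shift_inverse.
by exists (U Y), (a Y); apply: ai.
Qed.

(** Additivity holds for any equivalence. For scalars one compares with the chain map [k] times the
    identity, whose shift is again [k] times the identity. *)
Lemma shift_lin X Y : lin (fun f : lhom X Y => fmap S f : lhom (S X) (S Y)).
Proof.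
apply: equiv_linear; [exact: shift_full|exact: shift_faithful|exact: derived_zero|exact: derived_biprod|].
move=> {X Y} X k.
have [C [a [a' [a'a aa']]]] := dQ_ess_surj X; rewrite !lcompE in a'a aa'.
have [s [sn si]] := dshift_Q D.
have [s' [s's ss']] := si C; rewrite !lcompE in s's ss'.
pose kC := cmap_linc k (cmap_id C) (cmap_zero C C).
have QkC : Qm D kC = k *: lidm _ by rewrite Qm_linc Qm_id Qm0 addr0.
have Qs : Qm D (shift_cmap kC) = k *: lidm _.
  rewrite (@Qm_lin _ _ D _ _ k (cmap_id _) (cmap_zero _ _)) ?Qm_id ?Qm0 ?addr0 //.
have e1 : fmap S (Qm D kC) = k *: lidm (S (dQ D C)).
  have n1 : lcomp (Qm D (shift_cmap kC)) (s C) = lcomp (s C) (fmap S (Qm D kC)) := sn C C kC.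
  have s's1 : lcomp s' (s C) = lidm (S (dQ D C)) := s's.
  rewrite -[LHS](@lcomp1m _ D) -s's1 -lcompA -n1 Qs lcompZl lcompZr lcomp1m.
  by rewrite s's1.
have -> : k *: lidm X = lcomp a' (lcomp (Qm D kC) a).
  by rewrite QkC lcompZl lcompZr lcomp1m a'a.
rewrite !fmapL e1 lcompZl lcompZr lcomp1m -fmapL a'a; congr (_ *: _).
exact: (@fmap1 _ _ S X).
Qed.

End DerivedShift.

Lemma isoE (K : fieldType) (D : lin_cat K) (X Y : D) : @isomorphic D X Y ->
  exists (f : lhom X Y) (g : lhom Y X), lcomp g f = lidm X /\ lcomp f g = lidm Y.
Proof. by []. Qed.

Lemma Qm_inv (K : fieldType) (L : falgType K) (D : derived_cat L) (X Y : complex L)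
  (f : cmap X Y) : quasi_iso L X Y f -> exists g : lhom (dQ D Y) (dQ D X),
  lcomp g (Qm D f) = lidm _ /\ lcomp (Qm D f) g = lidm _.
Proof. exact: Qm_iso. Qed.

(** * Modules in the derived category *)

Section Stalks.
Variables (K : fieldType) (L : falgType K) (D : derived_cat L).
Hypothesis hL : hereditary L.
Local Notation S := (dshift D).
Implicit Types M N : mod L.

Definition stalk_map M N (f : mhom (mmod M) (mmod N)) : cmap (stalk M) (stalk N).
Proof.
refine (@Cmap K L (stalk M) (stalk N) (fun n =>
  if n == 0 as b return mhom (mmod (if b then M else zero_mod L))
     (mmod (if b then N else zero_mod L)) then f else mhom_zero _ _) _).
by move=> n x /=; rewrite mhom0.
Defined.

Definition iota M : D := dQ D (stalk M).
Definition iota_map M N (f : mhom (mmod M) (mmod N)) : lhom (iota M) (iota N) :=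
  Qm D (stalk_map f).

Lemma iota_comp M N P (g : mhom (mmod N) (mmod P)) (f : mhom (mmod M) (mmod N)) :
  iota_map (mhom_comp g f) = lcomp (iota_map g) (iota_map f).
Proof.
rewrite -Qm_comp; congr Qm; apply: cmap_eq => n x /=.
by move: x => /=; case: (n == 0).
Qed.

Lemma iota_id M : iota_map (mhom_id (mmod M)) = lidm _.
Proof.
rewrite -Qm_id; congr Qm; apply: cmap_eq => n x /=.
by move: x => /=; case: (n == 0) => x //; apply: zmE.
Qed.

Lemma iota_lin M N k (f g h : mhom (mmod M) (mmod N)) :
  (forall x, h x = k *: f x + g x) -> iota_map h = k *: iota_map f + iota_map g.
Proof.
move=> e; apply: Qm_lin => n x /=.
by move: x => /=; case: (n == 0) => x; [apply: e|apply: zmE].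
Qed.

Lemma mod_resolution M : exists (P1 P0 : mod L) (d : mhom (mmod P1) (mmod P0))
  (p : mhom (mmod P0) (mmod M)),
  [/\ projective (mmod P1), projective (mmod P0), injective d, surj p & exact_at d p].
Proof.
have [n [p ps]] := free_cover (mod_fd M).
pose P0 := mkmod (fd_free L false n).
have fk := fd_msub (mker_closed p) (fd_free L false n).
pose i := mincl (mker_closed p).
exists (mkmod fk), P0, i, p; split => //.
- apply: (sub_projective hL (i := i)) fk; first exact: mfree_projective.
  exact: mincl_inj.
- exact: mfree_projective.
- exact: mincl_inj.
- by move=> y; apply: mincl_im.
Qed.

Section ShiftIso.
Let s_ex : {s : forall X : Chb L, hom (fcomp S (dQ D) X) (fcomp (dQ D) (shift L) X) |
  natural s /\ forall X, is_iso (s X)} := cid (dshift_Q D).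
Definition shQ (C : complex L) : lhom (S (dQ D C)) (dQ D (shift_complex C)) := projT1 s_ex C.
Lemma shQ_nat (A B : complex L) (f : cmap A B) :
  lcomp (Qm D (shift_cmap f)) (shQ A) = lcomp (shQ B) (fmap S (Qm D f)).
Proof. exact: ((proj1 (projT2 s_ex)) A B f). Qed.
Lemma shQ_iso C : @is_iso D _ _ (shQ C).
Proof. exact: ((proj2 (projT2 s_ex)) C). Qed.
Lemma shQ_inv C : exists t : lhom (dQ D (shift_complex C)) (S (dQ D C)),
  lcomp t (shQ C) = lidm _ /\ lcomp (shQ C) t = lidm _.
Proof. exact: shQ_iso. Qed.
End ShiftIso.

Section Resolved.
Variables (M P1 P0 : mod L) (d : mhom (mmod P1) (mmod P0)) (p : mhom (mmod P0) (mmod M)).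
Hypotheses (pP1 : projective (mmod P1)) (pP0 : projective (mmod P0))
  (d_inj : injective d) (p_surj : surj p) (dp : exact_at d p).

Lemma stalk_concentrated : concentrated (stalk M) 0.
Proof.
move=> n n1 y; split=> [_|[x <-]] //; exists 0.
rewrite mhom0; move: y; rewrite /= (_ : n + 1 == 0 = false); last exact/eqP.
by move=> y; apply: zmE.
Qed.

Lemma stalk_resolution : exists f : cmap (two d) (stalk M),
  quasi_iso L _ _ f /\ forall x : mmod P0, f (Posz 0) x = p x.
Proof.
have [||||f [fq fE]] := @resolution_qi K L P1 P0 d pP1 pP0 (stalk M) M p d_inj p_surj dp
  stalk_concentrated M (mhom_id _) (mhom_id _).
- by [].
- by move=> y; split=> // _; exists y.
- by move=> y; exists y.
- move=> z; split=> [h|[x h]]; last exact: esym h.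
  by exists 0; rewrite mhom0; exact: esym h.
by exists f; split=> // x; rewrite (fE x (f (Posz 0) x)).
Qed.

(** The same projective resolution maps quasi-isomorphically to [C] and to the stalk complex. *)
Lemma concentrated_iota (C : complex L) : concentrated C 0 -> is_cohomology C 0 M ->
  @isomorphic D (dQ D C) (iota M).
Proof.
move=> C0 [n [n0 [Z [k [c [ki kk cs ck]]]]]].
have e : n = Negz 0 by lia.
subst n.
have [f [fq _]] := @resolution_qi K L P1 P0 d pP1 pP0 C M p d_inj p_surj dp C0 Z k c ki kk cs ck.
have [g [gq _]] := stalk_resolution.
apply: (@isomorphic_trans D _ (dQ D (two d))).
  by apply: isomorphic_sym; exists (Qm D f); apply: Qm_iso.
by exists (Qm D g); apply: Qm_iso.
Qed.

Lemma resolved_iota_full N (h : lhom (iota M) (iota N)) :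
  exists f : mhom (mmod M) (mmod N), h = iota_map f.
Proof.
have [q [qq qE]] := stalk_resolution.
have [q' [q'q qq']] := Qm_inv D qq.
have [g hg] := two_hom pP1 pP0 (lcomp h (Qm D q)).
pose g0 : mhom (mmod P0) (mmod N) := g (Posz 0).
have [x px|f hf] := @mhom_factor_surj _ _ _ _ _ _ p g0 p_surj.
  have [y <-] := (dp x).1 px.
  by have := cf_d g (n := Negz 0) y; rewrite (zmE (g (Negz 0) y) 0) mhom0.
exists f; rewrite -[h]lcompm1 -[iota_map f]lcompm1 -[lidm _]qq' !lcompA hg; congr lcomp.
rewrite -Qm_comp; congr Qm; apply: cmap_eq => -[[|n]|[|n]] x; try exact: zmE.
  by rewrite -[LHS]hf -qE.
Qed.

Lemma resolved_iota_faithful N (f g : mhom (mmod M) (mmod N)) :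
  iota_map f = iota_map g -> forall x, f x = g x.
Proof.
move=> e x; have [q [qq qE]] := stalk_resolution.
have [|s0 [s1 [h _]]] := @two_hom_htp K L D P1 P0 d pP1 pP0 _
   (cmap_comp (stalk_map f) q) (cmap_comp (stalk_map g) q).
  by rewrite !Qm_comp [Qm D (stalk_map f)]e.
have [y <-] := p_surj x.
have := h y; rewrite (zmE (s0 y) 0) mhom0 addr0 => {}h.
by rewrite -qE; exact: h.
Qed.

Definition ext_cmap N (g : mhom (mmod P1) (mmod N)) : cmap (two d) (shift_complex (stalk N)).
Proof.
refine (@two_map K L P1 P0 d (shift_complex (stalk N)) g (mhom_zero _ _) _ _).
  by move=> x; apply: oppr0.
by move=> x; rewrite mhom0.
Defined.

(** [delta] is the connecting morphism [M -> P1[1]]: the chain map from the resolution that is the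
    identity in degree -1, composed with the inverse of the resolution. Chain maps into [N[1]] are
    maps [P1 -> N], and the null-homotopic ones are those that extend over [P0]. *)
Lemma ext_class : exists delta : lhom (iota M) (S (iota P1)), forall N,
  (forall z : lhom (iota M) (S (iota N)), exists g : mhom (mmod P1) (mmod N),
     z = lcomp (fmap S (iota_map g)) delta) /\
  (forall g : mhom (mmod P1) (mmod N), lcomp (fmap S (iota_map g)) delta = 0 <->
     exists r : mhom (mmod P0) (mmod N), forall x, g x = r (d x)).
Proof.
have [q [qq qE]] := stalk_resolution.
have [q' [q'q qq']] := Qm_inv D qq.
have [t [ts st]] := shQ_inv (stalk P1).
exists (lcomp t (lcomp (Qm D (ext_cmap (mhom_id _))) q')) => N.
have [u [us su]] := shQ_inv (stalk N).
have E g : lcomp (fmap S (iota_map g)) (lcomp t (lcomp (Qm D (ext_cmap (mhom_id _))) q')) =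
    lcomp u (lcomp (Qm D (ext_cmap g)) q').
  have e1 : lcomp (fmap S (iota_map g) : lhom (S (iota P1)) (S (iota N))) t = lcomp u (Qm D (shift_cmap (stalk_map g))).
    rewrite -[LHS]lcomp1m -[lidm _]us -lcompA (lcompA (shQ _)) -shQ_nat.
    by rewrite -(lcompA _ _ t) st lcompm1.
  rewrite [LHS]lcompA e1 -lcompA; congr lcomp; rewrite lcompA -Qm_comp; congr (lcomp (Qm D _) _).
  by apply: cmap_eq => -[[|n]|[|n]] x; rewrite //= mhom0.
split=> [z|g].
  have [c hc] := two_hom pP1 pP0 (lcomp (shQ (stalk N)) (lcomp z (Qm D q))).
  exists (c (Negz 0)); rewrite E.
  have -> : ext_cmap (c (Negz 0)) = c.
    by apply: cmap_eq => -[[|n]|[|n]] x //; apply: zmE.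
  by rewrite -hc -!lcompA qq' lcompm1 lcompA us lcomp1m.
rewrite E; split=> [e|[r hr]].
  have {}e : Qm D (ext_cmap g) = Qm D (cmap_zero _ _).
    rewrite Qm0 -[LHS]lcompm1 -q'q lcompA -[lcomp (Qm D _) q']lcomp1m -su -(lcompA _ u) e.
    by rewrite lcomp0r lcomp0l.
  have [s0 [s1 [_ h]]] := two_hom_htp pP1 pP0 e.
  exists s0 => x; have := h x; rewrite (zmE (s1 x) 0) mhom0 addr0.
  by rewrite [RHS]add0r.
have -> : Qm D (ext_cmap g) = 0; last by rewrite lcomp0l lcomp0r.
rewrite -(Qm0 D); apply: htp_Qm; exists r, (mhom_zero _ _); split=> x.
  exact: zmE.
by rewrite [RHS]add0r mhom0 addr0; apply: hr.
Qed.

Lemma resolved_zero_hom (C : complex L) : (forall x : mmod (C (Posz 0)), x = 0) ->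
  (forall x : mmod (C (Negz 0)), x = 0) -> forall h : lhom (iota M) (dQ D C), h = 0.
Proof.
move=> C0 C1 h; have [q [qq qE]] := stalk_resolution.
have [q' [q'q qq']] := Qm_inv D qq.
have [g hg] := two_hom pP1 pP0 (lcomp h (Qm D q)).
rewrite -[h]lcompm1 -[lidm _]qq' lcompA hg.
have -> : g = cmap_zero _ _; last by rewrite Qm0 lcomp0l.
apply: cmap_eq => -[[|n]|[|n]] x; rewrite ?[LHS]C0 ?[LHS]C1 // (zmE x 0) //.
  by rewrite mhom0.
by rewrite mhom0.
Qed.

End Resolved.

Lemma iota_full M N (h : lhom (iota M) (iota N)) :
  exists f : mhom (mmod M) (mmod N), h = iota_map f.
Proof.
have [P1 [P0 [d [p [h1 h2 h3 h4 h5]]]]] := mod_resolution M.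
exact: (resolved_iota_full h1 h2 h3 h4 h5).
Qed.

Lemma iota_faithful M N (f g : mhom (mmod M) (mmod N)) : iota_map f = iota_map g -> f =1 g.
Proof.
have [P1 [P0 [d [p [h1 h2 h3 h4 h5]]]]] := mod_resolution M.
exact: (resolved_iota_faithful h1 h2 h3 h4 h5).
Qed.

Lemma iota0 M N : iota_map (mhom_zero (mmod M) (mmod N)) = 0.
Proof.
rewrite -(Qm0 D); congr Qm; apply: cmap_eq => n x /=.
by move: x => /=; case: (n == 0).
Qed.

Lemma shift_iter_iso (C : complex L) j :
  @isomorphic D (iter j S (dQ D C)) (dQ D (iter j (@shift_complex K L) C)).
Proof.
elim: j => [|j IH] /=; first exact: isomorphic_refl.
apply: isomorphic_trans (fmap_isomorphic S IH) _.
by exists (shQ _); apply: shQ_iso.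
Qed.

Lemma unshift_iter_iso (C : complex L) j :
  @isomorphic D (iter j S (dQ D (iter j (@unshift_complex K L) C))) (dQ D C).
Proof.
elim: j => [|j IH]; first exact: isomorphic_refl.
apply: isomorphic_trans _ IH; rewrite iterSr.
have h (X Y : D) : isomorphic X Y -> isomorphic (iter j S X) (iter j S Y).
  by move=> ?; elim: j => //= j IH; apply: fmap_isomorphic.
apply: h; apply: (@isomorphic_trans D _ (dQ D (shift_complex (iter j.+1 (@unshift_complex K L) C)))).
  by exists (shQ _); apply: shQ_iso.
have [v [vn vi]] := @shift_unshift K L.
exact: ex_intro _ _ (fmap_iso (dQ D) (vi (iter j (@unshift_complex K L) C : Chb L))).
Qed.

Lemma iter_shift_zero (C : complex L) j n (x : mmod (iter j (@shift_complex K L) C n)) :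
  (forall m (y : mmod (C m)), m = n + j%:Z -> y = 0) -> x = 0.
Proof.
elim: j n x => [|j IH] n x h /=; first by apply: h; rewrite addr0.
by apply: (IH (n + 1)) => m y e; apply: h; lia.
Qed.

Lemma iter_unshift_zero (C : complex L) j n (x : mmod (iter j (@unshift_complex K L) C n)) :
  (forall m (y : mmod (C m)), m = n - j%:Z -> y = 0) -> x = 0.
Proof.
elim: j n x => [|j IH] n x h /=; first by apply: h; rewrite subr0.
by apply: (IH (n - 1)) => m y e; apply: h; lia.
Qed.

Lemma stalk_zero M n (x : mmod (stalk M n)) : n <> 0 -> x = 0.
Proof.
by move: x => /=; case: eqP => // _ x _; apply: zmE.
Qed.

(** The stalk of [N[j+2]] lies in a degree at most -2, below both degrees of the resolution of
    [M]. *)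
Lemma hom_iota_shift M N j (h : lhom (iota M) (iter j.+2 S (iota N))) : h = 0.
Proof.
have [P1 [P0 [d [p [h1 h2 h3 h4 h5]]]]] := mod_resolution M.
have [f [g [gf fg]]] := isoE (shift_iter_iso (stalk N) j.+2).
rewrite -[h]lcomp1m -[lidm _]gf -lcompA.
rewrite (resolved_zero_hom h1 h2 h3 h4 h5 _ _ (lcomp f h)) ?lcomp0r //.
  by move=> x; apply: iter_shift_zero => m y e; apply: stalk_zero; lia.
by move=> x; apply: iter_shift_zero => m y e; apply: stalk_zero; lia.
Qed.

(** After moving the shifts to the other side, the target is a stalk in a positive degree, which the
    resolution does not reach. *)
Lemma hom_shift_iota M N j (h : lhom (iter j.+1 S (iota M)) (iota N)) : h = 0.
Proof.
have [P1 [P0 [d [p [h1 h2 h3 h4 h5]]]]] := mod_resolution M.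
have [f [g [gf fg]]] := isoE (unshift_iter_iso (stalk N) j.+1).
have ff i (X Y : D) (k : lhom (iter i S X) (iter i S Y)) :
    (forall k' : lhom X Y, k' = 0) -> k = 0.
  elim: i k => [|i IH] //= k z; have [k' <-] := shift_full k.
  by rewrite (IH k' z) (lin0 (@shift_lin _ _ D _ _)).
rewrite -[h]lcomp1m -[lidm _]fg -lcompA (ff _ _ _ (lcomp g h)) ?lcomp0r // => k'.
apply: (resolved_zero_hom h1 h2 h3 h4 h5) => x.
  by apply: iter_unshift_zero => m y e; apply: stalk_zero; lia.
by apply: iter_unshift_zero => m y e; apply: stalk_zero; lia.
Qed.

End Stalks.

Section ModuleExtras.
Variables (K : fieldType) (L : falgType K) (op : bool).

Lemma mhom_inv (M N : module L op) (f : mhom M N) : injective f -> surj f ->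
  exists g : mhom N M, (forall x, g (f x) = x) /\ (forall y, f (g y) = y).
Proof.
move=> fi fs; have [y|g gK] := mhom_factor_inj (f := mhom_id N) fi; first exact: fs.
by exists g; split=> // x; apply: fi; rewrite gK.
Qed.

Program Definition mreg (M : module L op) (x : M) : mhom (regular L op) M :=
  {| mfun := fun a => mact x a |}.
Next Obligation. by move=> M x k a b; apply: mact_linr. Qed.
Next Obligation. by move=> M x a b; rewrite /= mactM. Qed.

Lemma mreg_uniq (M : module L op) (f : mhom (regular L op) M) : f = mreg (f (1 : L)).
Proof.
apply: mhom_eq => a; rewrite /= -mhom_act; congr (f _).
by rewrite /= /amul; case: op; rewrite ?mul1r ?mulr1.
Qed.

Lemma regular_projective : projective (regular L op).
Proof.
move=> M N g f gs; have [x hx] := gs (f (1 : L)); exists (mreg x) => a.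
transitivity (mreg (f (1 : L)) a); last by rewrite -mreg_uniq.
by rewrite /= mhom_act hx.
Qed.
End ModuleExtras.

(** * Objects of the derived category isomorphic to modules *)

Section Concentrated.
Variables (K : fieldType) (L : falgType K) (D : derived_cat L).
Hypothesis hL : hereditary L.
Local Notation S := (dshift D).
Local Notation O := (Lambda D).
Implicit Types (M N : mod L) (X Y : D).

(* The objects isomorphic to modules; see [concP]. *)
Definition conc X : Prop :=
  (forall j (h : lhom (iter j.+1 S O) X), h = 0) /\
  (forall j (h : lhom O (iter j.+1 S X)), h = 0).

Lemma iter_isomorphic (F : functor D D) j X Y : @isomorphic D X Y ->
  @isomorphic D (iter j F X) (iter j F Y).
Proof. by move=> h; elim: j => //= j; apply: fmap_isomorphic. Qed.

Lemma hom_zero_iso X X' Y Y' : @isomorphic D X X' -> @isomorphic D Y Y' ->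
  (forall h : lhom X Y, h = 0) -> forall h : lhom X' Y', h = 0.
Proof.
move=> /isoE [a [a' [_ aa']]] /isoE [b [b' [_ bb']]] z h.
have -> : h = lcomp b (lcomp (lcomp b' (lcomp h a)) a').
  by rewrite !lcompA bb' lcomp1m -lcompA aa' lcompm1.
by rewrite (z (lcomp b' (lcomp h a))) lcomp0l lcomp0r.
Qed.

Lemma conc_iso X Y : @isomorphic D X Y -> conc X -> conc Y.
Proof.
move=> i [h1 h2]; split=> j.
  exact: hom_zero_iso (isomorphic_refl _) i (h1 j).
exact: hom_zero_iso (isomorphic_refl _) (iter_isomorphic _ _ i) (h2 j).
Qed.

Definition exactx (C : complex L) i j k (e : i + 1 = j) (e' : j + 1 = k) :=
  forall y : mmod (C j), cdx C e' y = 0 -> exists z, cdx C e z = y.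

Lemma exactx_shift (C : complex L) i j k (e : i + 1 = j) (e' : j + 1 = k)
    (f : i + 1 + 1 = j + 1) (f' : j + 1 + 1 = k + 1) :
  exactx (shift_complex C) e e' -> exactx C f f'.
Proof.
move=> h y dy; have [|z hz] := h y.
  by rewrite (shift_cdx _ f') dy oppr0.
by exists (- z); rewrite mhomN -(shift_cdx e).
Qed.

Lemma exactx_unshift (C : complex L) i j k (e : i + 1 = j) (e' : j + 1 = k)
    (f : i - 1 + 1 = j - 1) (f' : j - 1 + 1 = k - 1) :
  exactx (unshift_complex C) e e' -> exactx C f f'.
Proof.
move=> h y dy; have [|z hz] := h y.
  by rewrite (unshift_cdx _ f') dy oppr0.
by exists (- z); rewrite mhomN -(unshift_cdx e).
Qed.

Lemma exactx_iter_shift (C : complex L) m i j k (e : i + 1 = j) (e' : j + 1 = k) i' j' k'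
    (f : i' + 1 = j') (f' : j' + 1 = k') : i' = i + m%:Z ->
  exactx (iter m (@shift_complex K L) C) e e' -> exactx C f f'.
Proof.
elim: m i j k e e' => [|m IH] i j k e e' h.
  have ei : i' = i by lia. have ej : j' = j by lia. have ek : k' = k by lia.
  move: f f'; rewrite ei ej ek => f f'.
  by rewrite (eq_irrelevance f e) (eq_irrelevance f' e').
have e1 : i + 1 + 1 = j + 1 by lia.
have e2 : j + 1 + 1 = k + 1 by lia.
by move=> hx; apply: (IH _ _ _ e1 e2); [lia|exact: (@exactx_shift _ i j k e e')].
Qed.

Lemma exactx_iter_unshift (C : complex L) m i j k (e : i + 1 = j) (e' : j + 1 = k) i' j' k'
    (f : i' + 1 = j') (f' : j' + 1 = k') : i' = i - m%:Z ->
  exactx (iter m (@unshift_complex K L) C) e e' -> exactx C f f'.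
Proof.
elim: m i j k e e' => [|m IH] i j k e e' h.
  have ei : i' = i by lia. have ej : j' = j by lia. have ek : k' = k by lia.
  move: f f'; rewrite ei ej ek => f f'.
  by rewrite (eq_irrelevance f e) (eq_irrelevance f' e').
have e1 : i - 1 + 1 = j - 1 by lia.
have e2 : j - 1 + 1 = k - 1 by lia.
by move=> hx; apply: (IH _ _ _ e1 e2); [lia|exact: (@exactx_unshift _ i j k e e')].
Qed.

Lemma zero_projective : projective (mmod (zero_mod L)).
Proof.
move=> M N g f gs; exists (mhom_zero _ _) => x.
by rewrite (zmE x 0) !mhom0.
Qed.

Let zd : mhom (mmod (zero_mod L)) (mmod (regular_mod L)) := mhom_zero _ _.

(** A cocycle [y] of degree 0 gives a chain map from [Lambda] with [1] going to [y]. If it vanishes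
    in [D] it is null-homotopic, and the homotopy at [1] exhibits [y] as a boundary. *)
Lemma hom_Lambda_exact (C : complex L) : (forall h : lhom O (dQ D C), h = 0) ->
  exactx C (erefl : Negz 0 + 1 = Posz 0) (erefl : Posz 0 + 1 = Posz 1).
Proof.
move=> z y dy.
have [|||q [qq _]] := @stalk_resolution K L (regular_mod L) _ _ zd (mhom_id _)
   zero_projective (@regular_projective K L false).
- by move=> x x' _; apply: zmE.
- by move=> x; exists x.
- by move=> x; split=> [h|[x' <-]] //; exists 0; exact: esym h.
have [q' [q'q _]] := Qm_inv D qq.
have c1 (x : mmod (zero_mod L)) :
    cd C (Negz 0) (mhom_zero (mmod (zero_mod L)) (mmod (C (Negz 0))) x) = mreg (y : mmod (C (Posz 0))) (zd x).
  by rewrite [zd x]/= !mhom0.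
have c2 x : cd C (Posz 0) (mreg (y : mmod (C (Posz 0))) x) = 0.
  by rewrite /= mhom_act [cd C 0 y]dy mact0l.
pose f := @two_map K L (zero_mod L) (regular_mod L) zd C (mhom_zero _ _)
  (mreg (y : mmod (C (Posz 0)))) c1 c2.
have : Qm D f = Qm D (cmap_zero _ _).
  by rewrite Qm0 -[LHS]lcompm1 -q'q lcompA (z (lcomp (Qm D f) q')) lcomp0l.
move=> e; have [s0 [s1 [h _]]] := @two_hom_htp K L D (zero_mod L) (regular_mod L) zd
  zero_projective (@regular_projective K L false) C f (cmap_zero _ _) e.
exists (s0 (1 : L)); have := h (1 : L); rewrite add0r => <-.
exact: mact1.
Qed.

Lemma hom_zero_cancel m X Y : (forall h : lhom (iter m S X) (iter m S Y), h = 0) ->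
  forall h : lhom X Y, h = 0.
Proof.
elim: m => [|m IH] z //; apply: IH => h; apply: shift_faithful.
rewrite (lin0 (@shift_lin _ _ D _ _)); exact: z.
Qed.

(** [H^m(C)] is [Hom(Lambda, C[m])]; the two clauses of [conc] cover [m < 0] and [m > 0]. *)
Lemma conc_concentrated (C : complex L) : conc (dQ D C) -> concentrated C 0.
Proof.
move=> [h1 h2].
suff E i j k (e : i + 1 = j) (e' : j + 1 = k) : j <> 0 -> exactx C e e'.
  move=> n n1 y; split=> [dy|[x <-]]; last exact: cdd.
  by have [z hz] := E n _ _ erefl erefl n1 y dy; exists z.
case: j e e' => [[|m]|m] e e' // _.
  apply: (@exactx_iter_shift C m.+1 (Negz 0) (Posz 0) (Posz 1) erefl erefl); first by lia.
  apply: hom_Lambda_exact.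
  exact: hom_zero_iso (isomorphic_refl _) (shift_iter_iso D C m.+1) (h2 m).
apply: (@exactx_iter_unshift C m.+1 (Negz 0) (Posz 0) (Posz 1) erefl erefl); first by lia.
apply: hom_Lambda_exact; apply: (@hom_zero_cancel m.+1).
apply: hom_zero_iso (isomorphic_refl _) _ (h1 m).
exact/isomorphic_sym/unshift_iter_iso.
Qed.

Lemma concentrated_cohomology (C : complex L) : exists M : mod L, is_cohomology C 0 M.
Proof.
pose k := mincl (mker_closed (cd C (Posz 0))).
have cU : sclosed (fun z => exists x, cd C (Negz 0) x = k z).
  split; first split; first by exists 0; rewrite !mhom0.
    by move=> l x y [u hu] [v hv]; exists (l *: u + v); rewrite !mhom_lin hu hv.
  by move=> x a [u hu]; exists (mact u a); rewrite !mhom_act hu.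
have fZ := fd_msub (mker_closed (cd C (Posz 0))) (mod_fd (C (Posz 0))).
exists (mkmod (fd_mquo cU fZ)), (Negz 0); split=> //.
exists (mkmod fZ), k, (mpi cU); split.
- exact: mincl_inj.
- by move=> y; apply: (mincl_im (mker_closed (cd C (Posz 0)))).
- exact: mpi_surj.
- exact: mpi_ker.
Qed.

Lemma concentrated0_iota (C : complex L) M : concentrated C 0 -> is_cohomology C 0 M ->
  @isomorphic D (dQ D C) (iota D M).
Proof.
have [P1 [P0 [d [p [h1 h2 h3 h4 h5]]]]] := mod_resolution hL M.
exact: (concentrated_iota D h1 h2 h3 h4 h5).
Qed.

Lemma conc_iota X : conc X -> exists M, @isomorphic D X (iota D M).
Proof.
have [C i] := dQ_ess_surj X => /(conc_iso i)/conc_concentrated cC.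
have [M hM] := concentrated_cohomology C; exists M.
exact: isomorphic_trans i (concentrated0_iota cC hM).
Qed.

Lemma conc_chart X : conc X -> exists M (a : lhom X (iota D M)) (a' : lhom (iota D M) X),
  lcomp a' a = lidm X /\ lcomp a a' = lidm _.
Proof. by case/conc_iota => M /isoE [a [a' h]]; exists M, a, a'. Qed.

(** When [M] is projective its presentation splits, and every map on [P1] extends to [P0]. *)
Lemma ext_projective_zero M N (z : lhom (iota D M) (S (iota D N))) :
  projective (mmod M) -> z = 0.
Proof.
move=> pM; have [P1 [P0 [d [p [h1 h2 h3 h4 h5]]]]] := mod_resolution hL M.
have [delta h] := ext_class D h1 h2 h3 h4 h5.
have [g ->] := (h N).1 z; apply/(h N).2.
have [s hs] := pM _ _ p (mhom_id _) h4.
have [x|r hr] := mhom_factor_inj (i := d) (f := mlinc (-1) (mhom_comp s p) (mhom_id _)) h3.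
  by apply/h5; rewrite /= mhom_lin hs scaleN1r addNr.
exists (mhom_comp g r) => x /=; congr (g _); apply: h3.
by rewrite hr /= (_ : p (d x) = 0) ?mhom0 ?scaler0 ?add0r //; apply/h5; exists x.
Qed.

Lemma iota_conc M : conc (iota D M).
Proof.
split=> [j h|[|j] h]; first exact: (hom_shift_iota hL h).
  exact: (ext_projective_zero (M := regular_mod L) _ (@regular_projective K L false)).
exact: (@hom_iota_shift K L D hL (regular_mod L) M j h).
Qed.

Lemma concP X : conc X <-> exists M, @isomorphic D X (iota D M).
Proof.
split; first exact: conc_iota.
by case=> M /isomorphic_sym i; apply: conc_iso i (iota_conc M).
Qed.

Lemma in_degree0 (T : mod L -> Prop) X : in_degree 0 T X <->
  exists M, T M /\ @isomorphic D X (iota D M).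
Proof.
split=> [[C [i cC [M [hM TM]]]]|[M [TM i]]].
  by exists M; split=> //; apply: isomorphic_trans i (concentrated0_iota cC hM).
exists (stalk M); split=> //; first exact: stalk_concentrated.
exists M; split=> //; exists (Negz 0); split=> //.
exists M, (mhom_id _), (mhom_id _); split=> //.
- by move=> y; split=> // _; exists y.
- by move=> y; exists y.
- move=> z; split=> [h|[x h]]; last exact: esym h.
  by exists 0; rewrite mhom0; exact: esym h.
Qed.

Lemma shift_reflect X Y : @isomorphic D (S X) (S Y) -> @isomorphic D X Y.
Proof.
move=> /isoE [f [g [gf fg]]]; have [f' hf] := shift_full f; have [g' hg] := shift_full g.
have e Z : fmap S (lidm Z : lhom Z Z) = lidm (S Z) := @fmap1 _ _ S Z.
by exists f', g'; split; apply: shift_faithful; rewrite fmapL hf hg ?gf ?fg; apply/esym/e.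
Qed.

Lemma in_degree1 (T : mod L -> Prop) X : in_degree 1 T X <->
  exists M, T M /\ @isomorphic D (S X) (iota D M).
Proof.
split=> [[C [i cC [M [[n [n1 [Z [k [c [ki kk cs ck]]]]]] TM]]]]|[M [TM i]]].
  exists M; split=> //.
  have en : n = Posz 0 by lia.
  subst n.
  apply: isomorphic_trans (fmap_isomorphic S i) _.
  apply: (@isomorphic_trans D _ (dQ D (shift_complex C))).
    by exists (shQ _ _); apply: shQ_iso.
  apply: concentrated0_iota.
    move=> n n0 y; have n1' : n + 1 + 1 <> 1 by lia.
    have := cC (n + 1) n1' y => h; split=> [e|[x <-]]; last exact: cdd.
    have [|z hz] := h.1; first by apply: oppr_inj; rewrite oppr0; exact: e.
    by exists (- z); rewrite mhomN -[RHS]hz; exact: opprK.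
  exists (Negz 0); split=> //; exists Z, k, c; split=> //.
    move=> y; rewrite -(kk y); split=> [e|e]; last exact: etrans (congr1 -%R e) (oppr0 _).
    by apply: oppr_inj; rewrite oppr0; exact: e.
  move=> z; rewrite ck; split=> -[x hx]; exists (- x).
    by rewrite mhomN -hx; exact: opprK.
  by rewrite mhomN -hx.
exists (unshift_complex (stalk M)).
have z n (x : mmod (unshift_complex (stalk M) n)) : n <> 1 -> x = 0.
  by move=> n1; apply: (@stalk_zero K L M (n - 1)); lia.
split.
- apply: shift_reflect; apply: isomorphic_trans i _.
  exact/isomorphic_sym/(unshift_iter_iso D (stalk M) 1).
- move=> n n1 y; split=> [_|[x <-]]; last exact: cdd.
  by exists 0; rewrite mhom0 (z _ y).
exists M; split=> //; exists (Posz 0); split=> //.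
exists M, (mhom_id _), (mhom_id _); split=> //.
- move=> y; split=> [_|[x <-]]; last by apply: z.
  by exists y.
- by move=> y; exists y.
- move=> w; split=> [h|[x h]].
    by exists 0; rewrite mhom0; exact: esym h.
  by rewrite -[LHS]h (z _ x) // mhom0.
Qed.

End Concentrated.

Lemma lcompKl (K : fieldType) (D : lin_cat K) (X Y Z : D) (f : lhom Y X) (g : lhom X Y) :
  lcomp f g = lidm X -> forall x : lhom Z X, lcomp f (lcomp g x) = x.
Proof. by move=> e x; rewrite lcompA e lcomp1m. Qed.

Lemma lcompKr (K : fieldType) (D : lin_cat K) (X Y Z : D) (f : lhom Y X) (g : lhom X Y) :
  lcomp f g = lidm X -> forall x : lhom X Z, lcomp (lcomp x f) g = x.
Proof. by move=> e x; rewrite -lcompA e lcompm1. Qed.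

Lemma fmapLK (K : fieldType) (D : lin_cat K) (F : functor D D) (X Y : D)
    (f : lhom Y X) (g : lhom X Y) :
  lcomp f g = lidm X -> lcomp (fmap F f : lhom (F Y) (F X)) (fmap F g) = lidm (F X).
Proof. by move=> e; rewrite -fmapL e; exact: (@fmap1 _ _ F X). Qed.

(** * Degree zero cohomology as an equivalence with modules *)

Section DegreeZeroHom.
Variables (K : fieldType) (L : falgType K) (D : derived_cat L).
Local Notation S := (dshift D).
Local Notation O := (Lambda D).
Implicit Types (M N : mod L) (X Y Z : D).

Definition lact (a : L) : lhom O O :=
  iota_map D (M := regular_mod L) (N := regular_mod L) (mreg (M := regular L false) a).

Lemma lactM a b : lact (a * b) = lcomp (lact a) (lact b).
Proof.
rewrite /lact -iota_comp; congr (iota_map D _); apply: mhom_eq => x /=.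
by rewrite /amul mulrA.
Qed.

Lemma lact1 : lact 1 = lidm O.
Proof.
rewrite /lact -(iota_id D (regular_mod L)); congr (iota_map D _); apply: mhom_eq => x /=.
by rewrite /amul mul1r.
Qed.

Lemma lact_lin : lin (lact : L -> lhom O O).
Proof. by move=> k a b; apply: iota_lin => x /=; rewrite /amul mulrDl -scalerAl. Qed.

(** This is [H^0(X)], realized as [Hom(Lambda, X)] with [L] acting by precomposition with left
    multiplications. *)
Definition h0 X : module L false.
Proof.
refine (@Module K L false (lhom O X) (fun x a => lcomp x (lact a)) _ _ _ _).
- by move=> k x y a; rewrite lcompDl.
- by move=> k x a b; rewrite lact_lin lcompDr.
- by move=> x; rewrite lact1 lcompm1.
- by move=> x a b; rewrite -lcompA -lactM.
Defined.

Definition h0f X Y (f : lhom X Y) : mhom (h0 X) (h0 Y).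
Proof.
refine (@Mhom K L false (h0 X) (h0 Y) (fun x : lhom O X => lcomp f x) _ _).
  by move=> k x y; apply: lcompDr.
by move=> x a; apply: lcompA.
Defined.

Hypothesis hL : hereditary L.

(** An element [x] of [M] viewed as the map [Lambda -> M] that sends [1] to [x]. *)
Definition eltm M : mhom (mmod M) (h0 (iota D M)).
Proof.
refine (@Mhom K L false (mmod M) (h0 (iota D M))
  (fun x => iota_map D (M := regular_mod L) (mreg x)) _ _).
  by move=> k x y; apply: iota_lin => a /=; rewrite mact_linl.
move=> x a; rewrite /= /lact -iota_comp; congr (iota_map D _).
by apply: mhom_eq => b /=; rewrite mactM.
Defined.

Lemma eltm_inj M : injective (eltm M).
Proof. by move=> x y /(iota_faithful hL)/(_ (1 : L)) /=; rewrite !mact1. Qed.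

Lemma eltm_surj M : surj (eltm M).
Proof.
move=> h; have [f ->] := iota_full hL (h : lhom O (iota D M)).
exists (f (1 : L)) => /=; congr (iota_map D _).
by rewrite -mreg_uniq.
Qed.

Lemma eltm_nat M N (f : mhom (mmod M) (mmod N)) x :
  lcomp (iota_map D f) (eltm M x) = eltm N (f x).
Proof.
rewrite /= -iota_comp; congr (iota_map D _); apply: mhom_eq => a /=.
by rewrite mhom_act.
Qed.

Lemma conc_mod X : conc X -> exists M (a : lhom X (iota D M)) (a' : lhom (iota D M) X),
  [/\ lcomp a' a = lidm X, lcomp a a' = lidm _ &
      forall x : lhom O X, exists y, x = lcomp a' (eltm M y)].
Proof.
case/(conc_chart hL) => M [a [a' [h1 h2]]]; exists M, a, a'; split=> // x.
have [y hy] := eltm_surj (lcomp a x : h0 _); exists y.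
by rewrite hy (lcompKl h1).
Qed.

(** Together with [h0_full] and [h0_real] this makes [h0] an equivalence from the objects satisfying
    [conc] to finite dimensional modules; arguments with elements in [D] rest on it. *)
Lemma h0_faithful X Y (f : lhom X Y) : conc X -> conc Y ->
  (forall x : lhom O X, lcomp f x = 0) -> f = 0.
Proof.
move=> cX cY z; have [M [a [a' [h1 h2 _]]]] := conc_mod cX.
have [N [b [b' [k1 k2 _]]]] := conc_mod cY.
have [g hg] := iota_full hL (lcomp b (lcomp f a')).
have -> : f = lcomp b' (lcomp (iota_map D g) a).
  by rewrite -hg -!lcompA h1 lcompm1 (lcompKl k1).
have -> : g = mhom_zero _ _; last by rewrite iota0 lcomp0l lcomp0r.
apply: mhom_eq => x; apply: (@eltm_inj N); rewrite -eltm_nat -hg -!lcompA z lcomp0r.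
by rewrite mhom0.
Qed.

Lemma h0_faithful2 X Y (f g : lhom X Y) : conc X -> conc Y ->
  (forall x : lhom O X, lcomp f x = lcomp g x) -> f = g.
Proof.
move=> cX cY e; apply/eqP; rewrite -subr_eq0; apply/eqP/(h0_faithful cX cY) => x.
by rewrite lcompB e subrr.
Qed.

Lemma h0_full X Y (u : mhom (h0 X) (h0 Y)) : conc X -> conc Y ->
  exists f : lhom X Y, forall x : lhom O X, lcomp f x = u x.
Proof.
move=> cX cY; have [M [a [a' [h1 h2 h3]]]] := conc_mod cX.
have [N [b [b' [k1 k2 k3]]]] := conc_mod cY.
have [|g hg] := @mhom_factor_inj _ _ _ _ _ _ (eltm N)
   (mhom_comp (h0f b) (mhom_comp u (mhom_comp (h0f a') (eltm M)))) (@eltm_inj N).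
  by move=> x; apply: eltm_surj.
exists (lcomp b' (lcomp (iota_map D g) a)) => x; have [y ->] := h3 x.
rewrite -!lcompA (lcompKl h2) eltm_nat hg.
exact: (lcompKl k1 (u (lcomp a' (eltm M y)) : lhom O Y)).
Qed.

Lemma h0_fd X : conc X -> fd (h0 X).
Proof.
move=> cX; have [M [a [a' [h1 h2 h3]]]] := conc_mod cX.
apply: fd_surj (mhom_lin (mhom_comp (h0f a') (eltm M))) _ (mod_fd M) => x.
by have [y ->] := h3 x; exists y.
Qed.

Lemma h0_real (M : module L false) : fd M -> exists X (u : mhom M (h0 X)),
  [/\ conc X, injective u & surj u].
Proof.
move=> fM; exists (iota D (mkmod fM)), (eltm (mkmod fM)); split.
- exact: iota_conc.
- exact: eltm_inj.
- exact: eltm_surj.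
Qed.

Lemma h0_iso X Y (f : lhom X Y) : conc X -> conc Y ->
  (forall x : lhom O X, lcomp f x = 0 -> x = 0) ->
  (forall y : lhom O Y, exists x, lcomp f x = y) ->
  exists g : lhom Y X, lcomp g f = lidm X /\ lcomp f g = lidm Y.
Proof.
move=> cX cY fi fs; have [||v [vf fv]] := @mhom_inv _ _ _ _ _ (h0f f).
- by apply: lin_inj fi; apply: (mhom_lin (h0f f)).
- exact: fs.
have [g hg] := h0_full v cY cX; exists g; split; apply: h0_faithful2 => // x.
  by rewrite -lcompA hg lcomp1m; apply: vf.
by rewrite -lcompA hg lcomp1m; apply: fv.
Qed.

Lemma h0_iso_mod X Y (u : mhom (h0 X) (h0 Y)) : conc X -> conc Y ->
  injective u -> surj u -> @isomorphic D X Y.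
Proof.
move=> cX cY ui us; have [f hf] := h0_full u cX cY.
have [||g [h1 h2]] := h0_iso cX cY (f := f); last by exists f, g.
  by move=> x; rewrite hf => h; apply: ui; rewrite mhom0.
by move=> y; have [x <-] := us y; exists x.
Qed.

Lemma hom_conc_shift X Y j (h : lhom X (iter j.+2 S Y)) : conc X -> conc Y -> h = 0.
Proof.
move=> /(conc_iota hL) [M /isomorphic_sym i] /(conc_iota hL) [N /isomorphic_sym i'].
by move: h; apply: hom_zero_iso i (iter_isomorphic _ _ i') _ => h; apply: hom_iota_shift.
Qed.

Lemma hom_shift_conc X Y j (h : lhom (iter j.+1 S X) Y) : conc X -> conc Y -> h = 0.
Proof.
move=> /(conc_iota hL) [M /isomorphic_sym i] /(conc_iota hL) [N /isomorphic_sym i'].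
by move: h; apply: hom_zero_iso (iter_isomorphic _ _ i) i' _ => h; apply: hom_shift_iota.
Qed.

(** Short exactness of the underlying modules, tested on elements of [Hom(Lambda, -)]. *)
Definition sexact X Y Z (f : lhom X Y) (g : lhom Y Z) : Prop :=
  [/\ forall x : lhom O X, lcomp f x = 0 -> x = 0,
      forall z : lhom O Z, exists y : lhom O Y, lcomp g y = z
    & forall y : lhom O Y, lcomp g y = 0 <-> exists x : lhom O X, lcomp f x = y].

Definition projD X : Prop := conc X /\ projective (h0 X).

Lemma projD_iso X Y : @isomorphic D X Y -> projD X -> projD Y.
Proof.
move=> i [cX pX]; split; first exact: conc_iso i cX.
have [f [g [gf fg]]] := isoE i.
by apply: (projective_retract (s := h0f g) (p := h0f f)) pX _ => x; apply: (lcompKl fg).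
Qed.

Lemma iota_proj M : projective (mmod M) -> projD (iota D M).
Proof.
move=> pM; split; first exact: iota_conc.
have [v [h1 h2]] := mhom_inv (@eltm_inj M) (@eltm_surj M).
exact: (projective_retract (s := v) (p := eltm M)) pM h2.
Qed.

Lemma proj_iota M : projD (iota D M) -> projective (mmod M).
Proof.
case=> _ pM; have [v [h1 h2]] := mhom_inv (@eltm_inj M) (@eltm_surj M).
exact: (projective_retract (s := eltm M) (p := v)) pM h1.
Qed.

(** Transport of [ext_class] along isomorphisms with modules. This form is the working description
    of [Ext^1] in all that follows. *)
Lemma ext_class_conc X P1 P0 (d : lhom P1 P0) (p : lhom P0 X) :
  projD P1 -> projD P0 -> conc X -> sexact d p ->
  exists delta : lhom X (S P1), forall Y, conc Y ->
  (forall z : lhom X (S Y), exists g : lhom P1 Y, z = lcomp (fmap S g) delta) /\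
  (forall g : lhom P1 Y, lcomp (fmap S g) delta = 0 <-> exists r : lhom P0 Y, g = lcomp r d).
Proof.
move=> pP1 pP0 cX [di ps dp].
have [M [a [a' [a'a aa' ha]]]] := conc_mod cX.
have [M1 [b [b' [b'b bb' hb]]]] := conc_mod pP1.1.
have [M0 [c [c' [c'c cc' hc]]]] := conc_mod pP0.1.
have [d0 hd] := iota_full hL (lcomp c (lcomp d b')).
have [p0 hp] := iota_full hL (lcomp a (lcomp p c')).
have pM1 : projective (mmod M1) by apply: proj_iota; apply: projD_iso pP1; exists b, b'.
have pM0 : projective (mmod M0) by apply: proj_iota; apply: projD_iso pP0; exists c, c'.
have d0E x : lcomp d (lcomp b' (eltm M1 x)) = lcomp c' (eltm M0 (d0 x)).
  by rewrite -eltm_nat -hd -!lcompA (lcompKl c'c).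
have p0E x : lcomp p (lcomp c' (eltm M0 x)) = lcomp a' (eltm M (p0 x)).
  by rewrite -eltm_nat -hp -!lcompA (lcompKl a'a).
have i1 x : lcomp b' (eltm M1 x) = 0 -> x = 0.
  by move=> h; apply: (@eltm_inj M1); rewrite mhom0 -[eltm M1 x](lcompKl bb') h lcomp0r.
have i0 x y : lcomp c' (eltm M0 x) = lcomp c' (eltm M0 y) -> x = y.
  move=> h; apply: (@eltm_inj M0).
  by rewrite -[eltm M0 x](lcompKl cc') h (lcompKl cc').
have iM x y : lcomp a' (eltm M x) = lcomp a' (eltm M y) -> x = y.
  move=> h; apply: (@eltm_inj M).
  by rewrite -[eltm M x](lcompKl aa') h (lcompKl aa').
have [|||delta hdel] := ext_class D pM1 pM0 (d := d0) (p := p0).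
- apply: lin_inj => [|x hx]; first exact: mhom_lin.
  by apply: i1; apply: di; rewrite d0E hx mhom0 lcomp0r.
- move=> y; have [z hz] := ps (lcomp a' (eltm M y)).
  by have [x hx] := hc z; exists x; apply: iM; rewrite -p0E -hx.
- move=> y; split=> [hy|[x <-]].
    have /dp [x hx] : lcomp p (lcomp c' (eltm M0 y)) = 0.
      by rewrite p0E hy mhom0 lcomp0r.
    by have [w hw] := hb x; exists w; apply: i0; rewrite -d0E -hw.
  apply: iM; rewrite mhom0 lcomp0r -p0E -d0E.
  by apply/dp; exists (lcomp b' (eltm M1 x)).
exists (lcomp (fmap S b') (lcomp delta a)) => Y cY.
have [N [e [e' [e'e ee' _]]]] := conc_mod cY.
split=> [z|g].
  have [g hg] := (hdel N).1 (lcomp (fmap S e) (lcomp z a')).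
  exists (lcomp e' (lcomp (iota_map D g) b)).
  rewrite !fmapL -!lcompA (lcompKl (fmapLK S bb')) [lcomp _ (lcomp delta a)]lcompA -hg.
  by rewrite !lcompA (fmapLK S e'e) lcomp1m (lcompKr a'a).
have [g0 hg0] := iota_full hL (lcomp e (lcomp g b')).
have gE : g = lcomp e' (lcomp (iota_map D g0) b).
  by rewrite -hg0 !lcompA e'e lcomp1m (lcompKr b'b).
split=> [h|[r hr]].
  have /(hdel N).2 [r hr] : lcomp (fmap S (iota_map D g0)) delta = 0.
    have -> : lcomp (fmap S (iota_map D g0)) delta = lcomp (fmap S e)
        (lcomp (lcomp (fmap S g) (lcomp (fmap S b') (lcomp delta a))) a').
      by rewrite -hg0 !fmapL -!lcompA aa' lcompm1.
    by rewrite h lcomp0l lcomp0r.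
  exists (lcomp e' (lcomp (iota_map D r) c)).
  have e1 : iota_map D g0 = lcomp (iota_map D r) (lcomp c (lcomp d b')).
    by rewrite hd -iota_comp; congr (iota_map D _); apply: mhom_eq.
  by rewrite gE e1 -!lcompA b'b lcompm1.
have [r0 hr0] := iota_full hL (lcomp e (lcomp r c')).
have e0 : lcomp (fmap S (iota_map D g0)) delta = 0.
  apply/(hdel N).2; exists r0; apply: (iota_faithful hL (g := mhom_comp r0 d0)).
  apply: etrans (esym (iota_comp D r0 d0)).
  by rewrite -hd -hr0 -hg0 hr -!lcompA (lcompKl c'c).
have -> : lcomp (fmap S g) (lcomp (fmap S b') (lcomp delta a)) =
    lcomp (fmap S e') (lcomp (lcomp (fmap S (iota_map D g0)) delta) a).
  by rewrite -hg0 !fmapL -!lcompA (lcompKl (fmapLK S e'e)).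
by rewrite e0 lcomp0l lcomp0r.
Qed.

Lemma conc_resolution X : conc X -> exists P1 P0 (d : lhom P1 P0) (p : lhom P0 X),
  [/\ projD P1, projD P0 & sexact d p].
Proof.
move=> cX; have [n [p ps]] := free_cover (h0_fd cX).
have [P0 [u0 [c0 i0 s0]]] := h0_real (fd_free L false n).
have fk := fd_msub (mker_closed p) (fd_free L false n).
have [P1 [u1 [c1 i1 s1]]] := h0_real fk.
have [v0 [vu0 uv0]] := mhom_inv i0 s0; have [v1 [vu1 uv1]] := mhom_inv i1 s1.
have pF := @mfree_projective K L false n.
pose k := mincl (mker_closed p).
have ki : injective k by apply: mincl_inj.
have [d hd] := h0_full (mhom_comp u0 (mhom_comp k v1)) c1 c0.
have [q hq] := h0_full (mhom_comp p v0) c0 cX.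
exists P1, P0, d, q; split.
- split=> //; apply: (projective_retract (s := v1) (p := u1)) uv1.
  by apply: (sub_projective hL (i := k)) fk.
- by split=> //; apply: (projective_retract (s := v0) (p := u0)) uv0.
split=> [x|z|y].
- move=> e; apply: (can_inj uv1); apply: ki; apply: i0.
  by rewrite [v1 0]mhom0 !mhom0 -[RHS]e hd.
- by have [w <-] := ps z; exists (u0 w); rewrite hq /= vu0.
rewrite hq /=; split=> [/(mincl_im (mker_closed p)) [w hw]|[x <-]].
  by exists (u1 w); rewrite hd -[LHS]/(u0 (k (v1 (u1 w)))) vu1 [k w]hw uv0.
rewrite hd -[X in v0 X]/(u0 (k (v1 x))) vu0.
by apply/(mincl_im (mker_closed p)); exists (v1 x).
Qed.

End DegreeZeroHom.

(** * Serre duality and the translate *)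

Section Tau.
Variables (K : fieldType) (L : falgType K) (D : derived_cat L).
Variable SD : serre_duality D.
Hypothesis hL : hereditary L.
Local Notation S := (dshift D).
Local Notation O := (Lambda D).
Local Notation t := (tau SD).
Local Notation ti := (taui SD).
Implicit Types (X Y Z W : D).

Lemma tau_counit_nat_iso : nat_iso (fcomp ti t) (fid D).
Proof. exists (tau_counit SD); split; [exact: tau_counit_nat|exact: tau_counit_iso]. Qed.

Lemma tau_unit_nat_iso : nat_iso (fcomp t ti) (fid D).
Proof. exists (tau_unit SD); split; [exact: tau_unit_nat|exact: tau_unit_iso]. Qed.

Lemma tau_full X Y (g : lhom (t X) (t Y)) : exists f : lhom X Y, fmap t f = g.
Proof. exact: (fmap_full tau_counit_nat_iso tau_unit_nat_iso). Qed.
Lemma taui_full X Y (g : lhom (ti X) (ti Y)) : exists f : lhom X Y, fmap ti f = g.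
Proof. exact: (fmap_full tau_unit_nat_iso tau_counit_nat_iso). Qed.
Lemma tau_faithful X Y (f g : lhom X Y) : fmap t f = fmap t g -> f = g.
Proof. exact: (fmap_faithful tau_counit_nat_iso). Qed.
Lemma taui_faithful X Y (f g : lhom X Y) : fmap ti f = fmap ti g -> f = g.
Proof. exact: (fmap_faithful tau_unit_nat_iso). Qed.
Lemma tau_lin X Y : lin (fun f : lhom X Y => fmap t f : lhom (t X) (t Y)).
Proof. by move=> k f g; apply: tau_linear. Qed.
Lemma taui_lin X Y : lin (fun f : lhom X Y => fmap ti f : lhom (ti X) (ti Y)).
Proof. by move=> k f g; apply: taui_linear. Qed.
Lemma tau_tauiK X : @isomorphic D (t (ti X)) X.
Proof. by exists (tau_unit SD X); apply: tau_unit_iso. Qed.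
Lemma taui_tauK X : @isomorphic D (ti (t X)) X.
Proof. by exists (tau_counit SD X); apply: tau_counit_iso. Qed.

Lemma reflect_isomorphic (F : functor D D) :
  (forall X Y (g : lhom (F X) (F Y)), exists f : lhom X Y, fmap F f = g) ->
  (forall X Y (f g : lhom X Y), fmap F f = fmap F g -> f = g) ->
  forall X Y, @isomorphic D (F X) (F Y) -> @isomorphic D X Y.
Proof.
move=> Ff Fi X Y /isoE [f [g [gf fg]]].
have [f' hf] := Ff _ _ f; have [g' hg] := Ff _ _ g.
have e Z : fmap F (lidm Z : lhom Z Z) = lidm (F Z) := @fmap1 _ _ F Z.
by exists f', g'; split; apply: Fi; rewrite fmapL hf hg ?gf ?fg; apply/esym/e.
Qed.

Lemma tau_reflect X Y : @isomorphic D (t X) (t Y) -> @isomorphic D X Y.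
Proof. exact: (reflect_isomorphic tau_full tau_faithful). Qed.

Definition nohom X Y : Prop := forall h : lhom X Y, h = 0.

Lemma nohom_iso X X' Y Y' : @isomorphic D X X' -> @isomorphic D Y Y' ->
  nohom X Y -> nohom X' Y'.
Proof. exact: hom_zero_iso. Qed.

Lemma nohom_functor (F : functor D D) :
  (forall X Y (g : lhom (F X) (F Y)), exists f : lhom X Y, fmap F f = g) ->
  (forall X Y (f g : lhom X Y), fmap F f = fmap F g -> f = g) ->
  (forall X Y, lin (fun f : lhom X Y => fmap F f : lhom (F X) (F Y))) ->
  forall X Y, nohom (F X) (F Y) <-> nohom X Y.
Proof.
move=> Ff Fi Fl X Y; split=> z h.
  by apply: Fi; rewrite [LHS]z -[LHS](lin0 (Fl X Y)).
by have [f <-] := Ff _ _ h; rewrite (z f) (lin0 (Fl X Y)).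
Qed.

Lemma nohom_shift X Y : nohom (S X) (S Y) <-> nohom X Y.
Proof. exact: nohom_functor (@shift_full _ _ D) (@shift_faithful _ _ D) (@shift_lin _ _ D) X Y. Qed.
Lemma nohom_tau X Y : nohom (t X) (t Y) <-> nohom X Y.
Proof. exact: nohom_functor tau_full tau_faithful tau_lin X Y. Qed.
Lemma nohom_taui X Y : nohom (ti X) (ti Y) <-> nohom X Y.
Proof. exact: nohom_functor taui_full taui_faithful taui_lin X Y. Qed.

Lemma nohom_tau_adj X Y : nohom (t X) Y <-> nohom X (ti Y).
Proof.
rewrite -(nohom_tau X); split; apply: nohom_iso; try exact: isomorphic_refl.
  exact/isomorphic_sym/tau_tauiK.
exact: tau_tauiK.
Qed.

Lemma nohom_taui_adj X Y : nohom (ti X) Y <-> nohom X (t Y).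
Proof.
rewrite -(nohom_taui X); split; apply: nohom_iso; try exact: isomorphic_refl.
  exact/isomorphic_sym/taui_tauK.
exact: taui_tauK.
Qed.

Lemma serre_nohom X Y : nohom X (S Y) -> nohom Y (t X).
Proof.
move=> z g; apply: (serre_inj (s := SD)) => h; rewrite (z h).
have := @serre_linr _ _ _ SD X Y g (-1) 0 0.
by rewrite !scaleN1r !addNr mulN1r addNr.
Qed.

Lemma fd_functional (V : lmodType K) (x : V) : fd V -> x <> 0 ->
  exists phi : V -> K, scalar phi /\ phi x <> 0.
Proof.
move=> /fd_isdim [n [v [v' [vl _ vK _]]]] x0.
have [i hi] : exists i, v x 0 i <> 0.
  apply: contra_notP x0 => h; apply: (can_inj vK); rewrite (lin0 vl); apply/rowP => i.
  by rewrite mxE; apply: contrapT => hi; apply: h; exists i.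
exists (fun y => v y 0 i); split=> // k a b /=.
by rewrite vl !mxE.
Qed.

(** Finite dimension provides a functional that does not vanish at a given nonzero map; by duality
    it is pairing with some [g], which is zero. *)
Lemma serre_nohom_conv X Y : fd (lhom X (S Y)) -> nohom Y (t X) -> nohom X (S Y).
Proof.
move=> f z h; apply: contrapT => h0.
have [phi [pl p0]] := fd_functional f h0.
have [g hg] := @serre_surj _ _ _ SD X Y phi pl; apply: p0; rewrite -hg (z g).
have := @serre_linl _ _ _ SD X Y h (-1) 0 0.
by rewrite !scaleN1r !addNr mulN1r addNr.
Qed.

(** Call [u : Y[1] -> tau(X[1])] and [v : Y -> tau X] matched if they define the same functional on
    [Hom(X, Y[1])]. Matching is a bijection natural in [Y], so [tau(X[1])] and [(tau X)[1]]
    represent the same functor. *)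
Lemma tau_shift X : @isomorphic D (t (S X)) (S (t X)).
Proof.
pose match_ Y (u : lhom (S Y) (t (S X))) (v : lhom Y (t X)) :=
  forall h : lhom X (S Y), @serre _ _ _ SD (S X) (S Y) u (fmap S h) = @serre _ _ _ SD X Y v h.
have exv Y u : exists v, match_ Y u v.
  have [|v hv] := @serre_surj _ _ _ SD X Y (fun h => @serre _ _ _ SD (S X) (S Y) u (fmap S h)).
    move=> k a b /=.
    rewrite [fmap S _](@shift_lin _ _ D X (S Y)).
    exact: (@serre_linr _ _ _ SD (S X) (S Y) u).
  by exists v => h; rewrite hv.
have exu Y v : exists u, match_ Y u v.
  pose inv (k : lhom (S X) (S (S Y))) : lhom X (S Y) := projT1 (cid (shift_full k)).
  have invK k : fmap S (inv k) = k by rewrite /inv; case: cid.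
  have [|u hu] := @serre_surj _ _ _ SD (S X) (S Y) (fun k => @serre _ _ _ SD X Y v (inv k)).
    move=> k a b /=.
    have -> : inv (k *: a + b) = k *: inv a + inv b.
      by apply: shift_faithful; rewrite [RHS](@shift_lin _ _ D X (S Y)) !invK.
    exact: (@serre_linr _ _ _ SD X Y v).
  exists u => h; rewrite hu; congr serre.
  by apply: shift_faithful; rewrite invK.
have uniu Y u u' v : match_ Y u v -> match_ Y u' v -> u = u'.
  move=> m m'; apply/eqP; rewrite -subr_eq0; apply/eqP.
  apply: (serre_inj (s := SD)) => k; have [h <-] := shift_full k.
  rewrite -scaleN1r addrC (@serre_linl _ _ _ SD (S X) (S Y) (fmap S h)).
  by rewrite m m' mulN1r addNr.
have univ Y u v v' : match_ Y u v -> match_ Y u v' -> v = v'.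
  move=> m m'; apply/eqP; rewrite -subr_eq0; apply/eqP.
  apply: (serre_inj (s := SD)) => h.
  rewrite -scaleN1r addrC (@serre_linl _ _ _ SD X Y h).
  by rewrite -m -m' mulN1r addNr.
have natm Y Y' (w : lhom Y' Y) u v : match_ Y u v -> match_ Y' (lcomp u (fmap S w)) (lcomp v w).
  move=> m h.
  have e1 := @serre_natY _ _ _ SD X Y Y' w v h.
  have e2 := @serre_natY _ _ _ SD (S X) (S Y) (S Y') (fmap S w) u (fmap S h).
  rewrite lcompE in e1 e2.
  by rewrite e1 [LHS]e2 -m lcompE -fmapL.
(* Every object is a shift up to isomorphism, so the universal elements of both sides can be
   compared on shifted objects. *)
have [A' /isoE [a [a' [a'a aa']]]] := shift_ess_surj (t (S X)).
have [v0 m0] := exv _ a; have [u0 n0] := exu _ (lidm (t X)).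
have e1 : lcomp u0 (fmap S v0) = a.
  by apply: (uniu _ _ _ v0) m0; have := natm _ _ v0 _ _ n0; rewrite lcomp1m.
have [w hw] := shift_full (lcomp a' u0).
have e2 : lcomp v0 w = lidm _.
  apply: (univ _ u0) n0; have := natm _ _ w _ _ m0.
  by rewrite hw lcompA aa' lcomp1m.
exists (lcomp (fmap S v0) a'), u0; split; rewrite lcompE.
  by rewrite lcompA e1 aa'.
by rewrite -lcompA -hw -fmapL e2; apply: (@fmap1 _ _ S).
Qed.

Lemma taui_shift X : @isomorphic D (ti (S X)) (S (ti X)).
Proof.
apply: tau_reflect; apply: isomorphic_trans (tau_tauiK _) _.
apply: isomorphic_sym; apply: isomorphic_trans (tau_shift _) _.
exact: fmap_isomorphic (tau_tauiK X).
Qed.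

Lemma tau_shift_iter j X : @isomorphic D (t (iter j S X)) (iter j S (t X)).
Proof.
elim: j => [|j IH] /=; first exact: isomorphic_refl.
exact: isomorphic_trans (tau_shift _) (fmap_isomorphic S IH).
Qed.

Lemma taui_shift_iter j X : @isomorphic D (ti (iter j S X)) (iter j S (ti X)).
Proof.
elim: j => [|j IH] /=; first exact: isomorphic_refl.
exact: isomorphic_trans (taui_shift _) (fmap_isomorphic S IH).
Qed.

Lemma iter_taui_shift m X : @isomorphic D (iter m ti (S X)) (S (iter m ti X)).
Proof.
elim: m => [|m IH] /=; first exact: isomorphic_refl.
exact: isomorphic_trans (fmap_isomorphic ti IH) (taui_shift _).
Qed.

Lemma iter_tau_shift m X : @isomorphic D (iter m t (S X)) (S (iter m t X)).
Proof.
elim: m => [|m IH] /=; first exact: isomorphic_refl.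
exact: isomorphic_trans (fmap_isomorphic t IH) (tau_shift _).
Qed.

Lemma iter_tauK m X : @isomorphic D (iter m t (iter m ti X)) X.
Proof.
elim: m X => [|m IH] X; first exact: isomorphic_refl.
rewrite iterSr iterS; apply: isomorphic_trans _ (IH X).
by apply: iter_isomorphic; apply: tau_tauiK.
Qed.

Lemma iter_tauiK m X : @isomorphic D (iter m ti (iter m t X)) X.
Proof.
elim: m X => [|m IH] X; first exact: isomorphic_refl.
rewrite iterSr iterS; apply: isomorphic_trans _ (IH X).
by apply: iter_isomorphic; apply: taui_tauK.
Qed.

Lemma nohom_iter_taui m X Y : nohom (iter m ti X) (iter m ti Y) <-> nohom X Y.
Proof. by elim: m => //= m IH; rewrite nohom_taui. Qed.

Lemma nohom_iter_adj m X Y : nohom (iter m t X) Y <-> nohom X (iter m ti Y).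
Proof.
elim: m Y => //= m IH Y; rewrite nohom_tau_adj IH.
by rewrite -iterSr.
Qed.

Lemma Lambda_conc : conc O.
Proof. exact: (iota_conc D hL (regular_mod L)). Qed.

(** By Serre duality [Hom(Y, J0)] is dual to [Hom(Lambda, Y)]: this is the injective cogenerator
    [D Lambda]. *)
Definition J0 : D := S (t O).

Lemma tau_shift_Lambda j : @isomorphic D (t (iter j.+1 S O)) (iter j S J0).
Proof. by rewrite /J0 -iterSr; apply: tau_shift_iter. Qed.

Lemma J0_conc : conc J0.
Proof.
have [h1 h2] := Lambda_conc; split=> j.
  rewrite iterS; apply/(nohom_shift (iter j S O) (t O)).
  by apply: serre_nohom; apply: (h2 j).
have i := tau_shift_Lambda j.+1.
apply: (nohom_iso (isomorphic_refl O) i); apply: serre_nohom.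
by apply/(nohom_shift (iter j.+1 S O) O); apply: h1.
Qed.

(** The only obstruction is [Hom(Lambda[1], tau^- X)], which is [Hom(tau(Lambda[1]), X) = Hom(J0,
    X)]; all other shifts vanish for degree reasons. *)
Lemma conc_taui X : conc X -> conc (ti X) <-> nohom J0 X.
Proof.
move=> cX; split=> [[h1 _]|z].
  apply: nohom_iso (tau_shift_Lambda 0) (isomorphic_refl X) _.
  by apply/nohom_tau_adj; apply: (h1 0%N).
split=> j.
  apply/(nohom_tau_adj (iter j.+1 S O) X).
  apply: nohom_iso (isomorphic_sym (tau_shift_Lambda j)) (isomorphic_refl X) _.
  case: j => [//|j] h; exact: hom_shift_conc hL _ _ _ h J0_conc cX.
apply: (nohom_iso (isomorphic_refl O) (taui_shift_iter j.+1 X)).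
apply/nohom_tau_adj/(nohom_shift (t O)) => h.
exact: (@hom_conc_shift _ _ _ hL J0 X j h J0_conc cX).
Qed.

(** Dually, the only obstruction is [Hom(Lambda, (tau X)[1])], which is dual to [Hom(X, Lambda)]. *)
Lemma conc_tau X : conc X -> nohom X O -> conc (t X).
Proof.
move=> cX z; split=> j.
  apply: (serre_nohom (X := X) (Y := iter j.+1 S O)) => h.
  exact: (@hom_conc_shift _ _ _ hL X O j h cX Lambda_conc).
apply: nohom_iso (isomorphic_refl O) (tau_shift_iter j.+1 X) _.
apply: serre_nohom; apply/(nohom_shift (iter j S X) O).
by case: j => [//|j] h; apply: (hom_shift_conc hL h cX Lambda_conc).
Qed.

(** Injectivity as vanishing of [Ext^1]; [injD_injective] and [injective_injD] compare it with
    injectivity among all modules. *)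
Definition injD Z : Prop := conc Z /\ forall W, conc W -> nohom W (S Z).

Lemma injD_iso Z Z' : @isomorphic D Z Z' -> injD Z -> injD Z'.
Proof.
move=> i [cZ h]; split; first exact: conc_iso i cZ.
by move=> W cW; apply: nohom_iso (isomorphic_refl W) (fmap_isomorphic S i) (h W cW).
Qed.

Lemma J0_injD : injD J0.
Proof.
split=> [|W cW]; first exact: J0_conc.
have i : @isomorphic D (t (iter 2 S O)) (S J0) := tau_shift_Lambda 1.
apply: nohom_iso (isomorphic_refl W) i _.
apply: serre_nohom; apply/nohom_shift => h.
exact: (@hom_shift_conc _ _ _ hL O W 0 h Lambda_conc cW).
Qed.

Lemma proj_lift P B C (c : lhom B C) (f : lhom P C) : projD P -> conc B -> conc C ->
  (forall z : lhom O C, exists y : lhom O B, lcomp c y = z) ->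
  exists g : lhom P B, lcomp c g = f.
Proof.
move=> [cP pP] cB cC cs.
have [u hu] := pP _ _ (h0f c) (h0f f) cs.
have [g hg] := h0_full hL u cP cB; exists g.
by apply: (h0_faithful2 hL) => // x; rewrite -lcompA hg; apply: hu.
Qed.

Lemma mono_lift A B C (k : lhom A B) (f : lhom C B) : conc A -> conc B -> conc C ->
  (forall x : lhom O A, lcomp k x = 0 -> x = 0) ->
  (forall z : lhom O C, exists y : lhom O A, lcomp k y = lcomp f z) ->
  exists g : lhom C A, lcomp k g = f.
Proof.
move=> cA cB cC ki kf.
have ki' : injective (h0f k) by apply: lin_inj ki; apply: (mhom_lin (h0f k)).
have [u hu] := mhom_factor_inj (f := h0f f) ki' kf.
have [g hg] := h0_full hL u cC cA; exists g.
by apply: (h0_faithful2 hL) => // x; rewrite -lcompA hg; apply: hu.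
Qed.

Lemma epi_factor A B C (p : lhom A B) (f : lhom A C) : conc A -> conc B -> conc C ->
  (forall z : lhom O B, exists y : lhom O A, lcomp p y = z) ->
  (forall x : lhom O A, lcomp p x = 0 -> lcomp f x = 0) ->
  exists g : lhom B C, lcomp g p = f.
Proof.
move=> cA cB cC ps pf.
have [u hu] := mhom_factor_surj (p := h0f p) (f := h0f f) ps pf.
have [g hg] := h0_full hL u cB cC; exists g.
by apply: (h0_faithful2 hL) => // x; rewrite -lcompA hg; apply: hu.
Qed.

Lemma proj_ext P Y : projD P -> conc Y -> nohom P (S Y).
Proof.
move=> pP cY z; have [P1 [P0 [d [p [h1 h2 h3]]]]] := conc_resolution hL pP.1.
have [delta h] := ext_class_conc hL h1 h2 pP.1 h3.
have [di ps dp] := h3.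
have [g ->] := (h Y cY).1 z; apply/(h Y cY).2.
have [s hs] := proj_lift (lidm P) pP h2.1 pP.1 ps.
have [x|r hr] := @mono_lift _ _ P0 d (lidm P0 - lcomp s p) h1.1 h2.1 h2.1 di.
  apply/dp; rewrite lcompA lcompBR lcompm1 lcompA hs lcomp1m subrr.
  exact: lcomp0l.
have rd : lcomp r d = lidm _.
  apply: (h0_faithful2 hL) h1.1 h1.1 _ => x; apply/eqP; rewrite -subr_eq0; apply/eqP/di.
  have pd : lcomp p (lcomp d x) = 0 by apply/dp; exists x.
  rewrite lcompBR lcomp1m !lcompA hr lcompB lcomp1m lcompB -!lcompA pd.
  by rewrite lcomp0r subr0 subrr.
by exists (lcomp g r); rewrite -lcompA rd lcompm1.
Qed.

Lemma ext_proj P : conc P -> (forall Y, conc Y -> nohom P (S Y)) -> projD P.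
Proof.
move=> cP z; have [P1 [P0 [d [p [h1 h2 h3]]]]] := conc_resolution hL cP.
have [delta h] := ext_class_conc hL h1 h2 cP h3.
have [di ps dp] := h3.
have [r hr] : exists r : lhom P0 P1, lidm P1 = lcomp r d.
  by apply/(h P1 h1.1).2; exact: z h1.1 _.
have [x /dp [y <-]|s hs] := @epi_factor P0 P P0 p (lidm P0 - lcomp d r) h2.1 cP h2.1 ps.
  by rewrite lcompB lcomp1m -lcompA (lcompA r) -hr lcomp1m subrr.
split=> //; apply: (projective_retract (s := h0f s) (p := h0f p)) h2.2 _ => x /=.
have [y <-] := ps x; rewrite (lcompA s) hs lcompB lcomp1m lcompBR.
have -> : lcomp p (lcomp (lcomp d r) y) = 0; last by rewrite subr0.
by apply/dp; exists (lcomp r y); rewrite lcompA.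
Qed.

(** [Ext^1] is right exact in the second variable: a cocycle on the projective [P1] lifts along the
    surjection. *)
Lemma injD_quotient Z Z' (c : lhom Z Z') : injD Z -> conc Z' ->
  (forall z : lhom O Z', exists y : lhom O Z, lcomp c y = z) -> injD Z'.
Proof.
move=> [cZ iZ] cZ' cs; split=> // W cW z.
have [P1 [P0 [d [p [h1 h2 h3]]]]] := conc_resolution hL cW.
have [delta h] := ext_class_conc hL h1 h2 cW h3.
have [g ->] := (h Z' cZ').1 z.
have [g' hg'] := proj_lift g h1 cZ cZ' cs.
by rewrite -hg' fmapL -lcompA [lcomp _ delta](iZ W cW) lcomp0r.
Qed.

Lemma conc_cokernel A B (k : lhom A B) : conc B ->
  exists C (c : lhom B C), [/\ conc C, forall z : lhom O C, exists y : lhom O B, lcomp c y = z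
    & forall y : lhom O B, lcomp c y = 0 <-> exists x : lhom O A, lcomp k x = y].
Proof.
move=> cB; have cU := mim_closed (h0f k).
have [C [u [cC ui us]]] := h0_real D hL (fd_mquo cU (h0_fd hL cB)).
have [c hc] := h0_full hL (mhom_comp u (mpi cU)) cB cC.
exists C, c; split=> // [z|y].
  by have [w <-] := us z; have [y <-] := mpi_surj w; exists y; rewrite hc.
rewrite hc; split=> [e|h].
  by apply/(mpi_ker cU y); apply: ui; rewrite mhom0; exact: e.
transitivity (u 0); last exact: (mhom0 u).
by congr (u _); apply/(mpi_ker cU y).
Qed.

(** A monomorphism out of an injective splits. The class of the extension is the map [g : R1 -> J]
    obtained from a lift [r] of the resolution of the cokernel, and [r'] extends it to [R0]. *)
Lemma injD_retract J Z (k : lhom J Z) : injD J -> conc Z ->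
  (forall x : lhom O J, lcomp k x = 0 -> x = 0) -> exists r : lhom Z J, lcomp r k = lidm J.
Proof.
move=> [cJ iJ] cZ ki; have [C [c [cC cs ck]]] := conc_cokernel k cZ.
have [R1 [R0 [d [p [h1 h2 h3]]]]] := conc_resolution hL cC.
have [delta h] := ext_class_conc hL h1 h2 cC h3.
have [di ps dp] := h3.
have [r hr] := proj_lift p h2 cZ cC cs.
have [x|g hg] := @mono_lift _ _ R1 k (lcomp r d) cJ cZ h1.1 ki.
  by apply/ck; rewrite -lcompA lcompA hr; apply/dp; exists x.
have [r' hr'] : exists r', g = lcomp r' d by apply/(h J cJ).2; apply: iJ.
have kl : lin (h0f k) by apply: mhom_lin.
(* For [x] over [c z], the element [z - r x] lies in the image of [k]; adding [k (r' x)] removes the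
   dependence on the choice of [x]. *)
have [||y [x [px]]|rho hrho] := @mhom_of_rel _ _ _ (h0 Z) (h0 J) (fun z y =>
   exists x : lhom O R0, lcomp c z = lcomp p x /\
   lcomp k y = z - lcomp r x + lcomp k (lcomp r' x)).
- split=> [|l z z' y y' [x [e1 e2]] [x' [e1' e2']]|z y a [x [e1 e2]]].
  + by exists 0; rewrite !lcomp0r subr0 addr0.
  + exists (l *: x + x'); rewrite !lcompDr e1 e2 e1' e2'; split=> //.
    by rewrite !scalerDr scalerN opprD addrACA [X in X + _ = _]addrACA.
  + by exists (lcomp x (lact D a)); rewrite /= !lcompA e1 e2 !lcompD lcompNl -!lcompA.
- move=> z; have [x hx] := ps (lcomp c z).
  have [|y hy] := (ck (z - lcomp r x)).1; first by rewrite lcompBR lcompA hr hx subrr.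
  by exists (y + lcomp r' x), x; rewrite lcompDR hy.
- rewrite sub0r => e; have /dp [w hw] : lcomp p x = 0 by rewrite -px lcomp0r.
  apply: ki; rewrite e -hw (lcompA r) -hg hr'.
  by rewrite -!lcompA addNr.
have [r'' hr''] := h0_full hL rho cZ cJ; exists r''.
apply: (h0_faithful2 hL) => // x; rewrite lcomp1m -lcompA hr''.
have [w [e1 e2]] := hrho (lcomp k x).
have /dp [v hv] : lcomp p w = 0 by rewrite -e1; apply/ck; exists x.
apply/eqP; rewrite -subr_eq0; apply/eqP/ki; rewrite lcompBR e2 -hv.
rewrite (lcompA r) -hg hr' -!lcompA.
by rewrite subrK subrr.
Qed.

End Tau.

(** * Fitting's lemma and decomposition into indecomposables *)

Section Decomposition.
Variables (K : fieldType) (L : falgType K) (D : derived_cat L).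
Hypothesis hL : hereditary L.
Local Notation S := (dshift D).
Local Notation O := (Lambda D).
Implicit Types (M N : mod L) (X Y Z W : D).

Lemma fd_ffun (V : lmodType K) n : fd V -> fd {ffun 'I_n -> V}.
Proof.
move=> /fd_isdim [m [v [v' [vl _ vK _]]]].
pose f (x : {ffun 'I_n -> V}) : 'M[K]_(n, m) := \matrix_(i, j) v (x i) 0 j.
apply: (@fd_inj _ _ _ f) (@fd_vect K 'M[K]_(n, m)) => [k x y|x y e].
  by apply/matrixP => i j; rewrite !mxE !ffunE vl !mxE.
apply/ffunP => i; apply: (can_inj vK); apply/rowP => j.
by have := congr1 (fun A : 'M[K]_(n, m) => A i j) e; rewrite !mxE.
Qed.

Lemma fd_lhom X Y : conc X -> conc Y -> fd (lhom X Y).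
Proof.
move=> cX cY; have [n [g hg]] := free_cover (h0_fd hL cX).
pose f (u : lhom X Y) : {ffun 'I_n -> h0 Y} := [ffun i => lcomp u (g (mbasis _ _ i))].
apply: (@fd_inj _ _ _ f) (fd_ffun n (h0_fd hL cY)).
  by move=> k u v; apply/ffunP => i; rewrite !ffunE; apply: lcompDl.
apply: lin_inj => [k u v|u u0]; first by apply/ffunP => i; rewrite !ffunE; apply: lcompDl.
apply: (h0_faithful hL) => // x; have [c <-] := hg x.
have e : mhom_comp (h0f u) g = mhom_zero _ _.
  apply: mfree_hom_uniq => i.
  by have := congr1 (fun h : {ffun 'I_n -> h0 Y} => h i) u0; rewrite !ffunE.
exact: (congr1 (fun h : mhom _ _ => h c) e).
Qed.

Lemma fd_ext X Y : conc X -> conc Y -> fd (lhom X (S Y)).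
Proof.
move=> cX cY; have [P1 [P0 [d [p [h1 h2 h3]]]]] := conc_resolution hL cX.
have [delta h] := ext_class_conc hL h1 h2 cX h3.
apply: (@fd_surj _ _ _ (fun g : lhom P1 Y => lcomp (fmap S g : lhom _ _) delta)) _ _ (fd_lhom h1.1 cY).
  move=> k f g; rewrite [fmap S _](@shift_lin _ _ D P1 Y); exact: lcompDl.
by move=> z; have [g ->] := (h Y cY).1 z; exists g.
Qed.

Definition pw X (f : lhom X X) n : lhom X X := iter n (lcomp f) (lidm X).

Lemma pwS X (f : lhom X X) n : pw f n.+1 = lcomp f (pw f n). Proof. by []. Qed.

Lemma pwD X (f : lhom X X) m n : pw f (m + n) = lcomp (pw f m) (pw f n).
Proof. by elim: m => [|m IH]; rewrite ?lcomp1m // addSn !pwS IH lcompA. Qed.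

Lemma pw_comm X (f g : lhom X X) n : lcomp f g = lcomp g f ->
  lcomp (pw f n) g = lcomp g (pw f n).
Proof.
move=> c; elim: n => [|n IH]; first by rewrite lcomp1m lcompm1.
by rewrite pwS -lcompA IH lcompA c -lcompA.
Qed.

Lemma lcomp_suml X Y Z I (r : seq I) (P : pred I) (F : I -> lhom Y Z) (g : lhom X Y) :
  lcomp (\sum_(i <- r | P i) F i) g = \sum_(i <- r | P i) lcomp (F i) g.
Proof. exact: (lin_sum (lcompDl_ g)). Qed.

Lemma lcomp_sumr X Y Z I (r : seq I) (P : pred I) (F : I -> lhom X Y) (g : lhom Y Z) :
  lcomp g (\sum_(i <- r | P i) F i) = \sum_(i <- r | P i) lcomp g (F i).
Proof. exact: (lin_sum (lcompDr_ g)). Qed.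

(** In a linear relation among powers of [f], solve for the lowest power that occurs; [th] is a
    polynomial in [f], so it commutes with [f]. *)
Lemma fitting_aux X (f : lhom X X) : fd (lhom X X) ->
  exists k th, lcomp f th = lcomp th f /\ pw f k = lcomp (pw f k.+1) th.
Proof.
move=> /fd_dependent [n h]; have [c [[i0 ci0] c0]] := h (fun i => pw f i).
have exk : exists k : nat, [exists i : 'I_n, (i == k :> nat) && (c i != 0)].
  by exists i0; apply/existsP; exists i0; rewrite eqxx.
case: (ex_minnP exk) => k /existsP [ik /andP [/eqP ek ck]] kmin.
pose th := \sum_(i < n | (k < i)%N) (- (c i / c ik)) *: pw f (i - k.+1).
exists k, th; split.
  rewrite lcomp_sumr lcomp_suml; apply: eq_bigr => i _.
  by rewrite lcompZr lcompZl (pw_comm _ (erefl (lcomp f f))).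
have c0' : c ik *: pw f k + \sum_(i < n | (k < i)%N) c i *: pw f i = 0.
  rewrite -[RHS]c0 [in RHS](bigID (fun i : 'I_n => (k < i)%N)) /= [RHS]addrC; congr (_ + _).
  rewrite (bigD1 ik) /=; last by rewrite -ek ltnn.
  rewrite big1 ?addr0 ?ek // => i /andP [ki iik]; rewrite -leqNgt in ki.
  have [->|ci] := eqVneq (c i) 0; first by rewrite scale0r.
  have ik' : (k <= i)%N by apply: kmin; apply/existsP; exists i; rewrite eqxx.
  by case/eqP: iik; apply/val_inj/eqP; rewrite /= ek eqn_leq ki ik'.
apply: (scalerI ck); move/eqP: c0'; rewrite addr_eq0 => /eqP ->.
rewrite lcomp_sumr scaler_sumr -sumrN; apply: eq_bigr => i ki.
by rewrite lcompZr scalerA mulrN mulrC divfK // scaleNr -pwD subnKC.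
Qed.

(** From [f^k = f^(k+1) th] one gets [f^k = f^(k+j) th^j], and [(f th)^(k+1)] is the idempotent onto
    the part on which [f] is invertible. *)
Lemma fitting X (f : lhom X X) : fd (lhom X X) ->
  exists k e g, [/\ lcomp e e = e, lcomp (pw f k) e = pw f k, e = lcomp f g & e = lcomp g f].
Proof.
move=> /(@fitting_aux X f) [k [th [c h]]].
have h1 j : pw f k = lcomp (pw f (k + j)) (pw th j).
  elim: j => [|j IH]; first by rewrite addn0 lcompm1.
  have e : (k + j.+1 = j + k.+1)%N by lia.
  by rewrite {1}IH [(k + j)%N]addnC e !pwD {1}h [pw th j.+1]pwS -!lcompA.
have cm m n : lcomp (pw f m) (pw th n) = lcomp (pw th n) (pw f m).
  by apply: pw_comm; apply/esym/pw_comm/esym.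
have h2 j : pw f k.+1 = lcomp (pw f (k.+1 + j)) (pw th j).
  by rewrite pwS {1}(h1 j) lcompA.
exists k.+1, (lcomp (pw f k.+1) (pw th k.+1)), (lcomp (pw f k) (pw th k.+1)); split.
- rewrite -lcompA (lcompA (pw th _)) -cm lcompA (lcompA (pw f k.+1) (pw f k.+1)) -pwD.
  by rewrite -h2.
- by rewrite lcompA -pwD -h2.
- by rewrite lcompA.
rewrite -[RHS]lcompA [in RHS](pw_comm (f := th) _ (esym c)) [RHS]lcompA.
by rewrite (pw_comm (f := f) _ (erefl (lcomp f f))).
Qed.

(** Indecomposability through idempotents, which equivalences of [D] visibly preserve; [indec_iota]
    relates it to coproducts of modules. *)
Definition indecD X : Prop :=
  lidm X <> 0 /\ forall e : lhom X X, lcomp e e = e -> e = 0 \/ e = lidm X.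

Lemma indec_nilp_or_iso X (f : lhom X X) : fd (lhom X X) -> indecD X ->
  (exists k, pw f k = 0) \/ (exists g, lcomp g f = lidm X /\ lcomp f g = lidm X).
Proof.
move=> fX [_ iX]; have [k [e [g [ee fe e1 e2]]]] := fitting f fX.
have [e0|e0] := iX e ee; first by left; exists k; rewrite -fe e0 lcomp0r.
by right; exists g; rewrite -e1 -e2 e0.
Qed.

Lemma nilp_sub_iso X (f : lhom X X) k : pw f k = 0 ->
  exists g, lcomp g (lidm X - f) = lidm X /\ lcomp (lidm X - f) g = lidm X.
Proof.
move=> fk; pose g := \sum_(i < k) pw f i.
have e1 : lcomp (lidm X - f) g = lidm X.
  rewrite lcompB lcomp1m /g lcomp_sumr.
  have : \sum_(i < k) (pw f i - pw f i.+1) = lidm X - pw f k.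
    elim: k {fk g} => [|k IH]; first by rewrite big_ord0 subrr.
    by rewrite big_ord_recr /= IH addrA subrK.
  by rewrite fk subr0 sumrB.
have e2 : lcomp g (lidm X - f) = lidm X.
  rewrite -[RHS]e1 lcompB lcompBR lcomp1m lcompm1 /g lcomp_sumr lcomp_suml.
  by congr (_ - _); apply: eq_bigr => i _; apply: pw_comm.
by exists g.
Qed.

(** The endomorphism ring is local: if [u f] is nilpotent then [1 - u f] is invertible, so the rest
    of the sum still has a left inverse. *)
Lemma indec_local X I (r : seq I) (f : I -> lhom X X) : fd (lhom X X) -> indecD X ->
  (exists g, lcomp g (\sum_(i <- r) f i) = lidm X) ->
  exists i g, lcomp g (f i) = lidm X.
Proof.
move=> fX iX; elim: r => [|i r IH].
  by rewrite big_nil => -[g h]; case: iX => -[]; rewrite -h lcomp0r.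
rewrite big_cons => -[u h1].
have [[k nk]|[g [g1 _]]] := indec_nilp_or_iso (lcomp u (f i)) fX iX.
  apply: IH; have [g [g1 _]] := nilp_sub_iso nk.
  exists (lcomp g u); rewrite -[RHS]g1 -lcompA; congr (lcomp g _).
  by rewrite -h1 lcompDR addrAC subrr add0r.
by exists i, (lcomp g u); rewrite -lcompA.
Qed.

Lemma conc_retract X Y (i : lhom X Y) (p : lhom Y X) : lcomp p i = lidm X ->
  conc Y -> conc X.
Proof.
move=> pi [h1 h2]; split=> j h.
  by rewrite -[h]lcomp1m -pi -lcompA (h1 j (lcomp i h)) lcomp0r.
have e : lcomp (iter_map S j.+1 p : lhom _ _) (iter_map S j.+1 i) = lidm (iter j.+1 S X).
  apply: etrans (esym (@iter_mapM _ _ D S j.+1 _ _ _ p i)) _.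
  by rewrite lcompE pi; apply: (@iter_map1 _ _ D S j.+1 X).
by rewrite -[h]lcomp1m -e -lcompA (h2 j (lcomp _ h)) lcomp0r.
Qed.

Lemma conc_biprod X Y Z (i1 : lhom X Z) (i2 : lhom Y Z) p1 p2 :
  biprod i1 i2 p1 p2 -> conc X -> conc Y -> conc Z.
Proof.
case=> h11 h22 h12 h21 h [a1 a2] [b1 b2]; split=> j k.
  rewrite -[k]lcomp1m -h lcompD -!lcompA.
  by rewrite (a1 j (lcomp p1 k)) (b1 j (lcomp p2 k)) !lcomp0r addr0.
have lS Y1 Y2 : lin (fun f : lhom Y1 Y2 => iter_map S j.+1 f : lhom (iter j.+1 S Y1) (iter j.+1 S Y2)).
  by elim: (j.+1) => [|n IH] l f g //; rewrite /= IH; apply: (@shift_lin _ _ D).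
have m (V : D) (f : lhom V Z) (g : lhom Z V) : lcomp (iter_map S j.+1 f : lhom (iter j.+1 S V) _)
    (iter_map S j.+1 g) = iter_map S j.+1 (lcomp f g).
  exact: (esym (@iter_mapM _ _ D S j.+1 _ _ _ f g)).
have e : lcomp (iter_map S j.+1 i1 : lhom (iter j.+1 S X) _) (iter_map S j.+1 p1) +
    lcomp (iter_map S j.+1 i2 : lhom (iter j.+1 S Y) _) (iter_map S j.+1 p2) =
    lidm (iter j.+1 S Z).
  rewrite !m -[LHS](linD (lS Z Z)) h; exact: (@iter_map1 _ _ D S j.+1 Z).
rewrite -[k]lcomp1m -e lcompD -!lcompA.
rewrite (a2 j (lcomp (iter_map S j.+1 p1) k)) (b2 j (lcomp (iter_map S j.+1 p2) k)).
by rewrite !lcomp0r addr0.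
Qed.

Lemma proj_retractD X Y (i : lhom X Y) (p : lhom Y X) : lcomp p i = lidm X ->
  projD Y -> projD X.
Proof.
move=> pi [cY pY]; split; first exact: conc_retract pi cY.
by apply: (projective_retract (s := h0f i) (p := h0f p)) pY _ => x; apply: (lcompKl pi).
Qed.

Lemma image_factor A B (u : lhom A B) : conc A -> conc B ->
  exists I (k : lhom I B) (q : lhom A I), [/\ conc I, u = lcomp k q,
    forall x : lhom O I, lcomp k x = 0 -> x = 0
    & forall z : lhom O I, exists y : lhom O A, lcomp q y = z].
Proof.
move=> cA cB; have cU := mim_closed (h0f u).
have [I [v [cI vi vs]]] := h0_real D hL (fd_msub cU (h0_fd hL cB)).
have [w [wv vw]] := mhom_inv vi vs.
have [k hk] := h0_full hL (mhom_comp (mincl cU) w) cI cB.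
have ki (x : lhom O I) : lcomp k x = 0 -> x = 0.
  rewrite hk => e; apply: (can_inj vw); apply: (@mincl_inj _ _ _ _ _ cU).
  by rewrite [w 0]mhom0 mhom0; exact: e.
have [z|q hq] := mono_lift hL (f := u) cI cB cA ki.
  have [y hy] := (mincl_im cU (lcomp u z)).1 (ex_intro _ z erefl).
  by exists (v y); rewrite hk /= wv.
exists I, k, q; split=> // z.
have [y hy] := (mincl_im cU (lcomp k z)).2 (ex_intro _ (w z) (esym (hk z))).
exists y; apply/eqP; rewrite -subr_eq0; apply/eqP/ki.
by rewrite lcompBR lcompA hq [lcomp u y]hy subrr.
Qed.

Lemma idem_split X (e : lhom X X) : conc X -> lcomp e e = e ->
  exists Y (i : lhom Y X) (p : lhom X Y), lcomp p i = lidm Y /\ lcomp i p = e.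
Proof.
move=> cX ee; have [Y [i [p [cY ep ii ps]]]] := image_factor e cX cX.
exists Y, i, p; split=> //; apply: (h0_faithful2 hL) => // x.
have [y <-] := ps x; apply/eqP; rewrite -subr_eq0; apply/eqP/ii.
by rewrite lcompBR lcomp1m -!lcompA (lcompA i) -ep (lcompA i) -ep lcompA ee subrr.
Qed.

(** Finite direct sums up to isomorphism: in both constructors [X] is any object with the required
    structure. *)
Inductive sums (T : D -> Prop) : D -> Prop :=
| sums_zero X : lidm X = 0 -> sums T X
| sums_add Y Z X (i1 : lhom Y X) (i2 : lhom Z X) p1 p2 :
    biprod i1 i2 p1 p2 -> T Y -> sums T Z -> sums T X.

Lemma conc_nonzero X : conc X -> lidm X <> 0 -> exists x : lhom O X, x <> 0.
Proof.
move=> cX X0; apply: contra_notP X0 => h; apply: (h0_faithful hL) => // x.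
by rewrite lcomp1m; apply: contrapT => x0; apply: h; exists x.
Qed.

Lemma biprod_dim X Y Z (i1 : lhom X Z) (i2 : lhom Y Z) p1 p2 :
  biprod i1 i2 p1 p2 -> conc Z -> lidm Y <> 0 -> (dimv (h0 X) < dimv (h0 Z))%N.
Proof.
case=> h11 h22 h12 h21 h cZ Y0.
have [||le eq] := dimv_inj (f := h0f i1) (h0_fd hL cZ).
- exact: mhom_lin.
- by move=> x y e; rewrite -[x](lcompKl h11) [X in lcomp p1 X]e (lcompKl h11).
rewrite ltn_neqAle le andbT; apply/eqP => /eq s; apply: Y0.
have cY : conc Y by apply: conc_retract h22 cZ.
apply: (h0_faithful hL) => // x; have [y hy] := s (lcomp i2 x : h0 Z).
rewrite lcomp1m -[x](lcompKl h22).
by rewrite -[lcomp i2 x]hy (lcompA p2) h21 lcomp0l.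
Qed.

Lemma biprod_sym X Y Z (i1 : lhom X Z) (i2 : lhom Y Z) p1 p2 :
  biprod i1 i2 p1 p2 -> biprod i2 i1 p2 p1.
Proof. by case=> h11 h22 h12 h21 h; split=> //; rewrite addrC. Qed.

Lemma biprod_assoc X Y Z A B (i1 : lhom Y X) (i2 : lhom Z X) p1 p2
    (j1 : lhom A Z) (j2 : lhom B Z) q1 q2 :
  biprod i1 i2 p1 p2 -> biprod j1 j2 q1 q2 ->
  exists A' (k1 : lhom Y A') (k2 : lhom A A') r1 r2 (l1 : lhom A' X) (l2 : lhom B X) s1 s2,
    biprod k1 k2 r1 r2 /\ biprod l1 l2 s1 s2.
Proof.
move=> [h11 h22 h12 h21 h] [g11 g22 g12 g21 g].
have [A' [k1 [k2 [r1 [r2 [f11 f22 f12 f21 f]]]]]] := derived_biprod Y A.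
exists A', k1, k2, r1, r2.
exists (lcomp i1 r1 + lcomp i2 (lcomp j1 r2)), (lcomp i2 j2).
exists (lcomp k1 p1 + lcomp k2 (lcomp q1 p2)), (lcomp q2 p2); split=> //; split.
- rewrite lcompD !lcompDR -!lcompA (lcompA p1 i1) (lcompA p1 i2) (lcompA p2 i1) (lcompA p2 i2).
  rewrite h11 h12 h21 h22 !lcomp0l !lcomp0r !lcomp1m addr0 add0r (lcompA q1) g11 lcomp1m.
  by rewrite f.
- by rewrite -!lcompA (lcompA p2) h22 lcomp1m g22.
- rewrite lcompD -!lcompA (lcompA p1) (lcompA p2) h12 h22 lcomp0l lcomp1m g12 !lcomp0r.
  by rewrite addr0.
- rewrite lcompDR -!lcompA (lcompA p2) (lcompA p2) h21 h22 lcomp0l lcomp1m lcomp0r.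
  by rewrite (lcompA q2) g21 lcomp0l addr0.
- rewrite lcompD !lcompDR -!lcompA (lcompA r1 k1) (lcompA r1 k2) (lcompA r2 k1) (lcompA r2 k2).
  rewrite f11 f12 f21 f22 !lcomp0l !lcomp0r !lcomp1m addr0 add0r -addrA -lcompDR.
  by rewrite [lcomp j1 _]lcompA [lcomp j2 _]lcompA -lcompD g lcomp1m h.
Qed.

Lemma biprod_zero X Z : lidm Z = 0 ->
  biprod (lidm X) (0 : lhom Z X) (lidm X) (0 : lhom X Z).
Proof. by move=> Z0; split; rewrite ?lcomp1m ?lcomp0r ?lcomp0l ?addr0. Qed.

(** Induction on the dimension of [h0 X]: an idempotent other than 0 and 1 splits off two summands
    of smaller dimension. *)
Lemma conc_sums X : conc X -> sums (fun Y => conc Y /\ indecD Y) X.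
Proof.
have [n] := ubnP (dimv (h0 X)); elim: n X => // n IH X le cX.
have [X0|X0] := pselect (lidm X = 0); first exact: sums_zero.
have [iX|niX] := pselect (indecD X).
  have [Z Z0] := derived_zero D.
  by apply: (sums_add (biprod_zero X Z0)) => //; apply: sums_zero.
have [e [ee e0 e1]] : exists e : lhom X X, [/\ lcomp e e = e, e <> 0 & e <> lidm X].
  apply: contrapT => ne; apply: niX; split=> // e ee.
  have [|e0] := pselect (e = 0); first by left.
  by right; apply: contrapT => e1; apply: ne; exists e.
pose e' := lidm X - e.
have ee0 : lcomp e e' = 0 by rewrite lcompBR lcompm1 ee subrr.
have ee1 : lcomp e' e = 0 by rewrite lcompB lcomp1m ee subrr.
have ee' : lcomp e' e' = e' by rewrite {1}/e' lcompB lcomp1m ee0 subr0.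
have [Y [i [p [pi ip]]]] := idem_split cX ee.
have [Z [j [q [qj jq]]]] := idem_split cX ee'.
have pe : lcomp p e = p by rewrite -ip lcompA pi lcomp1m.
have ei : lcomp e i = i by rewrite -ip -lcompA pi lcompm1.
have qe : lcomp q e' = q by rewrite -jq lcompA qj lcomp1m.
have ej : lcomp e' j = j by rewrite -jq -lcompA qj lcompm1.
have b : biprod i j p q.
  split=> //; last by rewrite ip jq addrC subrK.
    by rewrite -pe -ej -lcompA (lcompA e) ee0 lcomp0l lcomp0r.
  by rewrite -qe -ei -lcompA (lcompA e') ee1 lcomp0l lcomp0r.
have Y0 : lidm Y <> 0.
  by move=> h; apply: e0; rewrite -ip -[p]lcomp1m h lcomp0l lcomp0r.
have Z0 : lidm Z <> 0.
  move=> h; apply: e1; apply/eqP; rewrite -subr_eq0 -opprB oppr_eq0 -[lidm X - e]jq.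
  by rewrite -[q]lcomp1m h lcomp0l lcomp0r.
have d1 := biprod_dim b cX Z0; have d2 := biprod_dim (biprod_sym b) cX Y0.
have sY := IH Y (leq_trans d1 le) (conc_retract pi cX).
have sZ := IH Z (leq_trans d2 le) (conc_retract qj cX).
(* The two decompositions are merged by moving the summands of [Y] over to [Z] one at a time. *)
elim: sY X i j p q {le cX X0 niX e e0 e1 e' ee ee0 ee1 ee' ip jq pi qj pe ei qe ej d1 d2} b.
  move=> Y' Y'0 X i j p q [h1 h2 h3 h4 h].
  case: sZ j q h2 h3 h4 h => [Z' Z'0|A B Z' k1 k2 r1 r2 bZ tA sB] j q h2 h3 h4 h.
    by apply: sums_zero; rewrite -h -[p]lcomp1m Y'0 -[q]lcomp1m Z'0 !lcomp0l !lcomp0r addr0.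
  have jq : lcomp j q = lidm X.
    have e : lcomp i p = 0 by rewrite -[p]lcomp1m Y'0 lcomp0l lcomp0r.
    by rewrite -h e add0r.
  case: bZ => g1 g2 g3 g4 g.
  apply: (@sums_add _ A B X (lcomp j k1) (lcomp j k2) (lcomp r1 q) (lcomp r2 q)) => //.
  split; rewrite -!lcompA ?(lcompA q) ?h2 ?lcomp1m //.
  by rewrite (lcompA k1) (lcompA k2) -lcompDR -lcompD g lcomp1m.
move=> A B Y' k1 k2 r1 r2 bY tA _ IHB X i j p q bX.
have [A' [l1 [l2 [s1 [s2 [m1 [m2 [u1 [u2 [b1 b2]]]]]]]]]] :=
  biprod_assoc (biprod_sym bX) (biprod_sym bY).
apply: (sums_add (biprod_sym b2) tA).
exact: IHB (biprod_sym b1).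
Qed.

End Decomposition.

(** * Powers of the inverse translate of the algebra *)

Section InfiniteType.
Variables (K : fieldType) (L : falgType K) (D : derived_cat L).
Variable SD : serre_duality D.
Hypothesis hL : hereditary L.
Local Notation S := (dshift D).
Local Notation O := (Lambda D).
Local Notation t := (tau SD).
Local Notation ti := (taui SD).
Local Notation J := (J0 SD).
Implicit Types (X Y Z W P : D).

Lemma not_nohom X Y : ~ nohom X Y -> exists f : lhom X Y, f <> 0.
Proof. by apply: contra_notP => h f; apply: contrapT => f0; apply: h; exists f. Qed.

(** Objects that stay modules under all powers of [tau^-]. Among indecomposable modules the others
    turn out to be postinjective, see [not_good_postinjective]. *)
Definition good X : Prop := forall m, conc (iter m ti X).

Definition retract X Y : Prop := exists (i : lhom X Y) (p : lhom Y X), lcomp p i = lidm X.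

Lemma retract_iter m X Y : retract X Y -> retract (iter m ti X) (iter m ti Y).
Proof.
move=> h; elim: m => //= m [i [p pi]].
exists (fmap ti i), (fmap ti p); exact: fmapLK.
Qed.

Lemma biprod_iter m X Y Z : (exists (i1 : lhom X Z) (i2 : lhom Y Z) p1 p2, biprod i1 i2 p1 p2) ->
  exists (i1 : lhom (iter m ti X) (iter m ti Z)) (i2 : lhom (iter m ti Y) (iter m ti Z)) p1 p2,
    biprod i1 i2 p1 p2.
Proof.
move=> h; elim: m => //= m [i1 [i2 [p1 [p2 [h11 h22 h12 h21 hh]]]]].
exists (fmap ti i1), (fmap ti i2), (fmap ti p1), (fmap ti p2); split.
- exact: fmapLK.
- exact: fmapLK.
- by rewrite -fmapL h12; apply: (lin0 (@taui_lin _ _ _ SD _ _)).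
- by rewrite -fmapL h21; apply: (lin0 (@taui_lin _ _ _ SD _ _)).
rewrite -!fmapL -[LHS](linD (@taui_lin _ _ _ SD _ _)) hh.
exact: (@fmap1 _ _ ti).
Qed.

Lemma retract_conc X Y : retract X Y -> conc Y -> conc X.
Proof. by case=> i [p pi]; apply: conc_retract pi. Qed.

Lemma iso_retract X Y : @isomorphic D X Y -> retract X Y.
Proof. by case/isoE => f [g [gf _]]; exists f, g. Qed.

Lemma good_retract X Y : retract X Y -> good Y -> good X.
Proof. by move=> r g m; apply: retract_conc (retract_iter m r) (g m). Qed.

Lemma good_iso X Y : @isomorphic D X Y -> good X -> good Y.
Proof. by move=> /isomorphic_sym/iso_retract; apply: good_retract. Qed.

Lemma good_iter m X : good X -> good (iter m ti X).
Proof. by move=> g k; rewrite -iterD. Qed.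

Lemma good_biprod X Y Z (i1 : lhom X Z) (i2 : lhom Y Z) p1 p2 :
  biprod i1 i2 p1 p2 -> good X -> good Y -> good Z.
Proof.
move=> b gX gY m; have [|j1 [j2 [q1 [q2 b']]]] := @biprod_iter m X Y Z.
  by exists i1, i2, p1, p2.
exact: conc_biprod b' (gX m) (gY m).
Qed.

Lemma zero_conc X : lidm X = 0 -> conc X.
Proof.
by move=> X0; apply: (@conc_retract _ _ D X O 0 0 _ (Lambda_conc D hL)); rewrite lcomp0r X0.
Qed.

Lemma good_zero X : lidm X = 0 -> good X.
Proof.
move=> X0 m; apply: zero_conc; elim: m => //= m IH.
transitivity (fmap ti (lidm (iter m ti X)) : lhom (ti (iter m ti X)) (ti (iter m ti X))).
  exact: (esym (@fmap1 _ _ ti _)).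
rewrite IH; exact: (lin0 (@taui_lin _ _ _ SD _ _)).
Qed.

(** At the last stage before the object stops being a module, [conc_taui] produces a nonzero map
    from [J0]. *)
Lemma first_exit X : conc X -> ~ good X ->
  exists m, (forall i, (i <= m)%N -> conc (iter i ti X)) /\ ~ nohom J (iter m ti X).
Proof.
move=> cX ng; have ex : exists m, `[< ~ conc (iter m ti X) >].
  by apply: contra_notP ng => h m; apply: contrapT => hm; apply: h; exists m; apply/asboolP.
case: (ex_minnP ex) => -[|m] /asboolP hm mmin; first by case: hm.
exists m; split=> [i im|z].
  apply: contrapT => hi; have := mmin i; rewrite leqNgt ltnS im => h.
  by have := h (asboolT hi).
apply: hm; apply/(conc_taui SD hL) => //.
apply: contrapT => hi; have := mmin m; rewrite ltnn => h.
by have := h (asboolT hi).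
Qed.

Lemma indecD_functor (F : functor D D) :
  (forall X Y (g : lhom (F X) (F Y)), exists f : lhom X Y, fmap F f = g) ->
  (forall X Y (f g : lhom X Y), fmap F f = fmap F g -> f = g) ->
  (forall X Y, lin (fun f : lhom X Y => fmap F f : lhom (F X) (F Y))) ->
  forall X, indecD (F X) <-> indecD X.
Proof.
move=> Ff Fi Fl X; have F1 : fmap F (lidm X : lhom X X) = lidm (F X) := @fmap1 _ _ F X.
have F0 : fmap F (0 : lhom X X) = 0 :> lhom (F X) (F X) := lin0 (Fl X X).
split=> -[X0 iX]; split.
- by move=> h; apply: X0; rewrite -F1 h F0.
- move=> e ee; have [|h|h] := iX (fmap F e); first by rewrite -fmapL ee.
    by left; apply: Fi; rewrite h F0.
  by right; apply: Fi; rewrite h F1.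
- by move=> h; apply: X0; apply: Fi; rewrite F1 h F0.
- move=> e; have [e' <-] := Ff _ _ e => ee.
  have [|->|->] := iX e'; [by apply: Fi; rewrite fmapL|by left|by right].
Qed.

Lemma indecD_taui X : indecD (ti X) <-> indecD X.
Proof.
exact: indecD_functor (@taui_full _ _ _ SD) (@taui_faithful _ _ _ SD) (@taui_lin _ _ _ SD) X.
Qed.
Lemma indecD_tau X : indecD (t X) <-> indecD X.
Proof.
exact: indecD_functor (@tau_full _ _ _ SD) (@tau_faithful _ _ _ SD) (@tau_lin _ _ _ SD) X.
Qed.
Lemma indecD_shift X : indecD (S X) <-> indecD X.
Proof.
exact: indecD_functor (@shift_full _ _ D) (@shift_faithful _ _ D) (@shift_lin _ _ D) X.
Qed.
Lemma indecD_iter_taui m X : indecD (iter m ti X) <-> indecD X.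
Proof. by elim: m => //= m <-; apply: indecD_taui. Qed.
Lemma indecD_iter_tau m X : indecD (iter m t X) <-> indecD X.
Proof. by elim: m => //= m <-; apply: indecD_tau. Qed.

Lemma indecD_iso X Y : @isomorphic D X Y -> indecD X -> indecD Y.
Proof.
move=> /isoE [f [g [gf fg]]] [X0 iX]; split.
  by move=> h; apply: X0; rewrite -gf -[f]lcomp1m h lcomp0l lcomp0r.
move=> e ee; have [|h|h] := iX (lcomp g (lcomp e f)).
- by rewrite -!lcompA (lcompKl fg) (lcompA e e) ee.
- left; rewrite -[e](lcompKr fg) -[lcomp e f](lcompKl fg) h.
  by rewrite lcomp0r lcomp0l.
right; rewrite -[e](lcompKr fg) -[lcomp e f](lcompKl fg) h.
by rewrite lcompm1.
Qed.

Lemma indec_retract X Y : indecD Y -> lidm X <> 0 -> retract X Y -> @isomorphic D X Y.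
Proof.
move=> [_ iY] X0 [i [p pi]]; exists i, p; split; first exact: pi.
have [|h|//] := iY (lcomp i p); first by rewrite -lcompA (lcompKl pi).
by case: X0; rewrite -pi -[i](lcompKr pi) h !lcomp0l lcomp0r.
Qed.

(** [Y] is the image of [Z] under the inverse Nakayama functor, which takes injectives to
    projectives. *)
Lemma taui_injD Z : injD Z -> exists Y, projD Y /\ @isomorphic D (ti Z) (S Y).
Proof.
move=> [cZ iZ]; have [Y iY] := shift_ess_surj (ti Z); have iY' := isomorphic_sym iY.
exists Y; split=> //.
have a j : nohom (iter j S O) (ti Z) <-> nohom (iter j S (t O)) Z.
  rewrite -(nohom_tau_adj SD); split; apply: nohom_iso; try exact: isomorphic_refl.
    exact: tau_shift_iter.
  exact/isomorphic_sym/tau_shift_iter.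
have cY : conc Y.
  split=> j.
    apply/(nohom_shift (iter j.+1 S O) Y); apply: nohom_iso (isomorphic_refl _) iY' _.
    apply/(a j.+2); rewrite (iterSr j.+1) => h.
    exact: (@hom_shift_conc _ _ _ hL J Z j h (J0_conc SD hL) cZ).
  rewrite iterSr; apply: nohom_iso (isomorphic_refl O) (iter_isomorphic S j iY') _.
  apply: nohom_iso (isomorphic_refl O) (taui_shift_iter SD j Z) _.
  apply/(nohom_tau_adj SD)/(nohom_shift (t O)).
  case: j => [|j]; first exact: iZ (J0_conc SD hL).
  by move=> h; apply: (hom_conc_shift hL h (J0_conc SD hL) cZ).
apply: ext_proj => // W cW; apply/(nohom_shift Y).
apply: nohom_iso iY' (isomorphic_refl _) _; apply/(nohom_taui_adj SD).
apply: serre_nohom; apply/(nohom_shift (S W)) => k.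
exact: (@hom_shift_conc _ _ _ hL W Z 0 k cW cZ).
Qed.

(** The image of a nonzero map [J0 -> Z] is a quotient of an injective, hence injective, hence a
    summand of [Z], hence all of [Z]. *)
Lemma exit_injD Z : conc Z -> indecD Z -> ~ nohom J Z -> injD Z.
Proof.
move=> cZ iZ nz; have [u u0] : exists u : lhom J Z, u <> 0.
  exact: not_nohom.
have [I [k [q [cI uE ki qs]]]] := image_factor hL u (J0_conc SD hL) cZ.
have iI : injD I by apply: (injD_quotient hL (J0_injD SD hL) cI qs).
have [r rk] := injD_retract hL iI cZ ki.
apply: injD_iso iI; apply: indec_retract => //; last by exists k, r.
by move=> I0; apply: u0; rewrite uE -[q]lcomp1m I0 lcomp0l lcomp0r.
Qed.

Lemma bad_exit P : conc P -> indecD P -> ~ good P -> exists m Y,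
  [/\ projD Y, @isomorphic D (iter m.+1 ti P) (S Y), injD (iter m ti P)
    & forall i, (i <= m)%N -> conc (iter i ti P)].
Proof.
move=> cP iP /(first_exit cP) [m [cm nJ]].
have iZ : injD (iter m ti P).
  by apply: exit_injD => //; [apply: cm|apply/indecD_iter_taui].
by have [Y [pY iY]] := taui_injD iZ; exists m, Y.
Qed.

(** Apply [tau^-] until [P] has become [Y[1]]; [W] is still a module then, and there are no maps
    from [Y[1]] to a module. *)
Lemma bad_good P W : conc P -> indecD P -> ~ good P -> good W -> nohom P W.
Proof.
move=> cP iP nP gW; have [m [Y [pY iY _ _]]] := bad_exit cP iP nP.
apply/(nohom_iter_taui SD m.+1).
apply: nohom_iso (isomorphic_sym iY) (isomorphic_refl _) _ => h.
exact: (@hom_shift_conc _ _ _ hL Y _ 0 h pY.1 (gW m.+1)).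
Qed.

(** By heredity the image is projective, so it splits off from the indecomposable [P]. *)
Lemma proj_mono P P' (f : lhom P P') : indecD P -> projD P -> projD P' -> f <> 0 ->
  forall x : lhom O P, lcomp f x = 0 -> x = 0.
Proof.
move=> iP pP pP' f0; have [I [k [q [cI fE ki qs]]]] := image_factor hL f pP.1 pP'.1.
have pI : projD I.
  split=> //; apply: (sub_projective hL (i := h0f k)) pP'.2 _ (h0_fd hL cI).
  by apply: lin_inj ki; apply: (mhom_lin (h0f k)).
have [s qs1] := proj_lift hL (lidm I) pI pP.1 cI qs.
have I0 : lidm I <> 0 by move=> h; apply: f0; rewrite fE -[q]lcomp1m h lcomp0l lcomp0r.
have sq : lcomp s q = lidm P.
  have [|e|//] := iP.2 (lcomp s q); first by rewrite -lcompA (lcompKl qs1).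
  by case: I0; rewrite -qs1 -[q](lcompKl qs1) e lcomp0r lcomp0l.
move=> x; rewrite fE -lcompA => /ki e.
by rewrite -[x](lcompKl sq) e lcomp0r.
Qed.

Lemma sums_detect (T : D -> Prop) X A (a : lhom A X) : sums T X -> a <> 0 ->
  exists Q (i : lhom Q X) (p : lhom X Q), [/\ T Q, lcomp p i = lidm Q & lcomp p a <> 0].
Proof.
move=> sX; elim: sX a => [{}X X0 a|Y Z {}X i1 i2 p1 p2 [h11 h22 h12 h21 h] tY _ IH a] a0.
  by case: a0; rewrite -[a]lcomp1m X0 lcomp0l.
have [e|e] := pselect (lcomp p1 a = 0); last by exists Y, i1, p1.
have [e'|Q [i [p [tQ pi pa]]]] := IH (lcomp p2 a).
  by case: a0; rewrite -[a]lcomp1m -h lcompD -!lcompA e e' !lcomp0r addr0.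
exists Q, (lcomp i2 i), (lcomp p p2); split=> //; last by rewrite -lcompA.
by rewrite -lcompA (lcompA p2) h22 lcomp1m.
Qed.

(* Take [P -> Q] nonzero with [dim P] maximal. A summand of the image of [P (+) R0 -> Q] into
   which [P] embeds is then [P] itself, so that every [g : R1 -> P] extends to [R0]; here
   [R1 -> R0] resolves [tau^- P], and this contradicts [Ext^1(tau^- P, P) <> 0]. *)
Lemma good_bad P Q : projD P -> indecD P -> good P -> projD Q -> indecD Q -> ~ good Q ->
  nohom P Q.
Proof.
move=> pP0 iP0 gP0 pQ iQ nQ.
pose N P := [/\ projD P, indecD P, good P & ~ nohom P Q].
have dimN P' : N P' -> (dimv (h0 P') <= dimv (h0 Q))%N.
  move=> [pP' iP' gP' nz]; have [f f0] : exists f : lhom P' Q, f <> 0.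
    exact: not_nohom.
  have [||//] := dimv_inj (f := h0f f) (h0_fd hL pQ.1); first exact: mhom_lin.
  by apply: lin_inj (proj_mono iP' pP' pQ f0); apply: (mhom_lin (h0f f)).
apply: contrapT => nz.
pose B n := `[< exists P', N P' /\ dimv (h0 P') = n >].
have exB : exists n, B n by exists (dimv (h0 P)); apply/asboolP; exists P.
have bB n : B n -> (n <= dimv (h0 Q))%N by move=> /asboolP [P' [nP' <-]]; apply: dimN.
case: (ex_maxnP exB bB) => n /asboolP [{pP0 iP0 gP0 nz exB}P [[pP iP gP nz] dP]] nmax.
have [f f0] : exists f : lhom P Q, f <> 0.
  exact: not_nohom.
have cC : conc (ti P) := gP 1%N.
have zC Q' : conc Q' -> indecD Q' -> ~ good Q' -> nohom Q' (ti P).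
  by move=> cQ' iQ' nQ'; apply: bad_good => //; apply: (good_iter 1).
have nCP : ~ nohom (ti P) (S P).
  move=> z; have z' : nohom P (t (ti P)) by apply: serre_nohom.
  have /(_ (lidm P)) := nohom_iso (isomorphic_refl P) (tau_tauiK SD P) z'.
  exact: iP.1.
(* By Serre duality this is dual to [Hom(Q, P)], which vanishes by [bad_good]; it lets [f g] extend
   over [R0]. *)
have zCQ : nohom (ti P) (S Q).
  apply: (serre_nohom_conv (SD := SD)); first exact: (fd_ext hL cC pQ.1).
  apply: nohom_iso (isomorphic_refl Q) (isomorphic_sym (tau_tauiK SD P)) _.
  exact: bad_good pQ.1 iQ nQ gP.
have [R1 [R0 [d [p [h1 h2 h3]]]]] := conc_resolution hL cC.
have [delta hd] := ext_class_conc hL h1 h2 cC h3; have [di ps dp] := h3.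
have [g hg] : exists g : lhom R1 P, ~ exists r : lhom R0 P, g = lcomp r d.
  apply: contrapT => h; apply: nCP => z; have [g ->] := (hd P pP.1).1 z.
  by apply/(hd P pP.1).2; apply: contrapT => hr; apply: h; exists g.
have [r hr] : exists r : lhom R0 Q, lcomp f g = lcomp r d.
  by apply/(hd Q pQ.1).2; apply: zCQ.
have [M [i1 [i2 [p1 [p2 bM]]]]] := derived_biprod P R0.
have [b11 b22 b12 b21 b] := bM.
have cM : conc M := conc_biprod bM pP.1 h2.1.
have [G [k [q [cG mE ki qs]]]] := image_factor hL (lcomp f p1 + lcomp r p2) cM pQ.1.
have pG : projD G.
  split=> //; apply: (sub_projective hL (i := h0f k)) pQ.2 _ (h0_fd hL cG).
  by apply: lin_inj ki; apply: (mhom_lin (h0f k)).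
have kI A (u v : lhom A G) : conc A -> lcomp k u = lcomp k v -> u = v.
  move=> cA e; apply: (h0_faithful2 hL) => // x; apply/eqP; rewrite -subr_eq0.
  by apply/eqP/ki; rewrite lcompBR !lcompA e subrr.
have [a aE] : exists a, a = lcomp q i1 by exists (lcomp q i1).
have [c cE] : exists c, c = lcomp q i2 by exists (lcomp q i2).
have ka : lcomp k a = f.
  by rewrite aE lcompA -mE lcompD -!lcompA b11 b21 lcompm1 lcomp0r addr0.
have kc : lcomp k c = r.
  by rewrite cE lcompA -mE lcompD -!lcompA b22 b12 lcompm1 lcomp0r add0r.
have ag : lcomp a g = lcomp c d by apply: kI h1.1 _; rewrite !lcompA ka kc.
have qE : q = lcomp a p1 + lcomp c p2 by rewrite aE cE -!lcompA -lcompDR b lcompm1.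
have zG Q' : projD Q' -> indecD Q' -> ~ good Q' -> nohom Q' G.
  move=> pQ' iQ' nQ' h; have [h' <-] := proj_lift hL h pQ' cM cG qs.
  have e : lcomp p (lcomp p2 h') = 0 by apply: zC pQ'.1 iQ' nQ' _.
  have [x|y hy] := mono_lift hL (k := d) (f := lcomp p2 h') h1.1 h2.1 pQ'.1 di.
    by apply/dp; rewrite lcompA e lcomp0l.
  rewrite qE lcompD -!lcompA -hy (lcompA c) -ag -lcompA -lcompDR.
  by rewrite (bad_good pQ'.1 iQ' nQ' gP (lcomp p1 h' + lcomp g y)) lcomp0r.
have a0 : a <> 0 by move=> e; apply: f0; rewrite -ka e lcomp0r.
have [Q' [i [pi [[cQ' iQ'] piK pa]]]] := sums_detect (conc_sums hL cG) a0.
have pQ' : projD Q' by apply: proj_retractD piK pG.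
have i0 : i <> 0.
  by move=> e; case: iQ' => + _; apply; rewrite -piK e lcomp0r.
have gQ' : good Q' by apply: contrapT => n'; apply: i0; apply: zG.
have nQ' : N Q'.
  split=> // z; apply: i0; apply: kI cQ' _; rewrite lcomp0r; exact: z.
have pai := proj_mono iP pP pQ' pa.
have pail : injective (h0f (lcomp pi a)).
  by apply: lin_inj pai; apply: (mhom_lin (h0f (lcomp pi a))).
have [|le eq] := dimv_inj (h0_fd hL cQ') _ pail; first exact: mhom_lin.
have ge : (dimv (h0 Q') <= dimv (h0 P))%N.
  by rewrite dP; apply: nmax; apply/asboolP; exists Q'.
have [|v [v1 v2]] := h0_iso hL pP.1 cQ' pai.
  by apply: eq; apply/eqP; rewrite eqn_leq le ge.
apply: hg; exists (lcomp v (lcomp pi c)).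
by rewrite -!lcompA -ag (lcompA pi) lcompA v1 lcomp1m.
Qed.

Lemma sums_good (T : D -> Prop) X : (forall Y, T Y -> good Y) -> sums T X -> good X.
Proof.
move=> gT; elim=> [{}X|Y Z {}X i1 i2 p1 p2 b tY _ gZ]; first exact: good_zero.
exact: good_biprod b (gT Y tY) gZ.
Qed.

Lemma sums_nohom (T U : D -> Prop) X Y : (forall A B, T A -> U B -> nohom A B) ->
  sums T X -> sums U Y -> nohom X Y.
Proof.
move=> z sX sY; elim: sX => [A A0 h|A B {}X i1 i2 p1 p2 [_ _ _ _ e] tA _ IH h].
  by rewrite -[h]lcompm1 A0 lcomp0r.
rewrite -[h]lcompm1 -e lcompDR !lcompA (IH (lcomp h i2)) lcomp0l addr0.
suff -> : lcomp h i1 = 0 by rewrite lcomp0l.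
move: (lcomp h i1) => {IH e i1 i2 p1 p2 h}.
elim: sY => [C C0 h|C E {}Y j1 j2 q1 q2 [_ _ _ _ e] tC _ IHY h].
  by rewrite -[h]lcomp1m C0 lcomp0l.
by rewrite -[h]lcomp1m -e lcompD -!lcompA (IHY (lcomp q2 h)) (z _ _ tA tC (lcomp q1 h))
  !lcomp0r addr0.
Qed.

Lemma sums_split (T U : D -> Prop) X : sums (fun Y => T Y \/ U Y) X ->
  exists A B (i1 : lhom A X) (i2 : lhom B X) p1 p2,
    [/\ sums T A, sums U B & biprod i1 i2 p1 p2].
Proof.
elim=> [{}X X0|Y Z {}X i1 i2 p1 p2 b tY _ [A [B [j1 [j2 [q1 [q2 [sA sB b']]]]]]]].
  exists X, X, (lidm X), 0, (lidm X), 0; split; [exact: sums_zero|exact: sums_zero|].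
  exact: biprod_zero.
case: tY => tY.
  have [A' [k1 [k2 [r1 [r2 [l1 [l2 [s1 [s2 [b1 b2]]]]]]]]]] := biprod_assoc b b'.
  exists A', B, l1, l2, s1, s2; split=> //; exact: sums_add b1 tY sA.
have [A' [k1 [k2 [r1 [r2 [l1 [l2 [s1 [s2 [b1 b2]]]]]]]]]] := biprod_assoc b (biprod_sym b').
exists A, A', l2, l1, s2, s1; split=> //; last exact: biprod_sym.
exact: sums_add b1 tY sB.
Qed.

Lemma sums_iso (T : D -> Prop) X Y : @isomorphic D X Y -> sums T X -> sums T Y.
Proof.
move=> /isoE [f [g [gf fg]]] sX.
case: sX f g gf fg => [{}X X0 f g gf fg|A B {}X i1 i2 p1 p2 [h11 h22 h12 h21 h] tA sB f g gf fg].
  by apply: sums_zero; rewrite -fg -[g]lcomp1m X0 lcomp0l lcomp0r.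
apply: (sums_add (i1 := lcomp f i1) (i2 := lcomp f i2) (p1 := lcomp p1 g) (p2 := lcomp p2 g) _ tA sB).
split; rewrite -?lcompA ?(lcompKl gf) // (lcompA i1) (lcompA i2) -lcompDR -lcompD.
by rewrite h lcomp1m.
Qed.

Lemma sums_weaken (T U : D -> Prop) X : (forall Y, retract Y X -> T Y -> U Y) ->
  sums T X -> sums U X.
Proof.
move=> h sX; elim: sX h => [{}X X0 _|Y Z {}X i1 i2 p1 p2 b tY _ IH h]; first exact: sums_zero.
have [h11 h22 _ _ _] := b; apply: (sums_add b).
  by apply: h => //; exists i1, p1.
apply: IH => W [i [p pi]] tW; apply: h => //.
by exists (lcomp i2 i), (lcomp p p2); rewrite -lcompA (lcompA p2) h22 lcomp1m.
Qed.

Lemma Lambda_proj : projD O.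
Proof. exact: (iota_proj D hL (M := regular_mod L) (@regular_projective K L false)). Qed.

Lemma lact_full (f : lhom O O) : exists a : L, f = lact D a.
Proof.
have [u ->] := iota_full hL (f : lhom (iota D (regular_mod L)) (iota D (regular_mod L))).
by exists (u (1 : L)); rewrite /lact -mreg_uniq.
Qed.

Lemma lact_inj : injective (lact D).
Proof.
move=> a b /(iota_faithful hL (M := regular_mod L) (N := regular_mod L))/(_ (1 : L)) /=.
by rewrite /amul !mulr1.
Qed.

Hypothesis L_connected : connected L.

(** Write [Lambda = A (+) B] with the summands of [A] leaving the modules and those of [B] staying.
    There are no maps between [A] and [B], so the projection onto [A] is a central idempotent of the
    endomorphism ring [L]. *)
Lemma Lambda_dichotomy :
  sums (fun P => [/\ projD P, indecD P & ~ good P]) O \/ good O.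
Proof.
have [|A [B [i1 [i2 [p1 [p2 [sA sB b]]]]]]] := @sums_split
   (fun P => [/\ projD P, indecD P & ~ good P]) (fun P => [/\ projD P, indecD P & good P]) O.
  apply: sums_weaken (conc_sums hL (Lambda_conc D hL)) => Y [i [p pi]] [cY iY].
  have pY : projD Y by apply: proj_retractD pi Lambda_proj.
  by have [g|g] := pselect (good Y); [right|left].
have [h11 h22 h12 h21 h] := b.
have zAB : nohom A B.
  by apply: sums_nohom sA sB => P Q [pP iP nP] [_ _ gQ]; apply: bad_good pP.1 iP nP gQ.
have zBA : nohom B A.
  by apply: sums_nohom sB sA => P Q [pP iP gP] [pQ iQ nQ]; apply: good_bad.
pose e := lcomp i1 p1; have [a ea] := lact_full e.
have ee : lcomp e e = e by rewrite -lcompA (lcompKl h11).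
have c f : lcomp e f = lcomp f e.
  have z1 : lcomp e (lcomp f (lcomp i2 p2)) = 0.
    by rewrite /e -lcompA (lcompA f) (lcompA p1) (zBA (lcomp p1 (lcomp f i2))) lcomp0l lcomp0r.
  have z2 : lcomp (lcomp i2 p2) (lcomp f e) = 0.
    by rewrite /e -lcompA (lcompA f) (lcompA p2) (zAB (lcomp p2 (lcomp f i1))) lcomp0l lcomp0r.
  transitivity (lcomp e (lcomp f e)).
    by rewrite -[f in LHS]lcompm1 -h !lcompDR z1 addr0.
  by rewrite -[RHS]lcomp1m -h lcompD z2 addr0.
have [||a0|a1] := L_connected (e := a).
- by apply: lact_inj; rewrite lactM -ea.
- by move=> x; apply: lact_inj; rewrite !lactM -ea c.
- right; apply: (@good_iso B).
    apply: isomorphic_sym; exists p2, i2; split; last exact: h22.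
    have e0 : e = 0 by rewrite ea a0; apply: (lin0 (@lact_lin _ _ D)).
    by rewrite lcompE -[RHS]h -/e e0 add0r.
  by apply: sums_good sB => Y [].
left; have e1 : e = lidm O by rewrite ea a1 lact1.
have B0 : lidm B = 0.
  by rewrite -h22 -[i2]lcomp1m -e1 /e -!lcompA h12 !lcomp0r.
have iAO : lcomp i1 p1 = lidm O := e1.
apply: sums_iso sA; exists i1, p1; split; [exact: h11|exact: iAO].
Qed.

Definition dsum n (Q : 'I_n -> D) X (i : forall k, lhom (Q k) X) (p : forall k, lhom X (Q k)) :=
  [/\ forall k, lcomp (p k) (i k) = lidm (Q k),
      forall j k, j <> k -> lcomp (p j) (i k) = 0
    & \sum_k lcomp (i k) (p k) = lidm X].

Lemma sums_dsum (T : D -> Prop) X : sums T X ->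
  exists n (Q : 'I_n -> D) i p, @dsum n Q X i p /\ forall k, T (Q k).
Proof.
move=> sX; suff [I [Q [i [p [[h1 h2 h3] tQ]]]]] :
    exists (I : finType) (Q : I -> D) (i : forall k, lhom (Q k) X) (p : forall k, lhom X (Q k)),
    [/\ forall k, lcomp (p k) (i k) = lidm (Q k),
      forall j k, j <> k -> lcomp (p j) (i k) = 0
    & \sum_k lcomp (i k) (p k) = lidm X] /\ forall k, T (Q k).
  exists #|I|, (fun k => Q (enum_val k)), (fun k => i (enum_val k)), (fun k => p (enum_val k)).
  split=> //; split=> // [j k jk|].
    by apply: h2 => /enum_val_inj.
  by rewrite -h3 [RHS](reindex (@enum_val I I)) //; apply: onW_bij; apply: enum_val_bij.
elim: sX => [{}X X0|Y Z {}X i1 i2 p1 p2 [h11 h22 h12 h21 h] tY _ [I [Q [i [p [[h1 h2 h3] tQ]]]]]].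
  exists 'I_0, (fun _ => X), (fun _ => 0), (fun _ => 0).
  by split; [split=> [[]//|[]//|]; rewrite big_ord0|case].
pose Q' (k : option I) := if k is Some k then Q k else Y.
exists (option I), Q'.
exists (fun k => match k return lhom (Q' k) X with Some k => lcomp i2 (i k) | None => i1 end).
exists (fun k => match k return lhom X (Q' k) with Some k => lcomp (p k) p2 | None => p1 end).
split; last by case.
split=> [[k|]//|[j|] [k|] // jk|].
- rewrite -lcompA (lcompKl h22); exact: h1.
- by rewrite -lcompA (lcompKl h22); apply: h2 => e; apply: jk; rewrite e.
- by rewrite -lcompA h21 lcomp0r.
- by rewrite lcompA h12 lcomp0l.
rewrite -h (bigD1 None) //=; congr (_ + _).
rewrite (reindex_omap Some id) => [/=|[]//].
rewrite -[p2 in RHS]lcomp1m -h3 lcomp_suml lcomp_sumr; apply: eq_big => [k|k _].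
  by rewrite eqxx.
by rewrite !lcompA.
Qed.

(** Dual basis lemma: the coordinates of a section of a free cover are maps to [Lambda]. It exhibits
    [Y] as a summand of a power of [Lambda], so properties of [Lambda] pass to all projectives. *)
Lemma proj_dual_basis Y : projD Y -> exists n (y : 'I_n -> lhom O Y) (z : 'I_n -> lhom Y O),
  \sum_k lcomp (y k) (z k) = lidm Y.
Proof.
move=> [cY pY]; have [n [c cs]] := free_cover (h0_fd hL cY).
have [s sc] := pY _ _ c (mhom_id _) cs.
have coord k : exists z : lhom Y O, forall x : lhom O Y,
    lcomp z x = lact D ((s x : {ffun 'I_n -> L}) k).
  have [u hu] : exists u : mhom (h0 Y) (h0 O), forall x, u x = lact D ((s x : {ffun 'I_n -> L}) k).
    unshelve eexists; first unshelve refine (@Mhom _ _ _ _ _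
      (fun x => lact D ((s x : {ffun 'I_n -> L}) k) : h0 O) _ _).
    - by move=> a x y /=; rewrite mhom_lin !ffunE; apply: (@lact_lin _ _ D).
    - by move=> x a /=; rewrite mhom_act ffunE lactM.
    - by [].
  have [z hz] := h0_full hL u cY (Lambda_conc D hL).
  exists z => x; rewrite hz; exact: hu.
have [z hz] := choice coord.
have [y cE] : exists y : 'I_n -> h0 Y, c = mfree_hom y.
  exists (fun k => c (mbasis L false k)).
  by apply: mfree_hom_uniq => k; rewrite mfree_homE.
exists n, y, z; apply: (h0_faithful2 hL) => // x.
rewrite lcomp1m lcomp_suml -[RHS](sc x) cE.
by apply: eq_bigr => k _; rewrite -lcompA hz.
Qed.

(** Inserting the decomposition of [Lambda] into the dual basis formula writes the identity of [Y]
    as a sum of maps through the [P k]; by locality one of them is invertible. *)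
Lemma indec_proj_summand Y n (P : 'I_n -> D) i p : projD Y -> indecD Y ->
  @dsum n P O i p -> (forall k, indecD (P k)) ->
  exists k, @isomorphic D Y (P k).
Proof.
move=> pY iY [h1 h2 h3] iP; have [m [y [z yz]]] := proj_dual_basis pY.
have [|[a b] [g g1]] := @indec_local _ _ D Y ('I_m * 'I_n)%type (index_enum _)
    (fun c => lcomp (y c.1) (lcomp (i c.2) (lcomp (p c.2) (z c.1)))) (fd_lhom hL pY.1 pY.1) iY.
  exists (lidm Y); rewrite lcomp1m -yz -(pair_big xpredT xpredT
    (fun a b => lcomp (y a) (lcomp (i b) (lcomp (p b) (z a))))) /=.
  apply: eq_bigr => a _; rewrite -[z a in RHS]lcomp1m -h3 lcomp_suml lcomp_sumr.
  by apply: eq_bigr => b _; rewrite !lcompA.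
exists b; apply: indec_retract iY.1 _ => //.
exists (lcomp (p b) (z a)), (lcomp g (lcomp (y a) (i b))).
by rewrite -g1 /= !lcompA.
Qed.

Lemma mod_zero_obj (M : mod L) : zero_obj M <-> forall x : mmod M, x = 0.
Proof.
split=> [h x|h X].
  have [_ [f [_ u]]] := h M; have e1 := u (mhom_id _) I; have e2 := u (mhom_zero _ _) I.
  have : f x = 0 by rewrite e2.
  by rewrite e1.
split; exists (mhom_zero _ _); split=> // f _; apply: mhom_eq => x /=; first by rewrite [RHS]h.
by rewrite [x]h mhom0.
Qed.

Lemma iota_zero (M : mod L) : lidm (iota D M) = 0 <-> forall x : mmod M, x = 0.
Proof.
rewrite -iota_id -(iota0 D M M); split=> [/(iota_faithful hL) e x|h]; first exact: e.
by congr (iota_map D _); apply: mhom_eq => x; apply: h.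
Qed.

Lemma iota_isomorphic (M N : mod L) : @isomorphic D (iota D M) (iota D N) <-> isomorphic M N.
Proof.
split=> [/isoE [f [g [gf fg]]]|[f [g [gf fg]]]].
  have [u uE] := iota_full hL f; have [v vE] := iota_full hL g; exists u, v.
  split; apply: mhom_eq; apply: (iota_faithful (D := D) hL).
    by rewrite iota_comp iota_id -uE -vE.
  by rewrite iota_comp iota_id -uE -vE.
exists (iota_map D f), (iota_map D g); rewrite !lcompE -!iota_comp; split.
  by rewrite -[RHS](iota_id D M); congr (iota_map D _); exact: gf.
by rewrite -[RHS](iota_id D N); congr (iota_map D _); exact: fg.
Qed.

Lemma indec_iota (M : mod L) : indecomposable M <-> indecD (iota D M).
Proof.
split=> -[M0 iM]; split.
- by move=> /iota_zero/mod_zero_obj.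
- move=> e ee; have cM := iota_conc D hL M.
  have [Y [i [p [pi ip]]]] := idem_split hL cM ee.
  have [|Z [j [q [qj jq]]]] := idem_split hL (e := lidm _ - e) cM.
    by rewrite lcompB lcomp1m lcompBR lcompm1 ee subrr subr0.
  have [Y' /isoE [a [b [ba ab]]]] := (concP hL Y).1 (conc_retract pi cM).
  have [Z' /isoE [a' [b' [ba' ab']]]] := (concP hL Z).1 (conc_retract qj cM).
  have [u uE] := iota_full hL (lcomp i b); have [v vE] := iota_full hL (lcomp a p).
  have [u' uE'] := iota_full hL (lcomp j b'); have [v' vE'] := iota_full hL (lcomp a' q).
  have vu x : v (u x) = x.
    apply: (iota_faithful (D := D) hL (f := mhom_comp v u) (g := mhom_id _)).
    by rewrite iota_comp iota_id -uE -vE -lcompA (lcompKl pi) ab.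
  have vu' x : v' (u' x) = x.
    apply: (iota_faithful (D := D) hL (f := mhom_comp v' u') (g := mhom_id _)).
    by rewrite iota_comp iota_id -uE' -vE' -lcompA (lcompKl qj) ab'.
  have uvE : lcomp (iota_map D u) (iota_map D v) = e.
    by rewrite -uE -vE -lcompA (lcompKl ba) ip.
  have uvE' : lcomp (iota_map D u') (iota_map D v') = lidm _ - e.
    by rewrite -uE' -vE' -lcompA (lcompKl ba') jq.
  have uv x : u (v x) + u' (v' x) = x.
    have e1 : iota_map D (mlinc 1 (mhom_comp u v) (mhom_comp u' v')) = iota_map D (mhom_id _).
      rewrite (@iota_lin _ _ D _ _ 1 (mhom_comp u v) (mhom_comp u' v')) // !iota_comp.
      by rewrite uvE uvE' scale1r addrC subrK iota_id.
    by have := iota_faithful hL e1 x; rewrite /= scale1r.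
  have vu0 x : v (u' x) = 0.
    have := uv (u' x); rewrite vu' => /(canRL (addrK _)); rewrite subrr => /(congr1 v).
    by rewrite vu mhom0.
  have vu0' x : v' (u x) = 0.
    have := uv (u x); rewrite vu => /(canRL (addKr _)); rewrite addNr => /(congr1 v').
    by rewrite vu' mhom0.
  have [|Y0|Z0] := iM Y' Z' u u'.
  + move=> W f g; exists (mlinc 1 (mhom_comp f v) (mhom_comp g v')).
    split; first split; try (apply: mhom_eq => x /=; rewrite ?vu ?vu0 ?vu' ?vu0' ?mhom0 scale1r ?addr0 ?add0r //).
    move=> h [hu hu']; apply: mhom_eq => x /=; rewrite scale1r -[in RHS](uv x).
    have e1 y : f y = h (u y) by rewrite -hu.
    have e2 y : g y = h (u' y) by rewrite -hu'.
    by rewrite e1 e2 -[u (v x) in RHS]scale1r (mhom_lin h) scale1r.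
  + left; rewrite -uvE; rewrite (_ : v = mhom_zero _ _) ?iota0 ?lcomp0r //.
    by apply: mhom_eq => x; apply: (mod_zero_obj Y').1.
  right; apply/eqP; rewrite eq_sym -subr_eq0; apply/eqP; rewrite -uvE'.
  rewrite (_ : v' = mhom_zero _ _) ?iota0 ?lcomp0r //.
  by apply: mhom_eq => x; apply: (mod_zero_obj Z').1.
- by move=> /mod_zero_obj/iota_zero.
- move=> Y Z i j cop.
  have [p [[pi pj] _]] := cop Y (mhom_id _) (mhom_zero _ _).
  have [q [[qi qj] _]] := cop Z (mhom_zero _ _) (mhom_id _).
  have pi' x : p (i x) = x by rewrite -[RHS]/(mhom_id _ x) -pi.
  have pj' x : p (j x) = 0 by rewrite -[RHS]/(mhom_zero _ (mmod Y) x) -pj.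
  have qj' x : q (j x) = x by rewrite -[RHS]/(mhom_id _ x) -qj.
  have qi' x : q (i x) = 0 by rewrite -[RHS]/(mhom_zero _ (mmod Z) x) -qi.
  have ipjq x : i (p x) + j (q x) = x.
    have [h [_ hu]] := cop M i j.
    have e1 : h = mhom_id _ by apply: hu; split; apply: mhom_eq.
    have : h = mlinc 1 (mhom_comp i p) (mhom_comp j q).
      by apply: hu; split; apply: mhom_eq => y /=;
        rewrite ?pi' ?pj' ?qi' ?qj' !mhom0 scale1r ?addr0 ?add0r.
    rewrite e1 => e2; have : x = mlinc 1 (mhom_comp i p) (mhom_comp j q) x by rewrite -e2.
    by rewrite /= scale1r.
  have [|e0|e1] := iM (iota_map D (mhom_comp i p)).
  + by rewrite -iota_comp; congr (iota_map D _); apply: mhom_eq => x /=; rewrite pi'.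
  + left; apply/mod_zero_obj => x; rewrite -(iota0 D M M) in e0.
    by have /= := iota_faithful hL e0 (i x); rewrite pi' => /(congr1 p); rewrite pi' mhom0.
  right; apply/mod_zero_obj => x; rewrite -iota_id in e1.
  by have /= := iota_faithful hL e1 (j x); rewrite pj' mhom0 => /(congr1 q); rewrite qj' mhom0.
Qed.

Hypothesis L_infinite : infinite_type L.

(** Otherwise every summand [P k] of [Lambda] becomes some [Y[1]] at step [m k + 1]. An
    indecomposable module [A] receives a nonzero map from some [P k], so it also leaves, no later
    than [P k], and becomes the shift of an indecomposable projective; it is then one of finitely
    many [tau^i (P l [1])]. *)
Lemma good_Lambda : good O.
Proof.
have [/sums_dsum [r [P [i [p [dP bP]]]]]|//] := Lambda_dichotomy.
case: L_infinite; have [h1 h2 h3] := dP.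
have /choice [m hm] k : exists m, exists Y, [/\ projD Y, @isomorphic D (iter m.+1 ti (P k)) (S Y)
    , injD (iter m ti (P k)) & forall i, (i <= m)%N -> conc (iter i ti (P k))].
  by have [pP iP nP] := bP k; have [m [Y h]] := bad_exit pP.1 iP nP; exists m, Y.
(* A module leaves at a step at most [N + 1], so the exponents range over [0, ..., N + 1]. *)
pose N := \max_k m k.
pose X (c : 'I_N.+2 * 'I_r) := iter c.1 t (S (P c.2)).
have /choice [M hM] c : exists M : mod L, conc (X c) -> @isomorphic D (X c) (iota D M).
  have [/(concP hL) [M h]|n] := pselect (conc (X c)); first by exists M.
  by exists (zero_mod L).
exists #|{: 'I_N.+2 * 'I_r}|, (fun k => M (enum_val k)) => A /indec_iota iA.
have cA := iota_conc D hL A.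
have [a a0] := conc_nonzero hL cA iA.1.
have [k nk] : exists k, ~ nohom (P k) (iota D A).
  apply: contra_notP a0 => h; rewrite -[a]lcompm1 -h3 lcomp_sumr big1 // => k _.
  rewrite lcompA; have [z|z] := pselect (nohom (P k) (iota D A)); last by case: h; exists k.
  by rewrite (z (lcomp a (i k))) lcomp0l.
have [pP iP nP] := bP k; have [Y [pY iY iZ cZ]] := hm k.
have nA : ~ good (iota D A) by move=> g; apply: nk; apply: bad_good pP.1 iP nP g.
have [n [Y' [pY' iY' iZ' cZ']]] := bad_exit cA iA nA.
(* If [A] outlived [P k], then at step [m k + 1] the first would be a module and the second a
   shifted one, leaving no map [P k -> A]. *)
have le_nm : (n <= m k)%N.
  rewrite leqNgt; apply/negP => lt; apply: nk; apply/(nohom_iter_taui SD (m k).+1).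
  apply: nohom_iso (isomorphic_sym iY) (isomorphic_refl _) _ => h.
  exact: (@hom_shift_conc _ _ _ hL Y _ 0 h pY.1 (cZ' _ lt)).
have iY'' : indecD Y'.
  by apply/indecD_shift; apply: indecD_iso iY' _; apply/indecD_iter_taui.
have [l il] := indec_proj_summand pY' iY'' dP (fun k => let: And3 _ h _ := bP k in h).
have nN : (n.+1 < N.+2)%N by rewrite !ltnS (leq_trans le_nm) // (leq_bigmax (F := m)).
pose c : 'I_N.+2 * 'I_r := (Ordinal nN, l).
have iX : @isomorphic D (iota D A) (X c).
  apply: isomorphic_trans (isomorphic_sym (iter_tauK SD n.+1 _)) _.
  apply: iter_isomorphic; apply: isomorphic_trans iY' _; exact: fmap_isomorphic.
have cX : conc (X c) by apply: conc_iso iX cA.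
exists (enum_rank c); rewrite enum_rankK; apply/iota_isomorphic.
exact: isomorphic_trans iX (hM c cX).
Qed.

(** The obstruction [Hom(tau^j J0, Lambda)] equals [Hom(Lambda[1], tau^-(j+1) Lambda)], which
    vanishes because the powers of [tau^-] of [Lambda] are modules. *)
Lemma J_conc j : conc (iter j t J).
Proof.
elim: j => [|j IH]; first exact: (J0_conc SD hL).
apply: (conc_tau SD hL IH); apply/(nohom_iter_adj SD).
apply: nohom_iso (tau_shift SD O) (isomorphic_refl _) _.
apply/(nohom_tau_adj SD) => h.
exact: (@hom_shift_conc _ _ _ hL O _ 0 h (Lambda_conc D hL) (good_Lambda j.+1)).
Qed.

(** The hypothesis only says that [X] is a summand of the sum of the [Q k], which is the form that
    [proj_dual_basis] delivers. *)
Lemma conc_sum n (Q : 'I_n -> D) X (y : forall k, lhom (Q k) X) (z : forall k, lhom X (Q k)) :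
  \sum_k lcomp (y k) (z k) = lidm X -> (forall k, conc (Q k)) -> conc X.
Proof.
move=> e cQ; split=> j h.
  rewrite -[h]lcomp1m -e lcomp_suml big1 // => k _; rewrite -lcompA.
  by rewrite ((cQ k).1 j (lcomp _ h)) lcomp0r.
have e' : \sum_k lcomp (iter_map S j.+1 (y k) : lhom _ _) (iter_map S j.+1 (z k)) =
    lidm (iter j.+1 S X).
  elim: (j.+1) => //= i IH.
  transitivity (fmap S (lidm (iter i S X)) : lhom (iter i.+1 S X) (iter i.+1 S X)).
    rewrite -IH (lin_sum (@shift_lin _ _ D _ _)); apply: eq_bigr => k _.
    by rewrite -fmapL.
  exact: (@fmap1 _ _ S _).
rewrite -[h]lcomp1m -e' lcomp_suml big1 // => k _; rewrite -lcompA.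
by rewrite ((cQ k).2 j (lcomp _ h)) lcomp0r.
Qed.

Lemma good_proj P : projD P -> good P.
Proof.
move=> pP m; have [n [y [z yz]]] := proj_dual_basis pP.
have e : \sum_k lcomp (iter_map ti m (y k) : lhom _ _) (iter_map ti m (z k)) = lidm (iter m ti P).
  elim: m => //= m IH.
  transitivity (fmap ti (lidm (iter m ti P)) : lhom _ _); last exact: (@fmap1 _ _ ti _).
  rewrite -IH (lin_sum (@taui_lin _ _ _ SD _ _)); apply: eq_bigr => k _.
  by rewrite -fmapL.
exact: conc_sum e (fun _ => good_Lambda m).
Qed.

(** By Serre duality this space is dual to [Ext^1(Lambda, tau^-k Lambda)]. It is what makes free
    graded modules vanish below their generators. *)
Lemma Lambda_tau_nohom k : nohom O (iter k.+1 t O).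
Proof.
apply/(nohom_iter_taui SD k.+1).
apply: nohom_iso (isomorphic_refl _) (isomorphic_sym (iter_tauiK SD k.+1 O)) _.
apply: nohom_iso (isomorphic_refl _) (tau_tauiK SD O) _.
apply: serre_nohom.
apply: nohom_iso (isomorphic_refl _) (taui_shift SD _) _; apply/(nohom_taui SD).
exact: (proj_ext hL Lambda_proj (good_Lambda k)).
Qed.

Lemma exit_conc P j : projD P -> conc (iter j t (S (t P))).
Proof.
move=> pP; have [n [y [z yz]]] := proj_dual_basis pP.
pose F (X Y : D) (f : lhom X Y) : lhom (iter j t (S (t X))) (iter j t (S (t Y))) :=
  iter_map t j (fmap S (fmap t f)).
have Fl X Y : lin (@F X Y).
  move=> k f g; rewrite /F -(iter_map_lin (tau_linear SD)); congr (iter_map t j _).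
  by rewrite (@tau_lin _ _ _ SD); apply: (@shift_lin _ _ D).
have FM X Y Z (f : lhom Y Z) (g : lhom X Y) : F _ _ (lcomp f g) = lcomp (F _ _ f) (F _ _ g).
  rewrite /F !fmapL; exact: (@iter_mapM _ _ D t j).
have F1 X : F _ _ (lidm X) = lidm _.
  apply: etrans (@iter_map1 _ _ D t j _); rewrite /F; congr (iter_map t j _).
  apply: etrans (@fmap1 _ _ S _); congr (fmap S _); exact: (@fmap1 _ _ t _).
have e : \sum_k lcomp (F _ _ (y k)) (F _ _ (z k)) = lidm _.
  by rewrite -F1 -yz (lin_sum (Fl _ _)); apply: eq_bigr => k _; rewrite FM.
exact: conc_sum e (fun _ => J_conc j).
Qed.

End InfiniteType.

(** * Auslander-Reiten translates and Serre duality *)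

Section ARBridge.
Variables (K : fieldType) (L : falgType K) (D : derived_cat L).
Variable SD : serre_duality D.
Hypothesis hL : hereditary L.
Local Notation S := (dshift D).
Local Notation O := (Lambda D).
Local Notation t := (tau SD).
Implicit Types (M N : mod L).

Local Notation R := (regular L false).
Local Notation Lm := (regular_mod L).

Lemma iota_sexact (P1 P0 M : mod L) (d : mhom (mmod P1) (mmod P0)) (p : mhom (mmod P0) (mmod M)) :
  injective d -> surj p -> exact_at d p -> sexact (iota_map D d) (iota_map D p).
Proof.
move=> di ps dp; split=> [x|z|y].
- have [a <-] := eltm_surj hL x; rewrite eltm_nat -(mhom0 (eltm D P0)) => /(eltm_inj hL) e.
  by rewrite (di a 0) ?mhom0.
- have [a <-] := eltm_surj hL z; have [b <-] := ps a.
  by exists (eltm D P0 b); rewrite eltm_nat.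
have [b <-] := eltm_surj hL y; rewrite eltm_nat -(mhom0 (eltm D M)); split.
  move=> /(eltm_inj hL)/dp [a <-]; exists (eltm D P1 a); exact: eltm_nat.
case=> x; have [a <-] := eltm_surj hL x; rewrite eltm_nat => /(eltm_inj hL) <-.
by rewrite (dp _).2 //; exists a.
Qed.

Lemma scal0 (V : lmodType K) (f : V -> K) : scalar f -> f 0 = 0.
Proof. by move=> h; have := h (-1) 0 0; rewrite !scaleN1r !addNr mulN1r addNr. Qed.

Lemma lact_mreg a : lact D a = iota_map D (mreg (a : R) : mhom (mmod Lm) (mmod Lm)).
Proof. by []. Qed.

(* By Serre duality [Hom(Lambda, tau M) = D Ext^1(M, Lambda)], which the presentation computes. *)
Lemma ar_core (P1 P0 M N : mod L) (d : mhom (mmod P1) (mmod P0)) (p : mhom (mmod P0) (mmod M))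
    (b : mhom (mmod P1) R -> mmod N -> K) :
  projective (mmod P1) -> projective (mmod P0) -> injective d -> surj p -> exact_at d p ->
  nohom (iota D M) O ->
  (forall k (f g h : mhom (mmod P1) R) y, (forall x, h x = k *: f x + g x) -> b h y = k * b f y + b g y) ->
  (forall f, scalar (b f)) ->
  (forall (f h : mhom (mmod P1) R) a y, (forall x, h x = a * (f x : L)) -> b h y = b f (mact y a)) ->
  (forall y, (forall f, b f y = 0) -> y = 0) ->
  (forall phi : mhom (mmod P1) R -> K,
     (forall k (f g h : mhom (mmod P1) R), (forall x, h x = k *: f x + g x) -> phi h = k * phi f + phi g) ->
     (forall (g : mhom (mmod P0) R) (f : mhom (mmod P1) R), (forall x, f x = g (d x)) -> phi f = 0) ->
     exists y, forall f, phi f = b f y) ->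
  (forall (g : mhom (mmod P0) R) (f : mhom (mmod P1) R) y, (forall x, f x = g (d x)) -> b f y = 0) ->
  @isomorphic D (t (iota D M)) (iota D N).
Proof.
move=> pP1 pP0 di ps dp nMO blf bly ba binj bsurj b0.
have sx := iota_sexact di ps dp.
have q1 := iota_proj D hL pP1; have q0 := iota_proj D hL pP0.
have [delta hdelta] := ext_class_conc hL q1 q0 (iota_conc D hL M) sx.
have [hs hz] := hdelta O (Lambda_conc D hL).
pose z (f : mhom (mmod P1) R) : lhom (iota D M) (S O) :=
  lcomp (fmap S (iota_map D (f : mhom (mmod P1) (mmod Lm)))) delta.
have zs w : exists f, w = z f.
  have [g ->] := hs w; have [f ->] := iota_full hL (N := Lm) g; by exists f.
have zl k (f g h : mhom (mmod P1) R) : (forall x, h x = k *: f x + g x) -> z h = k *: z f + z g.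
  move=> e; rewrite /z (iota_lin D (M := P1) (N := Lm) e) shift_lin.
  exact: lcompDl_.
have z0 f : z f = 0 -> exists g : mhom (mmod P0) R, forall x, f x = g (d x).
  move=> /hz [r e]; have [g rg] := iota_full hL (N := Lm) r; exists g => x.
  apply: (iota_faithful (D := D) hL (N := Lm) (g := mhom_comp g d)).
  by rewrite e rg iota_comp.
have za (f h : mhom (mmod P1) R) a : (forall x, h x = a * (f x : L)) -> z h = lcomp (fmap S (lact D a)) (z f).
  move=> e; rewrite /z lcompA -fmapL lact_mreg -iota_comp; congr (lcomp (fmap S _) _).
  by congr (iota_map D _); apply: mhom_eq => x /=; rewrite e.
have zlin (f g : mhom (mmod P1) R) k : z (mlinc k f g) = k *: z f + z g by apply: zl.
pose RR (y : mmod N) (g : h0 (t (iota D M))) : Prop := forall f, serre (g : lhom O _) (z f) = b f y.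
have zfac f f' y : z f = z f' -> b f y = b f' y.
  move=> e; have [|g hg] := z0 (mlinc (-1) f f'); first by rewrite zlin e scaleN1r addNr.
  have := b0 g (mlinc (-1) f f') y hg.
  rewrite (blf (-1) f f') // mulN1r => /eqP; rewrite addrC subr_eq0 => /eqP ->.
  by [].
have [||y Ry|u hu] := @mhom_of_rel _ _ _ _ _ RR.
- split=> [f|k y y' g g' h h' f|y g a h f].
  + by rewrite (scal0 (serre_linl (X := iota D M) (Y := O) (s := SD) (z f))) (scal0 (bly f)).
  + have e := serre_linl (X := iota D M) (Y := O) (s := SD) (z f) k g g'; rewrite e.
    by rewrite h h' [RHS](bly f).
  + have [f' f'E] : exists f' : mhom (mmod P1) R, forall x, f' x = a * (f x : L).
      exists (mhom_comp (mreg (a : R)) f) => x /=; by [].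
    rewrite -(ba f f' a y f'E) -h.
    by rewrite (za f f' a f'E); apply: (@serre_natY _ _ _ SD).
- move=> y; have [v vz] := choice zs.
  have [|g hg] := @serre_surj _ _ _ SD (iota D M) O (fun w => b (v w) y).
    move=> k w w'; rewrite -(blf k (v w) (v w') (mlinc k (v w) (v w'))) //.
    by apply: zfac; rewrite zlin -!vz.
  by exists g => f; rewrite hg; apply: zfac; rewrite -vz.
- apply: (@serre_inj _ _ _ SD (iota D M) O y) => w; have [f ->] := zs w.
  by rewrite (Ry f) (scal0 (bly f)).
have ui : injective u.
  apply: (lin_inj (mhom_lin u)) => y e; apply: binj => f; rewrite -hu e.
  by rewrite (scal0 (serre_linl (X := iota D M) (Y := O) (s := SD) (z f))).
have us : surj u.
  move=> g; have [||y hy] := bsurj (fun f => serre (g : lhom O _) (z f)).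
  - move=> k f f' h e; rewrite (zl k f f' h e); exact: (@serre_linr _ _ _ SD).
  - move=> r f e; rewrite (_ : z f = 0) ?(scal0 (serre_linr (s := SD) _)) //.
    apply/hz; exists (iota_map D (N := Lm) r); rewrite -iota_comp; congr (iota_map D _).
    exact: mhom_eq.
  exists y; apply/eqP; rewrite -subr_eq0; apply/eqP/(serre_inj (s := SD)) => w.
  have [f ->] := zs w; rewrite addrC -scaleN1r.
  have e := serre_linl (X := iota D M) (Y := O) (s := SD) (z f) (-1) g (u y); rewrite e.
  by rewrite hu -hy mulN1r addNr.
have cM := conc_tau SD hL (iota_conc D hL M) nMO.
have iN : injective (eltm D N) by apply: eltm_inj.
have sN : surj (eltm D N) by apply: eltm_surj.
have [v [v1 v2]] := mhom_inv iN sN.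
apply: isomorphic_sym; apply: (h0_iso_mod hL (u := mhom_comp u v) (iota_conc D hL N) cM).
  by move=> x y /= /ui e; rewrite -(v2 x) -(v2 y) e.
by move=> y; have [x <-] := us y; exists (eltm D N x); rewrite /= v1.
Qed.

(* Heredity makes the image of [g] projective, so a cover of least dimension is minimal. *)
Lemma min_cover (Y : mod L) : exists (P : mod L) (p : mhom (mmod P) (mmod Y)),
  [/\ projective (mmod P), surj p
    & forall (X : module L false) (g : mhom X (mmod P)), surj (mhom_comp p g) -> surj g].
Proof.
pose B n := `[< exists (P : mod L) (p : mhom (mmod P) (mmod Y)),
  [/\ projective (mmod P), surj p & dimv (mmod P) = n] >].
have ex : exists n, B n.
  have [n [f fs]] := free_cover (mod_fd Y).
  exists (dimv (mfree L false n)); apply/asboolP; exists (mkmod (fd_free L false n)), f.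
  by split=> //; apply: mfree_projective.
case: (ex_minnP ex) => n /asboolP [P [p [pP ps dP]]] nmin.
exists P, p; split=> // X g gs.
have fU := fd_msub (mim_closed g) (mod_fd P).
have pU : projective (msub (mim_closed g)).
  exact: (sub_projective hL (i := mincl (mim_closed g)) pP (@mincl_inj _ _ _ _ _ _) fU).
have [|le eq] := dimv_inj (mod_fd P) (mhom_lin (mincl (mim_closed g))).
  exact: mincl_inj.
have ge : (n <= dimv (msub (mim_closed g)))%N.
  apply: nmin; apply/asboolP; exists (mkmod fU), (mhom_comp p (mincl (mim_closed g))); split=> // y.
  have [x <-] := gs y; have [z hz] := (mincl_im (mim_closed g) (g x)).1 (ex_intro _ x erefl).
  by exists z; exact: (congr1 p hz).
move=> y; have [|z hz] := eq _ y; first by apply/eqP; rewrite eqn_leq le dP ge.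
by have := (mincl_im (mim_closed g) y).2 (ex_intro _ z hz).
Qed.

Lemma indec_idem (M : mod L) (e : mhom (mmod M) (mmod M)) : indecomposable M ->
  (forall x, e (e x) = e x) -> (forall x, e x = 0) \/ (forall x, e x = x).
Proof.
move=> /(indec_iota D hL) [_ iM] ee; have [|h|h] := iM (iota_map D e).
- by rewrite -iota_comp; congr (iota_map D _); apply: mhom_eq.
- by left; apply: (iota_faithful (D := D) hL (g := mhom_zero _ _)); rewrite h iota0.
by right; apply: (iota_faithful (D := D) hL (g := mhom_id _)); rewrite h iota_id.
Qed.

(** The image of such a map is projective by heredity, so it would split off from [M]. *)
Lemma indec_nohom_regular (M : mod L) : indecomposable M -> ~ projective (mmod M) ->
  forall f : mhom (mmod M) R, forall x, f x = 0.
Proof.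
move=> iM nM f; pose U := mim_closed f.
have fR : fd R by apply/fin_presP/fin_pres_regular.
have fU : fd (msub U) := fd_msub U fR.
have pU : projective (msub U).
  exact: (sub_projective hL (i := mincl U) (@regular_projective K L false) (@mincl_inj _ _ _ _ _ _) fU).
have [q qE] : exists q : mhom (mmod M) (msub U), forall x, mincl U (q x) = f x.
  apply: (mhom_factor_inj (i := mincl U)) => [|x]; first exact: mincl_inj.
  by have [z hz] := (mincl_im U (f x)).1 (ex_intro _ x erefl); exists z.
have qs : surj q.
  move=> z; have [x hx] := (mincl_im U (mincl U z)).2 (ex_intro _ z erefl).
  by exists x; apply: (@mincl_inj _ _ _ _ _ U); rewrite qE.
have [s sq] := pU _ _ q (mhom_id _) qs.
have [|h|h] := indec_idem (e := mhom_comp s q) iM; first by move=> x /=; rewrite sq.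
  move=> x; have e : s (q x) = 0 := h x.
  have e2 : q x = 0 := etrans (esym (sq (q x))) (etrans (congr1 q e) (mhom0 q)).
  by rewrite -qE e2 mhom0.
by case: nM; apply: (projective_retract (s := q) (p := s) pU h).
Qed.

(** [Ext^1(Y, Lambda)] as a left module; by heredity it is the transpose of [Y]. *)
Definition extL (Y : mod L) : module L true.
Proof.
refine (@Module K L true (lhom (iota D Y) (S O)) (fun h a => lcomp (fmap S (lact D a)) h) _ _ _ _).
- by move=> k x y a; apply: lcompDr_.
- by move=> k x a a'; rewrite (@lact_lin _ _ D) shift_lin; apply: lcompDl_.
- move=> x; rewrite lact1; apply: etrans (lcomp1m x); congr (lcomp _ _); exact: (@fmap1 _ _ S).
- by move=> x a a'; rewrite lcompA -fmapL -lactM.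
Defined.

(** The transpose is computed by the projective cover of [Y] and its kernel, and the Serre pairing
    between [Hom(Lambda, tau Y)] and [Ext^1(Y, Lambda)] is the required duality. *)
Lemma AR_translate_of_tau (Y N : mod L) : @isomorphic D (t (iota D Y)) (iota D N) ->
  is_AR_translate (mmod Y) (mmod N).
Proof.
move=> /isoE [phi [phi' [phiK phiK']]].
have [P0 [p [pP0 ps pmin]]] := min_cover Y.
pose U := mker_closed p; have fU := fd_msub U (mod_fd P0).
pose P1 := mkmod fU; pose d : mhom (mmod P1) (mmod P0) := mincl U.
have di : injective d := @mincl_inj _ _ _ _ _ U.
have dp : exact_at d p by move=> y; exact: (mincl_im U y).
have pP1 : projective (mmod P1) := sub_projective hL pP0 di fU.
have sx := iota_sexact di ps dp.
have q1 := iota_proj D hL pP1; have q0 := iota_proj D hL pP0.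
have [delta hdelta] := ext_class_conc hL q1 q0 (iota_conc D hL Y) sx.
have [hs hz] := hdelta O (Lambda_conc D hL).
exists (extL Y); split.
  exists (mmod P1), (mmod P0), d, p.
  exists (fun f => lcomp (fmap S (iota_map D (f : mhom (mmod P1) (mmod Lm)))) delta : extL Y); split.
  - split=> //; try by split=> //; apply/fin_presP; apply: mod_fd.
    move=> X g hg y; have [x hx] := (hg (d y)).1 ((dp (d y)).2 (ex_intro _ y erefl)).
    by exists x; apply: di.
  - move=> k f g h e /=; rewrite (iota_lin D (M := P1) (N := Lm) e) shift_lin; exact: lcompDl_.
  - move=> a f h e /=; rewrite lcompA -fmapL lact_mreg -iota_comp.
    congr (lcomp (fmap S _) _); congr (iota_map D _); apply: mhom_eq => x /=.
    by rewrite e.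
  - move=> w; have [g ->] := hs w; have [f ->] := iota_full hL (N := Lm) g; by exists f.
  move=> f; split=> [/hz [r e]|[g hg]].
    have [g rg] := iota_full hL (N := Lm) r; exists g => x.
    apply: (iota_faithful (D := D) hL (N := Lm) (g := mhom_comp g d)).
    by rewrite e rg iota_comp.
  apply/hz; exists (iota_map D (N := Lm) g); rewrite -iota_comp; congr (iota_map D _).
  exact: mhom_eq.
exists (fun y h => serre (lcomp phi' (eltm D N y : lhom O _)) (h : lhom _ _)); split.
- split=> [y|x]; first exact: (@serre_linr _ _ _ SD).
  move=> k y y'; rewrite (mhom_lin (eltm D N)).
  have -> : lcomp phi' (k *: eltm D N y + eltm D N y' : lhom O _) =
    k *: lcomp phi' (eltm D N y) + lcomp phi' (eltm D N y') by apply: lcompDr_.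
  exact: (@serre_linl _ _ _ SD).
- move=> y h; have e : lcomp phi' (eltm D N y) = 0 by apply: (serre_inj (s := SD)).
  apply: (@eltm_inj _ _ D hL N); apply: etrans (esym (mhom0 (eltm D N))).
  by rewrite -[LHS](lcompKl phiK') e lcomp0r.
- move=> f fl; have [g hg] := @serre_surj _ _ _ SD (iota D Y) O f fl.
  have [y hy] := eltm_surj hL (lcomp phi g : h0 (iota D N)); exists y => h.
  by rewrite hy -hg (lcompKl phiK).
move=> y a x; rewrite (mhom_act (eltm D N)) /=.
rewrite -(@serre_natY _ _ _ SD _ _ _ (lact D a)); congr (serre _ _).
by rewrite lcompA.
Qed.

Lemma min_pres_split op (P1 P0 M : module L op) (p1 : mhom P1 P0) (p0 : mhom P0 M) (s : mhom M P0) :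
  minimal_proj_pres p1 p0 -> (forall x, p0 (s x) = x) -> forall x : P1, x = 0.
Proof.
move=> [_ _ [ps ex] m0 m1] sp x.
have ss : surj s by apply: m0 => y; exists y; rewrite /= sp.
have p0i y : p0 y = 0 -> y = 0 by have [z <-] := ss y; rewrite sp => ->; rewrite mhom0.
have [|z <-] := m1 _ (mhom_zero P1 P1) _ x; last by [].
move=> y; split=> [/p0i ->|[z /= <-]]; first by exists 0; rewrite /= mhom0.
by rewrite !mhom0.
Qed.

(** If [M] is projective the minimal presentation has [P1 = 0] and the translate is zero. Otherwise
    the image of [p1] is projective, so minimality makes [p1] injective and [ar_core] applies. *)
Lemma AR_translate_tau (M N : mod L) : is_AR_translate (mmod M) (mmod N) ->
  indecomposable M \/ (forall x : mmod M, x = 0) ->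
  (forall x : mmod N, x = 0) \/ @isomorphic D (t (iota D M)) (iota D N).
Proof.
case=> T [[P1 [P0 [p1 [p0 [c [mp cl ca cs ck]]]]]]].
move=> [b [[bl1 bl2] binj bsurj ba]] iM.
have [[/fin_presP f0 q0] [/fin_presP f1 q1] [ps ex] m0 m1] := mp.
have [pM|nM] := pselect (projective (mmod M)).
  left; have [s sp'] := pM _ _ p0 (mhom_id _) ps; have sp x : p0 (s x) = x := sp' x.
  have P10 x : x = 0 :> P1 by apply: (min_pres_split mp sp).
  move=> y; apply: binj => w; have [f <-] := cs w; have -> : c f = 0.
    by apply/ck; exists (mhom_zero _ _) => x; rewrite (P10 x) mhom0.
  exact: (scal0 (bl1 y)).
have {}iM : indecomposable M.
  by case: iM => // M0; case: nM => A B g f gs; exists (mhom_zero _ _) => x; rewrite (M0 x) !mhom0.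
right; pose U := mim_closed p1.
have fU := fd_msub U f0.
have pU := sub_projective hL q0 (@mincl_inj _ _ _ _ _ U) fU.
have [q qE] : exists q : mhom P1 (msub U), forall x, mincl U (q x) = p1 x.
  apply: (mhom_factor_inj (i := mincl U)) => [|x]; first exact: mincl_inj.
  by have [z hz] := (mincl_im U (p1 x)).1 (ex_intro _ x erefl); exists z.
have qs : surj q.
  move=> z; have [x hx] := (mincl_im U (mincl U z)).2 (ex_intro _ z erefl).
  by exists x; apply: (@mincl_inj _ _ _ _ _ U); rewrite qE.
have [s sq] := pU _ _ q (mhom_id _) qs.
have ss : surj s.
  apply: m1 => y; split=> [/ex [x <-]|[x <-]]; last by apply/ex; exists (s x).
  by exists (q x); rewrite /= -qE sq qE.
have p1i : injective p1.
  apply: (lin_inj (mhom_lin p1)) => x; have [y <-] := ss x; rewrite -qE sq => e.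
  by rewrite (_ : y = 0) ?mhom0 //; apply: (@mincl_inj _ _ _ _ _ U); rewrite e mhom0.
apply: (ar_core (P1 := mkmod f1) (P0 := mkmod f0) (d := p1) (p := p0) (b := fun f y => b y (c f))) => //.
- move=> g; have [f ->] := iota_full hL (N := Lm) g; rewrite -(iota0 D M Lm).
  congr (iota_map D _); apply: mhom_eq => x; exact: (indec_nohom_regular iM nM).
- by move=> k f g h y e; rewrite (cl k f g h e); apply: bl1.
- by move=> f h a y e; rewrite (ca a f h e) ba.
- by move=> y h; apply: binj => w; have [f <-] := cs w.
- move=> phi pl p0'; have [v vE] := choice cs.
  have pfac f f' : c f = c f' -> phi f = phi f'.
    move=> e; have /ck [g hg] : c (mlinc (-1) f f') = 0.
      by rewrite (cl (-1) f f') // e scaleN1r addNr.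
    have := p0' g (mlinc (-1) f f') hg.
    by rewrite (pl (-1) f f') // mulN1r addrC => /eqP; rewrite subr_eq0 => /eqP.
  have [|y hy] := bsurj (fun w => phi (v w)).
    move=> k w w'; rewrite -(pl k (v w) (v w') (mlinc k (v w) (v w'))) //.
    by apply: pfac; rewrite vE (cl k (v w) (v w')) // !vE.
  by exists y => f; rewrite hy; apply: pfac; rewrite vE.
move=> g f y e; rewrite (_ : c f = 0) ?(scal0 (bl1 y)) //.
by apply/ck; exists g.
Qed.

(** [A] is the dual [Hom(P, L)] and [e] the evaluation. It is described by its properties because
    maps into [regular] carry no module structure here. *)
Definition dual_data (P : module L true) (A : mod L) (e : mmod A -> mhom P (regular L true)) :=
  [/\ [/\ forall k a a' x, e (k *: a + a') x = k *: e a x + e a' x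
        & forall a l x, e (mact a l) x = (e a x : L) * l],
      forall a, (forall x, e a x = 0) -> a = 0,
      forall f : mhom P (regular L true), exists a, forall x, e a x = f x,
      forall g : mhom (mmod A) R, exists x, forall a, g a = e a x
    & forall x, (forall a, e a x = 0) -> x = 0].

(** A splitting of a free cover of [P] realizes the dual as the submodule of [L^n] fixed by an
    idempotent. *)
Lemma dual_projective (P : module L true) : fd P -> projective P ->
  exists (A : mod L) (e : mmod A -> mhom P (regular L true)),
    projective (mmod A) /\ dual_data e.
Proof.
move=> fP pP; have [n [q qs]] := free_cover fP.
have [s sq'] := pP _ _ q (mhom_id _) qs; have sq x : q (s x) = x := sq' x.
have [qb qE] : exists qb : 'I_n -> P, q = mfree_hom qb.
  exists (fun k => q (mbasis L true k)); apply: mfree_hom_uniq => k; by rewrite mfree_homE.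
pose sk x k : L := (s x : {ffun 'I_n -> L}) k.
have xE x : x = \sum_k mact (qb k) (sk x k) by rewrite -[LHS]sq qE.
have F0 (v : mfree L false n) : exists f : mhom P (regular L true),
    forall x, f x = \sum_k sk x k * (v : {ffun 'I_n -> L}) k.
  unshelve eexists; first unshelve refine (@Mhom _ _ _ P (regular L true)
    (fun x => \sum_k sk x k * (v : {ffun 'I_n -> L}) k) _ _).
  - move=> k x y; rewrite /sk mhom_lin scaler_sumr -big_split /=; apply: eq_bigr => i _.
    by rewrite !ffunE mulrDl scalerAl.
  - move=> x a; rewrite /sk mhom_act /= /amul mulr_sumr; apply: eq_bigr => i _.
    by rewrite ffunE /amul mulrA.
  - by [].
have [F FE] := choice F0.
have FU (f : mhom P (regular L true)) v x : (forall k, (v : {ffun 'I_n -> L}) k = f (qb k)) -> F v x = f x.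
  move=> h; rewrite FE [in RHS](xE x) (lin_sum (mhom_lin f)); apply: eq_bigr => k _.
  by rewrite h (mhom_act f).
pose U (v : mfree L false n) : Prop := forall k, (v : {ffun 'I_n -> L}) k = F v (qb k).
have FL k v v' x : F (k *: v + v') x = k *: F v x + F v' x.
  rewrite !FE scaler_sumr -big_split /=; apply: eq_bigr => i _.
  by rewrite !ffunE mulrDr scalerAr.
have FA v l x : F (mact v l) x = (F v x : L) * l.
  rewrite !FE mulr_suml; apply: eq_bigr => i _; by rewrite ffunE /amul /= mulrA.
have cU : sclosed U.
  split; [split=> [k|k v v' h h' i]|move=> v a h i].
  - by rewrite ffunE FE big1 // => i _; rewrite ffunE mulr0.
  - by rewrite FL !ffunE -h -h'.
  by rewrite FA ffunE -h.
have UF (f : mhom P (regular L true)) : exists a : msub cU, forall k, (mincl cU a : {ffun 'I_n -> L}) k = f (qb k).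
  pose v : mfree L false n := [ffun k => f (qb k) : L].
  have [|a ha] := (mincl_im cU v).1.
    by move=> k; rewrite (FU f) ?ffunE // => i; rewrite ffunE.
  by exists a => k; rewrite ha ffunE.
have [rr rE] : exists r : mhom (mfree L false n) (msub cU),
    forall v k, (mincl cU (r v) : {ffun 'I_n -> L}) k = F v (qb k).
  have [||y hy|r hr] := @mhom_of_rel _ _ _ (mfree L false n) (msub cU)
     (fun v a => forall k, (mincl cU a : {ffun 'I_n -> L}) k = F v (qb k)).
  - split=> [k|k v v' a a' h h' i|v a l h i].
    + by rewrite mhom0 ffunE FE big1 // => i _; rewrite ffunE mulr0.
    + by rewrite FL mhom_lin !ffunE h h'.
    by rewrite FA mhom_act ffunE h.
  - by move=> v; apply: UF.
  - apply: (@mincl_inj _ _ _ _ _ cU); rewrite mhom0; apply/ffunP => k.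
    by rewrite hy FE !ffunE big1 // => i _; rewrite ffunE mulr0.
  by exists r.
have aE (a : msub cU) k : (mincl cU a : {ffun 'I_n -> L}) k = F (mincl cU a) (qb k).
  by have := (mincl_im cU (mincl cU a)).2 (ex_intro _ a erefl) k.
have rK (a : msub cU) : rr (mincl cU a) = a.
  by apply: (@mincl_inj _ _ _ _ _ cU); apply/ffunP => k; rewrite rE -aE.
exists (mkmod (fd_msub cU (fd_free L false n))), (fun a => F (mincl cU a)); split.
  exact: projective_retract (mfree_projective (L := L) (op := false) (n := n)) rK.
split; first split.
- by move=> k a a' x; rewrite (mhom_lin (mincl cU)) FL.
- by move=> a l x; rewrite (mhom_act (mincl cU)) FA.
- move=> a h; apply: (@mincl_inj _ _ _ _ _ cU); rewrite (mhom0 (mincl cU)); apply/ffunP => k.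
  by rewrite aE h ffunE.
- by move=> f; have [a ha] := UF f; exists a => x; apply: FU.
- move=> g; exists (\sum_k mact (qb k) (g (rr (mbasis L false k)) : L)) => a.
  rewrite (lin_sum (mhom_lin (F (mincl cU a)))).
  have -> : g a = \sum_k mact (g (rr (mbasis L false k))) ((mincl cU a : {ffun 'I_n -> L}) k).
    transitivity (mhom_comp g rr (mincl cU a)); first by rewrite /= rK.
    rewrite (@mfree_hom_uniq _ _ _ _ _ (mhom_comp g rr)
      (mfree_hom (fun k => mhom_comp g rr (mbasis L false k)))) // => k.
    by rewrite mfree_homE.
  apply: eq_bigr => k _; rewrite (mhom_act (F _)) /= /amul; congr (_ * _); exact: aE.
move=> x h; rewrite (xE x) big1 // => k _.
suff -> : sk x k = 0 by rewrite (lin0 (fun c y z => mact_linr c (qb k) y z)).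
have -> : sk x k = F (mbasis L false k) x.
  rewrite FE (bigD1 k) //= big1 => [|i ik]; rewrite !ffunE ?eqxx ?mulr1 ?addr0 //.
  by rewrite (negPf ik) mulr0.
have [a ha] := UF (F (mbasis L false k)).
rewrite -(FU _ (mincl cU a)) //; exact: h.
Qed.

Lemma dual_ev (P : module L true) (A : mod L) (e : mmod A -> mhom P (regular L true)) :
  dual_data e -> forall x, exists g : mhom (mmod A) R, forall a, g a = e a x.
Proof.
move=> [[el ea] _ _ _ _] x; unshelve eexists.
  unshelve refine (@Mhom _ _ _ (mmod A) R (fun a => e a x) _ _).
  - by move=> k a a'; rewrite el.
  - by move=> a l; rewrite ea.
by [].
Qed.

Lemma dual_ext (P : module L true) (A : mod L) (e : mmod A -> mhom P (regular L true)) :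
  dual_data e -> forall x x', (forall a, e a x = e a x') -> x = x'.
Proof.
move=> [_ _ _ _ e0] x x' h; apply/eqP; rewrite -subr_eq0; apply/eqP/e0 => a.
by rewrite addrC -scaleN1r mhom_lin h scaleN1r addNr.
Qed.

(** Endomorphisms of the dual come from [P], by biduality; this moves idempotents to the side where
    minimality is known. *)
Lemma dual_endo (P : module L true) (A : mod L) (e : mmod A -> mhom P (regular L true)) :
  dual_data e -> forall rho : mhom (mmod A) (mmod A),
  exists r : mhom P P, forall a x, e a (r x) = e (rho a) x.
Proof.
move=> de rho; have [[el ea] ei es ee es'] := de.
have [||x' h|r hr] := @mhom_of_rel _ _ _ _ _ (fun x x' => forall a, e a x' = e (rho a) x).
- split=> [a|k x y x' y' h h' a|x y l h a]; first by rewrite !mhom0.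
    by rewrite !mhom_lin h h'.
  by rewrite !(mhom_act (e _)) h.
- move=> x; have [g hg] := dual_ev de x; have [x' hx] := ee (mhom_comp g rho).
  by exists x' => a; rewrite -hx /= hg.
- by apply: es' => a; rewrite h mhom0.
by exists r.
Qed.

Lemma dual_transpose (M : mod L) (E : module L true) (b : E -> mmod M -> K) :
  (forall y, scalar (b y)) /\ (forall x, scalar (b^~ x)) ->
  (forall y, (forall x, b y x = 0) -> y = 0) ->
  (forall phi : mmod M -> K, scalar phi -> exists y, b y =1 phi) ->
  (forall y a x, b (mact y a) x = b y (mact x a)) ->
  forall f : mhom E E, exists g : mhom (mmod M) (mmod M), forall y m, b y (g m) = b (f y) m.
Proof.
move=> [bl1 bl2] binj bsurj ba f.
have [s1 s2] := fd_reflexive (mod_fd M) bl1 bl2 binj bsurj.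
have [||m h|g hg] := @mhom_of_rel _ _ _ _ _ (fun m m' => forall y, b y m' = b (f y) m).
- split=> [y|k m n m' n' h h' y|m m' a h y]; first by rewrite !(scal0 (bl1 _)).
    by rewrite (bl1 y) (bl1 (f y)) h h'.
  by rewrite -!ba h (mhom_act f).
- move=> m; have [|m' hm] := s2 (fun y => b (f y) m).
    by move=> k y y'; rewrite mhom_lin; apply: bl2.
  by exists m' => y; rewrite -hm.
- by apply: s1 => y; rewrite h (scal0 (bl1 _)).
by exists g => y m.
Qed.

(* [ar_core] applies to the resolution of [N] dual to the presentation of [D M]. The dual complex
   is exact unless [p0] splits, because [D M] is indecomposable. *)
Lemma inv_AR_translate_tau (M N : mod L) : is_inv_AR_translate (mmod M) (mmod N) ->
  indecomposable M \/ (forall x : mmod M, x = 0) ->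
  (forall x : mmod N, x = 0) \/ @isomorphic D (t (iota D N)) (iota D M).
Proof.
case=> E [[b [bl binj bsurj ba]] [P1 [P0 [p1 [p0 [c [mp cl ca cs ck]]]]]]] iM.
have [bl1 bl2] := bl.
have [[/fin_presP f0 q0] [/fin_presP f1 q1] [ps ex] m0 m1] := mp.
have [[s sp]|ns] := pselect (exists s : mhom E P0, forall x, p0 (s x) = x).
  left=> y; have [f <-] := cs y; have P10 := min_pres_split mp sp.
  by apply/ck; exists (mhom_zero _ _) => x; rewrite (P10 x) mhom0.
have {}iM : indecomposable M.
  case: iM => // M0; case: ns; exists (mhom_zero _ _) => x.
  by rewrite mhom0 (binj x) // => m; rewrite (M0 m) (scal0 (bl1 x)).
right.
have [A0 [e0 [pA0 d0]]] := dual_projective f0 q0.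
have [A1 [e1 [pA1 d1]]] := dual_projective f1 q1.
have [[el0 ea0] ei0 es0 ee0 ex0] := d0; have [[el1 ea1] ei1 es1 ee1 ex1] := d1.
have e00 x : e0 0 x = 0 by have := el0 (-1) 0 0 x; rewrite !scaleN1r !addNr.
have e10 x : e1 0 x = 0 by have := el1 (-1) 0 0 x; rewrite !scaleN1r !addNr.
have [||a1 h|d hd] := @mhom_of_rel _ _ _ _ _
    (fun (a : mmod A0) (a1 : mmod A1) => forall x, e1 a1 x = e0 a (p1 x)).
- split=> [x|k a a' a1 a1' h h' x|a a1 l h x]; first by rewrite e00 e10.
    by rewrite el0 el1 h h'.
  by rewrite ea0 ea1 h.
- move=> a; have [a1 ha] := es1 (mhom_comp (e0 a) p1); by exists a1.
- by apply: ei1 => x; rewrite h e00.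
have [pi piE] : exists pi : mhom (mmod A1) (mmod N), forall a, pi a = c (e1 a).
  unshelve eexists; first unshelve refine (@Mhom _ _ _ (mmod A1) (mmod N) (fun a => c (e1 a)) _ _).
  - by move=> k a a'; apply: cl => x; rewrite el1.
  - by move=> a l; apply: ca => x; rewrite ea1.
  by [].
have pis : surj pi.
  move=> y; have [f <-] := cs y; have [a ha] := es1 f; exists a.
  by rewrite piE; congr (c _); apply: mhom_eq.
have dpi : exact_at d pi.
  move=> a; rewrite piE; split=> [/ck [g hg]|[a0 <-]].
    have [a0 ha] := es0 g; exists a0; apply/eqP; rewrite -subr_eq0; apply/eqP/ei1 => x.
    by rewrite addrC -scaleN1r el1 hg -ha hd scaleN1r addNr.
  by apply/ck; exists (e0 a0) => x; rewrite hd.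
(* The dual [r] of [rho] vanishes on the image of [p1], so it induces an idempotent of [E = D M] and
   one of [M]. If that is 0 then [rho = 0]; if it is 1 then [p0] splits, which is excluded. *)
have kill (rho : mhom (mmod A0) (mmod A0)) : (forall a, rho (rho a) = rho a) ->
    (forall a, d (rho a) = 0) -> forall a, rho a = 0.
  move=> rr dr; have [r hr] := dual_endo d0 rho.
  have r1 z : r (p1 z) = 0 by apply: ex0 => a; rewrite hr -hd dr e10.
  have rK x : r (r x) = r x by apply: (dual_ext d0) => a; rewrite !hr rr.
  have [|eb heb'] := mhom_factor_surj (f := mhom_comp p0 r) ps.
    by move=> x /ex [z <-]; rewrite /= r1 mhom0.
  have heb x : eb (p0 x) = p0 (r x) := heb' x.
  have [ep hep] := dual_transpose bl binj bsurj ba eb.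
  have ebK y : eb (eb y) = eb y.
    by have [x <-] := ps y; rewrite !heb rK.
  have [|h|h] := indec_idem (e := ep) iM.
  - move=> m; apply/eqP; rewrite -subr_eq0; apply/eqP.
    have [s1 _] := fd_reflexive (mod_fd M) bl1 bl2 binj bsurj.
    apply: s1 => y; rewrite addrC -scaleN1r (bl1 y) !hep ebK mulN1r addNr //.
  - have r0 x : r x = 0.
      have [z hz] : exists z, p1 z = r x.
        by apply/ex; rewrite -heb; apply: binj => m; rewrite -hep h (scal0 (bl1 _)).
      by rewrite -rK -hz r1.
    by move=> a; apply: ei0 => x; rewrite -hr r0 mhom0.
  case: ns; have [|s hs] := mhom_factor_surj (f := r) ps.
    by move=> x /ex [z <-]; rewrite r1.
  exists s => y; have [x <-] := ps y; rewrite hs -heb.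
  apply/eqP; rewrite -subr_eq0; apply/eqP/binj => m.
  by rewrite addrC -scaleN1r bl2 -hep h mulN1r addNr.
have di : injective d.
  pose U := mim_closed d; have fU := fd_msub U (mod_fd A1).
  have pU : projective (msub U) := sub_projective hL pA1 (@mincl_inj _ _ _ _ _ U) fU.
  have [q qE] : exists q : mhom (mmod A0) (msub U), forall x, mincl U (q x) = d x.
    apply: (mhom_factor_inj (i := mincl U)) => [|x]; first exact: mincl_inj.
    by have [z hz] := (mincl_im U (d x)).1 (ex_intro _ x erefl); exists z.
  have qs : surj q.
    move=> z; have [x hx] := (mincl_im U (mincl U z)).2 (ex_intro _ z erefl).
    by exists x; apply: (@mincl_inj _ _ _ _ _ U); rewrite qE.
  have [s sq'] := pU _ _ q (mhom_id _) qs; have sq x : q (s x) = x := sq' x.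
  pose rho := mlinc (-1) (mhom_comp s q) (mhom_id (mmod A0)).
  have rE a : rho a = - s (q a) + a by rewrite /rho /= scaleN1r.
  have qr a : q (rho a) = 0 by rewrite /rho /= mhom_lin sq scaleN1r addNr.
  have k := kill rho; apply: (lin_inj (mhom_lin d)) => a da.
  have qa : q a = 0 by apply: (@mincl_inj _ _ _ _ _ U); rewrite qE da mhom0.
  have e : rho a = a by rewrite rE qa mhom0 oppr0 add0r.
  rewrite -e; apply: k => a'; first by rewrite {1}rE qr mhom0 oppr0 add0r.
  by rewrite -qE qr mhom0.
(* The image of [f] is projective, so it gives an idempotent of [A1]. Its dual maps [P1] into the
   kernel of [p1], and minimality of [p1] makes it zero. *)
have nN (f : mhom (mmod N) R) y : f y = 0.
  pose U := mim_closed f.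
  have fU := fd_msub U ((fin_presP _).1 (fin_pres_regular L)).
  have pU := sub_projective hL (@regular_projective K L false) (@mincl_inj _ _ _ _ _ U) fU.
  have [q qE] : exists q : mhom (mmod N) (msub U), forall x, mincl U (q x) = f x.
    apply: (mhom_factor_inj (i := mincl U)) => [|x]; first exact: mincl_inj.
    by have [z hz] := (mincl_im U (f x)).1 (ex_intro _ x erefl); exists z.
  have qs : surj (mhom_comp q pi).
    move=> z; have [x hx] := (mincl_im U (mincl U z)).2 (ex_intro _ z erefl).
    have [a ha] := pis x.
    exists a; apply: (@mincl_inj _ _ _ _ _ U); apply: etrans (qE (pi a)) _.
    by rewrite ha hx.
  have [s sq'] := pU _ _ _ (mhom_id _) qs; have sq x : q (pi (s x)) = x := sq' x.
  pose rho := mhom_comp s (mhom_comp q pi).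
  have [r hr] := dual_endo d1 rho.
  have rK x : r (r x) = r x by apply: (dual_ext d1) => a; rewrite !hr /= sq.
  have pr z : p1 (r z) = 0.
    apply: ex0 => a; rewrite -hd hr /rho /= (_ : pi (d a) = 0) ?mhom0 ?e10 //.
    by apply/dpi; exists a.
  have gs : surj (mlinc (-1) r (mhom_id P1)).
    have pg x : p1 (mlinc (-1) r (mhom_id P1) x) = p1 x by rewrite /= mhom_lin pr scaler0 add0r.
    apply: m1 => y0; split=> [/ex [x <-]|[x <-]]; first by exists x; apply: pg.
    by apply/ex; exists x; rewrite /= -pg.
  have r0 z : r z = 0.
    by have [w <-] := gs z; rewrite /= mhom_lin rK scaleN1r addNr.
  have rho0 a : rho a = 0 by apply: ei1 => z; rewrite -hr r0 mhom0.
  have [a <-] := pis y; have h : s (q (pi a)) = 0 := rho0 a.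
  by rewrite -qE -(sq (q (pi a))) h !mhom0.
have evx (f : mhom (mmod A0) R) : exists x, forall a, f a = e0 a x by apply: ee0.
have [v vE] := choice evx.
have vU (f : mhom (mmod A0) R) x : (forall a, f a = e0 a x) -> v f = x.
  by move=> h; apply: (dual_ext d0) => a; rewrite -vE h.
have [s1 s2] := fd_reflexive (mod_fd M) bl1 bl2 binj bsurj.
apply: (ar_core (P1 := A0) (P0 := A1) (d := d) (p := pi) (b := fun f y => b (p0 (v f)) y)) => //.
- move=> g; have [f ->] := iota_full hL (N := Lm) g; rewrite -(iota0 D N Lm).
  congr (iota_map D _); apply: mhom_eq => x; exact: nN.
- move=> k f g h y e; rewrite (vU h (k *: v f + v g)) ?mhom_lin ?bl2 // => a.
  by rewrite mhom_lin -!vE.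
- move=> f h a y e; rewrite (vU h (mact (v f) a)) ?mhom_act ?ba // => a'.
  by rewrite (mhom_act (e0 a')) -vE e.
- move=> y h; apply: s1 => w; have [x <-] := ps w; have [g hg] := dual_ev d0 x.
  by rewrite -(vU g x hg).
- move=> phi pl p0'; have [ev evE] := choice (dual_ev d0).
  have [w wE] := choice ps.
  have pfac x x' : p0 x = p0 x' -> phi (ev x) = phi (ev x').
    move=> e; have [z hz] : exists z, p1 z = x - x'.
      by apply/ex; rewrite addrC -scaleN1r mhom_lin e scaleN1r addNr.
    have [g hg] := dual_ev d1 z.
    have := p0' g (mlinc (-1) (ev x') (ev x)); rewrite (pl (-1) (ev x') (ev x)) // mulN1r.
    move=> h; apply/eqP; rewrite -subr_eq0 addrC; apply/eqP/h => a.
    by rewrite /= !evE -(mhom_lin (e0 a)) scaleN1r addrC -hz hg hd.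
  have [|y hy] := s2 (fun y => phi (ev (w y))).
    move=> k y y'; rewrite -(pl k (ev (w y)) (ev (w y')) (ev (k *: w y + w y'))).
      by apply: pfac; rewrite wE mhom_lin !wE.
    by move=> a; rewrite !evE mhom_lin.
  exists y => f; rewrite -hy.
  have {1}-> : f = ev (v f) by apply: mhom_eq => a; rewrite evE vE.
  by apply: pfac; rewrite wE.
move=> g f y e; have [z hz] := ee1 g.
rewrite (vU f (p1 z)); last by move=> a; rewrite e hz hd.
by rewrite (ex (p1 z)).2 ?(scal0 (bl2 y)) //; exists z.
Qed.

End ARBridge.

Lemma dchoice (I : Type) (T : I -> Type) (P : forall i, T i -> Prop) :
  (forall i, exists x, P i x) -> exists f : forall i, T i, forall i, P i (f i).
Proof. by move=> h; exists (fun i => projT1 (cid (h i))) => i; apply: projT2 (cid (h i)). Qed.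

(** * The heart *)

Section Heart.
Variables (K : fieldType) (L : falgType K) (D : derived_cat L).
Variable SD : serre_duality D.
Hypothesis hL : hereditary L.
Hypothesis L_connected : connected L.
Hypothesis L_infinite : infinite_type L.
Local Notation S := (dshift D).
Local Notation O := (Lambda D).
Local Notation t := (tau SD).
Local Notation ti := (taui SD).
Local Notation R := (regular L false).
Implicit Types (X Y Z W : D) (M : mod L).

(** [Ext^1(L/U, I) = 0] extends the map from the ideal to [L], and a map from [L] is given by the
    image of [1]. *)
Lemma injD_ideal (I : mod L) (U : R -> Prop) (cU : sclosed U) (f : mhom (msub cU) (mmod I)) :
  injD (iota D I) -> exists x : mmod I, forall u, f u = mact x (mincl cU u : L).
Proof.
move=> [_ iI]; have fR : fd R := (fin_presP _).1 (fin_pres_regular L).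
have fU := fd_msub cU fR; have fQ := fd_mquo cU fR.
have pU := sub_projective hL (@regular_projective K L false) (@mincl_inj _ _ _ _ _ cU) fU.
have [|||] := @iota_sexact _ _ D hL (mkmod fU) (regular_mod L) (mkmod fQ) (mincl cU) (mpi cU).
- exact: mincl_inj.
- exact: mpi_surj.
- by move=> y; rewrite -(mincl_im cU y); apply: mpi_ker.
move=> s1 s2 s3; have q1 := @iota_proj _ _ D hL (mkmod fU) pU.
have q0 := @iota_proj _ _ D hL (regular_mod L) (@regular_projective K L false).
have [delta hd] := ext_class_conc hL q1 q0 (iota_conc D hL (mkmod fQ)) (And3 s1 s2 s3).
have /(hd _ (iota_conc D hL I)).2 [r rE] :=
  iI _ (iota_conc D hL (mkmod fQ)) (lcomp (fmap S (iota_map D (M := mkmod fU) f)) delta).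
have [r' r'E] := iota_full hL (M := regular_mod L) r.
exists (r' (1 : R)) => u.
have -> : f u = r' (mincl cU u).
  apply: (iota_faithful (D := D) hL (M := mkmod fU) (g := mhom_comp r' (mincl cU))).
  by rewrite rE r'E iota_comp.
by have := mhom_act r' (1 : R) (mincl cU u : L); rewrite /= /amul mul1r.
Qed.

(* Baer's criterion: only ideals of [L], which are finite dimensional, have to be tested. *)
Lemma injD_injective (I : mod L) : injD (iota D I) -> injective_mod (mmod I).
Proof.
move=> iI M N g f gi.
(* The relations are partial extensions of [f]. The conditions are imposed on nonempty relations
   only, so that the union of the empty chain also qualifies. *)
pose P (G : N * mmod I -> Prop) := (exists p, G p) ->
  [/\ rclosed (fun x y => G (x, y)), forall y, G (0, y) -> y = 0 & forall x, G (g x, f x)].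
have [|A [PA Amax]] := @classical_sets.Zorn_bigcup _ P.
  move=> F FP Ft [p [X FX Xp]].
  have both p1 p2 : classical_sets.bigcup F id p1 -> classical_sets.bigcup F id p2 ->
      exists V, [/\ F V, V p1 & V p2].
    move=> [X1 F1 h1] [X2 F2 h2]; have [s|s] := Ft _ _ F1 F2.
      by exists X2; split=> //; apply: s.
    by exists X1; split=> //; apply: s.
  split.
  - split.
    + by exists X => //; have [[]] := FP _ FX (ex_intro _ p Xp).
    + move=> k x x' y y' h h'; have [X' [FX' X1 X2]] := both _ _ h h'.
      by exists X' => //; have [[_ hl _] _ _] := FP _ FX' (ex_intro _ _ X1); apply: hl.
    move=> x y a [X' FX' X1]; exists X' => //.
    by have [[_ _ hl] _ _] := FP _ FX' (ex_intro _ _ X1); apply: hl.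
  - by move=> y [X' FX' X1]; have [_ h _] := FP _ FX' (ex_intro _ _ X1); apply: h.
  by move=> x; exists X => //; have [_ _ h] := FP _ FX (ex_intro _ p Xp); apply: h.
have [|[A0 Al Aa] Au Af] := PA.
  apply: contrapT => nA; pose G0 (p : N * mmod I) := exists x, p = (g x, f x).
  apply: (Amax G0).
    split=> [p Ap|e]; first by case: nA; exists p.
    by apply: nA; exists (g 0, f 0); apply: e; exists 0.
  move=> _; split; [split|..].
  - by exists 0; rewrite !mhom0.
  - by move=> k x x' y y' [z [-> ->]] [z' [-> ->]]; exists (k *: z + z'); rewrite !mhom_lin.
  - by move=> x y a [z [-> ->]]; exists (mact z a); rewrite !mhom_act.
  - by move=> y [z [e ->]]; rewrite (gi z 0) ?mhom0 // -e.
  by move=> x; exists x.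
have [|h hA] := @mhom_of_rel _ _ _ N (mmod I) (fun x y => A (x, y)) (And3 A0 Al Aa) _ Au; last first.
  exists h => x; apply/eqP; rewrite -subr_eq0 addrC; apply/eqP/Au.
  by have := Al (-1) _ _ _ _ (Af x) (hA (g x)); rewrite !scaleN1r addNr.
move=> x; apply: contrapT => nx.
pose U (a : R) := exists y, A (mact x (a : L), y).
have cU : sclosed U.
  split; first split.
  - by exists 0; rewrite (lin0 (fun k => mact_linr k x)).
  - by move=> k a a' [y h] [y' h']; exists (k *: y + y'); rewrite mact_linr; apply: Al.
  by move=> a b [y h]; exists (mact y b); rewrite -mactM; apply: Aa.
have [||y hy|phi hphi] := @mhom_of_rel _ _ _ (msub cU) (mmod I)
    (fun u y => A (mact x (mincl cU u : L), y)).
- split=> [|k u u' y y' h h'|u y a h].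
  + by rewrite mhom0 (lin0 (fun k => mact_linr k x)).
  + by rewrite mhom_lin mact_linr; apply: Al.
  by rewrite mhom_act -mactM; apply: Aa.
- by move=> u; apply: (mincl_im cU (mincl cU u)).2; exists u.
- by apply: Au; move: hy; rewrite mhom0 (lin0 (fun k => mact_linr k x)).
have [z hz] := injD_ideal phi iI.
pose A' (p : N * mmod I) := exists n y a, A (n, y) /\ p = (n + mact x a, y + mact z a).
have AA' p : A p -> A' p.
  case: p => n y h; exists n, y, 0; split=> //.
  by rewrite !(lin0 (fun k => mact_linr k _)) !addr0.
apply: (Amax A').
  split=> [|e]; first exact: AA'.
  apply: nx; exists z; apply: e; exists 0, 0, 1; split=> //.
  by rewrite !mact1 !add0r.
move=> _; split; [split|..].
- exact: AA'.
- move=> k _ _ _ _ [n [y [a [h [-> ->]]]]] [n' [y' [a' [h' [-> ->]]]]].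
  exists (k *: n + n'), (k *: y + y'), (k *: a + a'); split; first exact: Al.
  by rewrite !mact_linr !scalerDr; congr (_, _); rewrite addrACA.
- move=> _ _ b [n [y [a [h [-> ->]]]]]; exists (mact n b), (mact y b), (a * b).
  by split; [exact: Aa|rewrite !mactDl !mactM].
- move=> w [n [y [a [h [e ->]]]]].
  have en : n = mact x (- a).
    by apply/eqP; rewrite (linN (fun k => mact_linr k x)) -subr_eq0 opprK -e.
  have [u hu] := (mincl_im cU (- a : R)).1 (ex_intro _ y (eq_ind n (fun n => A (n, y)) h _ en)).
  have e2 : y = phi u.
    apply/eqP; rewrite -subr_eq0 addrC; apply/eqP/Au.
    have := Al (-1) _ _ _ _ (hphi u) h; rewrite !scaleN1r hu -en addNr.
    by [].
  by rewrite e2 hz hu (linN (fun k => mact_linr k z)) addNr.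
by move=> m; apply: AA'; apply: Af.
Qed.

Lemma injective_injD (I : mod L) : injective_mod (mmod I) -> injD (iota D I).
Proof.
move=> iI; have cI := iota_conc D hL I; split=> // W cW z.
have [P1 [P0 [d [p [h1 h2 h3]]]]] := conc_resolution hL cW.
have [delta hd] := ext_class_conc hL h1 h2 cW h3; have [di ps dp] := h3.
have iN : injective (eltm D I) by apply: eltm_inj.
have sN : surj (eltm D I) by apply: eltm_surj.
have [v [v1 v2]] := mhom_inv iN sN.
have [g ->] := (hd _ cI).1 z; apply/(hd _ cI).2.
have [|r hr] := iI _ _ (h0f d) (mhom_comp v (h0f g)).
  by apply: lin_inj di; apply: (mhom_lin (h0f d)).
have [r' hr'] := h0_full hL (mhom_comp (eltm D I) r) h2.1 cI.
exists r'; apply: (h0_faithful2 hL) => //; first exact: h1.1.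
move=> x; rewrite -lcompA hr'; apply: esym.
exact: etrans (congr1 (eltm D I) (hr x)) (v2 (h0f g x)).
Qed.

Lemma nonproj_nohom X : conc X -> indecD X -> ~ nohom X O -> projD X.
Proof.
move=> cX iX nX; have [M iM] := (concP hL X).1 cX.
have iM' : indecomposable M by apply/(indec_iota D hL); apply: indecD_iso iM iX.
have [pM|nM] := pselect (projective (mmod M)).
  exact: projD_iso (isomorphic_sym iM) (iota_proj D hL pM).
case: nX; apply: nohom_iso (isomorphic_sym iM) (isomorphic_refl O) _ => g.
have [f ->] := iota_full hL (N := regular_mod L) g; rewrite -(iota0 D M (regular_mod L)).
congr (iota_map D _); apply: mhom_eq => x; exact: (indec_nohom_regular D hL iM' nM).
Qed.

Lemma indec_nontrivial M : indecomposable M -> ~ forall x : mmod M, x = 0.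
Proof. by move=> [M0 _] /mod_zero_obj. Qed.

(** The alternative of a zero module arises when a step starts from an injective module: there the
    translate of modules is zero while [tau^-] in [D] leaves the modules. *)
Lemma preprojective_iter n (P X : mod L) : indecomposable P -> iter_rel n (@is_inv_AR_translate K L) P X ->
  (forall x : mmod X, x = 0) \/ @isomorphic D (iter n ti (iota D P)) (iota D X).
Proof.
move=> iP; elim: n X => [|n IH] X /=; first by right; apply/(iota_isomorphic D hL).
move=> [M [/IH h /(inv_AR_translate_tau SD hL) hX]].
have [|h0|h1] := hX; [|by left|].
  case: h => h; [by right|left]; apply/(indec_iota D hL); apply: indecD_iso h _.
  by apply/indecD_iter_taui/(indec_iota D hL).
case: h => h; last first.
  right; apply: isomorphic_trans (fmap_isomorphic _ (isomorphic_sym (isomorphic_trans h1 (isomorphic_sym h)))) _.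
  exact: taui_tauK.
left=> x; have /(iota_zero D hL) e : lidm (iota D X) = 0; last exact: e.
have e : lidm (t (iota D X)) = 0.
  have /isoE [f [g [gf _]]] := h1.
  have e0 := (iota_zero D hL M).2 h.
  by rewrite -gf -[f]lcomp1m e0 lcomp0l lcomp0r.
apply: (@tau_faithful _ _ _ SD); rewrite (lin0 (@tau_lin _ _ _ SD _ _)) -[RHS]e.
exact: (@fmap1 _ _ t).
Qed.

Lemma postinjective_iter n (I X : mod L) : indecomposable I -> iter_rel n (@is_AR_translate K L) I X ->
  (forall x : mmod X, x = 0) \/ @isomorphic D (iter n t (iota D I)) (iota D X).
Proof.
move=> iP; elim: n X => [|n IH] X /=; first by right; apply/(iota_isomorphic D hL).
move=> [M [/IH h /(AR_translate_tau SD hL) hX]].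
have [|h0|h1] := hX; [|by left|].
  case: h => h; [by right|left]; apply/(indec_iota D hL); apply: indecD_iso h _.
  by apply/indecD_iter_tau/(indec_iota D hL).
case: h => h; last by right; apply: isomorphic_trans (fmap_isomorphic _ h) h1.
left=> x; have /(iota_zero D hL) e : lidm (iota D X) = 0; last exact: e.
have /isoE [f [g [_ fg]]] := h1.
rewrite -fg -[g]lcomp1m; have -> : lidm (t (iota D M)) = 0; last by rewrite lcomp0l lcomp0r.
rewrite -[LHS](@fmap1 _ _ t) -[RHS](lin0 (@tau_lin _ _ _ SD _ _)); congr (fmap t _).
exact: (iota_zero D hL M).2.
Qed.

(* The objects of [H]; see [inH_Hp] and [Hp_inH]. *)
Definition Hp X : Prop := exists N, good SD (iter N ti X).

Lemma Hp_iso X Y : @isomorphic D X Y -> Hp X -> Hp Y.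
Proof. by move=> h [N g]; exists N; apply: good_iso (iter_isomorphic ti N h) g. Qed.

Lemma Hp_zero X : lidm X = 0 -> Hp X.
Proof. by move=> X0; exists 0%N; apply: good_zero. Qed.

Lemma sum_iter_map (F : functor D D) m n (Q : 'I_n -> D) X (y : forall k, lhom (Q k) X)
    (z : forall k, lhom X (Q k)) : (forall A B, lin (fun f : lhom A B => fmap F f : lhom (F A) (F B))) ->
  \sum_k lcomp (y k) (z k) = lidm X ->
  \sum_k lcomp (iter_map F m (y k) : lhom (iter m F (Q k)) (iter m F X)) (iter_map F m (z k)) =
    lidm (iter m F X).
Proof.
move=> Fl yz; elim: m => //= m IH.
transitivity (fmap F (lidm (iter m F X)) : lhom (iter m.+1 F X) (iter m.+1 F X)).
  rewrite -IH (lin_sum (Fl _ _)); apply: eq_bigr => k _.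
  by rewrite -fmapL.
exact: (@fmap1 _ _ F _).
Qed.

Lemma Hp_sum n (Q : 'I_n -> D) X (y : forall k, lhom (Q k) X) (z : forall k, lhom X (Q k)) :
  \sum_k lcomp (y k) (z k) = lidm X -> (forall k, Hp (Q k)) -> Hp X.
Proof.
move=> yz /choice [N hN]; exists (\sum_k N k)%N => m.
rewrite -iterD; apply: (conc_sum (sum_iter_map (F := ti) _ (@taui_lin _ _ _ SD) yz)) => k.
have le : (N k <= \sum_j N j)%N by rewrite (bigD1 k) //= leq_addr.
by have := hN k (m + (\sum_j N j - N k))%N; rewrite -iterD -addnA subnK.
Qed.

Lemma Hp_biprod X Y Z (i1 : lhom X Z) (i2 : lhom Y Z) p1 p2 :
  biprod i1 i2 p1 p2 -> Hp X -> Hp Y -> Hp Z.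
Proof.
move=> [_ _ _ _ e] hX hY.
pose Q (k : 'I_2) := if val k == 0%N then X else Y.
apply: (@Hp_sum 2 Q Z (fun k => if val k == 0%N as b return lhom (if b then X else Y) Z then i1 else i2)
  (fun k => if val k == 0%N as b return lhom Z (if b then X else Y) then p1 else p2)).
  by rewrite big_ord_recl big_ord1.
by move=> k; rewrite /Q; case: ifP.
Qed.

Lemma coproduct_sum n (N : 'I_n -> mod L) M (inj : forall i, hom (N i) M) : is_coproduct inj ->
  exists p : forall k, lhom (iota D M) (iota D (N k)),
    \sum_k lcomp (iota_map D (inj k)) (p k) = lidm (iota D M).
Proof.
move=> cop.
have /dchoice [p hp] k : exists p : mhom (mmod M) (mmod (N k)),
    (forall x, p (inj k x) = x) /\ forall j, j <> k -> forall x, p (inj j x) = 0.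
  (* The Kronecker family: the identity for [j = k], transported along that equation, and zero
     otherwise. *)
  pose f j : mhom (mmod (N j)) (mmod (N k)) :=
    match pselect (j = k) with
    | left e => eq_rect j (fun k => mhom (mmod (N j)) (mmod (N k))) (mhom_id _) k e
    | right _ => mhom_zero _ _ end.
  have [p [hp _]] := cop (N k) f; exists p; split=> [x|j jk x].
    have := congr1 (fun f : mhom _ _ => f x) (hp k) => /= ->.
    by rewrite /f; case: pselect => // e; rewrite (Prop_irrelevance e erefl).
  have := congr1 (fun f : mhom _ _ => f x) (hp j) => /= ->.
  by rewrite /f; case: pselect.
exists (fun k => iota_map D (p k)).
have [u uE] := iota_full hL (\sum_k lcomp (iota_map D (inj k)) (iota_map D (p k))).
rewrite uE -iota_id; congr (iota_map D _).
have [h [_ hu]] := cop M inj; rewrite -(hu (mhom_id _)); last by move=> i; apply: mhom_eq.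
apply: esym; apply: hu => j; apply: mhom_eq; apply: (iota_faithful (D := D) hL).
rewrite [LHS](iota_comp D u (inj j)) -uE lcomp_suml (bigD1 j) //= big1 => [|k kj].
  rewrite addr0 -lcompA -iota_comp -[RHS]lcompm1 -iota_id; congr (lcomp _ (iota_map D _)).
  by apply: mhom_eq => x /=; rewrite (hp j).1.
rewrite -lcompA -iota_comp -[RHS](lcomp0r _ (iota_map D (inj k))) -(iota0 D (N j) (N k)).
congr (lcomp _ (iota_map D _)); apply: mhom_eq => x /=; apply: (hp k).2.
by apply/eqP; rewrite eq_sym.
Qed.

Lemma sums_functor (F : functor D D) (T U : D -> Prop) X :
  (forall A B, lin (fun f : lhom A B => fmap F f : lhom (F A) (F B))) ->
  (forall Y, T Y -> U (F Y)) -> sums T X -> sums U (F X).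
Proof.
move=> Fl TU; elim=> [{}X X0|Y Z {}X i1 i2 p1 p2 [h11 h22 h12 h21 h] tY _ IH].
  apply: sums_zero; rewrite -[LHS](@fmap1 _ _ F) -[RHS](lin0 (Fl X X)); congr (fmap F _).
  exact: X0.
apply: (sums_add (i1 := fmap F i1) (i2 := fmap F i2) (p1 := fmap F p1) (p2 := fmap F p2) _ (TU _ tY) IH).
split; rewrite -?fmapL ?h11 ?h22 ?h12 ?h21; try exact: fmapLK.
- exact: (@fmap1 _ _ F).
- exact: (@fmap1 _ _ F).
- exact: (lin0 (Fl _ _)).
- exact: (lin0 (Fl _ _)).
rewrite -[LHS](linD (Fl _ _)) h; exact: (@fmap1 _ _ F).
Qed.

Lemma sums_iter (F : functor D D) (T : D -> Prop) X m :
  (forall A B, lin (fun f : lhom A B => fmap F f : lhom (F A) (F B))) ->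
  sums T X -> sums (fun Z => exists Y, T Y /\ Z = iter m F Y) (iter m F X).
Proof.
move=> Fl sX; elim: m => [|m IH] /=; first by apply: sums_weaken sX => Y _ tY; exists Y.
by apply: sums_functor Fl _ IH => _ [Y [tY ->]]; exists Y.
Qed.

Lemma add_closure_sums (T : mod L -> Prop) X :
  sums (fun Y => exists M, T M /\ @isomorphic D Y (iota D M)) X ->
  exists M, add_closure T M /\ @isomorphic D X (iota D M).
Proof.
move=> /sums_dsum [n [Q [i [p [[h1 h2 h3] /choice [N hN]]]]]].
have cX : conc X.
  apply: (conc_sum h3) => k; apply: conc_iso (isomorphic_sym (hN k).2) _; exact: iota_conc.
have [M iM] := (concP hL X).1 cX; exists M; split=> //.
have [a [b [ba ab]]] := isoE iM.
have /dchoice [u hu] k : exists u : lhom (Q k) (iota D (N k)), exists v,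
    lcomp v u = lidm _ /\ lcomp u v = lidm _.
  by have [u [v h]] := isoE (hN k).2; exists u, v.
have [v hv] := dchoice hu.
have [inj hinj] := dchoice (fun k => iota_full hL (lcomp a (lcomp (i k) (v k)))).
pose q k := lcomp (u k) (lcomp (p k) b).
have q1 k : lcomp (q k) (iota_map D (inj k)) = lidm _.
  by rewrite -hinj /q -!lcompA (lcompKl ba) (lcompA (p k)) h1 lcomp1m (hv k).2.
have q2 j k : j <> k -> lcomp (q j) (iota_map D (inj k)) = 0.
  move=> jk; rewrite -hinj /q -!lcompA (lcompKl ba) (lcompA (p j)) h2 //.
  by rewrite lcomp0l lcomp0r.
have q3 : \sum_k lcomp (iota_map D (inj k)) (q k) = lidm (iota D M).
  rewrite -ab -[a in RHS]lcompm1 -h3 lcomp_sumr lcomp_suml; apply: eq_bigr => k _.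
  by rewrite -hinj /q -!lcompA (lcompKl (hv k).1).
exists n, N, (fun k => inj k : hom (N k) M); split=> [Y f|k]; last exact: (hN k).1.
have [h hE] := iota_full hL (\sum_k lcomp (iota_map D (f k)) (q k)); exists h; split=> [j|h' hh'].
  apply: mhom_eq; apply: (iota_faithful (D := D) hL).
  rewrite [LHS](iota_comp D h (inj j)) -hE lcomp_suml (bigD1 j) //= big1 => [|k kj].
    by rewrite addr0 -lcompA q1 lcompm1.
  by rewrite -lcompA q2 ?lcomp0r //; apply/eqP.
apply: mhom_eq; apply: (iota_faithful (D := D) hL).
rewrite -hE -[iota_map D h']lcompm1 -q3 lcomp_sumr; apply: eq_bigr => k _.
by rewrite lcompA -iota_comp -hh'.
Qed.

(** The functor [X -> (tau X)[1]] is the Nakayama functor, taking projectives to injectives. *)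
Lemma tau_injD V : projD V -> injD (S (t V)).
Proof.
move=> pV; split; first exact: (exit_conc SD hL L_connected L_infinite 0 pV).
move=> W cW; have h : nohom W (t (S (S V))).
  apply: serre_nohom; apply/(nohom_shift (S V)) => k.
  exact: (@hom_shift_conc _ _ _ hL V W 0 k pV.1 cW).
apply: nohom_iso (isomorphic_refl _) _ h.
exact: isomorphic_trans (tau_shift SD (S V)) (fmap_isomorphic S (tau_shift SD V)).
Qed.

Lemma tau_chain (I : mod L) j M : (forall k, (k <= j)%N -> conc (iter k t (iota D I))) ->
  @isomorphic D (iter j t (iota D I)) (iota D M) -> iter_rel j (@is_AR_translate K L) I M.
Proof.
elim: j M => [|j IH] M cI iM /=; first exact/(iota_isomorphic D hL).
have [M' iM'] := (concP hL _).1 (cI j (leqnSn j)); exists M'; split.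
  by apply: IH iM' => k kj; apply: cI; apply: leqW.
apply: (AR_translate_of_tau (SD := SD) hL).
exact: isomorphic_trans (fmap_isomorphic t (isomorphic_sym iM')) iM.
Qed.

Lemma exit_postinjective V j M : projD V -> indecD V ->
  @isomorphic D (iter j t (S (t V))) (iota D M) -> postinjective_ind M.
Proof.
move=> pV iV iM; have iSV : indecD (S (t V)) by apply/indecD_shift/indecD_tau.
have jV := tau_injD pV; have [I iI] := (concP hL _).1 jV.1.
split; first by apply/(indec_iota D hL); apply: indecD_iso iM _; apply/indecD_iter_tau.
exists j, I; split.
- by apply/(indec_iota D hL); apply: indecD_iso iI _.
- by apply: injD_injective; apply: injD_iso iI jV.
apply: tau_chain => [k _|]; last exact: isomorphic_trans (isomorphic_sym (iter_isomorphic t j iI)) iM.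
apply: conc_iso (iter_isomorphic t k iI) _; exact: (exit_conc SD hL L_connected L_infinite k pV).
Qed.

Lemma postinjective_exit M : postinjective_ind M ->
  exists n P, projD P /\ @isomorphic D (iter n.+1 ti (iota D M)) (S P).
Proof.
move=> [iM [n [I [iI jI hI]]]].
have [M0|e] := postinjective_iter iI hI; first by case: (indec_nontrivial iM).
have [P [pP iP]] := taui_injD SD hL (injective_injD jI); exists n, P; split=> //=.
apply: isomorphic_trans (fmap_isomorphic ti _) iP.
exact: isomorphic_trans (iter_isomorphic ti n (isomorphic_sym e)) (iter_tauiK SD n _).
Qed.

(** Just before it leaves the modules, the object is an injective [I] by [bad_exit]; going back
    gives [M = tau^m I] through modules only. *)
Lemma not_good_postinjective M : indecomposable M -> ~ good SD (iota D M) -> postinjective_ind M.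
Proof.
move=> iM ng; have iM' := (indec_iota D hL M).1 iM.
have [m [Y [pY iY jY cM]]] := bad_exit hL (iota_conc D hL M) iM' ng.
have [I iI] := (concP hL _).1 jY.1.
have iMI i : (i <= m)%N -> @isomorphic D (iter i t (iota D I)) (iter (m - i) ti (iota D M)).
  move=> im; apply: isomorphic_trans (iter_isomorphic t i (isomorphic_sym iI)) _.
  by rewrite -{1}(subnKC im) iterD; apply: iter_tauK.
split=> //; exists m, I; split.
- by apply/(indec_iota D hL); apply: indecD_iso iI _; apply/indecD_iter_taui.
- by apply: injD_injective; apply: injD_iso iI jY.
apply: tau_chain => [k km|]; last by have := iMI m (leqnn m); rewrite subnn.
by apply: conc_iso (isomorphic_sym (iMI k km)) (cM _ _); rewrite leq_subr.
Qed.

Lemma preprojective_good M : preprojective_ind M -> good SD (iota D M).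
Proof.
move=> [iM [n [P [iP pP hP]]]].
have [M0|e] := preprojective_iter iP hP; first by case: (indec_nontrivial iM).
apply: (good_iso e); apply: good_iter.
exact: (good_proj SD hL L_connected L_infinite (iota_proj D hL pP)).
Qed.

Lemma regular_good M : regular_ind M -> good SD (iota D M).
Proof. by move=> [iM _ nM]; apply: contrapT => /(not_good_postinjective iM). Qed.

(** A postinjective module becomes [P[1]] with [P] projective under a power of [tau^-], so its shift
    down becomes [P], whose powers stay modules. *)
Lemma postinjective_Hp M X : postinjective_ind M -> @isomorphic D (S X) (iota D M) -> Hp X.
Proof.
move=> /postinjective_exit [n [P [pP iP]]] iX; exists n.+1.
apply: (good_iso (X := P)); last exact: (good_proj SD hL L_connected L_infinite pP).
apply: shift_reflect; apply: isomorphic_trans (isomorphic_sym iP) _.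
apply: isomorphic_trans (iter_isomorphic ti n.+1 (isomorphic_sym iX)) _.
exact: iter_taui_shift.
Qed.

Lemma add_closure_Hp (T : mod L -> Prop) M : (forall N, T N -> Hp (iota D N)) ->
  add_closure T M -> Hp (iota D M).
Proof.
move=> h [n [N [inj [cop tN]]]]; have [p hp] := coproduct_sum cop.
by apply: (Hp_sum hp) => k; apply: h.
Qed.

Lemma postinjective_closure_Hp M X : Icat M -> @isomorphic D (S X) (iota D M) -> Hp X.
Proof.
move=> [n [N [inj [cop tN]]]] iX; have [p hp] := coproduct_sum cop.
have /choice [Q hQ] k : exists Q, @isomorphic D (S Q) (iota D (N k)) by apply: shift_ess_surj.
have [a [b [ba ab]]] := isoE iX.
have /dchoice [u hu] k := isoE (hQ k); have [v hv] := dchoice hu.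
have /dchoice [y hy] k := shift_full (lcomp b (lcomp (iota_map D (inj k)) (u k))).
have /dchoice [z hz] k := shift_full (lcomp (v k) (lcomp (p k) a)).
apply: (@Hp_sum n Q X y z); last by move=> k; apply: postinjective_Hp (tN k) (hQ k).
apply: shift_faithful; rewrite (lin_sum (@shift_lin _ _ D _ _)).
transitivity (lidm (S X)); last exact: esym (@fmap1 _ _ S X).
rewrite -ba -[a in RHS]lcomp1m -hp lcomp_suml lcomp_sumr; apply: eq_bigr => k _.
by rewrite fmapL hy hz -!lcompA (lcompKl (hv k).2).
Qed.

Lemma inH_Hp X : inH X -> Hp X.
Proof.
move=> [Y [Z [i [j [/coprod_biprod [p [q b]] hY hZ]]]]].
apply: (Hp_biprod b).
  have [M [IM iY]] := (in_degree1 hL _ _).1 hY; exact: postinjective_closure_Hp IM iY.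
have [A [B [i' [j' [/coprod_biprod [p' [q' b']] hA hB]]]]] := hZ.
apply: (Hp_biprod b').
  have [M [IM iY]] := (in_degree0 hL _ _).1 hA; apply: Hp_iso (isomorphic_sym iY) _.
  by apply: (add_closure_Hp _ IM) => N pN; exists 0%N; apply: preprojective_good.
have [M [IM iY]] := (in_degree0 hL _ _).1 hB; apply: Hp_iso (isomorphic_sym iY) _.
by apply: (add_closure_Hp _ IM) => N pN; exists 0%N; apply: regular_good.
Qed.

Lemma conc_shift_zero Z : conc Z -> conc (S Z) -> lidm Z = 0.
Proof.
move=> cZ [h _]; apply: contrapT => Z0; have [x x0] := conc_nonzero hL cZ Z0.
by apply: x0; apply: (nohom_shift O Z).1 => // k; apply: (h 0%N).
Qed.

Lemma good_tau_class W n : good SD W -> indecD W -> let Y := iter n t W in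
  (exists M, postinjective_ind M /\ @isomorphic D (S Y) (iota D M)) \/
  ((exists M, preprojective_ind M /\ @isomorphic D Y (iota D M)) \/
   (exists M, regular_ind M /\ @isomorphic D Y (iota D M))).
Proof.
move=> gW iW Y.
have [cY|] := pselect (forall k, (k <= n)%N -> conc (iter k t W)).
  right; have [M iM] := (concP hL Y).1 (cY n (leqnn n)).
  have iM' : indecomposable M.
    by apply/(indec_iota D hL); apply: indecD_iso iM _; apply/indecD_iter_tau.
  have [pM|npM] := pselect (preprojective_ind M); first by left; exists M.
  right; exists M; split=> //; split=> // /postinjective_exit [m [P [pP iP]]].
  have gP := good_proj SD hL L_connected L_infinite pP.
  have iWP : @isomorphic D (iter m.+1 ti W) (S (iter n ti P)).
    apply: isomorphic_trans (iter_isomorphic ti m.+1 (isomorphic_sym (iter_tauiK SD n W))) _.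
    rewrite -iterD addnC iterD; apply: isomorphic_trans (iter_taui_shift SD n P).
    apply: iter_isomorphic; apply: isomorphic_trans iP.
    exact: iter_isomorphic.
  have := conc_shift_zero (gP n) (conc_iso iWP (gW m.+1)).
  have : indecD (iter n ti P).
    by apply/indecD_shift; apply: indecD_iso iWP _; apply/indecD_iter_taui.
  by case.
move=> nc; left; have ex : exists k, `[< ~ conc (iter k t W) >].
  apply: contra_notP nc => h k _; apply: contrapT => hk; apply: h; exists k; exact/asboolP.
case: (ex_minnP ex) => -[|k] /asboolP nk kmin; first by case: nk; apply: (gW 0%N).
have cV : conc (iter k t W).
  apply: contrapT => hk; have := kmin k; rewrite ltnn => h.
  by have := h (asboolT hk).
have kn : (k < n)%N.
  rewrite ltnNge; apply/negP => nk'; apply: nc => j jn; apply: contrapT => hj.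
  have := kmin j (asboolT hj); rewrite leqNgt ltnS (leq_trans jn nk') //.
have iV : indecD (iter k t W) by apply/indecD_iter_tau.
have pV : projD (iter k t W).
  apply: nonproj_nohom => // z; apply: nk; exact: (conc_tau SD hL cV z).
have iY : @isomorphic D (S Y) (iter (n - k.+1) t (S (t (iter k t W)))).
  rewrite /Y -{1}(subnK kn) iterD; exact: isomorphic_sym (iter_tau_shift SD _ _).
have cY := exit_conc SD hL L_connected L_infinite (n - k.+1) pV.
have [M iM] := (concP hL _).1 cY; exists M; split; last exact: isomorphic_trans iY iM.
exact: exit_postinjective pV iV iM.
Qed.

Lemma Hp_inH X : Hp X -> inH X.
Proof.
move=> [n gX]; have iX := iter_tauK SD n X.
have sX : sums (fun Y => (exists M, postinjective_ind M /\ @isomorphic D (S Y) (iota D M)) \/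
    ((exists M, preprojective_ind M /\ @isomorphic D Y (iota D M)) \/
     (exists M, regular_ind M /\ @isomorphic D Y (iota D M)))) X.
  apply: (sums_iso iX).
  have : sums (fun Y => good SD Y /\ indecD Y) (iter n ti X).
    apply: sums_weaken (conc_sums hL (gX 0%N)) => Y rY [_ iY]; split=> //.
    exact: good_retract rY gX.
  move=> /(sums_iter n (@tau_lin _ _ _ SD)); apply: sums_weaken => _ _ [Y [[gY iY] ->]].
  exact: good_tau_class.
have [A [B [i1 [i2 [p1 [p2 [sA sB b]]]]]]] := sums_split sX.
have [A' [B' [j1 [j2 [q1 [q2 [sA' sB' b']]]]]]] := sums_split sB.
exists A, B, i1, i2; split; first exact: biprod_coprod b.
  apply/(in_degree1 hL).
  have := sums_functor (U := fun Y => exists M, postinjective_ind M /\ @isomorphic D Y (iota D M)) (@shift_lin _ _ D) _ sA.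
  by move=> /(_ (fun Y h => h))/add_closure_sums.
exists A', B', j1, j2; split; first exact: biprod_coprod b'.
  by apply/(in_degree0 hL); apply: add_closure_sums sA'.
by apply/(in_degree0 hL); apply: add_closure_sums sB'.
Qed.

End Heart.

(** * Exactness in high degrees *)

Section Tails.
Variables (K : fieldType) (L : falgType K) (D : derived_cat L).
Variable SD : serre_duality D.
Hypothesis hL : hereditary L.
Hypothesis L_connected : connected L.
Hypothesis L_infinite : infinite_type L.
Local Notation S := (dshift D).
Local Notation O := (Lambda D).
Local Notation t := (tau SD).
Local Notation ti := (taui SD).
Local Notation tm := (iter_map ti).
Local Notation T n := (iter n t O).
Implicit Types (X Y Z W : D).

(** Exactness conditions relative to a test object [A]. With [A = tau^n Lambda] they speak about
    degree [n] of [Gamma]. *)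
Definition monoT A X Y (f : lhom X Y) : Prop := forall x : lhom A X, lcomp f x = 0 -> x = 0.
Definition epiT A X Y (f : lhom X Y) : Prop := forall y : lhom A Y, exists x, lcomp f x = y.
Definition exT A X Y Z (f : lhom X Y) (g : lhom Y Z) : Prop :=
  forall y : lhom A Y, lcomp g y = 0 <-> exists x, lcomp f x = y.

Lemma monoT_iso A B X Y (f : lhom X Y) : @isomorphic D A B -> monoT A f -> monoT B f.
Proof.
move=> /isoE [a [b [ba ab]]] m x h; rewrite -[x]lcompm1 -ab lcompA.
by rewrite (m (lcomp x a)) ?lcomp0l // lcompA h lcomp0l.
Qed.

Lemma epiT_iso A B X Y (f : lhom X Y) : @isomorphic D A B -> epiT A f -> epiT B f.
Proof.
move=> /isoE [a [b [ba ab]]] e y; have [x hx] := e (lcomp y a).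
by exists (lcomp x b); rewrite lcompA hx -lcompA ab lcompm1.
Qed.

Lemma exT_iso A B X Y Z (f : lhom X Y) (g : lhom Y Z) : @isomorphic D A B -> exT A f g -> exT B f g.
Proof.
move=> /isoE [a [b [ba ab]]] e y; split=> [h|[x <-]].
  have [x hx] : exists x, lcomp f x = lcomp y a by apply/e; rewrite lcompA h lcomp0l.
  by exists (lcomp x b); rewrite lcompA hx -lcompA ab lcompm1.
have h : lcomp g (lcomp f (lcomp x a)) = 0 by apply/e; exists (lcomp x a).
have -> : lcomp g (lcomp f x) = lcomp (lcomp g (lcomp f (lcomp x a))) b.
  by rewrite -!lcompA ab lcompm1.
by rewrite h lcomp0l.
Qed.

Section FullyFaithful.
Variable F : functor D D.
Hypothesis Ff : forall X Y (g : lhom (F X) (F Y)), exists f : lhom X Y, fmap F f = g.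
Hypothesis Fi : forall X Y (f g : lhom X Y), fmap F f = fmap F g -> f = g.
Hypothesis Fl : forall X Y, lin (fun f : lhom X Y => fmap F f : lhom (F X) (F Y)).

Lemma fmap_eq0 X Y (f : lhom X Y) : fmap F f = 0 :> lhom (F X) (F Y) <-> f = 0.
Proof.
split=> [h|->]; last exact: (lin0 (@Fl X Y)).
by apply: Fi; rewrite h; apply: esym (lin0 (@Fl X Y)).
Qed.

Lemma monoT_fmap A X Y (f : lhom X Y) : monoT (F A) (fmap F f : lhom _ _) <-> monoT A f.
Proof.
split=> m x h.
  by apply/fmap_eq0/m; rewrite -fmapL; apply/fmap_eq0.
have [x' e] := Ff x; subst x; apply/fmap_eq0/m; apply/fmap_eq0; by rewrite fmapL.
Qed.

Lemma epiT_fmap A X Y (f : lhom X Y) : epiT (F A) (fmap F f : lhom _ _) <-> epiT A f.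
Proof.
split=> m y.
  have [x hx] := m (fmap F y); have [x' e] := Ff x; subst x; exists x'.
  by apply: Fi; rewrite fmapL.
have [y' <-] := Ff y; have [x <-] := m y'; exists (fmap F x); by rewrite fmapL.
Qed.

Lemma exT_fmap A X Y Z (f : lhom X Y) (g : lhom Y Z) :
  exT (F A) (fmap F f : lhom _ _) (fmap F g : lhom _ _) <-> exT A f g.
Proof.
split=> m y.
  rewrite -fmap_eq0 fmapL; split=> [/m [x hx]|[x hx]].
    by have [x' e] := Ff x; subst x; exists x'; apply: Fi; rewrite fmapL.
  by apply/m; exists (fmap F x); rewrite -fmapL hx.
have [y' <-] := Ff y; rewrite -fmapL fmap_eq0; split=> [/m [x <-]|[x hx]].
  by exists (fmap F x); rewrite fmapL.
apply/m; have [x' e] := Ff x; subst x; exists x'; by apply: Fi; rewrite fmapL.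
Qed.
End FullyFaithful.

Lemma monoT_tm n A X Y (f : lhom X Y) : monoT A (tm n f : lhom _ _) <-> monoT (iter n t A) f.
Proof.
elim: n A => //= n IH A; rewrite -[t (iter n t A)]/(iter n.+1 t A) iterSr -IH.
apply: (iff_trans _ (monoT_fmap (@taui_full _ _ _ SD) (@taui_faithful _ _ _ SD) (@taui_lin _ _ _ SD) _ _)).
split; apply: monoT_iso; [apply: isomorphic_sym|]; exact: taui_tauK.
Qed.

Lemma epiT_tm n A X Y (f : lhom X Y) : epiT A (tm n f : lhom _ _) <-> epiT (iter n t A) f.
Proof.
elim: n A => //= n IH A; rewrite -[t (iter n t A)]/(iter n.+1 t A) iterSr -IH.
apply: (iff_trans _ (epiT_fmap (@taui_full _ _ _ SD) (@taui_faithful _ _ _ SD) _ _)).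
split; apply: epiT_iso; [apply: isomorphic_sym|]; exact: taui_tauK.
Qed.

Lemma exT_tm n A X Y Z (f : lhom X Y) (g : lhom Y Z) :
  exT A (tm n f : lhom _ _) (tm n g : lhom _ _) <-> exT (iter n t A) f g.
Proof.
elim: n A => //= n IH A; rewrite -[t (iter n t A)]/(iter n.+1 t A) iterSr -IH.
apply: (iff_trans _ (exT_fmap (@taui_full _ _ _ SD) (@taui_faithful _ _ _ SD) (@taui_lin _ _ _ SD) _ _ _)).
split; apply: exT_iso; [apply: isomorphic_sym|]; exact: taui_tauK.
Qed.

Lemma tm_full n X Y (g : lhom (iter n ti X) (iter n ti Y)) : exists f : lhom X Y, tm n f = g.
Proof.
elim: n g => [|n IH] /= g; first by exists g.
by have [g' <-] := taui_full g; have [f <-] := IH g'; exists f.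
Qed.

Lemma tm_faithful n X Y (f g : lhom X Y) : tm n f = tm n g -> f = g.
Proof. by elim: n => //= n IH /(taui_faithful)/IH. Qed.

Lemma tm_lin n X Y : lin (fun f : lhom X Y => tm n f : lhom _ _).
Proof. exact: (iter_map_lin (taui_linear SD)). Qed.

Lemma tmL n X Y Z (g : lhom Y Z) (f : lhom X Y) : tm n (lcomp g f) = lcomp (tm n g : lhom _ _) (tm n f).
Proof. exact: (@iter_mapM _ _ D ti n). Qed.

Lemma tm1 n X : tm n (lidm X) = lidm (iter n ti X).
Proof. exact: (@iter_map1 _ _ D ti n). Qed.

Lemma tm_eq0 n X Y (f : lhom X Y) : tm n f = 0 :> lhom _ _ <-> f = 0.
Proof.
split=> [h|->]; last exact: (lin0 (@tm_lin n X Y)).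
by apply: (@tm_faithful n); rewrite h; apply: esym (lin0 (@tm_lin n X Y)).
Qed.

(** A cocycle on [P1] lifts along [g]; a cocycle with values in [B] that bounds in [C] is corrected
    by a lift of the bounding map to [P0], and then factors through the image of [f]. *)
Lemma ext_rexact J A B C (f : lhom A B) (g : lhom B C) : conc J -> conc A -> conc B -> conc C ->
  epiT O g -> exT O f g -> epiT J (fmap S g : lhom _ _) /\ exT J (fmap S f : lhom _ _) (fmap S g : lhom _ _).
Proof.
move=> cJ cA cB cC eg ex.
have gf : lcomp g f = 0.
  apply: (h0_faithful hL) => // x; rewrite -lcompA; apply/ex; by exists x.
have [P1 [P0 [d [p [h1 h2 h3]]]]] := conc_resolution hL cJ.
have [delta hd] := ext_class_conc hL h1 h2 cJ h3.
split=> z.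
  have [u ->] := (hd _ cC).1 z; have [u' <-] := proj_lift hL u h1 cB cC eg.
  by exists (lcomp (fmap S u') delta); rewrite lcompA fmapL.
split=> [|[x <-]]; last first.
  by rewrite lcompA -fmapL gf (lin0 (@shift_lin _ _ D _ _)) lcomp0l.
have [u ->] := (hd _ cB).1 z; rewrite lcompA -fmapL => /(hd _ cC).2 [r hr].
have [r' r'E] := proj_lift hL r h2 cB cC eg.
have [I [k [q [cI fE ki qs]]]] := image_factor hL f cA cB.
have [|w hw] := mono_lift hL (k := k) (f := u - lcomp r' d) cI cB h1.1 ki.
  move=> x; have [] := (ex (lcomp (u - lcomp r' d) x)).1; last first.
    by move=> a <-; exists (lcomp q a); rewrite fE lcompA.
  by rewrite lcompA lcompBR hr lcompA r'E subrr lcomp0l.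
have [v vE] := proj_lift hL w h1 cA cI qs.
exists (lcomp (fmap S v) delta); rewrite lcompA -fmapL fE -lcompA vE hw.
rewrite (linB (@shift_lin _ _ D _ _)) lcompB (_ : lcomp (fmap S (lcomp r' d)) delta = 0) ?subr0 //.
by apply/(hd _ cB).2; exists r'.
Qed.

(* [Hom(tau^n Lambda, -) = Ext^1(tau^(n-1) J0, -)] on modules, and [Ext^1] is right exact. *)
Lemma tail_rexact A B C (f : lhom A B) (g : lhom B C) : conc A -> conc B -> conc C ->
  epiT O g -> exT O f g -> forall n, epiT (T n) g /\ exT (T n) f g.
Proof.
move=> cA cB cC eg ex [//|n].
have [h1 h2] := ext_rexact (J_conc SD hL L_connected L_infinite n) cA cB cC eg ex.
have i : @isomorphic D (iter n t (J0 SD)) (S (T n.+1)).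
  apply: isomorphic_trans (iter_tau_shift SD n (t O)) _; rewrite -iterSr; exact: isomorphic_refl.
split.
  apply/(epiT_fmap (@shift_full _ _ D) (@shift_faithful _ _ D)); exact: epiT_iso i h1.
by apply/(exT_fmap (@shift_full _ _ D) (@shift_faithful _ _ D) (@shift_lin _ _ D)); apply: exT_iso i h2.
Qed.

Lemma Hp_level X Y : Hp SD X -> Hp SD Y ->
  exists N, forall n, (N <= n)%N -> good SD (iter n ti X) /\ good SD (iter n ti Y).
Proof.
move=> [a ga] [b gb]; exists (a + b)%N => n hn.
have ha : (a <= n)%N by rewrite (leq_trans _ hn) ?leq_addr.
have hb : (b <= n)%N by rewrite (leq_trans _ hn) ?leq_addl.
split; [rewrite -(subnK ha)|rewrite -(subnK hb)]; rewrite iterD; exact: good_iter.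
Qed.

(** Validity in all large degrees; finitely many such statements can be combined by [tail_and]. *)
Definition tail (P : nat -> Prop) := exists N, forall n, (N <= n)%N -> P n.

Lemma tail_and P Q : tail P -> tail Q -> tail (fun n => P n /\ Q n).
Proof. by move=> [a ha] [b hb]; exists (a + b)%N => n hn; split; [apply: ha|apply: hb]; lia. Qed.

Lemma tail_imp (P Q : nat -> Prop) : (forall n, P n -> Q n) -> tail P -> tail Q.
Proof. by move=> h [a ha]; exists a => n hn; apply/h/ha. Qed.

Lemma Hp_tail X : Hp SD X -> tail (fun n => conc (iter n ti X)).
Proof. by move=> hX; have [N h] := Hp_level hX hX; exists N => n /h [/(_ 0%N) ? _]. Qed.

Lemma tail_ex P : tail P -> exists n, P n.
Proof. by move=> [N h]; exists N; apply: h. Qed.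

(** Here and in the following lemmas one degree [n] is chosen in which all objects are modules; the
    statement is proved there and pulled back along the fully faithful functor [tau^-n]. *)
Lemma tail_iso X Y (f : lhom X Y) : Hp SD X -> Hp SD Y ->
  tail (fun n => monoT (T n) f) -> tail (fun n => epiT (T n) f) ->
  exists g, lcomp g f = lidm X /\ lcomp f g = lidm Y.
Proof.
move=> /Hp_tail tX /Hp_tail tY m e.
have [n [[cX cY] [/monoT_tm mn /epiT_tm en]]] := tail_ex (tail_and (tail_and tX tY) (tail_and m e)).
have [g [gf fg]] := h0_iso hL cX cY mn en; have [g' g'E] := tm_full g.
exists g'; split; apply: (@tm_faithful n); rewrite tmL tm1 g'E //.
Qed.

Lemma tail_zero X Y (f : lhom X Y) : Hp SD X -> Hp SD Y ->
  tail (fun n => forall x : lhom (T n) X, lcomp f x = 0) -> f = 0.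
Proof.
move=> /Hp_tail tX /Hp_tail tY z.
have [n [[cX cY] zn]] := tail_ex (tail_and (tail_and tX tY) z).
apply/(tm_eq0 n); apply: (h0_faithful hL) => // x.
have /exT_tm/(_ x) h : exT (T n) (lidm X) f.
  by move=> y; split=> // _; exists y; rewrite lcomp1m.
by apply/h; exists x; rewrite tm1 lcomp1m.
Qed.

Lemma tail_kernel X Y Z W (f : lhom X Y) (g : lhom Y Z) (h : lhom W Y) :
  Hp SD X -> Hp SD Y -> Hp SD W ->
  tail (fun n => monoT (T n) f) -> tail (fun n => exT (T n) f g) -> lcomp g h = 0 ->
  exists u, lcomp f u = h /\ forall v, lcomp f v = h -> v = u.
Proof.
move=> /Hp_tail tX /Hp_tail tY /Hp_tail tW m e gh.
have [n [[[cX cY] cW] [/monoT_tm mn /exT_tm en]]] :=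
  tail_ex (tail_and (tail_and (tail_and tX tY) tW) (tail_and m e)).
have [z|u hu] := mono_lift hL (f := tm n h) cX cY cW mn.
  by apply/en; rewrite lcompA -tmL gh (lin0 (@tm_lin n _ _)) lcomp0l.
have [u' u'E] := tm_full u; subst u; exists u'; split; first by apply: (@tm_faithful n); rewrite tmL.
move=> v hv; apply: (@tm_faithful n); apply: (h0_faithful2 hL) => // x.
apply/eqP; rewrite -subr_eq0; apply/eqP/mn.
by rewrite lcompBR !lcompA -tmL hv hu subrr.
Qed.

Lemma tail_cokernel X Y Z W (f : lhom X Y) (g : lhom Y Z) (h : lhom Y W) :
  Hp SD Y -> Hp SD Z -> Hp SD W ->
  tail (fun n => epiT (T n) g) -> tail (fun n => exT (T n) f g) -> lcomp h f = 0 ->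
  exists u, lcomp u g = h /\ forall v, lcomp v g = h -> v = u.
Proof.
move=> /Hp_tail tX /Hp_tail tY /Hp_tail tW m e gh.
have [n [[[cX cY] cW] [/epiT_tm mn /exT_tm en]]] :=
  tail_ex (tail_and (tail_and (tail_and tX tY) tW) (tail_and m e)).
have [y|u hu] := epi_factor hL (f := tm n h) cX cY cW mn.
  by move=> /en [x <-]; rewrite lcompA -tmL gh (lin0 (@tm_lin n _ _)) lcomp0l.
have [u' u'E] := tm_full u; subst u; exists u'; split; first by apply: (@tm_faithful n); rewrite tmL.
move=> v hv; apply: (@tm_faithful n); apply: (h0_faithful2 hL) => // z.
by have [x <-] := mn z; rewrite !lcompA hu -tmL hv.
Qed.

(** Once [P] has become [Q[1]] with [Q] projective, further powers of [tau^-] keep it a shifted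
    module, and [Hom(Lambda, -)] vanishes on shifted modules. *)
Lemma bad_tail B : sums (fun P => [/\ conc P, indecD P & ~ good SD P]) B ->
  tail (fun n => nohom (T n) B).
Proof.
elim=> [X X0|Y Z X i1 i2 p1 p2 [_ _ _ _ e] [cP iP nP] _ IH].
  by exists 0%N => n _ h; rewrite -[h]lcomp1m X0 lcomp0l.
have [m [Q [pQ iQ _ _]]] := bad_exit hL cP iP nP.
have h : tail (fun n => nohom (T n) Y).
  exists m.+1 => n hn; apply/(nohom_iter_adj SD); rewrite -(subnK hn) iterD.
  apply: nohom_iso (isomorphic_refl O) (isomorphic_sym (iter_isomorphic ti _ iQ)) _.
  apply: nohom_iso (isomorphic_refl O) (isomorphic_sym (iter_taui_shift SD _ _)) _ => h.
  exact: ((good_proj SD hL L_connected L_infinite pQ (n - m.+1)%N).2 0%N h).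
apply: tail_imp (tail_and h IH) => n [h1 h2] x.
by rewrite -[x]lcomp1m -e lcompD -!lcompA (h1 (lcomp p1 x)) (h2 (lcomp p2 x)) !lcomp0r addr0.
Qed.

(* The cokernel in [H] drops the summands of the cokernel of modules that leave degree [0]. *)
Lemma Hp_cokernel X Y (f : lhom X Y) : Hp SD X -> Hp SD Y ->
  exists Z (c : lhom Y Z), [/\ Hp SD Z, tail (fun n => epiT (T n) c) & tail (fun n => exT (T n) f c)].
Proof.
move=> hX hY; have [n [cX cY]] := tail_ex (tail_and (Hp_tail hX) (Hp_tail hY)).
have [Q [c0 [cQ e0 x0]]] := conc_cokernel hL (tm n f) cY.
have tl := tail_rexact cX cY cQ e0 x0.
have [|B [G [i1 [i2 [p1 [p2 [sB sG [_ h22 _ _ h]]]]]]]] := @sums_split _ _ D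
   (fun P => [/\ conc P, indecD P & ~ good SD P]) (fun P => [/\ conc P, indecD P & good SD P]) Q.
  apply: sums_weaken (conc_sums hL cQ) => P _ [cP iP].
  by have [g|g] := pselect (good SD P); [right|left].
have gG : good SD G by apply: sums_good sG => // P [].
have [phi [psi [pp pp']]] := isoE (iter_tauiK SD n G).
have [c cE] := tm_full (lcomp psi (lcomp p2 c0)).
have [N hN] := bad_tail sB.
have sp A : nohom A B -> epiT A c0 /\ exT A (tm n f) c0 ->
    epiT A (tm n c : lhom _ _) /\ exT A (tm n f : lhom _ _) (tm n c : lhom _ _).
  move=> nA [ea xa]; split=> z.
    have [y hy] := ea (lcomp i2 (lcomp phi z)); exists y.
    by rewrite cE -!lcompA hy (lcompKl h22) (lcompKl pp).
  rewrite -xa cE -!lcompA; split=> [e|->]; last by rewrite !lcomp0r.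
  rewrite -[lcomp c0 z]lcomp1m -h lcompD -!lcompA (nA (lcomp p1 (lcomp c0 z))) lcomp0r add0r.
  by rewrite -[lcomp p2 _](lcompKl pp') e !lcomp0r.
have key m : (N + n <= m)%N -> epiT (T m) c /\ exT (T m) f c.
  move=> hm; have [|s1 s2] := sp (T (m - n)) _ (tl (m - n)%N); first by apply: hN; lia.
  have e : iter n t (T (m - n)) = T m by rewrite -iterD subnKC //; lia.
  by rewrite -e -epiT_tm -exT_tm.
exists (iter n t G), c; split.
- by exists n; apply: good_iso gG; apply: isomorphic_sym; apply: iter_tauiK.
- by exists (N + n)%N => m /key [].
by exists (N + n)%N => m /key [].
Qed.

End Tails.

Lemma eqN1 (K : fieldType) (V : lmodType K) (x y : V) : -1 *: x + y = 0 -> y = x.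
Proof. by rewrite scaleN1r addrC => /eqP; rewrite subr_eq0 => /eqP. Qed.

(** * Graded modules *)

Section GradedConstructions.
Variables (K : fieldType) (A : gr_alg K).
Implicit Types (M N P : gr_mod A).

Lemma ghN M N (f : gr_hom M N) n (x : M n) : f n (- x) = - f n x.
Proof. by have := gh_lin f (-1) x 0; rewrite gr_hom0 !scaleN1r !addr0. Qed.

Lemma ghD M N (f : gr_hom M N) n (x y : M n) : f n (x + y) = f n x + f n y.
Proof. by have := gh_lin f 1 x y; rewrite !scale1r. Qed.

Lemma ghB M N (f : gr_hom M N) n (x y : M n) : f n (x - y) = f n x - f n y.
Proof. by rewrite ghD ghN. Qed.

Lemma gact0r M n q m (e : n + q%:Z = m) (x : M n) : gact e x (0 : A q) = 0.
Proof. by have := gact_linr e (-1) x 0 0; rewrite !scaleN1r !addNr. Qed.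

(** Graded analogue of [mhom_of_rel]. *)
Lemma gr_hom_of_rel M N (R : forall n, M n -> N n -> Prop) :
  (forall n k x x' y y', R n x y -> R n x' y' -> R n (k *: x + x') (k *: y + y')) ->
  (forall n q m (e : n + q%:Z = m) x y (a : A q), R n x y -> R m (gact e x a) (gact e y a)) ->
  (forall n x, exists y, R n x y) -> (forall n y, R n 0 y -> y = 0) ->
  exists f : gr_hom M N, forall n x, R n x (f n x).
Proof.
move=> Rl Ra Rt R0.
have Ru n x y y' : R n x y -> R n x y' -> y = y'.
  move=> h h'; apply/eqP; rewrite -subr_eq0; apply/eqP/R0.
  by have := Rl _ (-1) _ _ _ _ h' h; rewrite !scaleN1r addNr addrC.
pose f n x := projT1 (cid (Rt n x)).
have fP n x : R n x (f n x) := projT2 (cid (Rt n x)).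
unshelve eexists.
  unshelve refine (@GrHom _ _ M N f _ _).
  - by move=> n k x y; apply: Ru (fP _ _) _; apply: Rl.
  - by move=> n q m e x a; apply: Ru (fP _ _) _; apply: Ra.
exact: fP.
Qed.

Section Sub.
Variables (M : gr_mod A) (U : forall n, M n -> Prop).
Hypothesis cU : gr_submodule U.

Lemma gsub_lclosed n : lclosed (@U n).
Proof. by case: cU => h1 h2 _; split; [apply: h1|apply: h2]. Qed.

Lemma gsub_act n q m (e : n + q%:Z = m) (x : sublm (gsub_lclosed n)) (a : A q) :
  U (gact e (sub_val x) a).
Proof. by case: cU => _ _; apply; apply: sub_valP. Qed.

Definition gsub : gr_mod A.
Proof.
refine (@GrMod K A (fun n => sublm (gsub_lclosed n))
  (fun n q m e x a => sub_mk (gsub_lclosed m) (gsub_act e x a)) _ _ _ _).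
- by move=> n q m e k x y z; apply: sub_val_inj; rewrite /= gact_linl.
- by move=> n q m e k x y z; apply: sub_val_inj; rewrite /= gact_linr.
- by move=> n e x; apply: sub_val_inj; rewrite /= gact1.
- by move=> n q r m k l e1 e2 e3 e4 x y z; apply: sub_val_inj; rewrite /= (gactA e1 e2 e3 e4).
Defined.

Definition ginc : gr_hom gsub M.
Proof. by refine (@GrHom _ _ gsub M (fun n => @sub_val K (M n) (@U n) (gsub_lclosed n)) _ _). Defined.

Lemma ginc_inj n : injective (ginc n).
Proof. exact: sub_val_inj. Qed.

Lemma ginc_im n x : U x <-> exists y, ginc n y = x.
Proof.
split=> [h|[y <-]]; last exact: sub_valP.
by exists (sub_mk (gsub_lclosed n) h).
Qed.

Lemma quo_gact n q m (e : n + q%:Z = m) (x : M n) (a : A q) :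
  quo_pi (gsub_lclosed m) (gact e (quo_repr (quo_pi (gsub_lclosed n) x)) a) =
  quo_pi (gsub_lclosed m) (gact e x a).
Proof.
have h := quo_repr_pi (gsub_lclosed n) x.
apply/quo_piE; case: cU => _ _ /(_ n q m e _ a h).
move: (quo_repr _) => y.
have := gact_linl e (-1) x y a; rewrite !scaleN1r addrC => ->.
by rewrite addrC.
Qed.

Definition gquo : gr_mod A.
Proof.
refine (@GrMod K A (fun n => quolm (gsub_lclosed n))
  (fun n q m e x a => quo_pi (gsub_lclosed m) (gact e (quo_repr x) a)) _ _ _ _).
- move=> n q m e k x y a; rewrite -(quo_reprK x) -(quo_reprK y) -(quo_pi_lin (gsub_lclosed n)).
  by rewrite !quo_gact gact_linl (quo_pi_lin (gsub_lclosed m)).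
- by move=> n q m e k x a b; rewrite gact_linr (quo_pi_lin (gsub_lclosed m)).
- by move=> n e x; rewrite gact1 quo_reprK.
- by move=> n q r m k l e1 e2 e3 e4 x a b; rewrite quo_gact (gactA e1 e2 e3 e4).
Defined.

Definition gpi : gr_hom M gquo.
Proof.
refine (@GrHom _ _ M gquo (fun n => @quo_pi K (M n) (@U n) (gsub_lclosed n)) _ _).
- by move=> n; apply: quo_pi_lin.
- by move=> n q m e x a /=; rewrite quo_gact.
Defined.

Lemma gpi_surj n (y : gquo n) : exists x, gpi n x = y.
Proof. by exists (quo_repr y); apply: quo_reprK. Qed.

Lemma gpi_ker n x : gpi n x = 0 <-> U x.
Proof.
have e : gpi n x = 0 <-> U (x - 0); last by rewrite e subr0.
rewrite -(quo_piE (gsub_lclosed n)); split=> [h|h]; first by rewrite [LHS]h -(gr_hom0 gpi).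
by rewrite [LHS]h; apply: (gr_hom0 gpi).
Qed.
End Sub.

Lemma gr_factor_surj M N P (p : gr_hom M N) (f : gr_hom M P) :
  (forall n y, exists x, p n x = y) -> (forall n x, p n x = 0 -> f n x = 0) ->
  exists g : gr_hom N P, forall n x, g n (p n x) = f n x.
Proof.
move=> ps pf.
have [||||g hg] := @gr_hom_of_rel N P (fun n y z => exists x, p n x = y /\ f n x = z).
- by move=> n k _ _ _ _ [x [<- <-]] [x' [<- <-]]; exists (k *: x + x'); rewrite !gh_lin.
- by move=> n q m e _ _ a [x [<- <-]]; exists (gact e x a); rewrite !gh_act.
- by move=> n y; have [x <-] := ps n y; exists (f n x), x.
- by move=> n y [x [/pf h <-]].
exists g => n x; have [x' [e <-]] := hg n (p n x).
apply/eqP; rewrite -subr_eq0 -ghB; apply/eqP/pf; by rewrite ghB e subrr.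
Qed.

Lemma gr_factor_inj M N P (i : gr_hom N P) (f : gr_hom M P) :
  (forall n y, i n y = 0 -> y = 0) -> (forall n x, exists y, i n y = f n x) ->
  exists g : gr_hom M N, forall n x, i n (g n x) = f n x.
Proof.
move=> ii fi; apply: (@gr_hom_of_rel M N (fun n x y => i n y = f n x)) => //.
- by move=> n k x x' y y' h h'; rewrite !gh_lin h h'.
- by move=> n q m e x y a h; rewrite !gh_act h.
- by move=> n y; rewrite gr_hom0; apply: ii.
Qed.

Lemma gim_closed M N (f : gr_hom M N) : gr_submodule (fun n y => exists x, f n x = y).
Proof.
split=> [n|n k _ _ [x <-] [y <-]|n q m e _ a [x <-]]; first by exists 0; rewrite gr_hom0.
  by exists (k *: x + y); rewrite gh_lin.
by exists (gact e x a); rewrite gh_act.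
Qed.

Lemma gr_free_ext n (a : 'I_n -> int) (F : gr_mod A) (u : forall i, F (a i)) M (f g : gr_hom F M) :
  gr_free u -> (forall i, f _ (u i) = g _ (u i)) -> f = g.
Proof.
by move=> fu h; have [k [_ ku]] := fu M (fun i => g _ (u i)); rewrite -(ku f h) -(ku g).
Qed.

Lemma gr_free_lift n (a : 'I_n -> int) (F : gr_mod A) (u : forall i, F (a i)) M (x : forall i, M (a i)) :
  gr_free u -> exists f : gr_hom F M, forall i, f _ (u i) = x i.
Proof. by move=> fu; have [f [h _]] := fu M x; exists f. Qed.

Lemma gr_free_iso n (a : 'I_n -> int) (F G : gr_mod A) (u : forall i, F (a i)) (v : forall i, G (a i))
    (f : gr_hom F G) : gr_free u -> gr_free v -> (forall i, f _ (u i) = v i) ->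
  (forall n x, f n x = 0 -> x = 0) /\ forall n y, exists x, f n x = y.
Proof.
move=> fu fv h; have [g hg] := gr_free_lift u fv.
have gf : gr_comp g f = gr_id F by apply: (gr_free_ext fu) => i; rewrite /= h hg.
have fg : gr_comp f g = gr_id G by apply: (gr_free_ext fv) => i; rewrite /= hg h.
split=> [m x e|m y].
  have : gr_comp g f m x = x by rewrite gf.
  by rewrite /= e gr_hom0.
by exists (g m y); have : gr_comp f g m y = y by rewrite fg.
Qed.

Lemma gr_fp_free n (a : 'I_n -> int) (F : gr_mod A) (u : forall i, F (a i)) : gr_free u -> gr_fin_pres F.
Proof.
move=> fu; exists F, F, (gr_zero _ _), (gr_id _); split; try by exists n, a, u.
- by move=> m y; exists y.
- by move=> m y /=; split=> [->|[x <-]//]; exists 0.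
Qed.

End GradedConstructions.

(** * Free graded modules from powers of the translate *)

Section FreeGamma.
Variables (K : fieldType) (L : falgType K) (D : derived_cat L).
Variable SD : serre_duality D.
Hypothesis hL : hereditary L.
Hypothesis L_connected : connected L.
Hypothesis L_infinite : infinite_type L.
Local Notation O := (Lambda D).
Local Notation t := (tau SD).
Local Notation ti := (taui SD).
Local Notation A := (preproj_alg SD).
Local Notation tp := (tp SD).
Local Notation G := (gamma_obj SD).
Local Notation Gm := (gamma_map SD).
Implicit Types (X Y Z W Q : D).

Lemma is_iso_iter (F : functor D D) p X Y (f : lhom X Y) : @is_iso D _ _ f -> @is_iso D _ _ (iter_map F p f).
Proof. by move=> h; elim: p => //= p; apply: fmap_iso. Qed.

Lemma is_iso_id X : @is_iso D _ _ (idm X).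
Proof. by exists (idm X); rewrite comp1m. Qed.

Lemma tp_step_iso n X : @is_iso D _ _ (tp_step SD n X).
Proof. by case: n => [n|[|n]] /=; [apply: is_iso_id|apply: tau_counit_iso|apply: tau_counit_iso]. Qed.

Lemma tp_steps_iso n q X : @is_iso D _ _ (tp_steps SD n q X).
Proof.
elim: q => [|q IH] /=; first exact: is_iso_id.
apply: is_iso_comp; [exact: tp_step_iso|exact: fmap_iso].
Qed.

Lemma tp_cast_iso n m (e : n = m) X : @is_iso D _ _ (tp_cast SD e X).
Proof. by case: m / e; apply: is_iso_id. Qed.

Lemma tp_add_iso n q m (e : n + q%:Z = m) X : @is_iso D _ _ (tp_add SD e X).
Proof. by apply: is_iso_comp; [apply: tp_cast_iso|apply: tp_steps_iso]. Qed.

Lemma tp_full n X Y (g : lhom (tp n X) (tp n Y)) : exists f : lhom X Y, tp_map SD n f = g.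
Proof.
case: n g => n g; first exact: tm_full.
elim: n g => [|n IH] g; first exact: tau_full.
by have [g' <-] := tau_full g; have [f <-] := IH g'; exists f.
Qed.

Lemma tp_faithful n X Y (f g : lhom X Y) : tp_map SD n f = tp_map SD n g -> f = g.
Proof.
case: n => n; first exact: tm_faithful.
by elim: n => [|n IH] /(tau_faithful) // /IH.
Qed.

Lemma tp_lin n X Y : lin (fun f : lhom X Y => tp_map SD n f : lhom (tp n X) (tp n Y)).
Proof. by case: n => n; apply: iter_map_lin; [apply: taui_linear|apply: tau_linear]. Qed.

Lemma tpL n X Y Z (g : lhom Y Z) (f : lhom X Y) :
  tp_map SD n (lcomp g f) = lcomp (tp_map SD n g : lhom (tp n Y) (tp n Z)) (tp_map SD n f).
Proof. exact: (@tp_mapM _ _ _ SD n). Qed.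

Lemma tpL1 n X : tp_map SD n (lidm X) = lidm (tp n X).
Proof. exact: (@tp_map1 _ _ _ SD n). Qed.

Lemma tp_ess_surj n Y : exists Q, @isomorphic D (tp n Q) Y.
Proof. by case: n => n; [exists (iter n t Y); apply: iter_tauiK|exists (iter n.+1 ti Y); apply: iter_tauK]. Qed.

(* [w] exhibits [Q] as [tau^a Lambda]. *)
Definition generator (a : int) Q (w : lhom O (tp a Q)) : Prop := @is_iso D _ _ w.

Lemma generator_exists a : exists Q w, @generator a Q w.
Proof. by have [Q /isomorphic_sym [w hw]] := tp_ess_surj a O; exists Q, w. Qed.

Lemma generator_Hp a Q w : @generator a Q w -> Hp SD Q.
Proof.
move=> gw; have i : @isomorphic D O (tp a Q) by exists w.
have gO := good_Lambda SD hL L_connected L_infinite.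
case: a w gw i => n w _ i; first by exists n; apply: good_iso i gO.
exists 0%N; apply: (good_iso (X := iter n.+1 ti O)); last exact: good_iter.
apply: isomorphic_trans (iter_isomorphic ti n.+1 i) _; exact: iter_tauiK.
Qed.

(** Acting on [w] is composition with an isomorphism from [tau^-q Lambda] to [tau^-n Q]. *)
Lemma generator_act a Q w n q (e : a + q%:Z = n) : @generator a Q w ->
  (forall y : G Q n, exists c : A q, y = @gact _ A (G Q) a q n e w c) /\
  (forall c : A q, @gact _ A (G Q) a q n e w c = 0 -> c = 0).
Proof.
move=> gw.
have : @is_iso D _ _ (tp_add SD e Q \oc iter_map ti q w).
  by apply: is_iso_comp; [apply: tp_add_iso|apply: is_iso_iter].
have E c : @gact _ A (G Q) a q n e w c = lcomp (tp_add SD e Q \oc iter_map ti q w : lhom _ _) c.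
  exact: (@compA D).
move: (tp_add SD e Q \oc iter_map ti q w) E => u E [h [h1 h2]].
have h1' : lcomp (h : lhom _ _) u = lidm _ := h1; have h2' : lcomp (u : lhom _ _) h = lidm _ := h2.
split=> [y|c]; first by exists (lcomp (h : lhom _ _) y); rewrite E lcompA h2' lcomp1m.
by rewrite E => e0; rewrite -[c]lcomp1m -h1' -lcompA e0 lcomp0r.
Qed.

Lemma tp_add_isomorphic n q X : @isomorphic D (iter q ti (tp n X)) (tp (n + q%:Z) X).
Proof. by exists (tp_add SD (erefl (n + q%:Z)) X); apply: tp_add_iso. Qed.

Lemma generator_vanish a Q w n : @generator a Q w -> n < a -> nohom O (tp n Q).
Proof.
move=> gw na; pose q := `|a - n|%N.
have e : n + q%:Z = a by rewrite /q; lia.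
have q0 : (0 < q)%N by rewrite /q; lia.
apply/(nohom_iter_taui SD q).
apply: nohom_iso (isomorphic_refl _) (isomorphic_sym (tp_add_isomorphic n q Q)) _; rewrite e.
apply: nohom_iso (isomorphic_refl _) (_ : @isomorphic D O _) _; first by exists w.
case: q q0 {e} => // q _.
have h : nohom O (iter q.+1 t O) by apply: Lambda_tau_nohom.
have /(nohom_iter_taui SD q.+1) h' := h.
exact: nohom_iso (isomorphic_refl _) (iter_tauiK SD q.+1 O) h'.
Qed.

(* Uses [Hom(Lambda, tau^k Lambda) = 0] for [k > 0], so that nothing lives in degrees below [a]. *)
Lemma generator_free a Q w : @generator a Q w ->
  @gr_free _ A 1 (fun _ => a) (G Q) (fun _ => w).
Proof.
move=> gw M x'; pose x := x' ord0.
have act n q (e : a + q%:Z = n) := generator_act e gw.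
have van n : n < a -> forall y : G Q n, y = 0 by move=> h; apply: generator_vanish gw h.
have deg n : a <= n -> a + `|n - a|%N%:Z = n by lia.
(* In degrees from [a] on, every element is [w c] for a unique [c] and goes to [x c]; the second
   clause settles the degrees below [a], where [Gamma(Q)] is zero. *)
pose R n (y : G Q n) (z : M n) := (forall q (e : a + q%:Z = n) c,
   y = @gact _ A (G Q) a q n e w c -> z = gact e x c) /\ (n < a -> z = 0).
have [||||h hR] := @gr_hom_of_rel _ A (G Q) M R.
- move=> n k y y' z z' [h1 h2] [h1' h2']; split=> [q e c yE|na]; last by rewrite h2 // h2' // scaler0 addr0.
  have [s i] := act n q e; have [d dE] := s y; have [d' dE'] := s y'.
  have -> : c = k *: d + d'.
    apply: eqN1; apply: i.
    by rewrite !(gact_linr (g := G Q)) -dE -dE' -yE scaleN1r addNr.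
  by rewrite gact_linr -(h1 q e d dE) -(h1' q e d' dE').
- move=> n q m e y z b [h1 h2]; split=> [r e' c yE|ma]; last first.
    by rewrite h2 ?gact0l //; lia.
  have [na|an] := boolP (n < a).
    have [_ i] := act m r e'; rewrite (h2 na) gact0l (i c) ?gact0r //.
    by rewrite -yE (van n na y) gact0l.
  have an' : a <= n by lia.
  have [s _] := act n _ (deg n an'); have [d dE] := s y.
  have rE : (`|n - a| + q)%N = r by lia.
  have [_ i] := act m r e'.
  have -> : c = gmul rE d b.
    apply: eqN1; apply: i.
    rewrite (gact_linr (g := G Q)) -yE dE (gactA _ e rE e').
    by rewrite scaleN1r addNr.
  by rewrite -(gactA (deg n an') e rE e') -(h1 _ _ d dE).
- move=> n y; have [na|an] := boolP (n < a).
    exists 0; split=> // q e c yE; have [_ i] := act n q e.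
    by rewrite (i c) ?gact0r // -yE; apply: van.
  have an' : a <= n by lia.
  have [s i] := act n _ (deg n an'); have [d dE] := s y.
  exists (gact (deg n an') x d); split=> [q e c yE|]; last by lia.
  have qE : q = `|n - a|%N by lia.
  subst q; rewrite (Prop_irrelevance e (deg n an')) in yE *.
  congr (gact _ _ _); apply: eqN1; apply: i.
  by rewrite (gact_linr (g := G Q)) -dE -yE scaleN1r addNr.
- move=> n z [h1 h2]; have [na|an] := boolP (n < a); first exact: h2.
  have an' : a <= n by lia.
  by rewrite (h1 _ (deg n an') 0) ?gact0r.
have w1 : w = @gact _ A (G Q) a 0 a (addr0 a) w (gone A) by rewrite (gact1 (g := G Q)).
exists h; split=> [i|h' hh'].
  have -> : i = ord0 by apply/val_inj; case: i => -[].
  by rewrite ((hR a w).1 _ _ _ w1) gact1.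
apply: gr_hom_eq => n y; have [na|an] := boolP (n < a).
  by rewrite (van n na y) !gr_hom0.
have an' : a <= n by lia.
have [s i] := act n _ (deg n an'); have [d dE] := s y.
by rewrite ((hR n y).1 _ _ d dE) dE gh_act (hh' ord0).
Qed.

(** Head and tail for dependent families: the casts between [k] and [lift ord0 j] are confined to
    this proof. *)
Lemma ord_family n (T : 'I_n.+1 -> Type) (x0 : T ord0) (xs : forall j, T (lift ord0 j)) :
  exists f : forall k, T k, f ord0 = x0 /\ forall j, f (lift ord0 j) = xs j.
Proof.
have ex k : exists x : T k, (forall e : ord0 = k, x = eq_rect _ T x0 _ e) /\
    (forall j (e : lift ord0 j = k), x = eq_rect _ T (xs j) _ e).
  case: (unliftP ord0 k) => [j kE|kE]; subst k.
    exists (xs j); split=> [e|j' e]; first by have /eqP/(_ e) := neq_lift ord0 j.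
    by have e' := lift_inj e; subst j'; rewrite (eq_irrelevance e erefl).
  exists x0; split=> [e|j e]; first by rewrite (eq_irrelevance e erefl).
  by have /eqP/(_ (esym e)) := neq_lift ord0 j.
have [f hf] := dchoice ex; exists f.
by split=> [|j]; [exact: ((hf ord0).1 erefl)|exact: ((hf _).2 j erefl)].
Qed.

Lemma dsum_exists n (Q : 'I_n -> D) : exists X i p, @dsum _ _ D n Q X i p.
Proof.
elim: n Q => [|n IH] Q.
  have [Z Z0] := derived_zero D; exists Z, (fun k => 0), (fun k => 0).
  by split=> [[]//|[]//|]; rewrite big_ord0.
have [X [i [p [h1 h2 h3]]]] := IH (fun k => Q (lift ord0 k)).
have [Y [i1 [i2 [p1 [p2 [h11 h22 h12 h21 h]]]]]] := derived_biprod (Q ord0) X.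
have [I [I0 IS]] := @ord_family n (fun k => lhom (Q k) Y) i1 (fun j => lcomp i2 (i j)).
have [P [P0 PS]] := @ord_family n (fun k => lhom Y (Q k)) p1 (fun j => lcomp (p j) p2).
exists Y, I, P; split=> [k|j k|].
- case: (unliftP ord0 k) => [j|] ->; last by rewrite I0 P0.
  by rewrite IS PS -lcompA (lcompKl h22) h1.
- case: (unliftP ord0 j) => [j'|] ->; case: (unliftP ord0 k) => [k'|] -> // jk.
  + by rewrite IS PS -lcompA (lcompKl h22) h2 // => e; apply: jk; rewrite e.
  + by rewrite I0 PS -lcompA h21 lcomp0r.
  by rewrite P0 IS lcompA h12 lcomp0l.
rewrite big_ord_recl I0 P0 -[RHS]h; congr (_ + _).
rewrite -[p2 in RHS]lcomp1m -h3 lcomp_suml lcomp_sumr; apply: eq_bigr => k _.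
by rewrite IS PS !lcompA.
Qed.

(** [Gamma] of a direct sum is the direct sum of the [Gamma(Q k)], each free of rank one on
    [w k]. *)
Lemma dsum_free n (a : 'I_n -> int) (Q : 'I_n -> D) (w : forall k, lhom O (tp (a k) (Q k))) X i p :
  @dsum _ _ D n Q X i p -> (forall k, generator (w k)) ->
  @gr_free _ A n a (G X) (fun k => lcomp (tp_map SD (a k) (i k) : lhom _ _) (w k)).
Proof.
move=> [h1 h2 h3] gw M x.
have /dchoice [h hh] k : exists h : gr_hom (G (Q k)) M, h (a k) (w k) = x k.
  by have [h [e _]] := generator_free (gw k) (fun _ => x k); exists h; apply: (e ord0).
pose R m (y : G X m) (z : M m) := z = \sum_k h k m (Gm (p k) m y).
have [||||f fE] := @gr_hom_of_rel _ A (G X) M R.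
- move=> m c y y' z z' -> ->; rewrite /R scaler_sumr -big_split; apply: eq_bigr => k _.
  by rewrite !gh_lin.
- move=> m q m' e y z b ->; rewrite /R (lin_sum (fun c u v => gact_linl e c u v b)).
  by apply: eq_bigr => k _; rewrite !gh_act.
- by move=> m y; exists (\sum_k h k m (Gm (p k) m y)).
- by move=> m z ->; rewrite big1 // => k _; rewrite !gr_hom0.
exists f; split=> [k|f' hf'].
  rewrite fE (bigD1 k) //= big1 => [|j jk].
    rewrite addr0 -[RHS]hh; congr (h k _ _); rewrite lcompE lcompA -tpL h1 tpL1.
    exact: lcomp1m.
  rewrite -[RHS](gr_hom0 (h j)); congr (h j _ _); rewrite lcompE lcompA -tpL h2 //.
    by rewrite (lin0 (@tp_lin _ _ _)) lcomp0l.
  by apply/eqP.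
apply: gr_hom_eq => m y; rewrite fE.
have yE : y = \sum_k Gm (i k) m (Gm (p k) m y).
  rewrite -[LHS](lcomp1m (y : lhom O (tp m X))) -tpL1 -h3 (lin_sum (@tp_lin m X X)) lcomp_suml.
  by apply: eq_bigr => k _; rewrite tpL -lcompA.
rewrite [in RHS]yE (lin_sum (@gh_lin _ _ _ _ f' m)); apply: eq_bigr => k _.
have e : h k = gr_comp f' (Gm (i k)).
  by apply: (gr_free_ext (generator_free (gw k))) => j; rewrite hh /= hf'.
by rewrite e.
Qed.

End FreeGamma.

(** * The left adjoint *)

Section Adjoint.
Variables (K : fieldType) (L : falgType K) (D : derived_cat L).
Variable SD : serre_duality D.
Hypothesis hL : hereditary L.
Hypothesis L_connected : connected L.
Hypothesis L_infinite : infinite_type L.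
Local Notation O := (Lambda D).
Local Notation t := (tau SD).
Local Notation T n := (iter n t O).
Local Notation A := (preproj_alg SD).
Local Notation tp := (tp SD).
Local Notation G := (gamma_obj SD).
Local Notation Gm := (gamma_map SD).
Implicit Types (X Y Z Q : D) (M N : gr_mod A).

Lemma GmL X Y Z (g : lhom Y Z) (f : lhom X Y) n x : Gm (lcomp g f) n x = Gm g n (Gm f n x).
Proof. by rewrite /= !lcompE (tpL SD) lcompA. Qed.

Lemma Gm1 X n x : Gm (lidm X) n x = x.
Proof. by rewrite /= lcompE (tpL1 SD); apply: lcomp1m. Qed.

Lemma Gm_lin X Y n x : lin (fun f : lhom X Y => Gm f n x : G Y n).
Proof. by move=> k f g; rewrite /= !lcompE (tp_lin SD n k f g) lcompDl_. Qed.

(** A universal arrow from [M] to [Gamma]. The last clause goes beyond the adjunction; it is carried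
    along because exactness and invertibility are tested in large degrees. *)
Definition univ M X (eta : gr_hom M (G X)) : Prop :=
  [/\ Hp SD X,
      forall Y, Hp SD Y -> forall h : gr_hom M (G Y), exists f : lhom X Y,
        forall n x, Gm f n (eta n x) = h n x,
      forall Y, Hp SD Y -> forall f : lhom X Y, (forall n x, Gm f n (eta n x) = 0) -> f = 0
    & tail (fun m => (forall x, eta (Posz m) x = 0 -> x = 0) /\
                     forall y, exists x, eta (Posz m) x = y)].

(** A map from a free module to [Gamma(Y)] is a family of elements of degrees [a k], that is, of
    maps [tau^(a k) Lambda -> Y]; the direct sum of these powers represents such families. *)
Lemma univ_free n (a : 'I_n -> int) (F : gr_mod A) (u : forall i, F (a i)) : gr_free u ->
  exists X (eta : gr_hom F (G X)), univ eta /\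
    forall m, (forall x, eta m x = 0 -> x = 0) /\ forall y, exists x, eta m x = y.
Proof.
move=> fu.
have [Q /dchoice [w gw]] := choice (fun k => generator_exists SD (a k)).
have [X [i [p dX]]] := dsum_exists Q; have [h1 h2 h3] := dX.
have fv := dsum_free hL L_connected L_infinite dX gw.
have [eta hu] := gr_free_lift (fun k => lcomp (tp_map SD (a k) (i k) : lhom _ _) (w k) : G X (a k)) fu.
have [ei es] := gr_free_iso fu fv hu.
exists X, eta; split; last by move=> m; split; [apply: ei|apply: es].
split.
- by apply: (Hp_sum h3) => k; apply: (generator_Hp hL L_connected L_infinite (gw k)).
- move=> Y _ h.
  have /dchoice [f hf] k : exists f : lhom (Q k) Y, lcomp (tp_map SD (a k) f) (w k) = h _ (u k).
    have [w' [w1 w2]] := gw k.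
    have [f fE] := tp_full (n := a k) (lcomp (h _ (u k) : lhom O (tp (a k) Y)) w').
    exists f; rewrite fE -lcompA -[RHS]lcompm1; congr (lcomp _ _); exact: w1.
  exists (\sum_k lcomp (f k) (p k)).
  suff e : gr_comp (Gm (\sum_k lcomp (f k) (p k))) eta = h by move=> m x; rewrite -e.
  apply: (gr_free_ext fu) => k; rewrite [LHS]/= hu.
  rewrite lcompE lcompA -tpL lcomp_suml (bigD1 k) //= big1 => [|j jk].
    by rewrite -lcompA h1 lcompm1 addr0 hf.
  by rewrite -lcompA h2 ?lcomp0r //; apply/eqP.
- move=> Y _ f h; rewrite -[f]lcompm1 -h3 lcomp_sumr big1 // => k _; rewrite lcompA.
  suff -> : lcomp f (i k) = 0 by rewrite lcomp0l.
  have [w' [w1 w2]] := gw k.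
  apply: (@tp_faithful _ _ _ SD (a k)); rewrite (lin0 (@tp_lin _ _ _ SD _ _ _)).
  rewrite -[LHS]lcompm1 -(w2 : lcomp (w k) (w' : lhom _ _) = lidm _) lcompA.
  have := h _ (u k); rewrite hu /= !lcompE lcompA -tpL => ->.
  by rewrite lcomp0l.
by exists 0%N => m _; split; [apply: ei|apply: es].
Qed.

Lemma gr_map_tail X Y Z (f : lhom X Y) (g : lhom Y Z) m : epiT (T m) g /\ exT (T m) f g ->
  (forall z, exists y, Gm g (Posz m) y = z) /\
  forall y, Gm g (Posz m) y = 0 <-> exists x, Gm f (Posz m) x = y.
Proof. by move=> [/epiT_tm e /exT_tm h]; split; [exact: e|exact: h]. Qed.

(** [X] is the cokernel in [H] of the map between the objects attached to [F1] and [F0]. In large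
    degrees [M] and [Gamma(X)] are both cokernels of the same map [F1 -> F0]. *)
Lemma univ_exists M : gr_fin_pres M -> exists X (eta : gr_hom M (G X)), univ eta.
Proof.
move=> [F1 [F0 [f [p [[n1 [a1 [u1 fu1]]] [n0 [a0 [u0 fu0]]] ps px]]]]].
have [X1 [e1 [[H1 l1 z1 t1] b1]]] := univ_free fu1.
have [X0 [e0 [[H0 l0 z0 t0] b0]]] := univ_free fu0.
have [d dE] := l1 X0 H0 (gr_comp e0 f).
have [Z [c [HZ ct xt]]] := Hp_cokernel hL L_connected L_infinite d H1 H0.
have cd : lcomp c d = 0.
  apply: (tail_zero hL H1 HZ); apply: tail_imp xt => m h x; rewrite -lcompA; apply/h.
  by exists x.
have [|eta etaE] := gr_factor_surj (p := p) (f := gr_comp (Gm c) e0) ps.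
  move=> n x /px [y <-]; rewrite [LHS]/= -/(gr_comp e0 f n y).
  have := dE n y => /= <-; rewrite -[LHS]/(Gm c n (Gm d n (e1 n y))) -GmL cd.
  exact: (lin0 (@Gm_lin _ _ _ _)).
exists Z, eta; split=> //.
- move=> Y HY h; have [g gE] := l0 Y HY (gr_comp h p).
  have gd : lcomp g d = 0.
    apply: z1 => // n x; rewrite GmL dE -[gr_comp e0 f n x]/(e0 n (f n x)) gE /=.
    by rewrite (px _ _).2 ?gr_hom0 //; exists x.
  have [k [kc _]] := tail_cokernel hL H0 HZ HY ct xt gd.
  exists k => n y; have [x <-] := ps n y; rewrite etaE -[gr_comp _ _ n x]/(Gm c n (e0 n x)).
  by rewrite -GmL kc gE.
- move=> Y HY k h; have kc : lcomp k c = 0.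
    by apply: z0 => // n x; rewrite GmL -[Gm c n (e0 n x)]/(gr_comp (Gm c) e0 n x) -etaE h.
  have c0 : lcomp (0 : lhom X0 Y) d = 0 by rewrite lcomp0l.
  have [u [_ uu]] := tail_cokernel hL H0 HZ HY ct xt c0.
  by rewrite (uu k kc) -(uu 0) // lcomp0l.
apply: tail_imp (tail_and ct xt) => m /gr_map_tail [cs cx].
have [e0i e0s] := b0 (Posz m); have [_ e1s] := b1 (Posz m); split=> [y|z].
  have [x <-] := ps _ y; rewrite etaE => /cx [v vE]; apply/px.
  have [x' x'E] := e1s v; exists x'; apply/eqP; rewrite -subr_eq0; apply/eqP/e0i.
  rewrite ghB -vE -x'E dE /= subrr //.
have [v <-] := cs z; have [x <-] := e0s v; exists (p _ x); exact: etaE.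
Qed.

Lemma Lambda_Hp : Hp SD O.
Proof. by exists 0%N; apply: good_Lambda. Qed.

(** A map out of the regular module is given by the image of [1], an element of [Hom(Lambda, Y)]; so
    [Lambda] has the same universal property as [X]. *)
Lemma univ_regular X (e : gr_hom (gr_regular A) (G X)) : univ e -> @isomorphic D X O.
Proof.
move=> [HX l z _]; pose r := @reg_hom K A (G O) (lidm O : lhom O (tp 0 O)).
have fr := @gr_free_regular K A.
have r1 : r 0 (gone A) = lidm O by exact: (gact1 (g := G O)).
have Gmx Y (f : lhom O Y) : Gm f 0 (r 0 (gone A)) = f by rewrite r1; exact: (@lcompm1 _ D).
have u Y (h : gr_hom (gr_regular A) (G Y)) n x :
    Gm (h 0 (gone A) : lhom O Y) n (r n x) = h n x.
  suff e' : gr_comp (Gm (h 0 (gone A) : lhom O Y)) r = h by rewrite -[in RHS]e'.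
  by apply: (gr_free_ext fr) => i; exact: Gmx.
have [f fE] := l O Lambda_Hp r; pose g : lhom O X := e 0 (gone A).
have gf : lcomp g f = lidm X.
  apply/eqP; rewrite -subr_eq0; apply/eqP/z => // n x.
  by rewrite (linB (@Gm_lin _ _ n _)) Gm1 GmL fE u subrr.
have fg : lcomp f g = lidm O.
  rewrite -[LHS]Gmx GmL Gmx; exact: etrans (fE 0 (gone A)) r1.
by exists f, g.
Qed.

Local Notation gr := (grmod A).
Local Notation car := (@proj1_sig (GrModCat A) _).
Implicit Types (U V : gr).

Definition hcat X (hX : Hp SD X) : Hcat D :=
  exist _ X (Hp_inH hL L_connected L_infinite hX).

Lemma hcat_Hp (Y : Hcat D) : Hp SD (proj1_sig Y).
Proof. apply: inH_Hp => //; exact: (proj2_sig Y). Qed.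

Definition Tob U : D := projT1 (cid (univ_exists (proj2_sig U))).
Definition eta U : gr_hom (car U : gr_mod A) (G (Tob U)) :=
  projT1 (cid (projT2 (cid (univ_exists (proj2_sig U))))).
Lemma eta_univ U : univ (eta U).
Proof. exact: projT2 (cid (projT2 (cid (univ_exists (proj2_sig U))))). Qed.

Lemma Tob_Hp U : Hp SD (Tob U). Proof. by case: (eta_univ U). Qed.

Lemma eta_lift U Y (h : gr_hom (car U : gr_mod A) (G Y)) : Hp SD Y ->
  exists f : lhom (Tob U) Y, forall n x, Gm f n (eta U n x) = h n x.
Proof. by move=> HY; case: (eta_univ U) => _ l _ _; apply: l. Qed.

Lemma eta_eq U Y (f g : lhom (Tob U) Y) : Hp SD Y ->
  (forall n x, Gm f n (eta U n x) = Gm g n (eta U n x)) -> f = g.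
Proof.
move=> HY h; case: (eta_univ U) => _ _ z _; apply/eqP; rewrite -subr_eq0; apply/eqP/z => // n x.
by rewrite (linB (@Gm_lin _ _ n _)) h subrr.
Qed.

Definition Tmap U V (u : gr_hom (car U : gr_mod A) (car V)) : lhom (Tob U) (Tob V) :=
  projT1 (cid (eta_lift (gr_comp (eta V) u) (Tob_Hp V))).

Lemma TmapE U V (u : gr_hom (car U : gr_mod A) (car V)) n x :
  Gm (Tmap u) n (eta U n x) = eta V n (u n x).
Proof. exact: (projT2 (cid (eta_lift (gr_comp (eta V) u) (Tob_Hp V)))). Qed.

Definition TF : functor gr (Hcat D).
Proof.
refine (@Functor gr (Hcat D) (fun U => hcat (Tob_Hp U)) (fun U V u => Tmap u) _ _).
- move=> U; apply: eta_eq => [|n x]; first exact: Tob_Hp.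
  by rewrite TmapE Gm1.
- move=> U V W v u; apply: eta_eq => [|n x]; first exact: Tob_Hp.
  by rewrite TmapE [RHS]GmL !TmapE.
Defined.

Lemma TF_adjoint : partial_left_adjoint TF.
Proof.
exists (fun U (Y : Hcat D) (f : lhom (Tob U) (proj1_sig Y)) => gr_comp (Gm f) (eta U)); split.
- move=> U Y.
  have ex (h : gr_hom (car U : gr_mod A) (G (proj1_sig Y))) :
      exists f : lhom (Tob U) (proj1_sig Y), gr_comp (Gm f) (eta U) = h.
    have [f fE] := eta_lift h (hcat_Hp Y); exists f; apply: gr_hom_eq => n x; exact: fE.
  have [g gE] := choice ex; exists g => [f|h]; last exact: gE.
  apply: eta_eq => [|n x]; first exact: hcat_Hp.
  have := gE (gr_comp (Gm f) (eta U)) => /(congr1 (fun h : gr_hom _ _ => h n x)); exact.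
- by move=> U Y k f g n x; apply: Gm_lin.
- by move=> U Y Y' g f; apply: gr_hom_eq => n x; apply: GmL.
move=> U V Y u f; apply: gr_hom_eq => n x.
transitivity (Gm f n (Gm (Tmap u) n (eta V n x))); first exact: GmL.
by rewrite TmapE.
Qed.

Lemma TF_regular : @isomorphic D (proj1_sig (TF (grmod_regular A))) O.
Proof. exact: univ_regular (eta_univ (grmod_regular A)). Qed.

End Adjoint.

(** * Exactness *)

Section Exactness.
Variables (K : fieldType) (L : falgType K) (D : derived_cat L).
Variable SD : serre_duality D.
Hypothesis hL : hereditary L.
Hypothesis L_connected : connected L.
Hypothesis L_infinite : infinite_type L.
Local Notation O := (Lambda D).
Local Notation t := (tau SD).
Local Notation T n := (iter n t O).
Local Notation A := (preproj_alg SD).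
Local Notation G := (gamma_obj SD).
Local Notation Gm := (gamma_map SD).
Local Notation gr := (grmod A).
Local Notation car := (@proj1_sig (GrModCat A) _).
Local Notation TF := (TF SD hL L_connected L_infinite).
Local Notation eta := (eta hL L_connected L_infinite).
Local Notation Tmap := (Tmap hL L_connected L_infinite).
Implicit Types (X Y Z Q : D) (M N : gr_mod A) (U V W : gr).

Lemma free_exists n (a : 'I_n -> int) : exists (F : gr_mod A) (u : forall i, F (a i)), gr_free u.
Proof.
have [Q /dchoice [w gw]] := choice (fun k => generator_exists SD (a k)).
have [X [i [p dX]]] := dsum_exists Q.
have h := dsum_free hL L_connected L_infinite dX gw.
by exists (G X), (fun k => lcomp (tp_map SD (a k) (i k) : lhom _ _) (w k)).
Qed.

Lemma free_proj n (a : 'I_n -> int) (F : gr_mod A) (u : forall i, F (a i)) M N (p : gr_hom M N)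
    (f : gr_hom F N) : gr_free u -> (forall n y, exists x, p n x = y) ->
  exists g : gr_hom F M, forall n x, p n (g n x) = f n x.
Proof.
move=> fu ps; have /dchoice [x hx] k : exists x : M (a k), p _ x = f _ (u k) by apply: ps.
have [g hg] := gr_free_lift x fu; exists g => m y.
suff e : gr_comp p g = f by rewrite -[in RHS]e.
by apply: (gr_free_ext fu) => k; rewrite /= hg hx.
Qed.

(** The free module on the union of two bases, used to enlarge the relations of a presentation. The
    degree of a basis element depends on [split k], which is why [v'] needs a transport. *)
Lemma free_sum n1 (a1 : 'I_n1 -> int) (F1 : gr_mod A) (u1 : forall i, F1 (a1 i))
    n2 (a2 : 'I_n2 -> int) (F2 : gr_mod A) (u2 : forall i, F2 (a2 i)) M
    (f1 : gr_hom F1 M) (f2 : gr_hom F2 M) : gr_free u1 -> gr_free u2 ->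
  exists (F : gr_mod A) (g : gr_hom F M),
  [/\ exists n (a : 'I_n -> int) (u : forall i, F (a i)), gr_free u,
      forall n x y, exists z, g n z = f1 n x + f2 n y
    & forall N (h : gr_hom M N), (forall n x, h n (f1 n x) = 0) -> (forall n x, h n (f2 n x) = 0) ->
        forall n z, h n (g n z) = 0].
Proof.
move=> h1 h2; pose a (j : 'I_n1 + 'I_n2) := match j with inl i => a1 i | inr i => a2 i end.
pose x (j : 'I_n1 + 'I_n2) : M (a j) :=
  match j with inl i => f1 _ (u1 i) | inr i => f2 _ (u2 i) end.
have [F [v fv]] := free_exists (fun k : 'I_(n1 + n2) => a (split k)).
have [g hg] := gr_free_lift (fun k => x (split k)) fv.
pose v' j : F (a j) := eq_rect _ (fun j => F (a j)) (v (unsplit j)) j (unsplitK j).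
have aux k j (e : split k = j) : g _ (eq_rect _ (fun j => F (a j)) (v k) j e) = x j.
  by case: j / e; apply: hg.
have gv' j : g _ (v' j) = x j by apply: aux.
have [s1 hs1] := gr_free_lift (fun i => v' (inl i)) h1.
have [s2 hs2] := gr_free_lift (fun i => v' (inr i)) h2.
have e1 : gr_comp g s1 = f1 by apply: (gr_free_ext h1) => i; rewrite /= hs1 (gv' (inl i)).
have e2 : gr_comp g s2 = f2 by apply: (gr_free_ext h2) => i; rewrite /= hs2 (gv' (inr i)).
exists F, g; split.
- by exists (n1 + n2)%N, (fun k => a (split k)), v.
- by move=> n y z; exists (s1 n y + s2 n z); rewrite ghD -e1 -e2.
move=> N h k1 k2 n z; suff e : gr_comp h g = gr_zero _ _ by rewrite -[LHS]/(gr_comp h g n z) e.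
apply: (gr_free_ext fv) => k; rewrite /= hg /x; case: (split k) => i; [exact: k1|exact: k2].
Qed.

(** Generators of [N] with two kinds of relations: those of [N], and lifts of the images of
    generators of [M]. *)
Lemma fp_gquo M N (f : gr_hom M N) : gr_fin_pres M -> gr_fin_pres N ->
  gr_fin_pres (gquo (gim_closed f)).
Proof.
move=> [_ [E0 [_ [q [_ [k0 [b0 [v0 fv0]]] qs _]]]]].
move=> [F1 [F0 [f1 [p [[n1 [a1 [u1 fu1]]] hF0 ps px]]]]].
have [ft hft'] := free_proj (gr_comp f q) fv0 ps.
have hft n x : p n (ft n x) = f n (q n x) := hft' n x.
have [F [g [hF gs gk]]] := free_sum ft f1 fv0 fu1.
exists F, F0, g, (gr_comp (gpi (gim_closed f)) p); split=> // [n y|n y].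
  by have [x <-] := gpi_surj y; have [z <-] := ps n x; exists z.
split=> [/gpi_ker [m]|[z <-]].
  have [x <-] := qs n m; rewrite -hft => e.
  have [z hz] : exists z, f1 n z = y - ft n x by apply/px; rewrite ghB e subrr.
  by have [w hw] := gs n x z; exists w; rewrite hw hz addrC subrK.
apply: (gk _ (gr_comp (gpi (gim_closed f)) p)) => m x /=.
  by apply/gpi_ker; rewrite hft; exists (q m x).
by rewrite (px _ _).2 ?gr_hom0 //; exists x.
Qed.

Definition gr_coker U V (f : gr_hom (car U : gr_mod A) (car V)) : gr :=
  exist _ (gquo (gim_closed f)) (fp_gquo f (proj2_sig U) (proj2_sig V)).

(* Elements of degree [a] are maps from a graded free module of rank one, so kernels in [grmod]
   are computed degreewise. *)
Lemma gr_point a : exists (P : gr) (w : (car P : gr_mod A) a),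
  forall M (x : M a), exists h : gr_hom (car P) M, h a w = x /\
    forall h' : gr_hom (car P) M, h' a w = x -> h' = h.
Proof.
have [Q [w gw]] := generator_exists SD a.
have fw := generator_free hL L_connected L_infinite gw.
exists (exist _ (G Q) (gr_fp_free fw)), w => M x.
have [h [hw hu]] := fw M (fun _ => x); exists h; split; first exact: (hw ord0).
by move=> h' e; rewrite (hu h').
Qed.

Lemma gr_zero_objP U : zero_obj U <-> forall n (x : (car U : gr_mod A) n), x = 0.
Proof.
split=> [h n x|h V].
  have [P [w hw]] := gr_point n; have [f [<- _]] := hw _ x.
  have [[f0 [_ fu]] _] := h P.
  by rewrite -(fu f I) (fu (gr_zero _ _) I).
split; exists (gr_zero _ _); split=> // f _; apply: gr_hom_eq => n x; first by rewrite [RHS]h.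
by rewrite [x]h !gr_hom0.
Qed.

Lemma gr_zero_morP U V (f : hom U V) : zero_mor f <-> forall n x, ghfun f n x = 0.
Proof.
split=> [[Z [g [h [/gr_zero_objP Z0 ->]]]] n x|h].
  by rewrite /= [ghfun h n x]Z0 gr_hom0.
exists (gr_coker (gr_id (car U))), (gr_zero _ _), (gr_zero _ _); split.
  apply/gr_zero_objP => n y; have [x <-] := gpi_surj y.
  by apply/gpi_ker; exists x.
by apply: gr_hom_eq => n x; rewrite h.
Qed.

Lemma gr_kernel U V W (g : hom V W) (k : hom U V) : is_kernel g k ->
  (forall n x, ghfun k n x = 0 -> x = 0) /\
  (forall n y, ghfun g n y = 0 <-> exists x, ghfun k n x = y).
Proof.
move=> [/gr_zero_morP gk ku]; have lift n y : ghfun g n y = 0 ->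
    exists x, ghfun k n x = y /\ forall x', ghfun k n x' = y -> x' = x.
  move=> gy; have [P [w hw]] := gr_point n; have [h [hy hu]] := hw _ y.
  have [|u [e uu]] := ku P h.
    apply/gr_zero_morP => m x; have [f0 [_ fu]] := hw _ (ghfun g n y).
    have e : gr_comp g h = gr_zero _ _.
      by rewrite (fu (gr_comp g h)) 1?(fu (gr_zero _ _)) //= ?gy ?hy.
    by rewrite -[LHS]/(gr_comp g h m x) e.
  exists (u n w); split=> [|x' x'y].
    by rewrite -hy -e.
  have [u' [u'w _]] := hw _ x'; rewrite -u'w (uu u') //.
  by apply: hu; rewrite /= u'w.
split=> n x.
  move=> kx; have [x0 [_ uu]] := lift n 0 (gr_hom0 g n).
  by rewrite (uu x kx) -(uu 0) // gr_hom0.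
split=> [/lift [z [e _]]|[z <-]]; first by exists z.
exact: gk.
Qed.

Lemma gr_coker_cokernel U V (f : hom U V) :
  is_cokernel f (gpi (gim_closed f) : hom V (gr_coker f)).
Proof.
split=> [|W h /gr_zero_morP hf].
  by apply/gr_zero_morP => n x /=; apply/gpi_ker; exists x.
have [|g hg] := gr_factor_surj (p := gpi (gim_closed f)) (f := h) (@gpi_surj _ _ _ _ _).
  by move=> n x /gpi_ker [y <-]; apply: hf.
exists g; split; first exact: gr_hom_eq.
move=> g' e; apply: gr_hom_eq => n y; have [x <-] := gpi_surj y.
by rewrite hg -e.
Qed.

Lemma gr_cokernel U V W (f : hom U V) (c : hom V W) : is_cokernel f c ->
  (forall n y, exists x, ghfun c n x = y) /\
  (forall n y, ghfun c n y = 0 <-> exists x, ghfun f n x = y).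
Proof.
move=> [cf cu]; have [pf pu] := gr_coker_cokernel f.
have [u [uc _]] := cu _ _ pf; have [v [vp _]] := pu _ _ cf.
have [w [wc ww]] := cu _ _ cf.
have vu : v \oc u = idm W.
  by rewrite -(ww (idm W)) ?(ww (v \oc u)) ?comp1m // -compA uc vp.
split=> n y.
  have [x hx] := gpi_surj (u n y : gquo (gim_closed f) n); exists x.
  transitivity (ghfun v n (gpi (gim_closed f) n x)); first by rewrite -vp.
  rewrite hx; exact: (congr1 (fun h : gr_hom _ _ => h n y) vu).
split=> [e|[x <-]]; last by move/gr_zero_morP: cf => /(_ n x).
by apply/(gpi_ker (gim_closed f)); rewrite -uc /= e gr_hom0.
Qed.

Lemma H_zero_objP (Y : Hcat D) : zero_obj Y <-> lidm (proj1_sig Y) = 0.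
Proof.
split=> [h|h V].
  by have [[f0 [_ fu]] _] := h Y; rewrite -(fu (lidm _ : hom Y Y) I) (fu (0 : lhom _ _) I).
split; exists (0 : lhom _ _); split=> // f _.
  by rewrite -[RHS](@lcomp1m _ D) h lcomp0l.
by rewrite -[RHS](@lcompm1 _ D) h lcomp0r.
Qed.

Lemma H_zero_morP (X Y : Hcat D) (f : lhom (proj1_sig X) (proj1_sig Y)) :
  zero_mor (f : hom X Y) <-> f = 0.
Proof.
split=> [[Z [g [h [/H_zero_objP Z0 ->]]]]|->].
  have -> : h = (0 : lhom (proj1_sig X) (proj1_sig Z)).
    by rewrite -[LHS](@lcomp1m _ D) Z0 lcomp0l.
  exact: (@lcomp0r _ D).
have [Z Z0] := derived_zero D.
exists (hcat (SD := SD) hL L_connected L_infinite (Hp_zero SD hL Z0)), (0 : lhom Z _), (0 : lhom _ Z).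
split; first exact/H_zero_objP.
by rewrite -[RHS]/(lcomp (0 : lhom Z _) (0 : lhom _ Z)) lcomp0l.
Qed.

Lemma eta_tail U : tail (fun m => (forall x, eta U (Posz m) x = 0 -> x = 0) /\
  forall y, exists x, eta U (Posz m) x = y).
Proof. by case: (eta_univ hL L_connected L_infinite U). Qed.

(** In large degrees the maps [eta] are bijective and identify [Gamma(T u)] with [u]. *)
Lemma Tmap_tail U V (u : gr_hom (car U : gr_mod A) (car V)) :
  (tail (fun m => forall x, u (Posz m) x = 0 -> x = 0) -> tail (fun m => monoT (T m) (Tmap u))) /\
  (tail (fun m => forall y, exists x, u (Posz m) x = y) -> tail (fun m => epiT (T m) (Tmap u))).
Proof.
split=> h; apply: tail_imp (tail_and h (tail_and (eta_tail U) (eta_tail V))) => m [{}h [[i1 s1] [i2 s2]]].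
  apply/monoT_tm => x; have [y <-] := s1 x => e.
  rewrite (h y) ?gr_hom0 //; apply: i2; rewrite -TmapE; exact: e.
apply/epiT_tm => z; have [y <-] := s2 z; have [x <-] := h y.
exists (eta U (Posz m) x); exact: (TmapE hL L_connected L_infinite u x).
Qed.

Lemma Tmap_exact U V W (f : gr_hom (car U : gr_mod A) (car V)) (g : gr_hom (car V : gr_mod A) (car W)) :
  (forall n y, g n y = 0 <-> exists x, f n x = y) -> tail (fun m => exT (T m) (Tmap f) (Tmap g)).
Proof.
move=> h; apply: tail_imp (tail_and (eta_tail U) (tail_and (eta_tail V) (eta_tail W))).
move=> m [[i1 s1] [[i2 s2] [i3 s3]]]; apply/exT_tm => y; have [z <-] := s2 y.
have e1 := TmapE hL L_connected L_infinite g z; rewrite /= lcompE in e1.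
rewrite e1; split=> [/i3/h [x <-]|[x]].
  exists (eta U (Posz m) x); exact: (TmapE hL L_connected L_infinite f x).
have [x' <-] := s1 x; rewrite -[lcomp _ _]/(Gm (Tmap f) (Posz m) (eta U (Posz m) x')) TmapE => e2.
have -> : z = f (Posz m) x'.
  by apply/esym/eqP; rewrite -subr_eq0; apply/eqP/i2; rewrite ghB e2 subrr.
by rewrite (h _ _).2 ?gr_hom0 //; exists x'.
Qed.

Lemma TF_exact : exact_functor TF.
Proof.
move=> U V W f g [/gr_kernel [fi fg] /gr_cokernel [gs gf]].
have ex := Tmap_exact fg.
have mf : tail (fun m => monoT (T m) (Tmap f)).
  by apply: (Tmap_tail f).1; exists 0%N => m _; apply: fi.
have eg : tail (fun m => epiT (T m) (Tmap g)).
  by apply: (Tmap_tail g).2; exists 0%N => m _; apply: gs.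
have HU := Tob_Hp hL L_connected L_infinite U.
have HV := Tob_Hp hL L_connected L_infinite V.
have HW := Tob_Hp hL L_connected L_infinite W.
have z : zero_mor (fmap TF g \oc fmap TF f).
  rewrite -fmapM; apply/H_zero_morP; apply: eta_eq => // n x.
  rewrite TmapE (lin0 (@Gm_lin _ _ _ SD _ _ n _)) /= (fg _ _).2 ?gr_hom0 //.
  by exists x.
split; split=> // Y h /H_zero_morP h0.
  have [u [e uu]] := tail_kernel hL HU HV (hcat_Hp SD hL L_connected L_infinite Y) mf ex h0.
  by exists u; split=> // v hv; rewrite (uu v).
have [u [e uu]] := tail_cokernel hL HV HW (hcat_Hp SD hL L_connected L_infinite Y) eg ex h0.
by exists u; split=> // v hv; rewrite (uu v).
Qed.

End Exactness.

(** * Functors induced on a localization *)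

Section Equivalences.

Lemma ff_equivalence (C E : cat) (F : functor C E) :
  (forall X Y (g : hom (F X) (F Y)), exists f : hom X Y, fmap F f = g) ->
  (forall X Y (f g : hom X Y), fmap F f = fmap F g -> f = g) ->
  (forall Y, exists X, isomorphic (F X) Y) -> is_equivalence F.
Proof.
move=> Ff Fi Fs; have [g hg] := choice Fs.
have /dchoice [e he] Y : exists e : hom (F (g Y)) Y, is_iso e by apply: hg.
have [e' he'] := dchoice he.
have /dchoice [gm gmE] (p : {XY : E * E & hom XY.1 XY.2}) :
    exists f : hom (g (tag p).1) (g (tag p).2), fmap F f = e' _ \oc (tagged p \oc e _) by apply: Ff.
pose gmap X Y (f : hom X Y) := gm (existT (fun XY : E * E => hom XY.1 XY.2) (X, Y) f).
have gE X Y (f : hom X Y) : fmap F (gmap X Y f) = e' Y \oc (f \oc e X) by apply: gmE.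
unshelve eexists.
  unshelve refine (@Functor E C g gmap _ _).
  - by move=> X; apply: Fi; rewrite gE fmap1 comp1m (he' X).1.
  - move=> X Y Z u v; apply: Fi; rewrite gE fmapM !gE -!compA (compA (e Y)) (he' Y).2.
    by rewrite comp1m.
split.
  have /dchoice [a aE] X : exists a : hom (g (F X)) X, fmap F a = e (F X) by apply: Ff.
  have /dchoice [b bE] X : exists b : hom X (g (F X)), fmap F b = e' (F X) by apply: Ff.
  exists a; split=> [X Y f|X].
    by apply: (@Fi _ _); rewrite /= !fmapM !aE gE !compA (he' _).2 comp1m.
  exists (b X); split; apply: (@Fi _ _); rewrite fmapM aE bE fmap1; [exact: (he' _).1|exact: (he' _).2].
exists e; split=> [X Y f|X]; last exact: he.
by rewrite /= gE !compA (he' _).2 comp1m.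
Qed.

Variables (C E : cat) (W : mor_class C) (F : functor C E).
Hypothesis WF : inverts W F.

(** Evaluation of a zigzag: a formal inverse goes to a chosen inverse in [E]. *)
Fixpoint zint X Y (s : zigzag W X Y) : hom (F X) (F Y) :=
  match s in zigzag _ X Y return hom (F X) (F Y) with
  | zmor _ _ f => fmap F f
  | zinv _ _ w Ww => projT1 (cid (WF Ww))
  | zcomp _ _ _ s t => zint s \oc zint t
  end.

Lemma zint_invP X Y (w : hom X Y) (Ww : W w) :
  zint (zinv Ww) \oc fmap F w = idm _ /\ fmap F w \oc zint (zinv Ww) = idm _.
Proof. exact: projT2 (cid (WF Ww)). Qed.

Lemma zint_eq X Y (s t : zigzag W X Y) : zeq s t -> zint s = zint t.
Proof.
elim=> {X Y s t} //=.
- by move=> X Y s t u _ -> _ ->.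
- by move=> X Y Z s s' t t' _ -> _ ->.
- by move=> X Y Z V s t u; rewrite compA.
- by move=> X Y s; rewrite fmap1 comp1m.
- by move=> X Y s; rewrite fmap1 compm1.
- by move=> X Y Z g f; rewrite fmapM.
- by move=> X Y w Ww; rewrite fmap1 (zint_invP Ww).1.
- by move=> X Y w Ww; rewrite fmap1 (zint_invP Ww).2.
Qed.

Definition zfunctor : functor (localize W) E.
Proof.
refine (@Functor (localize W) E (fun X => F X) (fun X Y c => zint (zrepr c)) _ _).
- by move=> X; rewrite (zint_eq (zreprP _)) /= fmap1.
- by move=> X Y Z g f; rewrite /= (zint_eq (zreprP _)).
Defined.

Lemma zfunctorE X Y (s : zigzag W X Y) : fmap zfunctor (zpi s : @hom (localize W) X Y) = zint s.
Proof. exact: zint_eq (zreprP _). Qed.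

Lemma zfunctor_nat_iso : nat_iso (fcomp zfunctor (localize_functor W)) F.
Proof.
exists (fun X => idm (F X)); split=> [X Y f|X]; last by exists (idm _); rewrite comp1m.
by rewrite comp1m compm1 /= (zint_eq (zreprP _)).
Qed.

End Equivalences.

Lemma fd_sum (K : fieldType) n (V : 'I_n -> lmodType K) (W : lmodType K) (f : forall k, V k -> W) :
  (forall k, fd (V k)) -> (forall k, lin (f k)) ->
  (forall w, exists x : forall k, V k, w = \sum_k f k (x k)) -> fd W.
Proof.
elim: n V W f => [|n IH] V W f fV fl fs.
  apply: (@fd_surj K 'rV[K]_0 W (fun _ => 0)).
  - by move=> k x y; rewrite scaler0 addr0.
  - by move=> w; have [x ->] := fs w; exists 0; rewrite big_ord0.
  exact: fd_vect.
pose U w := exists x : forall j, V (lift ord0 j), w = \sum_j f _ (x j).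
have cU : lclosed U.
  split.
    by exists (fun j => 0); rewrite big1 // => j _; apply: lin0 (fl _).
  move=> k _ _ [x ->] [y ->]; exists (fun j => k *: x j + y j).
  by rewrite scaler_sumr -big_split; apply: eq_bigr => j _; rewrite fl.
have memU j (x : V (lift ord0 j)) : U (f _ x).
  have [xs hx] : exists xs : forall j, V (lift ord0 j), xs j = x /\ forall i, i <> j -> xs i = 0.
    have /dchoice [xs hxs] i : exists y : V (lift ord0 i),
        (forall e : j = i, y = eq_rect _ (fun j => V (lift ord0 j)) x _ e) /\ (i <> j -> y = 0).
      have [e|e] := eqVneq j i.
        by subst i; exists x; split=> // e; rewrite (eq_irrelevance e erefl).
      by exists 0; split=> // e'; rewrite e' eqxx in e.
    by exists xs; split=> [|i ij]; [exact: ((hxs j).1 erefl)|exact: (hxs i).2].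
  exists xs; rewrite (bigD1 j) //= hx.1 big1 ?addr0 // => i /eqP ij.
  by rewrite (hx.2 i ij); apply: lin0 (fl _).
have fU : fd (sublm cU).
  apply: (IH (fun j => V (lift ord0 j)) (sublm cU) (fun j x => sub_mk cU (memU j x))) => // [k|w].
    by move=> c x y; apply: sub_val_inj; apply: fl.
  have [x hx] := sub_valP w; exists x; apply: sub_val_inj; rewrite hx.
  by rewrite (lin_sum (@sub_val_lin _ _ _ cU)).
apply: (@fd_surj K (V ord0 * sublm cU)%type W (fun p => f ord0 p.1 + sub_val p.2)).
- by move=> k x y; rewrite /= fl scalerDr addrACA.
- move=> w; have [x ->] := fs w; rewrite big_ord_recl.
  have h : U (\sum_(i < n) f (lift ord0 i) (x (lift ord0 i))) by exists (fun j => x (lift ord0 j)).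
  by exists (x ord0, sub_mk cU h).
exact: fd_prod.
Qed.

(** * Graded modules of finite length *)

Section FiniteLength.
Variables (K : fieldType) (A : gr_alg K).
Implicit Types (M N : gr_mod A).

(** Take [x] of degree [n] in [U_(i+1)] outside [U_i]. The elements of [U_(i+1)] that lie in [U_i]
    when their degree is at most [n] form an intermediate submodule missing [x]; it equals [U_i], so
    the two agree above degree [n]. *)
Lemma finite_length_tail M : finite_length M -> tail (fun m => forall x : M (Posz m), x = 0).
Proof.
move=> [l [U [cU U0 Ul hU]]].
suff h i : (i <= l)%N -> tail (fun m => forall x : M (Posz m), U i _ x -> x = 0).
  by have [N hN] := h l (leqnn l); exists N => m /hN hm x; apply/hm/Ul.
elim: i => [_|i IH il]; first by exists 0%N => m _ x /U0.
have [N hN] := IH (ltnW il); have [h1 h2 h3] := hU i il.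
have [n [x [Ux nUx]]] : exists n (x : M n), U i.+1 n x /\ ~ U i n x.
  apply: contrapT => h; apply: h2 => n x Ux; apply: contrapT => nUx; apply: h; by exists n, x.
pose V m (y : M m) := U i.+1 m y /\ (m <= n -> U i m y).
have [c1 c2 c3] := cU i; have [d1 d2 d3] := cU i.+1.
have cV : gr_submodule V.
  split=> [m|m k y z [a b] [a' b']|m q m' e y z [a b]]; split; auto.
  by move=> h; apply: c3; apply: b; lia.
have [||h|h] := h3 V cV.
- by move=> m y Uy; split=> //; apply: h1.
- by move=> m y [].
- exists (N + `|n|.+1)%N => m hm y Uy; apply: hN; first by lia.
  by apply: h; split=> // h'; lia.
by case: nUx; apply: (h n x Ux).2.
Qed.

Variables (M : gr_mod A) (lo : int) (len : nat).
Hypothesis M_low : forall n, n < lo -> forall x : M n, x = 0.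
Hypothesis M_high : forall n, lo + len%:Z <= n -> forall x : M n, x = 0.
Hypothesis M_fd : forall n, fd (M n).

(** The default 0 makes this a total function of [U], so that [gdim] is a plain sum over the degrees
    where [M] may be nonzero. *)
Definition dimP n (U : M n -> Prop) : nat :=
  match pselect (lclosed U) with left c => dimv (sublm c) | right _ => 0%N end.

Lemma dimP_le n (U V : M n -> Prop) : lclosed U -> lclosed V -> (forall x, U x -> V x) ->
  (dimP U <= dimP V)%N /\ (dimP U = dimP V -> forall x, V x -> U x).
Proof.
move=> cU cV UV; rewrite /dimP; case: pselect => // c; case: pselect => // d.
have fV : fd (sublm d) by apply: (fd_inj (@sub_val_lin _ _ _ d) (@sub_val_inj _ _ _ d)).
pose f (x : sublm c) := sub_mk d (UV _ (sub_valP x)).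
have [||h1 h2] := @dimv_inj K (sublm c) (sublm d) f fV.
- by move=> k x y; apply: sub_val_inj.
- by move=> x y /(congr1 (fun z => sub_val z)) /= /sub_val_inj.
split=> // /h2 h x Vx; have [y hy] := h (sub_mk d Vx).
by have := congr1 (fun z => sub_val z) hy => /= <-; apply: sub_valP.
Qed.

Definition gdim (U : forall n, M n -> Prop) : nat := (\sum_(j < len) dimP (U (lo + j%:Z)%R))%N.

Lemma gr_sub_lclosed (U : forall n, M n -> Prop) n : gr_submodule U -> lclosed (U n).
Proof. by case=> h1 h2 _; split; [apply: h1|apply: h2]. Qed.

Lemma gdim_le (U V : forall n, M n -> Prop) : gr_submodule U -> gr_submodule V -> gr_sub U V ->
  (gdim U <= gdim V)%N /\ (gdim U = gdim V -> gr_sub V U).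
Proof.
move=> cU cV UV.
have h j := dimP_le (gr_sub_lclosed (lo + j%:Z) cU) (gr_sub_lclosed (lo + j%:Z) cV) (UV _).
split=> [|e n x Vx]; first by apply: leq_sum => j _; case: (h j).
have [nlo|] := boolP (n < lo); first by rewrite (M_low nlo x); case: cU.
move=> nlo; have [nhi|nhi] := boolP (lo + len%:Z <= n); first by rewrite (M_high nhi x); case: cU.
have jlt : (`|n - lo| < len)%N by lia.
pose j := Ordinal jlt; have ne : n = lo + (val j)%:Z by rewrite /=; lia.
have le (i : 'I_len) : (dimP (U (lo + i%:Z)%R) <= dimP (V (lo + i%:Z)%R))%N by case: (h i).
have ej : dimP (U (lo + (val j)%:Z)) = dimP (V (lo + (val j)%:Z)).
  apply/eqP; rewrite eqn_leq le /=.
  rewrite -(leq_add2r (\sum_(i < len | i != j) dimP (U (lo + i%:Z)%R))%N).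
  move: e; rewrite /gdim (bigD1 j) // [X in _ = X -> _](bigD1 j) // => e.
  by rewrite [X in (_ <= X)%N]e leq_add2l; apply: leq_sum.
by have := (h j).2 ej; rewrite -ne; apply.
Qed.

(** A proper submodule of [V] of largest total dimension is maximal, and it has a composition series
    by induction. *)
Lemma finite_length_chain k (V : forall n, M n -> Prop) : gr_submodule V -> (gdim V <= k)%N ->
  exists (l : nat) (U : nat -> forall n, M n -> Prop),
    [/\ forall i, gr_submodule (U i), forall n x, U 0%N n x <-> x = 0,
        forall n x, U l n x <-> V n x
      & forall i, (i < l)%N ->
          [/\ gr_sub (U i) (U i.+1), ~ gr_sub (U i.+1) (U i)
            & forall V, gr_submodule V -> gr_sub (U i) V ->
                gr_sub V (U i.+1) -> gr_sub V (U i) \/ gr_sub (U i.+1) V]].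
Proof.
have c0 : gr_submodule (fun n (x : M n) => x = 0).
  split=> // [n c x y -> ->|n q m e x y ->]; [by rewrite scaler0 addr0|exact: gact0l].
elim: k V => [|k IH] V cV dV.
  have [_ h] := gdim_le c0 cV (fun n x e => eq_ind_r (V n) (let: And3 h _ _ := cV in h n) e).
  exists 0%N, (fun _ => V); split=> // n x; split=> [Vx|->]; last by case: cV.
  have [le eq] := gdim_le c0 cV (fun n x e => eq_ind_r (V n) (let: And3 h _ _ := cV in h n) e).
  by apply: (eq _ n x Vx); lia.
have [V0|nV0] := pselect (forall n x, V n x -> x = 0).
  exists 0%N, (fun _ => V); split=> // n x; split=> [/V0//|->]; by case: cV.
pose B d := `[< exists U, [/\ gr_submodule U, gr_sub U V, ~ gr_sub V U & gdim U = d] >].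
have exB : exists d, B d.
  exists (gdim (fun n (x : M n) => x = 0)); apply/asboolP; exists (fun n (x : M n) => x = 0).
  by split=> // n x ->; case: cV.
have ubB d : B d -> (d <= gdim V)%N.
  by move=> /asboolP [U [cU UV _ <-]]; case: (gdim_le cU cV UV).
case: (ex_maxnP exB ubB) => d /asboolP [U [cU UV nVU dU]] dmax.
have [leU eqU] := gdim_le cU cV UV.
have [|l [C [C1 C2 C3 C4]]] := IH U cU.
  have : gdim U <> gdim V by move=> /eqU.
  lia.
exists l.+1, (fun i => if (i <= l)%N then C i else V); split.
- by move=> i; case: ifP.
- exact: C2.
- by move=> n x; rewrite ltnn.
move=> i il1; have [->|il] : i = l \/ (i < l)%N by lia.
2: by rewrite /= (ltnW il) il; apply: C4.
rewrite /= leqnn ltnn; split.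
- by move=> n x /C3; apply: UV.
- by move=> h; apply: nVU => n x /h /C3.
move=> W cW CW WV; have [WU|nWU] := pselect (gr_sub V W); [by right|left].
have UW : gr_sub U W by move=> n x /C3; apply: CW.
have [le eq] := gdim_le cU cW UW.
have ge : (gdim W <= d)%N by apply: dmax; apply/asboolP; exists W.
by move=> n x Wx; apply/C3; apply: eq Wx; lia.
Qed.

Lemma bounded_finite_length : finite_length M.
Proof.
have cT : gr_submodule (fun n (x : M n) => True) by [].
have [l [U [h1 h2 h3 h4]]] := finite_length_chain cT (leqnn _).
by exists l, U; split=> // n x; apply/h3.
Qed.

End FiniteLength.

(** * Truncations *)

Section Quotient.
Variables (K : fieldType) (L : falgType K) (D : derived_cat L).
Variable SD : serre_duality D.
Hypothesis hL : hereditary L.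
Hypothesis L_connected : connected L.
Hypothesis L_infinite : infinite_type L.
Local Notation O := (Lambda D).
Local Notation t := (tau SD).
Local Notation ti := (taui SD).
Local Notation T n := (iter n t O).
Local Notation A := (preproj_alg SD).
Local Notation tp := (tp SD).
Local Notation G := (gamma_obj SD).
Local Notation Gm := (gamma_map SD).
Local Notation gr := (grmod A).
Implicit Types (X Y Z Q : D) (M N : gr_mod A) (U V W : gr).

(** [X1] is a sum of copies of [tau^m Lambda], one for each generator of the submodule, so
    [Gamma(X1)] is free with all generators in degree [m]. *)
Lemma cover_submodule m X (cX : conc (iter m ti X)) (P : h0 (iter m ti X) -> Prop) : sclosed P ->
  exists X1 (d : lhom X1 X),
  [/\ Hp SD X1 /\ conc (iter m ti X1),
      exists n (a : 'I_n -> int) (u : forall i, G X1 (a i)), gr_free u,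
      forall k : int, k < m%:Z -> nohom O (tp k X1)
    & forall y : lhom O (iter m ti X), P y <->
        exists x, lcomp (iter_map ti m d : lhom (iter m ti X1) (iter m ti X)) x = y].
Proof.
move=> cP; have [n [f fs]] := free_cover (fd_msub cP (h0_fd hL cX)).
pose y k : lhom O (iter m ti X) := mincl cP (f (mbasis L false k)).
have [Q [w gw]] := generator_exists SD m%:Z; have [w' [w1 w2]] := gw.
have w2' : lcomp w (w' : lhom _ _) = lidm _ := w2.
have w1' : lcomp (w' : lhom _ _) w = lidm _ := w1.
have [X1 [i [p dX]]] := dsum_exists (fun k : 'I_n => Q); have [h1 h2 h3] := dX.
have /choice [g hg] k : exists g : lhom Q X, lcomp (iter_map ti m g : lhom (iter m ti Q) (iter m ti X)) w = y k.
  have [g gE] := tm_full (lcomp (y k) (w' : lhom _ _)); exists g.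
  by rewrite gE -lcompA w1' lcompm1.
pose d := \sum_k lcomp (g k) (p k).
have dE k : lcomp d (i k) = g k.
  rewrite lcomp_suml (bigD1 k) //= big1 => [|j jk]; first by rewrite -lcompA h1 lcompm1 addr0.
  by rewrite -lcompA h2 ?lcomp0r //; apply/eqP.
have sm := sum_iter_map (F := ti) m (@taui_lin _ _ _ SD) h3.
have cQ : conc (iter m ti Q).
  by apply: conc_iso (Lambda_conc D hL); exists w.
exists X1, d; split.
- split; first by apply: (Hp_sum h3) => k; apply: (generator_Hp hL L_connected L_infinite gw).
  exact: conc_sum sm (fun _ => cQ).
- exists n, (fun _ => m%:Z), (fun k => lcomp (tp_map SD m%:Z (i k) : lhom _ _) w).
  exact: (dsum_free hL L_connected L_infinite dX (fun _ => gw)).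
- move=> k km x; rewrite -[x]lcomp1m -(tpL1 SD) -h3 (lin_sum (@tp_lin _ _ _ SD k _ _)) lcomp_suml big1 // => j _.
  rewrite (tpL SD) -lcompA.
  by rewrite (generator_vanish hL L_connected L_infinite gw km (lcomp (tp_map SD k (p j) : lhom _ _) x)) lcomp0r.
have memP k a : P (mact (y k : h0 _) a).
  by apply/(mincl_im cP); exists (mact (f (mbasis L false k)) a); rewrite mhom_act.
move=> z; split=> [/(mincl_im cP) [u <-]|[x <-]].
  have [v <-] := fs u.
  exists (\sum_k lcomp (lcomp (iter_map ti m (i k) : lhom (iter m ti Q) (iter m ti X1)) w)
    (lact D ((v : {ffun 'I_n -> L}) k))).
  have -> : f v = mfree_hom (fun k => f (mbasis L false k)) v.
    by apply: (congr1 (fun h : mhom _ _ => h v)); apply: mfree_hom_uniq => k; rewrite mfree_homE.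
  rewrite lcomp_sumr; apply: etrans _ (esym (lin_sum (mhom_lin (mincl cP)) _ _ _)); apply: eq_bigr => k _.
  by rewrite (mhom_act (mincl cP)) /= !lcompA -tmL dE hg.
rewrite -[x]lcomp1m -sm lcomp_suml lcomp_sumr.
have clP : lclosed P := proj1 cP.
elim/big_ind: _ => [|a b|k _]; [exact: clP.1|exact: lclosedD|].
have [a aE] := lact_full hL (lcomp (w' : lhom _ _) (lcomp (iter_map ti m (p k) : lhom (iter m ti X1) (iter m ti Q)) x)).
have -> : lcomp (iter_map ti m d : lhom (iter m ti X1) (iter m ti X))
    (lcomp (lcomp (iter_map ti m (i k) : lhom (iter m ti Q) (iter m ti X1)) (iter_map ti m (p k))) x) =
    lcomp (y k) (lact D a); last exact: memP.
  by rewrite -aE -hg -[RHS]lcompA (lcompKl w2') !lcompA -tmL dE.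
Qed.

Definition trU (m : nat) M n (x : M n) : Prop := m%:Z <= n \/ x = 0.

Lemma trU_closed m M : gr_submodule (@trU m M).
Proof.
split=> [n|n k x y|n q r e x y]; first by right.
  by move=> [h|->] [h'|->]; [left|left|left|right; rewrite scaler0 addr0].
by move=> [h|->]; [left; lia|right; apply: gact0l].
Qed.

(** Cover degree [m] of [Gamma(Y)] and then the kernel in degree [m] by free modules generated
    there. Exactness in degree [m] propagates to all higher degrees by [tail_rexact], and below [m]
    everything vanishes. *)
Lemma fp_trunc m Y : Hp SD Y -> conc (iter m ti Y) -> gr_fin_pres (gsub (trU_closed m (G Y))).
Proof.
move=> HY cY.
have [|X0 [d0 [[H0 c0] f0 v0 i0]]] := cover_submodule cY (P := fun _ => True); first by [].
have [X1 [d1 [[H1 c1] f1 v1 i1]]] := cover_submodule c0 (mker_closed (h0f (iter_map ti m d0 : lhom (iter m ti X0) (iter m ti Y)))).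
have e1 : epiT O (iter_map ti m d0 : lhom (iter m ti X0) (iter m ti Y)) by move=> z; apply/i0.
have tl := tail_rexact SD hL L_connected L_infinite c1 c0 cY e1 i1.
have tlk k : (m <= k)%N -> epiT (T k) d0 /\ exT (T k) d1 d0.
  move=> mk; have e : iter m t (T (k - m)) = T k by rewrite -iterD subnKC.
  by have [h1 h2] := tl (k - m)%N; rewrite -e -epiT_tm -exT_tm.
have [p pE] : exists p : gr_hom (G X0) (gsub (trU_closed m (G Y))),
    forall n x, ginc (trU_closed m (G Y)) n (p n x) = Gm d0 n x.
  apply: gr_factor_inj => [n y e|n x]; first by apply: ginc_inj; rewrite e gr_hom0.
  apply/ginc_im; have [h|h] := boolP (m%:Z <= n); [by left|right].
  have /v0 v : n < m%:Z by lia.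
  by rewrite (v (x : lhom O (tp n X0))) gr_hom0.
have cases n : (exists k, n = Posz k /\ (m <= k)%N) \/ n < m%:Z.
  by case: n => n; [have [h|h] := leqP m n; [left; exists n|right]|right]; lia.
exists (G X1), (G X0), (Gm d1), p; split=> // n y.
  have [[k [nk mk]]|h] := cases n.
    subst n; have [s _] := gr_map_tail (tlk k mk).
    have [x hx] := s (ginc (trU_closed m (G Y)) _ y); exists x.
    by apply: ginc_inj; rewrite pE.
  exists 0; rewrite gr_hom0; apply: ginc_inj; rewrite gr_hom0.
  by have [|->] := (ginc_im (trU_closed m (G Y)) (ginc _ _ y)).2 (ex_intro _ y erefl); first by lia.
have -> : p n y = 0 <-> Gm d0 n y = 0.
  by rewrite -pE; split=> [->|h]; [rewrite gr_hom0|apply: ginc_inj; rewrite h gr_hom0].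
have [[k [nk mk]]|h] := cases n.
  by subst n; have [_ s] := gr_map_tail (tlk k mk); apply: s.
rewrite (v0 n h (y : lhom O (tp n X0))); split=> [_|_]; last exact: gr_hom0.
by exists 0; rewrite gr_hom0.
Qed.

(** [M] is a quotient of a finite sum of modules [Gamma(tau^a Lambda)], whose components are zero or
    of the form [Hom(Lambda, tau^-q Lambda)]. *)
Lemma fp_bounds M : gr_fin_pres M -> (forall n, fd (M n)) /\
  exists lo : int, forall n, n < lo -> forall x : M n, x = 0.
Proof.
move=> [_ [F [_ [p [_ [r [a [u fu]]] ps _]]]]].
have [Q /dchoice [w gw]] := choice (fun k => generator_exists SD (a k)).
have [X [i [q dX]]] := dsum_exists Q; have [h1 h2 h3] := dX.
have fv := dsum_free hL L_connected L_infinite dX gw.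
have [e he] := gr_free_lift u fv; have [_ es] := gr_free_iso fv fu he.
have yE n (y : G X n) : y = \sum_k Gm (i k) n (Gm (q k) n y).
  rewrite -[LHS](lcomp1m (y : lhom O (tp n X))) -(tpL1 SD) -h3 (lin_sum (@tp_lin _ _ _ SD n X X)) lcomp_suml.
  by apply: eq_bigr => k _; rewrite (tpL SD) -lcompA.
have sur n (z : M n) : exists y : G X n, p n (e n y) = z.
  by have [x <-] := ps n z; have [y <-] := es n x; exists y.
split=> [n|].
  apply: (@fd_surj K (G X n) (M n) (fun y => p n (e n y))) => [k x y|y|]; [by rewrite !gh_lin|exact: sur|].
  apply: (@fd_sum K r (fun k => G (Q k) n) (G X n) (fun k => Gm (i k) n)) => [k|k|y].
  - have [na|an] := boolP (n < a k).
      apply: (@fd_surj K 'rV[K]_0 _ (fun _ => 0)) => [c x y|y|]; last exact: fd_vect.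
        by rewrite scaler0 addr0.
      by exists 0; apply/esym; apply: (generator_vanish hL L_connected L_infinite (gw k) na).
    have eq : a k + `|n - a k|%N%:Z = n by lia.
    have [s _] := generator_act eq (gw k).
    apply: (@fd_surj K (A `|n - a k|%N) _ (fun c => @gact _ A (G (Q k)) _ _ _ eq (w k) c)).
    + by move=> c x y; apply: gact_linr.
    + by move=> y; have [c ->] := s y; exists c.
    exact: (fd_lhom hL (Lambda_conc D hL) (good_Lambda SD hL L_connected L_infinite `|n - a k|%N)).
  - exact: gh_lin.
  by exists (fun k => Gm (q k) n y); apply: yE.
exists (- (\sum_k `|a k|)%N%:Z) => n hn z; have [y <-] := sur n z.
suff -> : y = 0 by rewrite !gr_hom0.
rewrite (yE n y) big1 // => k _.
have na : n < a k.
  have le : (`|a k| <= \sum_k `|a k|)%N by rewrite (bigD1 k) //= leq_addr.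
  by lia.
by rewrite (generator_vanish hL L_connected L_infinite (gw k) na (Gm (q k) n y : lhom O (tp n (Q k)))) gr_hom0.
Qed.

End Quotient.

(** * The induced equivalence *)

Section Localization.
Variables (K : fieldType) (L : falgType K) (D : derived_cat L).
Variable SD : serre_duality D.
Hypothesis hL : hereditary L.
Hypothesis L_connected : connected L.
Hypothesis L_infinite : infinite_type L.
Local Notation O := (Lambda D).
Local Notation t := (tau SD).
Local Notation T n := (iter n t O).
Local Notation A := (preproj_alg SD).
Local Notation G := (gamma_obj SD).
Local Notation Gm := (gamma_map SD).
Local Notation gr := (grmod A).
Local Notation car := (@proj1_sig (GrModCat A) _).
Local Notation TF := (TF SD hL L_connected L_infinite).
Local Notation Tob := (Tob hL L_connected L_infinite).
Local Notation eta := (eta hL L_connected L_infinite).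
Local Notation Tmap := (Tmap hL L_connected L_infinite).
Implicit Types (X Y Z Q : D) (M : gr_mod A) (U V : gr).

Local Notation gro := (@grmod0 K A).
Local Notation W := (serre_class gro).
Local Notation loc := (localize W).
Local Notation TmapE := (TmapE hL L_connected L_infinite).

(** A kernel or cokernel of finite length vanishes in large degrees, where invertibility of [T u] is
    decided. *)
Lemma TF_inverts : inverts W TF.
Proof.
move=> U V u [[N [k [/(gr_kernel hL L_connected L_infinite) [_ ku] /finite_length_tail N0]]]
  [C [c [/(gr_cokernel hL L_connected L_infinite) [cs cu] /finite_length_tail C0]]]].
have m1 : tail (fun m => monoT (T m) (Tmap u)).
  apply: (Tmap_tail hL L_connected L_infinite u).1; apply: tail_imp N0 => m z x /ku [y <-].
  by rewrite (z y) gr_hom0.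
have e1 : tail (fun m => epiT (T m) (Tmap u)).
  apply: (Tmap_tail hL L_connected L_infinite u).2; apply: tail_imp C0 => m z y.
  by apply/cu; apply: z.
have [g [h1 h2]] := tail_iso hL (Tob_Hp hL L_connected L_infinite U) (Tob_Hp hL L_connected L_infinite V) m1 e1.
by exists g.
Qed.

(** [R] plays the role of the part of [Gamma(T U)] in degrees from [m] on, embedded by [inc]. It
    also maps to [U] by [kap], which the quotient inverts: a roof between [U] and [Gamma(T U)]. *)
Definition kdata U m (R : gr) (kap : hom R U) (inc : gr_hom (car R : gr_mod A) (G (Tob U))) : Prop :=
  [/\ W kap, forall n x, eta U n (ghfun kap n x) = inc n x, forall n x, inc n x = 0 -> x = 0,
      forall n y, (exists x, inc n x = y) <-> trU m y
    & forall n y, m%:Z <= n -> eta U n y = 0 -> y = 0].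

(** From degree [m] on [eta] is bijective, and [kap] is its inverse there. So [kap] is injective,
    and its cokernel lives in finitely many degrees with finite dimensional components. *)
Lemma kdata_exists U : exists N, forall m, (N <= m)%N -> exists R kap inc, @kdata U m R kap inc.
Proof.
have HU := Tob_Hp hL L_connected L_infinite U.
have [N hN] := tail_and (Hp_tail HU) (eta_tail hL L_connected L_infinite U).
exists N => m Nm; have [cm _] := hN m Nm.
have fp := fp_trunc hL L_connected L_infinite HU cm.
pose R : gr := exist _ _ fp; pose inc := ginc (trU_closed m (G (Tob U))).
have bij n : m%:Z <= n -> (forall x, eta U n x = 0 -> x = 0) /\ forall y, exists x, eta U n x = y.
  by case: n => n mn; [apply: (hN n _).2; lia|lia].
have inc0 n x : inc n x = 0 -> x = 0 by move=> e; apply: ginc_inj; rewrite gr_hom0.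
have incP n y : (exists x, inc n x = y) <-> trU m y by rewrite (ginc_im (trU_closed m (G (Tob U)))).
have [||n x|n y [e h]|kap hk] := @gr_hom_of_rel _ A (car R) (car U)
    (fun n x y => eta U n y = inc n x /\ trU m y).
- move=> n k x x' y y' [e h] [e' h']; split; first by rewrite !gh_lin e e'.
  by have [_ l _] := trU_closed m (car U); apply: l.
- move=> n q r e x y a [e' h]; split; first by rewrite !gh_act e'.
  by have [_ _ l] := trU_closed m (car U); apply: l.
- have /(incP n) [h|h] : exists z, inc n z = inc n x by exists x.
    by have [_ s] := bij n h; have [y hy] := s (inc n x); exists y; split=> //; left.
  by exists 0; rewrite h gr_hom0; split=> //; right.
- by case: h => // h; have [i _] := bij n h; apply: i; rewrite e gr_hom0.
exists R, kap, inc; split=> // [|n x|n y mn]; last by have [i _] := bij n mn; apply: i.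
- have ki n x : kap n x = 0 -> x = 0 by move=> e; apply: inc0; rewrite -(hk n x).1 e gr_hom0.
  have Z0 n (x : gquo (gim_closed (gr_id (car R))) n) : x = 0.
    by have [y <-] := gpi_surj x; apply/gpi_ker; exists y.
  split.
    exists (gr_coker hL L_connected L_infinite (gr_id (car R))), (gr_zero _ _); split; first split.
    + by apply/(gr_zero_morP hL L_connected L_infinite) => n x /=; rewrite gr_hom0.
    + move=> V h /(gr_zero_morP hL L_connected L_infinite) kh; exists (gr_zero _ _); split.
        by apply: gr_hom_eq => n x; apply: esym; apply: ki; apply: kh.
      by move=> h' _; apply: gr_hom_eq => n x; rewrite [RHS]Z0.
    exists 0%N, (fun _ _ _ => True); split=> // n x; by split=> // _; apply: Z0.
  exists (gr_coker hL L_connected L_infinite kap), (gpi (gim_closed kap)); split.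
    exact: gr_coker_cokernel.
  have [fM [lo hlo]] := fp_bounds hL L_connected L_infinite (proj2_sig (gr_coker hL L_connected L_infinite kap)).
  (* The absolute value covers the case [lo > m]; in either case [lo + |m - lo| >= m]. *)
  apply: (@bounded_finite_length _ _ _ lo `|m%:Z - lo|%N) => // n mn y.
  have {}mn : m%:Z <= n by lia.
  have [z <-] := gpi_surj y; apply/gpi_ker.
  have [x hx] : exists x, inc n x = eta U n z by apply/incP; left.
  exists x; have [i _] := bij n mn; apply/eqP; rewrite -subr_eq0; apply/eqP/i.
  by rewrite ghB (hk n x).1 hx subrr.
exact: (hk n x).1.
Qed.

Lemma kdata_map U V m R R' kap kap' inc inc' (f : lhom (Tob U) (Tob V)) :
  @kdata U m R kap inc -> @kdata V m R' kap' inc' ->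
  exists g : gr_hom (car R : gr_mod A) (car R'), forall n x, inc' n (g n x) = Gm f n (inc n x).
Proof.
move=> [_ _ _ h1 _] [_ _ i h2 _]; apply: (gr_factor_inj (i := inc') (f := gr_comp (Gm f) inc)) => // n x.
apply/h2; have [h|e] : trU m (inc n x) by apply/h1; exists x.
  by left.
by right; rewrite /= e; apply: (gr_hom0 (Gm f)).
Qed.

Lemma kdata_uniq U m R kap inc (R' : gr) (g g' : gr_hom (car R' : gr_mod A) (car R)) :
  @kdata U m R kap inc -> (forall n x, inc n (g n x) = inc n (g' n x)) -> g = g'.
Proof.
move=> [_ _ i _ _] h; apply: gr_hom_eq => n x; apply/eqP; rewrite -subr_eq0; apply/eqP/i.
by rewrite ghB h subrr.
Qed.

(** From degree [m] on the two sides agree after the injective [eta]; below [m] the module [R] is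
    zero. *)
Lemma kdata_square U V m R R' kap kap' inc inc' (u : gr_hom (car U : gr_mod A) (car V))
    (g : gr_hom (car R : gr_mod A) (car R')) : @kdata U m R kap inc -> @kdata V m R' kap' inc' ->
  (forall n x, inc' n (g n x) = Gm (Tmap u) n (inc n x)) ->
  @comp gr _ _ _ u kap = @comp gr _ _ _ kap' g.
Proof.
move=> [_ e1 i1 h1 _] [_ e2 i2 h2 b2] hg; apply: gr_hom_eq => n x /=.
have [mn|mn] := boolP (m%:Z <= n).
  apply/eqP; rewrite -subr_eq0; apply/eqP/(b2 n) => //.
  by rewrite ghB e2 hg -e1 TmapE subrr.
have -> : x = 0; last by rewrite !gr_hom0.
apply: i1; have [h|//] : trU m (inc n x) by apply/h1; exists x.
by rewrite h in mn.
Qed.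

Local Notation Q f := (zpi (zmor W f) : @hom loc _ _).

(* A zigzag agrees, after restriction to high degrees, with an honest morphism determined by its
   image under [T]. *)
Lemma zigzag_square U V (s : zigzag W U V) : exists N, forall m, (N <= m)%N ->
  forall R R' kap kap' inc inc' (g : gr_hom (car R : gr_mod A) (car R')),
  @kdata U m R kap inc -> @kdata V m R' kap' inc' ->
  (forall n x, inc' n (g n x) = Gm (zint TF_inverts s : lhom _ _) n (inc n x)) ->
  zeq (zcomp s (zmor W kap)) (zcomp (zmor W kap') (zmor W (g : @hom gr R R'))).
Proof.
elim: s => {U V} [U V u|U V w Ww|U V Z s [N1 IH1] t [N2 IH2]].
- exists 0%N => m _ R R' kap kap' inc inc' g d d' hg.
  apply: zeq_trans (zeq_mor _ _ _) _; apply: zeq_trans _ (zeq_sym (zeq_mor _ _ _)).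
  by rewrite (kdata_square d d' hg); apply: zeq_refl.
- exists 0%N => m _ R R' kap kap' inc inc' g d d' hg.
  have [inv1 inv2] := zint_invP TF_inverts Ww.
  have [g' hg'] := kdata_map (Tmap w) d' d.
  have g'g : gr_comp g' g = gr_id _.
    apply: (kdata_uniq d) => n x; rewrite /= hg' hg -GmL.
    transitivity (Gm (lidm (Tob V)) n (inc n x)); last exact: Gm1.
    by congr (ghfun (Gm _) n _); exact: inv2.
  have e : kap = @comp gr _ _ _ w (@comp gr _ _ _ kap' g).
    rewrite compA (kdata_square d' d hg') -compA -[LHS]compm1; congr (comp _ _).
    exact: esym.
  rewrite [in X in zeq X _]e.
  apply: zeq_trans (zeq_comp (zeq_refl _) (zeq_sym (zeq_mor W _ _))) _.
  apply: zeq_trans (zeq_assoc _ _ _) _.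
  apply: zeq_trans (zeq_comp (zeq_invl Ww) (zeq_refl _)) _.
  apply: zeq_trans (zeq_idl _) _; exact: zeq_sym (zeq_mor _ _ _).
(* The middle object of a composite needs its own truncation, so the bound also depends on [V]. *)
have [N3 hN3] := kdata_exists V.
exists (N1 + N2 + N3)%N => m hm R R' kap kap' inc inc' g d d' hg.
have [|R2 [kap2 [inc2 d2]]] := hN3 m; first by lia.
have [g1 hg1] := kdata_map (zint TF_inverts t : lhom _ _) d d2.
have [g2 hg2] := kdata_map (zint TF_inverts s : lhom _ _) d2 d'.
have gE : g = gr_comp g2 g1.
  apply: (kdata_uniq d') => n x; rewrite hg /= hg2 hg1 -GmL.
  by [].
have [q1 q2] : (N1 <= m)%N /\ (N2 <= m)%N by lia.
have s1 := IH1 m q1 _ _ _ _ _ _ _ d2 d' hg2.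
have s2 := IH2 m q2 _ _ _ _ _ _ _ d d2 hg1.
apply: zeq_trans (zeq_sym (zeq_assoc _ _ _)) _.
apply: zeq_trans (zeq_comp (zeq_refl _) s2) _.
apply: zeq_trans (zeq_assoc _ _ _) _.
apply: zeq_trans (zeq_comp s1 (zeq_refl _)) _.
apply: zeq_trans (zeq_sym (zeq_assoc _ _ _)) _.
apply: zeq_comp (zeq_refl _) _; rewrite gE; exact: zeq_mor.
Qed.

(** Both zigzags agree with the same [g] after composition with [kap], and [kap] is invertible in
    the quotient. *)
Lemma zint_faithful U V (s t : zigzag W U V) :
  zint TF_inverts s = zint TF_inverts t -> zeq s t.
Proof.
move=> e; have [N1 h1] := zigzag_square s; have [N2 h2] := zigzag_square t.
have [N3 h3] := kdata_exists U; have [N4 h4] := kdata_exists V.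
pose m := (N1 + N2 + N3 + N4)%N.
have [|R [kap [inc d]]] := h3 m; first by lia.
have [|R' [kap' [inc' d']]] := h4 m; first by lia.
have [g hg] := kdata_map (zint TF_inverts s : lhom _ _) d d'.
have [q1 q2] : (N1 <= m)%N /\ (N2 <= m)%N by lia.
have s1 := h1 m q1 _ _ _ _ _ _ g d d' hg.
have s2 := h2 m q2 _ _ _ _ _ _ g d d' (fun n x => eq_ind _ (fun f : lhom _ _ => inc' n (g n x) = Gm f n (inc n x)) (hg n x) _ e).
have k : zeq (zcomp s (zmor W kap)) (zcomp t (zmor W kap)) by apply: zeq_trans s1 (zeq_sym s2).
have [Wk _ _ _ _] := d.
have cancel (r : zigzag W U V) : zeq (zcomp (zcomp r (zmor W kap)) (zinv Wk)) r.
  apply: zeq_trans (zeq_sym (zeq_assoc _ _ _)) _.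
  by apply: zeq_trans (zeq_comp (zeq_refl _) (zeq_invr Wk)) _; apply: zeq_idr.
apply: zeq_trans (zeq_sym (cancel s)) _; apply: zeq_trans (cancel t).
exact: zeq_comp k (zeq_refl _).
Qed.

(** [f] restricts to a map [g] of truncations, and the zigzag is [kap' g] followed back along the
    formal inverse of [kap]. *)
Lemma zint_full U V (f : lhom (Tob U) (Tob V)) : exists s : zigzag W U V, zint TF_inverts s = f.
Proof.
have [N3 h3] := kdata_exists U; have [N4 h4] := kdata_exists V.
have [|R [kap [inc d]]] := h3 (N3 + N4)%N; first by lia.
have [|R' [kap' [inc' d']]] := h4 (N3 + N4)%N; first by lia.
have [g hg] := kdata_map f d d'; have [Wk e1 _ _ _] := d; have [_ e2 _ _ _] := d'.
exists (zcomp (zmor W (@comp gr _ _ _ kap' g)) (zinv Wk)).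
have [inv1 inv2] := zint_invP TF_inverts Wk.
have sq : Tmap (gr_comp kap' g) = lcomp f (Tmap kap).
  apply: (@eta_eq _ _ _ _ hL L_connected L_infinite R _ (Tmap (gr_comp kap' g)) (lcomp f (Tmap kap))); first exact: Tob_Hp.
  by move=> n x; rewrite GmL !TmapE e1 -hg -e2.
transitivity (lcomp (Tmap (gr_comp kap' g)) (zint TF_inverts (zinv Wk) : lhom _ _)); first by [].
rewrite sq -lcompA -[RHS]lcompm1; congr (lcomp _ _); exact: inv2.
Qed.

(** For the truncation [R] of [Gamma(Y)], the map [T R -> Y] adjoint to the inclusion is bijective
    in large degrees. *)
Lemma zint_ess_surj (Y : Hcat D) : exists U, @isomorphic (Hcat D) (TF U) Y.
Proof.
have HY := hcat_Hp SD hL L_connected L_infinite Y.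
have [m cm] := tail_ex (Hp_tail HY).
pose R : gr := exist _ _ (fp_trunc hL L_connected L_infinite HY cm).
have HR := Tob_Hp hL L_connected L_infinite R.
have [f fE] := eta_lift hL L_connected L_infinite (U := R) (ginc (trU_closed m (G (proj1_sig Y)))) HY.
exists R; have bij := eta_tail hL L_connected L_infinite R.
have [||g [g1 g2]] := tail_iso (SD := SD) hL (f := f) HR HY; last by exists f, g.
  apply: tail_imp bij => k [i s]; apply/monoT_tm => x; have [z <-] := s x => h.
  have -> : z = 0; last by rewrite gr_hom0.
  by apply: ginc_inj; rewrite gr_hom0 -(fE k z); exact: h.
have [N bij'] := bij; exists (N + m)%N => k hk; have [|i s] := bij' k; first by lia.
apply/epiT_tm => y.
have [z hz] := (ginc_im (trU_closed m (G (proj1_sig Y))) (y : G _ k%:Z)).1 (or_introl (ltac:(lia) : m%:Z <= k%:Z)).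
by exists (eta R k z); rewrite -hz -(fE k z).
Qed.

Lemma TF_equivalence : induces_equivalence TF.
Proof.
exists (zfunctor TF_inverts); split; first exact: zfunctor_nat_iso.
apply: ff_equivalence => [U V f|U V c c'|Y].
- by have [s sE] := zint_full f; exists (zpi s); rewrite zfunctorE.
- rewrite -(zreprK c) -(zreprK c') => e; apply: zpi_eq; apply: zint_faithful.
  by rewrite -!zfunctorE.
exact: zint_ess_surj.
Qed.

End Localization.

Theorem theorem14 (K : fieldType) (L : falgType K)
    (L_connected : connected L) (L_hereditary : hereditary L)
    (L_infinite_type : infinite_type L)
    (D : derived_cat L) (S : serre_duality D) :
  exists T : functor (grmod (preproj_alg S)) (Hcat D),
    [/\ partial_left_adjoint T,
        @isomorphic D (proj1_sig (T (grmod_regular (preproj_alg S)))) (Lambda D),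
        exact_functor T
      & induces_equivalence T].
Proof.
exists (TF S L_hereditary L_connected L_infinite_type); split.
- exact: TF_adjoint.
- exact: TF_regular.
- exact: TF_exact.
exact: TF_equivalence.
Qed.
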